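(* Let $\mathfrak g$ be one of the types $A_n^{(1)}\,(n\ge2)$, $B_n^{(1)}\,(n\ge3)$, $C_n^{(1)}\,(n\ge2)$, $D_n^{(1)}\,(n\ge4)$, $A_{2n-1}^{(2)}\,(n\ge3)$, $D_{n+1}^{(2)}\,(n\ge2)$, $A_{2n}^{(2)\dagger}\,(n\ge2)$, and let $\mathcal V(\mathfrak g)$ (and $\mathcal V_2(\mathfrak g)$ when $\mathfrak g=A_{2n}^{(2)\dagger}$), the rational mapping $\overline\sigma$, and the data $e_i,\gamma_i,\varepsilon_i$ ($i\ne0$) on $\mathcal V(\mathfrak g)$ be as in the context. Then the rational mapping $\overline\sigma$ is birational. Moreover, if one defines on $\mathcal V(\mathfrak g)$ $$e_0^c:=\overline\sigma^{-1}\circ e_{\sigma(0)}^c\circ\overline\sigma,\quad \varepsilon_0:=\varepsilon_{\sigma(0)}\circ\overline\sigma,\quad \gamma_0:=\gamma_{\sigma(0)}\circ\overline\sigma\qquad\text{if }\mathfrak g\neq A_{2n}^{(2)\dagger},$$ $$e_0^c:=\overline\sigma^{-1}\circ e_0^c\circ\overline\sigma,\quad \varepsilon_0:=\varepsilon_0\circ\overline\sigma,\quad \gamma_0:=\gamma_0\circ\overline\sigma\qquad\text{if }\mathfrak g= A_{2n}^{(2)\dagger}$$ (where in the second line $e_0^c,\varepsilon_0,\gamma_0$ on the right-hand sides are those of $\mathcal V_2(\mathfrak g)$), then $(\mathcal V(\mathfrak g),\{e_i\}_{i\in I},\{\gamma_i\}_{i\in I},\{\varepsilon_i\}_{i\in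 I})$ is an (affine) $\mathfrak g$-geometric crystal.
   Context: **Cartan matrices.** $I=\{0,1,\dots,n\}$, $a_{ij}=\langle\alpha_i^\vee,\alpha_j\rangle$, $a_{ii}=2$. For adjacent $i,j$ one has $a_{ij}=-1$ except for the listed entries; for non-adjacent $i\neq j$, $a_{ij}=0$. - $A_n^{(1)}$: $i,j$ adjacent iff $i\equiv j\pm1 \bmod n+1$; no exceptions. - $B_n^{(1)}$: adjacent pairs $\{0,2\}$, $\{i,i+1\}$ ($1\le i\le n-1$); exception $a_{n,n-1}=-2$. - $A_{2n-1}^{(2)}$: adjacent pairs as for $B_n^{(1)}$; exception $a_{n-1,n}=-2$. - $D_n^{(1)}$: adjacent pairs $\{0,2\}$, $\{i,i+1\}$ ($1\le i\le n-2$), $\{n-2,n\}$; no exceptions. - $C_n^{(1)}$, $D_{n+1}^{(2)}$, $A_{2n}^{(2)\dagger}$: adjacent pairs $\{i,i+1\}$ ($0\le i\le n-1$); exceptions $a_{1,0}=a_{n-1,n}=-2$ for $C_n^{(1)}$; $a_{0,1}=a_{n,n-1}=-2$ for $D_{n+1}^{(2)}$; $a_{1,0}=a_{n,n-1}=-2$ for $A_{2n}^{(2)\dagger}$. **Geometric crystals.** Let $X$ be a complex variety, $\gamma_i,\varepsilon_i:X\to\mathbb C$ rational functions and $e_i:\mathbb C^\times\times X\to X$, $(c,x)\mapsto e_i^c(x)$, rational $\mathbb C^\times$-actions ($i\in I$). The quadruple $(X,\{e_i\},\{\gamma_i\},\{\varepsilon_i\})$ is a $\mathfrak g$-geometric crystal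 if (i) $\{1\}\times X\subset \mathrm{dom}(e_i)$ for any $i\in I$; (ii) $\gamma_j(e_i^c(x))=c^{a_{ij}}\gamma_j(x)$; (iii) for every $w$ in the Weyl group and any two reduced words $\mathbf i,\mathbf i'$ of $w$, $e_{\mathbf i}=e_{\mathbf i'}$, where for $\mathbf i=(i_1,\dots,i_l)$ and $t$ in the maximal torus, $e_{\mathbf i}^t=e_{i_1}^{\alpha^{(1)}(t)}\cdots e_{i_l}^{\alpha^{(l)}(t)}$, $\alpha^{(j)}=s_{i_l}\cdots s_{i_{j+1}}(\alpha_{i_j})$; (iv) $\varepsilon_i(e_i^c(x))=c^{-1}\varepsilon_i(x)$. Condition (iii) is equivalent (for the types here) to: $e_i^{c_1}e_j^{c_2}=e_j^{c_2}e_i^{c_1}$ if $a_{ij}=a_{ji}=0$; $e_i^{c_1}e_j^{c_1c_2}e_i^{c_2}=e_j^{c_2}e_i^{c_1c_2}e_j^{c_1}$ if $a_{ij}=a_{ji}=-1$; $e_i^{c_1}e_j^{c_1^2c_2}e_i^{c_1c_2}e_j^{c_2}=e_j^{c_2}e_i^{c_1c_2}e_j^{c_1^2c_2}e_i^{c_1}$ if $a_{ij}=-2,a_{ji}=-1$. **The module $W(\varpi_1)$** (the fundamental representation specialized at $q=1$). It is the complex vector space with the basis below; each basis vector is a weight vector, weights being written in the fundamental weights $\Lambda_i$ ($\langle\alpha_i^\vee,\Lambda_j\rangle=\delta_{ij}$), and $f_i$ kills every basis vector for which no value is listed. Always $\mathrm{wt}(v_{\bar i})=-\mathrm{wt}(v_i)$.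 - $A_n^{(1)}$: basis $v_1,\dots,v_{n+1}$; $\mathrm{wt}(v_i)=\Lambda_i-\Lambda_{i-1}$ with $\Lambda_{n+1}=\Lambda_0$; $f_iv_i=v_{i+1}$ ($1\le i\le n$), $f_0v_{n+1}=v_1$. - All other types: the basis contains $v_1,\dots,v_n,v_{\bar n},\dots,v_{\bar1}$, and $f_iv_i=v_{i+1}$, $f_iv_{\overline{i+1}}=v_{\bar i}$ for $1\le i\le n-1$. Moreover $\mathrm{wt}(v_i)=\Lambda_i-\Lambda_{i-1}$ unless stated otherwise. In addition: - $B_n^{(1)}$: one more basis vector $v_0$ of weight $0$; $\mathrm{wt}(v_2)=\Lambda_2-\Lambda_1-\Lambda_0$, $\mathrm{wt}(v_n)=2\Lambda_n-\Lambda_{n-1}$; $f_nv_n=v_0$, $f_nv_0=2v_{\bar n}$, $f_0v_{\bar2}=v_1$, $f_0v_{\bar1}=v_2$. - $C_n^{(1)}$: $f_nv_n=v_{\bar n}$, $f_0v_{\bar1}=v_1$. - $D_n^{(1)}$: $\mathrm{wt}(v_2)=\Lambda_2-\Lambda_1-\Lambda_0$, $\mathrm{wt}(v_{n-1})=\Lambda_{n-1}+\Lambda_n-\Lambda_{n-2}$; $f_nv_n=v_{\overline{n-1}}$, $f_nv_{n-1}=v_{\bar n}$, $f_0v_{\bar2}=v_1$, $f_0v_{\bar1}=v_2$. - $A_{2n-1}^{(2)}$: $\mathrm{wt}(v_2)=\Lambda_2-\Lambda_1-\Lambda_0$; $f_nv_n=v_{\bar n}$, $f_0v_{\bar2}=v_1$,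 $f_0v_{\bar1}=v_2$. - $D_{n+1}^{(2)}$: two more basis vectors $v_0,\phi$ of weight $0$; $\mathrm{wt}(v_1)=\Lambda_1-2\Lambda_0$, $\mathrm{wt}(v_n)=2\Lambda_n-\Lambda_{n-1}$; $f_nv_n=v_0$, $f_nv_0=2v_{\bar n}$, $f_0v_{\bar1}=\phi$, $f_0\phi=2v_1$. - $A_{2n}^{(2)\dagger}$: one more basis vector $v_0$ of weight $0$; $\mathrm{wt}(v_n)=2\Lambda_n-\Lambda_{n-1}$; $f_nv_n=v_0$, $f_nv_0=2v_{\bar n}$, $f_0v_{\bar1}=v_1$. For $c\in\mathbb C^\times$ let $\alpha_i^\vee(c)$ act on a weight vector $u$ by $c^{\langle\alpha_i^\vee,\mathrm{wt}(u)\rangle}$, and set $Y_i(c)=\exp(c^{-1}f_i)\,\alpha_i^\vee(c)$ on $W(\varpi_1)$. **Words.** $\mathbf i_1=(n,n-1,\dots,1)$ for $A_n^{(1)}$; $(1,2,\dots,n,n-1,\dots,1)$ for $B_n^{(1)},A_{2n-1}^{(2)}$; $(1,2,\dots,n-1,n,n-2,n-3,\dots,1)$ for $D_n^{(1)}$; $(0,1,\dots,n,n-1,\dots,1)$ for $C_n^{(1)},D_{n+1}^{(2)},A_{2n}^{(2)\dagger}$. For $A_{2n}^{(2)\dagger}$ also $\mathbf i_2=(n,n-1,\dots,1,0,1,\dots,n-1)$. **The varieties.** With $\mathbf i_1=(i_1,\dots,i_k)$, $\mathcal V(\mathfrak g)=\{v(x)=Y_{i_1}(x_1)\cdots Y_{i_k}(x_k)v_1: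 x\in(\mathbb C^\times)^k\}\subset W(\varpi_1)$. For $A_{2n}^{(2)\dagger}$, writing $v_1(x)$ for $v(x)$ and $\mathbf i_2=(j_1,\dots,j_{2n})$, $\mathcal V_2(\mathfrak g)=\{v_2(y)=Y_{j_1}(y_1)\cdots Y_{j_{2n}}(y_{2n})v_{\bar n}: y\in(\mathbb C^\times)^{2n}\}$. The parametrizations by tori are birational. **Structure for a word.** For a word $(i_1,\dots,i_k)$ put, for $i\in I$, $$P_m=\frac{1}{x_1^{a_{i_1,i}}\cdots x_{m-1}^{a_{i_{m-1},i}}x_m}\ (\text{for } i_m=i),\quad \varepsilon_i=\sum_{m:\,i_m=i}P_m,\quad \gamma_i=x_1^{a_{i_1,i}}\cdots x_k^{a_{i_k,i}},$$ and $e_i^c:(x_1,\dots,x_k)\mapsto(x_1',\dots,x_k')$ with $$x_j'=x_j\cdot\frac{c\sum_{m\le j,\,i_m=i}P_m+\sum_{m>j,\,i_m=i}P_m}{c\sum_{m<j,\,i_m=i}P_m+\sum_{m\ge j,\,i_m=i}P_m}.$$ On $\mathcal V(\mathfrak g)$ these formulas for the word $\mathbf i_1$ define $e_i,\gamma_i,\varepsilon_i$ for $i\in I\setminus\{0\}$; on $\mathcal V_2(\mathfrak g)$ (type $A_{2n}^{(2)\dagger}$) the formulas for $\mathbf i_2$ define $e_i,\gamma_i,\varepsilon_i$ for $i\in I\setminus\{n\}$. **The automorphism $\sigma$** (for $\mathfrak g\ne A_{2n}^{(2)\dagger}$). On $I$: $\sigma(i)=i+1 \bmod (n+1)$ for $A_n^{(1)}$;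 $\sigma$ exchanges $0$ and $1$ and fixes the rest for $B_n^{(1)},D_n^{(1)},A_{2n-1}^{(2)}$; $\sigma(i)=n-i$ for $C_n^{(1)},D_{n+1}^{(2)}$. On $W(\varpi_1)$ (linear): $v_i\mapsto v_{i+1}$, $v_{n+1}\mapsto v_1$ for $A_n^{(1)}$; exchange $v_1\leftrightarrow v_{\bar1}$ and fix the other basis vectors for $B_n^{(1)},D_n^{(1)},A_{2n-1}^{(2)}$; $v_i\leftrightarrow v_{\overline{n+1-i}}$ ($1\le i\le n$), and for $D_{n+1}^{(2)}$ also $v_0\leftrightarrow\phi$, for $C_n^{(1)},D_{n+1}^{(2)}$. **The rational mapping $\overline\sigma$.** It is defined using the following fact, established in the paper. If $\mathfrak g\ne A_{2n}^{(2)\dagger}$: for $x\in(\mathbb C^\times)^k$ there exist a unique $y\in(\mathbb C^\times)^k$ and a positive rational function $a(x)$ (a ratio of linear combinations of characters of the torus with positive coefficients) such that $v(y)=a(x)\sigma(v(x))$ and $\varepsilon_{\sigma(i)}(v(y))=\varepsilon_i(v(x))$ if $i,\sigma(i)\ne0$; the rational mapping $\overline\sigma:\mathcal V(\mathfrak g)\to\mathcal V(\mathfrak g)$ is $v(x)\mapsto v(y)$. If $\mathfrak g=A_{2n}^{(2)\dagger}$: for any $x\in(\mathbb C^\times)^{2n}$ there exist a unique $y\in(\mathbb C^\times)^{2n}$ and a rational function $a(x)$ such that $v_2(y)=a(x)v_1(x)$; the rational mapping $\overline\sigma:\mathcal V(\mathfrak g)\to\mathcal V_2(\mathfrak g)$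 is $v_1(x)\mapsto v_2(y)$.
   Formalization: Condition (i), {1}×X ⊂ dom(e_i), is required only for x in a dense open subset of X = V(g); read literally it fails, e.g. for C_2^{(1)}, i=1, at points where P_2+P_4=0 (ε_1=0), where e_1 is not regular at (1,x). *)

(* Defs.v *)
From HB Require Import structures.
From mathcomp Require Import all_boot all_order all_algebra.
From mathcomp Require Import boolp classical_sets reals.
From mathcomp Require Import complex.
From mathcomp Require Import mpoly.

Set Implicit Arguments.
Unset Strict Implicit.
Unset Printing Implicit Defensive.

Import Order.TTheory GRing.Theory Num.Theory.
Local Open Scope classical_set_scope.
Local Open Scope ring_scope.

(* Rational functions and rational maps on subsets of affine space.           *)
(* A point of K^m is a column vector, a variety is a subset S of K^m, and     *)
(* rational functions on S are quotients of polynomials in the ambient        *)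
(* coordinates. A rational function or map is carried by a total function     *)
(* whose values off a proper Zariski closed subset of S are irrelevant;       *)
(* accordingly, equalities of rational maps are stated with [generically].    *)
Section RationalMaps.
Variable K : fieldType.

Definition peval m (p : {mpoly K[m]}) (s : 'cV[K]_m) : K :=
  p.@[fun i => s i ord0].

Definition irreducible_set m (S : set 'cV[K]_m) : Prop :=
  (exists s, S s) /\
  forall p q : {mpoly K[m]},
    (forall s, S s -> peval p s * peval q s = 0) ->
    (forall s, S s -> peval p s = 0) \/ (forall s, S s -> peval q s = 0).

Definition generically m (S : set 'cV[K]_m) (P : 'cV[K]_m -> Prop) : Prop :=
  exists q : {mpoly K[m]},
    (exists2 s, S s & peval q s != 0) /\
    (forall s, S s -> peval q s != 0 -> P s).

Definition ratfun m (S : set 'cV[K]_m) (f : 'cV[K]_m -> K) : Prop :=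
  exists p q : {mpoly K[m]},
    (exists2 s, S s & peval q s != 0) /\
    (forall s, S s -> peval q s != 0 -> f s = peval p s / peval q s).

Definition ratmap m m' (S : set 'cV[K]_m) (S' : set 'cV[K]_m')
    (f : 'cV[K]_m -> 'cV[K]_m') : Prop :=
  (forall i, ratfun S (fun s => f s i ord0)) /\
  generically S (fun s => S' (f s)).

(* The rational map f is regular at s, with value u there. The value u need   *)
(* not be f s, which may be irrelevant.                                       *)
Definition regular_value m m' (S : set 'cV[K]_m) (f : 'cV[K]_m -> 'cV[K]_m')
    (s : 'cV[K]_m) (u : 'cV[K]_m') : Prop :=
  forall i, exists p q : {mpoly K[m]},
    [/\ peval q s != 0,
        generically S (fun t => f t i ord0 = peval p t / peval q t) &
        u i ord0 = peval p s / peval q s].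

Definition dom m m' (S : set 'cV[K]_m) (S' : set 'cV[K]_m')
    (f : 'cV[K]_m -> 'cV[K]_m') : set 'cV[K]_m :=
  [set s | S s /\ exists2 u, S' u & regular_value S f s u].

Definition rational_inverse m m' (S : set 'cV[K]_m) (S' : set 'cV[K]_m')
    (f : 'cV[K]_m -> 'cV[K]_m') (h : 'cV[K]_m' -> 'cV[K]_m) : Prop :=
  [/\ ratmap S S' f, ratmap S' S h,
      generically S (fun s => h (f s) = s) &
      generically S' (fun s => f (h s) = s)].

Definition birational m m' (S : set 'cV[K]_m) (S' : set 'cV[K]_m')
    (f : 'cV[K]_m -> 'cV[K]_m') : Prop :=
  exists h, rational_inverse S S' f h.

Definition torus r : set 'cV[K]_r := [set t | forall i, t i ord0 != 0].
Arguments torus : clear implicits.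

Definition torus_char r (b : 'cV[int]_r) (t : 'cV[K]_r) : K :=
  \prod_(j < r) t j ord0 ^ b j ord0.

Definition torus_times r m (X : set 'cV[K]_m) : set 'cV[K]_(r + m) :=
  [set s | torus r (usubmx s) /\ X (dsubmx s)].
Arguments torus_times r {m} X _.

Definition generically_family r m (X : set 'cV[K]_m)
    (P : 'cV[K]_r -> 'cV[K]_m -> Prop) : Prop :=
  generically (torus_times r X) (fun s => P (usubmx s) (dsubmx s)).

Definition uncurry_map m (f : K -> 'cV[K]_m -> 'cV[K]_m) :
    'cV[K]_(1 + m) -> 'cV[K]_m :=
  fun s => f (usubmx s ord0 ord0) (dsubmx s).

Definition one_times m (x : 'cV[K]_m) : 'cV[K]_(1 + m) :=
  col_mx (const_mx 1) x.

Definition rational_action m (X : set 'cV[K]_m)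
    (f : K -> 'cV[K]_m -> 'cV[K]_m) : Prop :=
  [/\ ratmap (torus_times 1 X) X (uncurry_map f),
      (forall x u, X x ->
         regular_value (torus_times 1 X) (uncurry_map f) (one_times x) u ->
         u = x) &
      generically_family X (fun (c : 'cV[K]_(1 + 1)) x =>
        f (usubmx c ord0 ord0) (f (dsubmx c ord0 ord0) x) =
        f (usubmx c ord0 ord0 * dsubmx c ord0 ord0) x)].

End RationalMaps.

Arguments torus K r _ : clear implicits.
Arguments torus_times {K} r {m} X _.

(* The Weyl group of a generalized Cartan matrix A, through its (faithful)    *)
(* action on the root lattice: coordinates with respect to the simple roots,  *)
(* s_i (alpha_j) = alpha_j - A i j alpha_i.                                   *)
Section Weyl.
Variables (N : nat) (A : 'M[int]_N).

Definition simple_root (i : 'I_N) : 'cV[int]_N := delta_mx i ord0.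

Definition srefl (i : 'I_N) : 'M[int]_N := 1%:M - delta_mx i i *m A.

Definition weyl (w : seq 'I_N) : 'M[int]_N := \prod_(i <- w) srefl i.

Definition reduced (w : seq 'I_N) : Prop :=
  forall w', weyl w' = weyl w -> (size w <= size w')%N.

End Weyl.

Section GeometricCrystal.
Variables (K : fieldType) (N m : nat) (A : 'M[int]_N).

(* An element t of the maximal torus enters only through the values           *)
(* alpha_j (t) = t j ord0 of the simple roots.                                *)
Fixpoint e_word (e : 'I_N -> K -> 'cV[K]_m -> 'cV[K]_m) (t : 'cV[K]_N)
    (w : seq 'I_N) (x : 'cV[K]_m) : 'cV[K]_m :=
  if w is i :: w' then
    e i (torus_char (weyl A (rev w') *m simple_root i) t) (e_word e t w' x)
  else x.

(* The condition that {1} x X lie in dom (e_i) is imposed on a dense open     *)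
(* part of X, i.e. after shrinking X within its birational class. At points   *)
(* x with eps_i x = 0, e_i is in general not regular at (1, x).               *)
Record geometric_crystal (X : set 'cV[K]_m)
    (e : 'I_N -> K -> 'cV[K]_m -> 'cV[K]_m)
    (gam eps : 'I_N -> 'cV[K]_m -> K) : Prop := GeometricCrystal {
  gc_variety : irreducible_set X;
  gc_gam_rational : forall i, ratfun X (gam i);
  gc_eps_rational : forall i, ratfun X (eps i);
  gc_action : forall i, rational_action X (e i);
  gc_dom : forall i, generically X (fun x =>
    dom (torus_times 1 X) X (uncurry_map (e i)) (one_times x));
  gc_gam_e : forall i j, generically_family X (fun (c : 'cV[K]_1) x =>
    gam j (e i (c ord0 ord0) x) = c ord0 ord0 ^ A i j * gam j x);
  gc_reduced_words : forall w w', reduced A w -> reduced A w' ->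
    weyl A w = weyl A w' ->
    generically_family X (fun (t : 'cV[K]_N) x =>
      e_word e t w x = e_word e t w' x);
  gc_eps_e : forall i, generically_family X (fun (c : 'cV[K]_1) x =>
    eps i (e i (c ord0 ord0) x) = (c ord0 ord0)^-1 * eps i x)
}.

End GeometricCrystal.

(* A_n^(1), B_n^(1), C_n^(1), D_n^(1), A_{2n-1}^(2), D_{n+1}^(2) and          *)
(* A_{2n}^(2)dagger, in this order.                                           *)
Inductive affine_type :=
  | tyA1 | tyB1 | tyC1 | tyD1 | tyAodd2 | tyD2 | tyAeven2d.

Definition min_rank (g : affine_type) : nat :=
  match g with
  | tyA1 | tyC1 | tyD2 | tyAeven2d => 2
  | tyB1 | tyAodd2 => 3
  | tyD1 => 4
  end.

Section CartanData.
Local Open Scope nat_scope.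
Variables (g : affine_type) (n : nat).

Definition edges : seq (nat * nat) :=
  match g with
  | tyA1 => (n, 0) :: [seq (i, i.+1) | i <- iota 0 n]
  | tyB1 | tyAodd2 => (0, 2) :: [seq (i, i.+1) | i <- iota 1 n.-1]
  | tyD1 => [:: (0, 2), (n.-2, n) & [seq (i, i.+1) | i <- iota 1 n.-2]]
  | tyC1 | tyD2 | tyAeven2d => [seq (i, i.+1) | i <- iota 0 n]
  end.

(* the pairs (i, j) with a_ij = -2 *)
Definition double_entries : seq (nat * nat) :=
  match g with
  | tyA1 | tyD1 => [::]
  | tyB1 => [:: (n, n.-1)]
  | tyAodd2 => [:: (n.-1, n)]
  | tyC1 => [:: (1, 0); (n.-1, n)]
  | tyD2 => [:: (0, 1); (n, n.-1)]
  | tyAeven2d => [:: (1, 0); (n, n.-1)]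
  end.

Definition cartan (i j : nat) : int :=
  if i == j then 2%:Z
  else if ((i, j) \in edges) || ((j, i) \in edges) then
    if (i, j) \in double_entries then (- 2%:Z)%R else (- 1%:Z)%R
  else 0%:Z.

Definition cartan_mx : 'M[int]_n.+1 := (\matrix_(i, j) cartan i j)%R.

Definition word1 : seq nat :=
  match g with
  | tyA1 => rev (iota 1 n)
  | tyB1 | tyAodd2 => iota 1 n ++ rev (iota 1 n.-1)
  | tyD1 => iota 1 n ++ rev (iota 1 n.-2)
  | tyC1 | tyD2 | tyAeven2d => iota 0 n.+1 ++ rev (iota 1 n.-1)
  end.

(* only meaningful for A_{2n}^(2)dagger *)
Definition word2 : seq nat := rev (iota 0 n.+1) ++ iota 1 n.-1.

Definition sigma_index (i : nat) : nat :=
  match g with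
  | tyA1 => i.+1 %% n.+1
  | tyB1 | tyD1 | tyAodd2 => if i == 0 then 1 else if i == 1 then 0 else i
  | tyC1 | tyD2 => n - i
  | tyAeven2d => i
  end.

End CartanData.

(* Labels of the basis vectors v_j, v_{\bar j}, v_0 and phi of W(varpi_1).    *)
Inductive wlabel := V of nat | Vbar of nat | V0 | Phi.

Definition wlabel_code (b : wlabel) : nat + nat + bool :=
  match b with
  | V j => inl (inl j) | Vbar j => inl (inr j) | V0 => inr true | Phi => inr false
  end.
Definition wlabel_decode (c : nat + nat + bool) : wlabel :=
  match c with
  | inl (inl j) => V j | inl (inr j) => Vbar j | inr true => V0 | inr false => Phi
  end.
Lemma wlabel_codeK : cancel wlabel_code wlabel_decode.
Proof. by case. Qed.
HB.instance Definition _ := Equality.copy wlabel (can_type wlabel_codeK).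

Section ModuleData.
Variables (g : affine_type) (n : nat).

Definition basis : seq wlabel :=
  match g with
  | tyA1 => [seq V j | j <- iota 1 n.+1]
  | _ =>
    [seq V j | j <- iota 1 n] ++
    match g with tyB1 | tyAeven2d => [:: V0] | tyD2 => [:: V0; Phi] | _ => [::] end ++
    [seq Vbar j | j <- rev (iota 1 n)]
  end.

(* Weights in the fundamental weights: wt b i is the coefficient of Lambda_i, *)
(* that is, the pairing of alpha_i^vee with the weight.                       *)
Definition Lam (j i : nat) : int := (i == j)%:Z.

Definition wtV (j i : nat) : int :=
  let generic := Lam j i - Lam j.-1 i in
  let v2 := Lam 2 i - Lam 1 i - Lam 0 i in
  let vn := 2%:Z * Lam n i - Lam n.-1 i in
  match g with
  | tyA1 => if j == n.+1 then Lam 0 i - Lam n i else generic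
  | tyB1 => if j == 2 then v2 else if j == n then vn else generic
  | tyC1 => generic
  | tyD1 => if j == 2 then v2
            else if j == n.-1 then Lam n.-1 i + Lam n i - Lam n.-2 i
            else generic
  | tyAodd2 => if j == 2 then v2 else generic
  | tyD2 => if j == 1%N then Lam 1 i - 2%:Z * Lam 0 i
            else if j == n then vn else generic
  | tyAeven2d => if j == n then vn else generic
  end.

Definition wt (b : wlabel) (i : nat) : int :=
  match b with
  | V j => wtV j i
  | Vbar j => - wtV j i
  | V0 | Phi => 0
  end.

(* The quadruple (i, u, k, u') records f_i u = k u'; the values of the f_i    *)
(* that are not listed are 0.                                                 *)
Definition arrows : seq (nat * wlabel * nat * wlabel) :=
  let common :=
    [seq (i, V i, 1%N, V i.+1) | i <- iota 1 n.-1] ++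
    [seq (i, Vbar i.+1, 1%N, Vbar i) | i <- iota 1 n.-1] in
  let short_n := [:: (n, V n, 1%N, V0); (n, V0, 2, Vbar n)] in
  let fork_0 := [:: (0%N, Vbar 2, 1%N, V 1); (0%N, Vbar 1, 1%N, V 2)] in
  match g with
  | tyA1 => [seq (i, V i, 1%N, V i.+1) | i <- iota 1 n] ++
            [:: (0%N, V n.+1, 1%N, V 1)]
  | tyB1 => common ++ short_n ++ fork_0
  | tyC1 => common ++ [:: (n, V n, 1%N, Vbar n); (0%N, Vbar 1, 1%N, V 1)]
  | tyD1 => common ++
            [:: (n, V n, 1%N, Vbar n.-1); (n, V n.-1, 1%N, Vbar n)] ++ fork_0
  | tyAodd2 => common ++ [:: (n, V n, 1%N, Vbar n)] ++ fork_0
  | tyD2 => common ++ short_n ++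
            [:: (0%N, Vbar 1, 1%N, Phi); (0%N, Phi, 2, V 1)]
  | tyAeven2d => common ++ short_n ++ [:: (0%N, Vbar 1, 1%N, V 1)]
  end.

Definition sigma_label (b : wlabel) : wlabel :=
  match g with
  | tyA1 => if b is V j then V (j %% n.+1).+1 else b
  | tyB1 | tyD1 | tyAodd2 =>
      if b == V 1 then Vbar 1 else if b == Vbar 1 then V 1 else b
  | tyC1 | tyD2 =>
      match b with
      | V j => Vbar (n.+1 - j) | Vbar j => V (n.+1 - j) | V0 => Phi | Phi => V0
      end
  | tyAeven2d => b
  end.

End ModuleData.

Section Module_W.
Variables (R : realType) (g : affine_type) (n : nat).
Local Notation C := R[i].

Definition dimW : nat := size (basis g n).
Definition lab (a : 'I_dimW) : wlabel := nth V0 (basis g n) a.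

Definition bvec (b : wlabel) : 'cV[C]_dimW := \col_a (lab a == b)%:R.

(* Matrices act on column vectors: column b is the image of the b-th basis    *)
(* vector.                                                                    *)
Definition f_mx (i : nat) : 'M[C]_dimW := \matrix_(a, b)
  \sum_(t <- arrows g n | (t.1.1.1 == i) && (t.1.1.2 == lab b) && (t.2 == lab a))
    (t.1.2)%:R.

Definition coroot_mx (i : nat) (c : C) : 'M[C]_dimW :=
  diag_mx (\row_a c ^ wt g n (lab a) i).

(* The exponential of a nilpotent matrix of size d, such as a multiple of     *)
(* f_mx i.                                                                    *)
Definition exp_nilp d (M : 'M[C]_d) : 'M[C]_d :=
  \sum_(k < d) (k`!%:R)^-1 *: M ^+ k.

Definition Y (i : nat) (c : C) : 'M[C]_dimW :=
  exp_nilp (c^-1 *: f_mx i) *m coroot_mx i c.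

Definition sigma_W (u : 'cV[C]_dimW) : 'cV[C]_dimW :=
  (\matrix_(a, b) (lab a == sigma_label g n (lab b))%:R) *m u.

Section Word.
Variables (w : seq nat) (b : wlabel).
Local Notation k := (size w).
Local Notation idx j := (nth 0%N w j).

Definition vpar (x : 'cV[C]_k) : 'cV[C]_dimW :=
  (\prod_(j < k) Y (idx j) (x j ord0)) *m bvec b.

Definition vvariety : set 'cV[C]_dimW := vpar @` torus C k.

Definition Pmon (i : nat) (x : 'cV[C]_k) (l : 'I_k) : C :=
  ((\prod_(j < k | (j < l)%N) x j ord0 ^ cartan g n (idx j) i) * x l ord0)^-1.

Definition eps_par (i : nat) (x : 'cV[C]_k) : C :=
  \sum_(l < k | idx l == i) Pmon i x l.

Definition gam_par (i : nat) (x : 'cV[C]_k) : C :=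
  \prod_(j < k) x j ord0 ^ cartan g n (idx j) i.

Definition e_par (i : nat) (c : C) (x : 'cV[C]_k) : 'cV[C]_k := \col_j
  (x j ord0 *
   ((c * (\sum_(l < k | (idx l == i) && (l <= j)%N) Pmon i x l)
     + \sum_(l < k | (idx l == i) && (j < l)%N) Pmon i x l) /
    (c * (\sum_(l < k | (idx l == i) && (l < j)%N) Pmon i x l)
     + \sum_(l < k | (idx l == i) && (j <= l)%N) Pmon i x l))).

(* Transport to the variety along the birational parametrization vpar. *)
Definition coords (u : 'cV[C]_dimW) : 'cV[C]_k :=
  xget 0 [set x | torus C k x /\ vpar x = u].

Definition eV (i : nat) (c : C) (u : 'cV[C]_dimW) : 'cV[C]_dimW :=
  vpar (e_par i c (coords u)).
Definition gamV (i : nat) (u : 'cV[C]_dimW) : C := gam_par i (coords u).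
Definition epsV (i : nat) (u : 'cV[C]_dimW) : C := eps_par i (coords u).

End Word.

Definition Vg : set 'cV[C]_dimW := vvariety (word1 g n) (V 1).

(* The target of sigma_bar: V_2(g) for A_{2n}^(2)dagger, V(g) otherwise. *)
Definition tgt_word : seq nat :=
  if g is tyAeven2d then word2 n else word1 g n.
Definition tgt_base : wlabel := if g is tyAeven2d then Vbar n else V 1.
Definition Vtgt : set 'cV[C]_dimW := vvariety tgt_word tgt_base.

Definition pos_laurent r (f : 'cV[C]_r -> C) : Prop :=
  exists s : seq (C * 'cV[int]_r),
    [/\ s != [::], all (fun t => 0 < t.1) s &
        forall x, torus C r x -> f x = \sum_(t <- s) t.1 * torus_char t.2 x].

Definition pos_ratfun r (a : 'cV[C]_r -> C) : Prop :=
  exists p q : 'cV[C]_r -> C,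
    [/\ pos_laurent p, pos_laurent q &
        forall x, torus C r x -> a x = p x / q x].

Definition is_sigma_lift
    (y : 'cV[C]_(size (word1 g n)) -> 'cV[C]_(size tgt_word)) : Prop :=
  ratmap (torus C _) (torus C _) y /\
  exists a : 'cV[C]_(size (word1 g n)) -> C,
    match g with
    | tyAeven2d =>
        ratfun (torus C _) a /\
        generically (torus C _) (fun x =>
          vpar tgt_base (y x) = a x *: vpar (V 1) x)
    | _ =>
        pos_ratfun a /\
        generically (torus C _) (fun x =>
          vpar tgt_base (y x) = a x *: sigma_W (vpar (V 1) x) /\
          forall i, (0 < i <= n)%N -> sigma_index g n i != 0%N ->
            eps_par (sigma_index g n i) (y x) = eps_par i x)
    end.

(* Such a lift exists and is unique as a rational map; the default value 0    *)
(* of the choice is not a map to the torus.                                   *)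
Definition sigma_lift : 'cV[C]_(size (word1 g n)) -> 'cV[C]_(size tgt_word) :=
  xget (fun=> 0) [set y | is_sigma_lift y].

Definition sigma_bar (u : 'cV[C]_dimW) : 'cV[C]_dimW :=
  vpar tgt_base (sigma_lift (coords (word1 g n) (V 1) u)).

(* The crystal structure on V(g), given the inverse sbi of sigma_bar. For     *)
(* A_{2n}^(2)dagger, sigma_index is the identity, so that the index used on   *)
(* V_2(g) is 0.                                                               *)
Definition e_full (sbi : 'cV[C]_dimW -> 'cV[C]_dimW) (i : 'I_n.+1) (c : C)
    (u : 'cV[C]_dimW) : 'cV[C]_dimW :=
  if i == ord0 then
    sbi (eV tgt_word tgt_base (sigma_index g n 0) c (sigma_bar u))
  else eV (word1 g n) (V 1) i c u.

Definition gam_full (i : 'I_n.+1) (u : 'cV[C]_dimW) : C :=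
  if i == ord0 then gamV tgt_word tgt_base (sigma_index g n 0) (sigma_bar u)
  else gamV (word1 g n) (V 1) i u.

Definition eps_full (i : 'I_n.+1) (u : 'cV[C]_dimW) : C :=
  if i == ord0 then epsV tgt_word tgt_base (sigma_index g n 0) (sigma_bar u)
  else epsV (word1 g n) (V 1) i u.

End Module_W.

Arguments Vg : clear implicits.
Arguments Vtgt : clear implicits.
Arguments sigma_bar : clear implicits.
Arguments e_full : clear implicits.
Arguments gam_full : clear implicits.
Arguments eps_full : clear implicits.

(* Main.v *)
(** All maps in sight are given by subtraction-free expressions, and the points
    of a torus with positive real coordinates are Zariski dense in it. So every
    identity of rational maps is checked at positive points only, where no
    denominator vanishes.

    For the types other than A, let y_i be the product of the letters of x in
    the places where the word has i, let w_l be the product of the y_i^kap_i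
    over the nodes i at position l of the chain, and let p_l and q_l be the
    coordinates of v(x) at v_{bar (l+1)} and v_{l+1}. Then
    p_l q_l = w_l + w_{l+1}, and on the states (y, p), taken modulo scaling,
    e_i^c just multiplies y_i by c and keeps q_l for l the position of i as well
    as all other p_l. This description is invariant under the reflection
    y_j <-> y_{n-j}, p_l <-> q_{n-1-l} of the diagram and under the exchange of
    the two branches of a fork, and these are the maps sigma-bar: the torus
    coordinates of the source and of the target are two normalizations of the
    same state. Hence e_0 is of the same form as the other e_i, and the rank two
    relations become identities in a few variables. Condition (iii) for
    arbitrary reduced words follows by Matsumoto's theorem. In type A a state is
    a point with n + 1 homogeneous coordinates; e_i^c scales one of them and
    sigma-bar rotates them. *)

From HB Require Import structures.
Require Import Defs.
From mathcomp Require Import all_boot all_order all_algebra.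
From mathcomp Require Import boolp classical_sets reals.
From mathcomp Require Import complex mpoly zify ring lra.

Set Implicit Arguments.
Unset Strict Implicit.
Unset Printing Implicit Defensive.

Import Order.TTheory GRing.Theory Num.Theory.
Local Open Scope classical_set_scope.
Local Open Scope ring_scope.

(** * Rational maps and positive points *)

(** The maps of the statement are not given by formulas: [coords] and [sigma_lift] are choices, and
    [sbi] is any rational inverse. Each is shown to agree generically with an explicit map, and the
    axioms are proved for the explicit maps. To replace a map inside a composite, one needs that the
    image is not contained in the exceptional set; this is ensured by the explicit maps being onto
    the positive points, so that inverses are carried along everywhere. The relation p_l q_l = w_l +
    w_(l+1) appears when v(x) is computed from the right. In these terms epsilon_i is a power of
    p_(l-1) q_l divided by y_i, with l the position of i, and e_i keeps both factors. Scaling by s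
    multiplies p and q by s and y_j by the power of s given by the null vector of the Cartan matrix,
    so gamma and epsilon do not change. The torus has one dimension less than the states; which
    representative it picks depends on the end at 0. At a long end a multiple of v(x) may lie in the
    variety again, and then the condition on epsilon in the definition of sigma-bar is what fixes
    the factor. *)

Section RatOn.
Variable K : fieldType.

(** A polynomial is built from constants and variables by sums and products, so closure of [Cl]
    under these is enough. The lemma is applied to quotients without poles at positive points, to
    polynomials in other variables and to univariate polynomials along a line. *)
Lemma peval_alg (T : Type) (Cl : (T -> K) -> Prop) m (f : T -> 'cV[K]_m) :
    (forall c, Cl (fun=> c)) ->
    (forall g h, Cl g -> Cl h -> Cl (fun s => g s + h s)) ->
    (forall g h, Cl g -> Cl h -> Cl (fun s => g s * h s)) ->
    (forall i, Cl (fun s => f s i ord0)) ->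
  forall p, Cl (fun s => peval p (f s)).
Proof.
move=> Cc CD CM Cf p.
have Cprod (I : Type) (r : seq I) (g : I -> T -> K) :
    (forall i, Cl (g i)) -> Cl (fun s => \prod_(i <- r) g i s).
  move=> Cg; elim: r => [|i r IH].
    by under eq_fun => s do rewrite big_nil; apply: Cc.
  by under eq_fun => s do rewrite big_cons; apply: CM.
have Csum (I : Type) (r : seq I) (g : I -> T -> K) :
    (forall i, Cl (g i)) -> Cl (fun s => \sum_(i <- r) g i s).
  move=> Cg; elim: r => [|i r IH].
    by under eq_fun => s do rewrite big_nil; apply: Cc.
  by under eq_fun => s do rewrite big_cons; apply: CD.
have Cexp (g : T -> K) k : Cl g -> Cl (fun s => g s ^+ k).
  move=> Cg; elim: k => [|k IH].
    by under eq_fun => s do rewrite expr0; apply: Cc.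
  by under eq_fun => s do rewrite exprS; apply: CM.
rewrite /peval; under eq_fun => s do rewrite mevalE.
by apply: Csum => a; apply: CM => //; apply: Cprod => i; apply: Cexp.
Qed.

Section Evaluation.
Variable m : nat.
Implicit Types (p q : {mpoly K[m]}) (s : 'cV[K]_m).
Lemma pevalC c s : peval c%:MP s = c. Proof. exact: mevalC. Qed.
Lemma peval1 s : peval 1 s = 1. Proof. exact: meval1. Qed.
Lemma pevalX i s : peval 'X_i s = s i ord0. Proof. exact: mevalXU. Qed.
Lemma pevalD p q s : peval (p + q) s = peval p s + peval q s.
Proof. exact: mevalD. Qed.
Lemma pevalB p q s : peval (p - q) s = peval p s - peval q s.
Proof. exact: mevalB. Qed.
Lemma pevalM p q s : peval (p * q) s = peval p s * peval q s.
Proof. exact: mevalM. Qed.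
End Evaluation.

(* Quotients of polynomials on S whose denominator vanishes nowhere on P.     *)
Definition rat_on m (S P : set 'cV[K]_m) (f : 'cV[K]_m -> K) : Prop :=
  exists p q : {mpoly K[m]},
    (forall s, P s -> peval q s != 0) /\
    (forall s, S s -> peval q s != 0 -> f s = peval p s / peval q s).

Section RatOnTheory.
Variables (m : nat) (S P : set 'cV[K]_m).
Implicit Types f g : 'cV[K]_m -> K.

Lemma rat_on_ext f g : (forall s, S s -> f s = g s) -> rat_on S P f -> rat_on S P g.
Proof.
by move=> fg [p [q [q0 H]]]; exists p, q; split=> // s Ss /H -/(_ Ss) <-; rewrite fg.
Qed.

Lemma rat_on_cst c : rat_on S P (fun=> c).
Proof.
exists c%:MP, 1; split=> s _; first by rewrite peval1 oner_neq0.
by rewrite peval1 pevalC divr1.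
Qed.

Lemma rat_on_coord i : rat_on S P (fun s => s i ord0).
Proof.
exists 'X_i, 1; split=> s _; first by rewrite peval1 oner_neq0.
by rewrite peval1 pevalX divr1.
Qed.

Lemma rat_onD f g : rat_on S P f -> rat_on S P g -> rat_on S P (fun s => f s + g s).
Proof.
move=> [p [q [q0 H]]] [p' [q' [q0' H']]]; exists (p * q' + p' * q), (q * q').
split=> s Ss; rewrite !pevalM; first by rewrite mulf_neq0 ?q0 ?q0'.
rewrite mulf_eq0 negb_or => /andP[n n'].
by rewrite H // H' // pevalD !pevalM addf_div.
Qed.

Lemma rat_onM f g : rat_on S P f -> rat_on S P g -> rat_on S P (fun s => f s * g s).
Proof.
move=> [p [q [q0 H]]] [p' [q' [q0' H']]]; exists (p * p'), (q * q').
split=> s Ss; rewrite !pevalM; first by rewrite mulf_neq0 ?q0 ?q0'.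
rewrite mulf_eq0 negb_or => /andP[n n'].
by rewrite H // H' // mulf_div.
Qed.

Lemma rat_onN f : rat_on S P f -> rat_on S P (fun s => - f s).
Proof.
move=> Hf; apply: (@rat_on_ext (fun s => -1 * f s)) => [s _|]; first by rewrite mulN1r.
by apply: rat_onM => //; apply: rat_on_cst.
Qed.

Lemma rat_onB f g : rat_on S P f -> rat_on S P g -> rat_on S P (fun s => f s - g s).
Proof. by move=> Hf Hg; apply: rat_onD => //; apply: rat_onN. Qed.

Lemma rat_onX f k : rat_on S P f -> rat_on S P (fun s => f s ^+ k).
Proof.
move=> Hf; elim: k => [|k IH]; first by under eq_fun => s do rewrite expr0; apply: rat_on_cst.
by under eq_fun => s do rewrite exprS; apply: rat_onM.
Qed.

Lemma rat_on_sum (I : Type) (r : seq I) (Q : pred I) F :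
  (forall i, Q i -> rat_on S P (F i)) -> rat_on S P (fun s => \sum_(i <- r | Q i) F i s).
Proof.
move=> H; elim: r => [|i r IH].
  by apply: rat_on_ext (rat_on_cst _) => s _; rewrite big_nil.
case Qi: (Q i); last by apply: rat_on_ext IH => s _; rewrite big_cons Qi.
by apply: rat_on_ext (rat_onD (H _ Qi) IH) => s _; rewrite big_cons Qi.
Qed.

Lemma rat_on_prod (I : Type) (r : seq I) (Q : pred I) F :
  (forall i, Q i -> rat_on S P (F i)) -> rat_on S P (fun s => \prod_(i <- r | Q i) F i s).
Proof.
move=> H; elim: r => [|i r IH].
  by apply: rat_on_ext (rat_on_cst _) => s _; rewrite big_nil.
case Qi: (Q i); last by apply: rat_on_ext IH => s _; rewrite big_cons Qi.
by apply: rat_on_ext (rat_onM (H _ Qi) IH) => s _; rewrite big_cons Qi.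
Qed.

Hypothesis PS : P `<=` S.

Lemma rat_onV f : (forall s, P s -> f s != 0) -> rat_on S P f -> rat_on S P (fun s => (f s)^-1).
Proof.
(* The fraction q / p is expanded by [q]: the value of [f] is known only where [q] does not vanish,
   and the denominator has to ensure this. *)
move=> f0 [p [q [q0 H]]]; exists (q * q), (p * q).
have p0 s : P s -> peval p s != 0.
  by move=> Ps; have := f0 _ Ps; rewrite H ?q0 //; [by apply: contraNneq => ->; rewrite mul0r|exact: PS].
split=> s Ss; rewrite !pevalM; first by rewrite mulf_neq0 ?q0 ?p0.
rewrite mulf_eq0 negb_or => /andP[n n'].
by rewrite H // invf_div -mulf_div divff // mulr1.
Qed.

Lemma rat_on_div f g : (forall s, P s -> g s != 0) -> rat_on S P f -> rat_on S P g ->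
  rat_on S P (fun s => f s / g s).
Proof. by move=> g0 Hf Hg; apply: rat_onM => //; apply: rat_onV. Qed.

Lemma rat_onXz f (k : int) : (forall s, P s -> f s != 0) -> rat_on S P f ->
  rat_on S P (fun s => f s ^ k).
Proof.
move=> f0 Hf; case: k => k; first exact: rat_onX.
apply: rat_onV; last exact: rat_onX.
by move=> s Ps; rewrite expf_neq0 ?f0.
Qed.

End RatOnTheory.

Lemma rat_on_peval m (S P : set 'cV[K]_m) m' (f : 'cV[K]_m -> 'cV[K]_m') p :
  (forall i, rat_on S P (fun s => f s i ord0)) -> rat_on S P (fun s => peval p (f s)).
Proof.
move=> Hf; apply: (@peval_alg _ (rat_on S P)) => //.
- exact: rat_on_cst.
- exact: rat_onD.
- exact: rat_onM.
Qed.

Lemma rat_on_comp m (S P : set 'cV[K]_m) m' (S' P' : set 'cV[K]_m')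
    (f : 'cV[K]_m -> 'cV[K]_m') h :
    P `<=` S ->
    (forall i, rat_on S P (fun s => f s i ord0)) ->
    (forall s, P s -> P' (f s)) ->
    (exists q, (forall s, P s -> peval q s != 0) /\
       forall s, S s -> peval q s != 0 -> S' (f s)) ->
  rat_on S' P' h -> rat_on S P (fun s => h (f s)).
Proof.
move=> PS Hf fP [r [r0 Hr]] [p [q [q0 H]]].
have q0' s : P s -> peval q (f s) != 0 by move=> /fP; apply: q0.
have [n [d [d0 Hd]]] := rat_on_div PS q0' (rat_on_peval p Hf) (rat_on_peval q Hf).
have [n' [d' [d0' Hd']]] := rat_on_peval q Hf.
have n0' s : P s -> peval n' s != 0.
  move=> Ps; have := q0' _ Ps; rewrite Hd' ?d0' //; last exact: PS.
  by apply: contraNneq => ->; rewrite mul0r.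
(* The factor [r] ensures that [f s] lies in [S'], [d'] that the value of [q] at [f s] is given by
   its fraction, and [n'] that this value is not zero. *)
exists (n * (r * n' * d')), (d * (r * n' * d')); split=> s Ss; rewrite !pevalM.
  by rewrite !mulf_neq0 ?d0 ?r0 ?n0' ?d0'.
rewrite !mulf_eq0 !negb_or => /and3P[nd /andP[nr nn'] nd'].
rewrite -mulf_div divff ?mulf_neq0 // mulr1 -Hd // H //; first exact: Hr.
by rewrite Hd' // mulf_neq0 // invr_neq0.
Qed.

(* A subset of affine space with a Zariski dense part, which will be the      *)
(* positive part: identities of rational functions are checked there, at      *)
(* honest points, and then hold generically.                                  *)
Record pspace m := PSpace {
  car : set 'cV[K]_m;
  pos : set 'cV[K]_m;
  pos_car : pos `<=` car;
  pos_dense : forall q : {mpoly K[m]}, (exists2 s, car s & peval q s != 0) ->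
    exists2 s, pos s & peval q s != 0;
  car_irr : irreducible_set car }.

Definition posrat m (X : pspace m) := rat_on (car X) (pos X).

(** Stronger than [generically]: the exceptional hypersurface contains no positive point. Such
    statements can be intersected without irreducibility and pulled back along any [posmap],
    dominant or not. *)
Definition posgen m (X : pspace m) (Q : 'cV[K]_m -> Prop) : Prop :=
  exists q : {mpoly K[m]}, (forall s, pos X s -> peval q s != 0) /\
    (forall s, car X s -> peval q s != 0 -> Q s).

Record posmap m m' (X : pspace m) (X' : pspace m') (f : 'cV[K]_m -> 'cV[K]_m') : Prop :=
  PosMap {
    posmap_rat : forall i, posrat X (fun s => f s i ord0);
    posmap_car : posgen X (fun s => car X' (f s));
    posmap_pos : forall s, pos X s -> pos X' (f s) }.

Section PSpaceTheory.
Variables (m : nat) (X : pspace m).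

Lemma pos_ex : exists s, pos X s.
Proof.
have [[s Xs] _] := car_irr X.
have [|t Pt _] := @pos_dense _ X 1; last by exists t.
by exists s => //; rewrite peval1 oner_neq0.
Qed.

Lemma peval_pos_eq0 q : (forall s, pos X s -> peval q s = 0) ->
  forall s, car X s -> peval q s = 0.
Proof.
move=> H s Xs; apply/eqP/negPn/negP => n.
have [|t Pt] := @pos_dense _ X q; first by exists s.
by rewrite H ?eqxx.
Qed.

Lemma posgen_generically Q : posgen X Q -> generically (car X) Q.
Proof.
move=> [q [q0 H]]; exists q; split=> //; have [s Ps] := pos_ex.
by exists s; [exact: pos_car|exact: q0].
Qed.

Lemma posgen_true (Q : _ -> Prop) : (forall s, car X s -> Q s) -> posgen X Q.
Proof. by move=> H; exists 1; split=> s *; [rewrite peval1 oner_neq0|apply: H]. Qed.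

Lemma posgenS (Q Q' : _ -> Prop) : (forall s, car X s -> Q s -> Q' s) ->
  posgen X Q -> posgen X Q'.
Proof. by move=> H [q [q0 Hq]]; exists q; split=> // s Xs n; apply/H/Hq. Qed.

Lemma posgenI Q Q' : posgen X Q -> posgen X Q' -> posgen X (fun s => Q s /\ Q' s).
Proof.
move=> [q [q0 Hq]] [q' [q0' Hq']]; exists (q * q').
split=> s Xs; rewrite pevalM; first by rewrite mulf_neq0 ?q0 ?q0'.
by rewrite mulf_eq0 negb_or => /andP[n n']; split; [apply: Hq|apply: Hq'].
Qed.

Lemma posgen_allord k (Q : 'I_k -> _ -> Prop) :
  (forall i, posgen X (Q i)) -> posgen X (fun s => forall i, Q i s).
Proof.
move=> H; have [q Hq] := choice H; exists (\prod_i q i); split=> s Xs; rewrite /peval rmorph_prod.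
  by apply/prodf_neq0 => i _; have [q0 _] := Hq i; apply: q0.
by move/prodf_neq0 => n i; have [_] := Hq i; apply=> //; apply: n.
Qed.

(** After clearing denominators the difference is a polynomial that vanishes at all positive points,
    hence on the whole set by density. *)
Lemma posrat_eq f g : posrat X f -> posrat X g -> (forall s, pos X s -> f s = g s) ->
  posgen X (fun s => f s = g s).
Proof.
move=> [p [q [q0 H]]] [p' [q' [q0' H']]] fg; exists (q * q').
split=> s Xs; rewrite pevalM; first by rewrite mulf_neq0 ?q0 ?q0'.
rewrite mulf_eq0 negb_or => /andP[n n'].
rewrite H // H' //; apply/eqP; rewrite eqr_div // -subr_eq0 -!pevalM -pevalB; apply/eqP.
apply: peval_pos_eq0 => // {Xs n n'} {}s Ps; have Xs := pos_car Ps.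
apply/eqP; rewrite pevalB !pevalM subr_eq0 -eqr_div ?q0 ?q0' //.
by rewrite -H ?q0 // -H' ?q0' // fg.
Qed.

Lemma posrat_neq0 f : posrat X f -> (forall s, pos X s -> f s != 0) ->
  posgen X (fun s => f s != 0).
Proof.
move=> [p [q [q0 H]]] f0; exists (p * q); split=> s Xs; rewrite pevalM.
  have := f0 _ Xs; rewrite H ?q0 //; last exact: pos_car.
  by rewrite mulf_eq0 invr_eq0 mulf_eq0.
rewrite mulf_eq0 negb_or => /andP[n n'].
by rewrite H // mulf_neq0 ?invr_neq0.
Qed.

Lemma posrat_eqv k (f g : 'cV[K]_m -> 'cV[K]_k) :
  (forall i, posrat X (fun s => f s i ord0)) -> (forall i, posrat X (fun s => g s i ord0)) ->
  (forall s, pos X s -> f s = g s) -> posgen X (fun s => f s = g s).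
Proof.
move=> Hf Hg fg.
have: posgen X (fun s => forall i, f s i ord0 = g s i ord0).
  by apply: posgen_allord => i; apply: posrat_eq => // s Ps; rewrite fg.
by apply: posgenS => s _ H; apply/matrixP => i j; rewrite ord1.
Qed.

Lemma posrat_ratfun f : posrat X f -> ratfun (car X) f.
Proof.
move=> [p [q [q0 H]]]; exists p, q; split=> //; have [s Ps] := pos_ex.
by exists s; [exact: pos_car|exact: q0].
Qed.

(** By irreducibility two nonempty open subsets meet. *)
Lemma generically_and Q Q' : generically (car X) Q -> generically (car X) Q' ->
  generically (car X) (fun s => Q s /\ Q' s).
Proof.
move=> [q [[s Xs n] Hq]] [q' [[s' Xs' n'] Hq']]; exists (q * q'); split; last first.
  by move=> t Xt; rewrite pevalM mulf_eq0 negb_or => /andP[? ?]; split; [apply: Hq|apply: Hq'].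
apply: contrapT => H; have [_ /(_ q q')] := car_irr X; case=> [t Xt|H1|H1].
- apply/eqP/negPn/negP => nt; apply: H; exists t => //.
  by rewrite pevalM.
- by rewrite H1 ?eqxx in n.
- by rewrite H1 ?eqxx in n'.
Qed.

Lemma generically_impl (Q Q' : _ -> Prop) : (forall s, car X s -> Q s -> Q' s) ->
  generically (car X) Q -> generically (car X) Q'.
Proof. by move=> H [q [q0 Hq]]; exists q; split=> // s Xs n; apply/H/Hq. Qed.

Lemma ratfun_ext f g : generically (car X) (fun s => f s = g s) ->
  ratfun (car X) f -> ratfun (car X) g.
Proof.
move=> fg [p [q [q0 H]]]; have H1 : generically (car X) (fun s => f s = peval p s / peval q s).
  by exists q.
have [r [r0 Hr]] := generically_and fg (generically_and H1
  (ex_intro _ q (conj q0 (fun s _ n => n)))).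
have [t Xt nt] := r0.
have [_ [_ nqt]] := Hr _ Xt nt.
exists (p * r), (q * r); split.
  by exists t => //; rewrite pevalM mulf_neq0.
move=> s Xs; rewrite !pevalM mulf_eq0 negb_or => /andP[n n'].
have [<- [-> _]] := Hr _ Xs n'.
by rewrite -mulf_div divff // mulr1.
Qed.

Lemma ratmap_ext k (S : set 'cV[K]_k) (f g : 'cV[K]_m -> 'cV[K]_k) : generically (car X) (fun s => f s = g s) ->
  ratmap (car X) S f -> ratmap (car X) S g.
Proof.
move=> fg [H1 H2]; split.
  by move=> i; apply: ratfun_ext (H1 i); apply: generically_impl fg => s _ ->.
by apply: generically_impl (generically_and fg H2) => s _ [<-].
Qed.

End PSpaceTheory.

Section PosMapTheory.
Variables (m m' : nat) (X : pspace m) (X' : pspace m').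

Lemma posmap_ratmap f : posmap X X' f -> ratmap (car X) (car X') f.
Proof.
by move=> [H1 H2 _]; split; [move=> i; apply: posrat_ratfun|apply: posgen_generically].
Qed.

Lemma posrat_comp (f : 'cV[K]_m -> 'cV[K]_m') h : posmap X X' f -> posrat X' h -> posrat X (fun s => h (f s)).
Proof. by move=> [H1 H2 H3]; apply: rat_on_comp => //; apply: pos_car. Qed.

Lemma posgen_comp (f : 'cV[K]_m -> 'cV[K]_m') (Q : _ -> Prop) : posmap X X' f -> posgen X' Q -> posgen X (fun s => Q (f s)).
Proof.
move=> fp [q [q0 H]].
have [||r [r0 Hr]] := @posrat_neq0 _ X (fun s => peval q (f s)).
- by apply: rat_on_peval; case: fp.
- by move=> s /(posmap_pos fp); apply: q0.
have [r' [r0' Hr']] := posmap_car fp.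
exists (r * r'); split=> s Xs; rewrite pevalM; first by rewrite mulf_neq0 ?r0 ?r0'.
by rewrite mulf_eq0 negb_or => /andP[n n']; apply: H; [apply: Hr'|apply: Hr].
Qed.

(** The exceptional set of [Q] may contain positive points, so its preimage must be shown to be
    proper: by density some positive point is not exceptional, and by surjectivity it is a value of
    [f]. *)
Lemma generically_comp (f : 'cV[K]_m -> 'cV[K]_m') (Q : _ -> Prop) : posmap X X' f ->
    (forall s', pos X' s' -> exists2 s, pos X s & f s = s') ->
  generically (car X') Q -> generically (car X) (fun s => Q (f s)).
Proof.
move=> fp fs [q [q0 H]]; have [t Pt nt] := pos_dense q0.
have [s Ps fst] := fs _ Pt.
have [n [d [d0 Hd]]] : posrat X (fun s => peval q (f s)) by apply: rat_on_peval; case: fp.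
have [r [r0 Hr]] := posmap_car fp.
exists (n * d * r); split.
  exists s; first exact: pos_car.
  rewrite !pevalM !mulf_neq0 ?d0 ?r0 //.
  have := Hd _ (pos_car Ps) (d0 _ Ps); rewrite fst => Hq.
  by move: nt; rewrite Hq; apply: contraNneq => ->; rewrite mul0r.
move=> s1 Xs1; rewrite !pevalM !mulf_eq0 !negb_or => /andP[/andP[n1 n2] n3].
by apply: H; [apply: Hr|rewrite Hd // mulf_neq0 ?invr_neq0].
Qed.

Lemma posmap_ext (f g : 'cV[K]_m -> 'cV[K]_m') : (forall s, car X s -> f s = g s) -> posmap X X' f -> posmap X X' g.
Proof.
move=> fg [H1 H2 H3]; split.
- by move=> i; apply: rat_on_ext (H1 i) => s Xs; rewrite fg.
- by apply: posgenS H2 => s Xs; rewrite fg.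
- by move=> s Ps; rewrite -fg; [exact: H3|exact: pos_car].
Qed.

Lemma posmap_comp m'' (X'' : pspace m'')
    (f : 'cV[K]_m -> 'cV[K]_m') (g : 'cV[K]_m' -> 'cV[K]_m'') : posmap X X' f -> posmap X' X'' g ->
  posmap X X'' (fun s => g (f s)).
Proof.
move=> fp gp; split.
- by move=> i; apply: (posrat_comp (h := fun s => g s i ord0) fp); case: gp.
- by apply: (posgen_comp (Q := fun s => car X'' (g s)) fp); case: gp.
- by move=> s Ps; apply: (posmap_pos gp); apply: (posmap_pos fp).
Qed.

End PosMapTheory.

End RatOn.

Section PolynomialMaps.
Variable K : fieldType.

Lemma peval_comp m m' (f : 'cV[K]_m -> 'cV[K]_m') q :
    (forall i, exists p, forall s, f s i ord0 = peval p s) ->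
  exists p, forall s, peval q (f s) = peval p s.
Proof.
move=> Hf; apply: (@peval_alg _ _ (fun g => exists p, forall s, g s = peval p s)) => //.
- by move=> c; exists c%:MP => s; rewrite pevalC.
- by move=> g h [p Hp] [p' Hp']; exists (p + p') => s; rewrite pevalD Hp Hp'.
- by move=> g h [p Hp] [p' Hp']; exists (p * p') => s; rewrite pevalM Hp Hp'.
Qed.

Lemma peval_line m (q : {mpoly K[m]}) (s d : 'cV[K]_m) :
  exists P : {poly K}, forall c, peval q (s + c *: d) = P.[c].
Proof.
apply: (@peval_alg _ _ (fun g => exists P : {poly K}, forall c, g c = P.[c])).
- by move=> c; exists c%:P => x; rewrite hornerC.
- by move=> g h [p Hp] [p' Hp']; exists (p + p') => x; rewrite hornerD Hp Hp'.
- by move=> g h [p Hp] [p' Hp']; exists (p * p') => x; rewrite hornerM Hp Hp'.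
- move=> i; exists ((s i ord0)%:P + d i ord0 *: 'X) => x.
  by rewrite !mxE hornerD hornerC hornerZ hornerX mulrC.
Qed.

Lemma peval_col_r r m (q : {mpoly K[r + m]}) t :
  exists p, forall s, peval q (col_mx t s) = peval p s.
Proof.
apply: peval_comp => i; case: (splitP i) => j Hj.
  exists (t j ord0)%:MP => s; rewrite pevalC -(col_mxEu t s).
  by congr (fun_of_matrix _ _ _); apply: val_inj.
exists 'X_j => s; rewrite pevalX -(col_mxEd t s).
by congr (fun_of_matrix _ _ _); apply: val_inj.
Qed.

Lemma peval_col_l r m (q : {mpoly K[r + m]}) s :
  exists p, forall t, peval q (col_mx t s) = peval p t.
Proof.
apply: peval_comp => i; case: (splitP i) => j Hj.
  exists 'X_j => t; rewrite pevalX -(col_mxEu t s).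
  by congr (fun_of_matrix _ _ _); apply: val_inj.
exists (s j ord0)%:MP => t; rewrite pevalC -(col_mxEd t s).
by congr (fun_of_matrix _ _ _); apply: val_inj.
Qed.

End PolynomialMaps.

(** * Products, images and tori as spaces with a dense positive part *)

Section ProductSpace.
Variables (K : fieldType) (r m : nat) (T : pspace K r) (X : pspace K m).

Let S : set 'cV[K]_(r + m) := [set s | car T (usubmx s) /\ car X (dsubmx s)].
Let P : set 'cV[K]_(r + m) := [set s | pos T (usubmx s) /\ pos X (dsubmx s)].

Lemma ptimes_pos_car : P `<=` S.
Proof. by move=> s [H1 H2]; split; apply: pos_car. Qed.

(** One factor is moved at a time: first the point of [X] with that of [T] fixed, then the point of
    [T]. *)
Lemma ptimes_pos_dense (q : {mpoly K[r + m]}) : (exists2 s, S s & peval q s != 0) ->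
  exists2 s, P s & peval q s != 0.
Proof.
move=> [s [St Sx] n]; rewrite -[s]vsubmxK in n.
have [p Hp] := peval_col_r q (usubmx s).
have [|x Px] := @pos_dense _ _ X p; first by exists (dsubmx s); rewrite // -Hp.
rewrite -Hp => nx; have [p' Hp'] := peval_col_l q x.
have [|t Pt] := @pos_dense _ _ T p'; first by exists (usubmx s); rewrite // -Hp'.
rewrite -Hp' => nt; exists (col_mx t x) => //.
by rewrite /P /= col_mxKu col_mxKd.
Qed.

(** Irreducibility is used on slices: if p and q do not vanish at (t1, x1) and (t2, x2)
    respectively, irreducibility of [T] gives a t with p nonzero at (t, x1) and q nonzero at (t,
    x2), and irreducibility of [X] then gives an x with both nonzero at (t, x). *)
Lemma ptimes_irr : irreducible_set S.
Proof.
split.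
  have [t Pt] := pos_ex T; have [x Px] := pos_ex X; exists (col_mx t x).
  by rewrite /S /= col_mxKu col_mxKd; split; apply: pos_car.
move=> p q pq0; apply: contrapT => /not_orP[/existsNP[s Hs] /existsNP[s' Hs']].
have [Ss ns] : S s /\ peval p s <> 0 by apply: contrapT => H; apply: Hs => ?; apply: contrapT => ?; apply: H.
have [Ss' ns'] : S s' /\ peval q s' <> 0 by apply: contrapT => H; apply: Hs' => ?; apply: contrapT => ?; apply: H.
rewrite -[s]vsubmxK in ns; rewrite -[s']vsubmxK in ns'.
case: Ss => St Sx; case: Ss' => St' Sx'.
have [a Ha] := peval_col_l p (dsubmx s); have [b Hb] := peval_col_l q (dsubmx s').
have [_ /(_ a b)] := car_irr T; case => [t Tt|/(_ _ St)|/(_ _ St')]; last 2 first.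
- by rewrite -Ha.
- by rewrite -Hb.
rewrite -Ha -Hb.
have [c Hc] := peval_col_r p t; have [d Hd] := peval_col_r q t.
have [_ /(_ c d)] := car_irr X; case => [x Xx|/(_ _ Sx)|/(_ _ Sx')].
- by rewrite -Hc -Hd pq0 // /S /= col_mxKu col_mxKd.
- by rewrite -Hc => ->; rewrite mul0r.
- by rewrite -Hd => ->; rewrite mulr0.
Qed.

Definition ptimes : pspace K (r + m) := PSpace ptimes_pos_car ptimes_pos_dense ptimes_irr.

Lemma posmap_fst : posmap ptimes T usubmx.
Proof.
split; [|by apply: posgen_true => s []|by move=> s []].
by move=> i; apply: rat_on_ext (rat_on_coord _ _ (lshift m i)) => s _; rewrite mxE.
Qed.

Lemma posmap_snd : posmap ptimes X dsubmx.
Proof.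
split; [|by apply: posgen_true => s []|by move=> s []].
by move=> i; apply: rat_on_ext (rat_on_coord _ _ (rshift r i)) => s _; rewrite mxE.
Qed.

Lemma posmap_pair k (Z : pspace K k) (f : 'cV[K]_k -> 'cV[K]_r) (h : 'cV[K]_k -> 'cV[K]_m) :
  posmap Z T f -> posmap Z X h -> posmap Z ptimes (fun z => col_mx (f z) (h z)).
Proof.
move=> [f1 f2 f3] [h1 h2 h3]; split.
- move=> i; case: (splitP i) => j Hj.
    apply: rat_on_ext (f1 j) => s _; rewrite -(col_mxEu _ (h s)).
    by congr (fun_of_matrix _ _ _); apply: val_inj.
  apply: rat_on_ext (h1 j) => s _; rewrite -(col_mxEd (f s)).
  by congr (fun_of_matrix _ _ _); apply: val_inj.
- by apply: posgenS (posgenI f2 h2) => s _ [? ?]; rewrite /= /S /= col_mxKu col_mxKd.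
- by move=> s Ps; rewrite /= /P /= col_mxKu col_mxKd; split; [apply: f3|apply: h3].
Qed.

End ProductSpace.

Section ImageSpace.
Variables (K : fieldType) (m m' : nat) (X : pspace K m) (f : 'cV[K]_m -> 'cV[K]_m').
Hypothesis freg : forall i, rat_on (car X) (car X) (fun s => f s i ord0).

Lemma image_pos_car : f @` pos X `<=` f @` car X.
Proof. by move=> _ [s Ps <-]; exists s => //; apply: pos_car. Qed.

Lemma image_pos_dense (q : {mpoly K[m']}) : (exists2 s, (f @` car X) s & peval q s != 0) ->
  exists2 s, (f @` pos X) s & peval q s != 0.
Proof.
move=> [_ [s Xs <-]]; have [n [d [d0 Hd]]] := rat_on_peval q freg.
rewrite Hd ?d0 // => H; have ns : peval n s != 0 by apply: contraNneq H => ->; rewrite mul0r.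
have [|t Pt nt] := @pos_dense _ _ X n; first by exists s.
have Xt := pos_car Pt.
by exists (f t); [exists t|rewrite Hd ?d0 // mulf_neq0 ?invr_neq0 ?d0].
Qed.

Lemma image_irr : irreducible_set (f @` car X).
Proof.
split; first by have [[s Xs] _] := car_irr X; exists (f s), s.
move=> p q pq; have [n [d [d0 Hd]]] := rat_on_peval p freg.
have [n' [d' [d0' Hd']]] := rat_on_peval q freg.
have [_ /(_ n n')] := car_irr X; case => [s Xs|H|H]; last 2 first.
- by left=> _ [s Xs <-]; rewrite Hd ?d0 // H // mul0r.
- by right=> _ [s Xs <-]; rewrite Hd' ?d0' // H // mul0r.
have /eqP := pq (f s) (imageP f Xs); rewrite Hd ?d0 // Hd' ?d0' //.
rewrite !mulf_eq0 !invr_eq0 (negbTE (d0 _ Xs)) (negbTE (d0' _ Xs)) !orbF.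
by case/orP => /eqP ->; rewrite ?mul0r ?mulr0.
Qed.

Definition pimage : pspace K m' := PSpace image_pos_car image_pos_dense image_irr.

Lemma posmap_pimage : posmap X pimage f.
Proof.
split; last by move=> s Ps; exists s.
  move=> i; have [p [q [q0 H]]] := freg i; exists p, q; split=> // s /pos_car; exact: q0.
by apply: posgen_true => s Xs; exists s.
Qed.

End ImageSpace.

Section TorusSpace.
Variables (K : numFieldType) (r : nat).

Definition postorus : set 'cV[K]_r := [set t | forall i, 0 < t i ord0].

Lemma postorus_torus : postorus `<=` torus K r.
Proof. by move=> t Pt i; rewrite gt_eqF. Qed.

(** The integers from 1 to the size of [P] are distinct in characteristic zero, and they are too
    many to be all roots. *)
Lemma poly_pos_nonroot (P : {poly K}) : P != 0 -> exists2 c, 0 < c & P.[c] != 0.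
Proof.
move=> P0; pose rs := [seq (i.+1%:R : K) | i <- iota 0 (size P)].
have [|] := boolP (all (root P) rs); last first.
  by case/allPn => c /mapP[i _ ->] n; exists i.+1%:R; rewrite ?ltr0Sn.
move=> /(max_poly_roots P0); rewrite size_map size_iota ltnn => H.
suff /H: uniq rs by [].
by rewrite map_inj_uniq ?iota_uniq // => i j /eqP; rewrite eqr_nat => /eqP[].
Qed.

(** The coordinates are made positive one after the other: along a coordinate line through a point
    where [q] is nonzero, [q] is a nonzero polynomial in one variable. *)
Lemma postorus_dense (q : {mpoly K[r]}) : (exists2 s, torus K r s & peval q s != 0) ->
  exists2 s, postorus s & peval q s != 0.
Proof.
move=> [s _ ns].
suff H (l : seq 'I_r) : exists2 t : 'cV[K]_r, (forall j, j \in l -> 0 < t j ord0) & peval q t != 0.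
  by have [t Pt nt] := H (enum 'I_r); exists t => // i; apply: Pt; rewrite mem_enum.
elim: l => [|j l [t Pt nt]]; first by exists s.
pose t0 := t - t j ord0 *: delta_mx j ord0 : 'cV[K]_r.
have [P HP] := peval_line q t0 (delta_mx j ord0).
have Ht : t = t0 + t j ord0 *: delta_mx j ord0 by rewrite /t0 subrK.
have P0 : P != 0 by apply: contraNneq nt => P0; rewrite Ht HP P0 horner0.
have [c c0 nc] := poly_pos_nonroot P0.
exists (t0 + c *: delta_mx j ord0); last by rewrite HP.
move=> i; rewrite inE !mxE eqxx andbT; have [-> _|_] := eqVneq i j.
  by rewrite !mulr1 subrr add0r.
by rewrite !mulr0 subr0 addr0 => /Pt.
Qed.

Lemma torus_irr : irreducible_set (torus K r).
Proof.
split; first by exists (const_mx 1) => i; rewrite mxE oner_neq0.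
move=> p q pq; apply: contrapT => /not_orP[/existsNP[s Hs] /existsNP[s' Hs']].
have [Ss /eqP ns] : torus K r s /\ peval p s <> 0.
  by apply: contrapT => H; apply: Hs => ?; apply: contrapT => ?; apply: H.
have [Ss' /eqP ns'] : torus K r s' /\ peval q s' <> 0.
  by apply: contrapT => H; apply: Hs' => ?; apply: contrapT => ?; apply: H.
have [P HP] := peval_line p s (s' - s); have [Q HQ] := peval_line q s (s' - s).
(* [l] is the product of the coordinates along the line through [s] and [s']; away from its roots
   the line stays in the torus. *)
pose l := \prod_(i < r) ((s i ord0)%:P + (s' i ord0 - s i ord0) *: 'X).
have l0 : l != 0.
  apply/prodf_neq0 => i _; apply: contraNneq (Ss i) => /(congr1 (horner^~ 0)).
  by rewrite hornerD hornerC hornerZ hornerX mulr0 addr0 horner0 => ->.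
have P0 : P != 0.
  by apply: contraNneq ns => P0; have := HP 0; rewrite scale0r addr0 P0 horner0 => ->.
have Q0 : Q != 0.
  apply: contraNneq ns' => Q0; have := HQ 1.
  by rewrite scale1r addrC subrK Q0 horner0 => ->.
have [|c _] := @poly_pos_nonroot (P * Q * l); first by rewrite !mulf_neq0.
rewrite !hornerM !mulf_eq0 !negb_or => /andP[/andP[nP nQ] nl].
have Hc : torus K r (s + c *: (s' - s)).
  move=> i; move: nl; rewrite horner_prod => /prodf_neq0/(_ i isT).
  by rewrite hornerD hornerC hornerZ hornerX !mxE mulrC.
by have /eqP := pq _ Hc; rewrite HP HQ mulf_eq0 (negbTE nP) (negbTE nQ).
Qed.

Definition tspace : pspace K r := PSpace postorus_torus postorus_dense torus_irr.

Lemma posmap_tspace m (X : pspace K m) (f : 'cV[K]_m -> 'cV[K]_r) :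
    (forall i, posrat X (fun s => f s i ord0)) ->
    (forall s, pos X s -> forall i, 0 < f s i ord0) ->
  posmap X tspace f.
Proof.
move=> Hf fP; split=> //; apply: posgen_allord => i.
by apply: posrat_neq0 => // s Ps; rewrite gt_eqF // fP.
Qed.

End TorusSpace.

(** * Reduced words *)

Section WeylWords.
Variables (N : nat) (A : 'M[int]_N).
Local Notation al := (@simple_root N).
Local Notation s := (srefl A).
Local Notation weyl := (weyl A).

(** Only the rank two systems A1 x A1, A2 and B2 occur, so the Coxeter exponents are 2, 3 and 4 and
    everything about dihedral subgroups can be checked by listing. *)
Definition rank2_cartan : Prop := forall i j : 'I_N, i != j ->
  [\/ A i j = 0 /\ A j i = 0, A i j = -1 /\ A j i = -1,
      A i j = -2%:Z /\ A j i = -1 | A i j = -1 /\ A j i = -2%:Z].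

Hypothesis Aii : forall i, A i i = 2%:Z.
Hypothesis Arank2 : rank2_cartan.

Definition cox (i j : 'I_N) : nat :=
  if A i j == 0 then 2 else if A i j * A j i == 1 then 3 else 4.

Fixpoint alt (i j : 'I_N) k := if k is k'.+1 then i :: alt j i k' else [::].

Lemma size_alt i j k : size (alt i j k) = k.
Proof. by elim: k i j => //= k IH i j; rewrite IH. Qed.

Lemma alt_catr i j k1 k2 : exists l, alt i j (k1 + k2) = alt i j k1 ++ l.
Proof.
elim: k1 i j => [|k IH] i j /=; first by exists (alt i j k2).
by have [l ->] := IH j i; exists l.
Qed.

Lemma cox_gt0 i j : (0 < cox i j)%N.
Proof. by rewrite /cox; case: ifP => // _; case: ifP. Qed.

Lemma cox_sym i j : i != j -> cox i j = cox j i.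
Proof. by move=> ij; rewrite /cox; case: (Arank2 ij) => -[-> ->]. Qed.

Lemma srefl_root i j : s i *m al j = al j - A i j *: al i.
Proof.
rewrite /srefl mulmxBl mul1mx -mulmxA; congr (_ - _).
apply/matrixP => k l; rewrite !mxE (bigD1 i) //= big1 ?addr0; last first.
  by move=> h hi; rewrite !mxE (negbTE hi) andbF mul0r.
rewrite !mxE eqxx andbT (bigD1 j) //= big1 ?addr0; last first.
  by move=> h hi; rewrite !mxE (negbTE hi) mulr0.
by rewrite !mxE !ord1 eqxx mulr1 andbT mulrC.
Qed.

Lemma weyl_nil : weyl [::] = 1%:M. Proof. by rewrite /weyl big_nil. Qed.
Lemma weyl_cons i w : weyl (i :: w) = s i *m weyl w.
Proof. by rewrite /weyl big_cons. Qed.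
Lemma weyl_cat w1 w2 : weyl (w1 ++ w2) = weyl w1 *m weyl w2.
Proof. by rewrite /weyl big_cat. Qed.
Lemma weyl_rcons w i : weyl (rcons w i) = weyl w *m s i.
Proof. by rewrite -cats1 weyl_cat weyl_cons weyl_nil mulmx1. Qed.

(** With these matrices s_i is 1 - F i i, and by [FF] the matrices 1, F i i, F i j, F j i, F j j
    span a space stable under s_i and s_j. The coordinates [G] on it turn the rank two braid
    relations into identities of integers. *)
Let F (i j : 'I_N) : 'M[int]_N := delta_mx i j *m A.

Let FF i j k l : F i j *m F k l = A j k *: F i l.
Proof.
rewrite /F mulmxA scalemxAl -[_ *m delta_mx k l]mulmxA; congr (_ *m A).
apply/matrixP => a b; rewrite !mxE (bigD1 j) //= big1 ?addr0; last first.
  by move=> h hi; rewrite !mxE (negbTE hi) andbF mul0r.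
rewrite !mxE eqxx andbT (bigD1 k) //= big1 ?addr0; last first.
  by move=> h hi; rewrite !mxE (negbTE hi) mulr0.
by rewrite !mxE eqxx /= mulrC; case: (a == i); case: (b == l);
   rewrite ?(mulr0, mulr1, mul0r, mul1r).
Qed.

Lemma srefl_sq i : s i *m s i = 1%:M.
Proof.
rewrite /srefl -/(F i i) mulmxBl mul1mx mulmxBr mulmx1 FF Aii.
by rewrite -[2%:Z]/(1 + 1 : int) scalerDl scale1r opprB addrK subrK.
Qed.

Lemma weyl_revK w : weyl (rev w) *m weyl w = 1%:M.
Proof.
elim: w => [|i w IH]; first by rewrite weyl_nil mul1mx.
by rewrite rev_cons weyl_rcons weyl_cons -mulmxA [s i *m _]mulmxA srefl_sq mul1mx.
Qed.

Lemma weyl_Krev w : weyl w *m weyl (rev w) = 1%:M.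
Proof. by rewrite -{1}[w]revK weyl_revK. Qed.

Lemma weyl_rev_eq w w' : weyl w = weyl w' -> weyl (rev w) = weyl (rev w').
Proof.
by move=> H; rewrite -[LHS]mulmx1 -(weyl_Krev w') -H mulmxA weyl_revK mul1mx.
Qed.

(** s_i differs from the identity in row i only, and the cofactors of row i do not see that row. *)
Lemma cofactor_srefl i j : cofactor (s i) i j = cofactor 1%:M i j.
Proof.
rewrite /cofactor; congr (_ * \det _); apply/matrixP => k l; rewrite !mxE big1 ?subr0 // => h _.
by rewrite !mxE eq_sym (negbTE (neq_lift _ _)) mul0r.
Qed.

Lemma det_srefl i : \det (s i) = -1.
Proof.
rewrite (expand_det_row _ i).
have H j : cofactor (1%:M : 'M[int]_N) i j = (j == i)%:R.
  have := mul_mx_adj (1%:M : 'M[int]_N); rewrite mul1mx det1 => /matrixP/(_ j i).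
  by rewrite !mxE.
rewrite (bigD1 i) //= big1 ?addr0; last first.
  by move=> j ji; rewrite cofactor_srefl H (negbTE ji) mulr0.
rewrite cofactor_srefl H eqxx mulr1 !mxE eqxx (bigD1 i) //= big1 ?addr0; last first.
  by move=> h hi; rewrite !mxE (negbTE hi) andbF mul0r.
by rewrite !mxE !eqxx Aii.
Qed.

Lemma det_weyl w : \det (weyl w) = (-1) ^+ size w.
Proof.
elim: w => [|i w IH]; first by rewrite weyl_nil det1.
by rewrite weyl_cons det_mulmx det_srefl IH exprS.
Qed.

(** The determinant is the sign character. It shows that multiplication by a reflection never
    preserves the length. *)
Lemma weyl_parity w w' : weyl w = weyl w' -> odd (size w) = odd (size w').
Proof.
move=> /(congr1 determinant); rewrite !det_weyl -[LHS]signr_odd -[RHS]signr_odd.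
by case: (odd _); case: (odd _) => //= /eqP.
Qed.

Let G i j x y z t : 'M[int]_N :=
  1%:M + x *: F i i + y *: F i j + z *: F j i + t *: F j j.

Let G1 i j : 1%:M = G i j 0 0 0 0.
Proof. by rewrite /G !scale0r !addr0. Qed.

Let sG i j x y z t :
  s i *m G i j x y z t = G i j (-1 - x - A i j * z) (- y - A i j * t) z t.
Proof.
rewrite /G /srefl -/(F i i) !mulmxDr !mulmxBl !mul1mx mulmx1 -!scalemxAr !FF Aii !scalerA.
move: (F i i) (F i j) (F j i) (F j j) => f1 f2 f3 f4.
by apply/matrixP => a b; rewrite !mxE; ring.
Qed.

Let G_sym i j x y z t : G i j x y z t = G j i t z y x.
Proof.
rewrite /G; move: (F i i) (F i j) (F j i) (F j j) => f1 f2 f3 f4.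
by apply/matrixP => a b; rewrite !mxE; ring.
Qed.

Let sG' i j x y z t :
  s j *m G i j x y z t = G i j x y (- z - A j i * x) (-1 - t - A j i * y).
Proof. by rewrite G_sym sG G_sym. Qed.

Lemma weyl_braid i j : i != j -> weyl (alt i j (cox i j)) = weyl (alt j i (cox i j)).
Proof.
move=> ij; rewrite /cox; case: (Arank2 ij) => -[H1 H2];
  rewrite H1 ?H2 /= !weyl_cons !weyl_nil (G1 i j) !(sG, sG') H1 H2;
  by rewrite /G; congr (_ + _ *: _ + _ *: _ + _ *: _ + _ *: _); ring.
Qed.

(** The roots met along an alternating word are listed in the three rank two systems; they are
    positive as long as the word is shorter than the longest element of the dihedral group. *)
Lemma rank2_nonneg i j k : i != j -> (k < cox i j)%N ->
  exists x y, [/\ 0 <= x, 0 <= y & weyl (rev (alt j i k)) *m al i = x *: al i + y *: al j].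
Proof.
have Hi u v c d : s u *m (c *: al u + d *: al v) = (- c - A u v * d) *: al u + d *: al v.
  rewrite mulmxDr -!scalemxAr !srefl_root Aii.
  by move: (al u) (al v) => f1 f2; apply/matrixP => a b; rewrite !mxE; ring.
have Hj u v c d : s v *m (c *: al u + d *: al v) = c *: al u + (- d - A v u * c) *: al v.
  by rewrite addrC Hi addrC.
have H0 : al i = 1 *: al i + 0 *: al j by rewrite scale1r scale0r addr0.
move=> ij; rewrite /cox; case: (Arank2 ij) => -[H1 H2]; rewrite H1 ?H2 /=;
  case: k => [|[|[|[|//]]]] // _; rewrite /rev /= ?weyl_cons ?weyl_nil ?mulmx1 ?mul1mx -?mulmxA;
  rewrite {1}H0 ?Hi ?Hj ?Hi ?Hj ?(H1, H2); by [eexists; eexists; split; last reflexivity; lia].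
Qed.

Lemma reduced_tail i w : reduced A (i :: w) -> reduced A w.
Proof.
move=> H w' E; have := H (i :: w'); rewrite !weyl_cons E /= ltnS; exact.
Qed.

Lemma reduced_catl u v : reduced A (u ++ v) -> reduced A u.
Proof.
move=> H w' E; have := H (w' ++ v); rewrite !weyl_cat E !size_cat leq_add2r; exact.
Qed.

Lemma reduced_eq w w' : weyl w = weyl w' -> size w = size w' -> reduced A w -> reduced A w'.
Proof. by move=> E S H v Ev; rewrite -S; apply: H; rewrite Ev. Qed.

Lemma not_reduced_ii i w : ~ reduced A (i :: i :: w).
Proof.
move=> /(_ w); rewrite !weyl_cons mulmxA srefl_sq mul1mx => /(_ erefl) /=.
by rewrite ltnNge leqnSn.
Qed.

(** If s_i w has a word [w'] that is not longer than [w], then [w'] is strictly shorter by parity,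
    and putting i in front of it gives back w with the right length. *)
Lemma not_reduced_cons i w : reduced A w -> ~ reduced A (i :: w) ->
  exists2 v, weyl w = weyl (i :: v) & size w = (size v).+1.
Proof.
move=> rw /existsNP[w' /not_implyP[E /negP]]; rewrite -ltnNge /= ltnS => L.
have Ew : weyl w = weyl (i :: w') by rewrite weyl_cons E weyl_cons mulmxA srefl_sq mul1mx.
exists w' => //; have := rw _ (esym Ew); have := weyl_parity Ew; rewrite /=.
have [->|ne] := eqVneq (size w') (size w); first by case: odd.
by move=> _ L'; apply/eqP; rewrite eqn_leq L' ltn_neqAle ne.
Qed.

(** Letters i and j are split off on the left as long as possible: [a] lies in the subgroup
    generated by s_i and s_j, and [v] is the shortest element of its coset. The last clause says
    that nothing is split off only if [w] itself is shortest. *)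
Lemma reduced_split i j w : reduced A w -> exists a v,
  [/\ all (pred2 i j) a, weyl (a ++ v) = weyl w, (size a + size v = size w)%N,
      reduced A (i :: v) /\ reduced A (j :: v) &
      a = [::] -> reduced A (i :: w) /\ reduced A (j :: w)].
Proof.
move: {2}(size w) (leqnn (size w)) => n; elim: n w => [|n IH] w wn rw.
  case: w wn rw => // _ _; have H k : reduced A [:: k] by case=> // /weyl_parity.
  by exists [::], [::].
have step k : k \in pred2 i j -> ~ reduced A (k :: w) -> exists a v,
  [/\ all (pred2 i j) a, weyl (a ++ v) = weyl w, (size a + size v = size w)%N,
      reduced A (i :: v) /\ reduced A (j :: v) &
      a = [::] -> reduced A (i :: w) /\ reduced A (j :: w)].
  move=> kij nr; have [v Ev Sv] := not_reduced_cons rw nr.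
  have rv : reduced A v by apply: (@reduced_tail k); apply: reduced_eq rw.
  have [|//|a [v' [H1 H2 H3 H4 _]]] := IH v; first by lia.
  exists (k :: a), v'; split=> //; first by rewrite /= H1 andbT.
    by rewrite cat_cons weyl_cons H2 Ev weyl_cons.
  by rewrite /= Sv -H3.
have [ri|/step H] := pselect (reduced A (i :: w)); last by apply: H; rewrite inE eqxx.
have [rj|/step H] := pselect (reduced A (j :: w)); last by apply: H; rewrite inE eqxx orbT.
by exists [::], w.
Qed.

Lemma reduced_alt i j a : all (pred2 i j) a -> reduced A a ->
  a = alt i j (size a) \/ a = alt j i (size a).
Proof.
elim: a => [|k a IH] /=; first by left.
case/andP => ka /IH {}IH ra; have [{}IH|{}IH] := IH (reduced_tail ra); move: ka => /orP[]/eqP kE.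
- case: a ra IH => [|k' a] /=; first by left; rewrite kE.
  by move=> ra []; rewrite -kE => k1 _; rewrite k1 in ra; case: (not_reduced_ii ra).
- by right; rewrite kE {1}IH.
- by left; rewrite kE {1}IH.
- case: a ra IH => [|k' a] /=; first by right; rewrite kE.
  by move=> ra []; rewrite -kE => k1 _; rewrite k1 in ra; case: (not_reduced_ii ra).
Qed.

Lemma reduced_alt_cox i j k : i != j -> reduced A (alt i j k) -> (k <= cox i j)%N.
Proof.
move=> ij rk; rewrite leqNgt; apply/negP => lt.
have [l El] := alt_catr i j (cox i j).+1 (k - (cox i j).+1).
move: rk; rewrite -(subnKC lt) El => /reduced_catl /= ra.
suff: reduced A (i :: alt i j (cox i j)).
  by case: (cox i j) (cox_gt0 i j) => // c _; apply: not_reduced_ii.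
apply: reduced_eq ra; last by rewrite /= !size_alt.
by rewrite !weyl_cons weyl_braid.
Qed.

Definition nonneg (v : 'cV[int]_N) := forall k, 0 <= v k ord0.

Lemma nonneg_lin x y u v : 0 <= x -> 0 <= y -> nonneg u -> nonneg v ->
  nonneg (x *: u + y *: v).
Proof. by move=> x0 y0 Hu Hv k; rewrite !mxE addr_ge0 ?mulr_ge0. Qed.

(** Here [weyl (rev w)] is the inverse of w, and the claim is that w^-1 alpha_i is a nonnegative
    combination if s_i w is longer than w. Let j be the first letter of w and split w = a v along
    the pair i, j: a^-1 alpha_i is a nonnegative combination of alpha_i and alpha_j by the rank two
    case, and v^-1 preserves the sign of both by induction. *)
Lemma reduced_nonneg i w : reduced A (i :: w) -> nonneg (weyl (rev w) *m al i).
Proof.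
move: {2}(size w) (leqnn (size w)) => n; elim: n i w => [|n IH] i w wn rw.
  by case: w wn rw => // _ _ k; rewrite weyl_nil mul1mx mxE.
case: w wn rw => [|j u] wn rw; first by move=> k; rewrite weyl_nil mul1mx mxE.
have ij : i != j by apply/eqP => ij; rewrite ij in rw; exact: not_reduced_ii rw.
have [a [v [H1 H2 H3 [Hi Hj] H4]]] := reduced_split i j (reduced_tail rw).
have av : reduced A (i :: a ++ v).
  apply: reduced_eq rw; first by rewrite !weyl_cons H2 weyl_cons.
  by rewrite /= size_cat H3.
have a0 : a <> [::] by move=> /H4[_]; apply: not_reduced_ii.
have ra : reduced A (i :: a) by exact: (@reduced_catl _ v).
have aE : a = alt j i (size a).
  have [aE|//] := reduced_alt H1 (reduced_tail ra).
  case: a aE a0 ra {H1 H2 H3 H4 av} => //= k a [kE _] _; rewrite -kE => /not_reduced_ii. done.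
have sa : (size a < cox i j)%N.
  by apply: reduced_alt_cox => //; rewrite /= -aE.
have [x [y [x0 y0 E]]] := rank2_nonneg ij sa.
rewrite -(weyl_rev_eq H2) rev_cat weyl_cat -mulmxA aE E mulmxDr -!scalemxAr.
have sv : (size v <= n)%N.
  by move: H3 wn a0; rewrite /=; case: (a) => //= ? ?; lia.
by apply: nonneg_lin => //; apply: IH.
Qed.

Inductive braid_eq : seq 'I_N -> seq 'I_N -> Prop :=
  | braid_refl w : braid_eq w w
  | braid_trans w1 w2 w3 : braid_eq w1 w2 -> braid_eq w2 w3 -> braid_eq w1 w3
  | braid_move u v i j : i != j ->
      braid_eq (u ++ alt i j (cox i j) ++ v) (u ++ alt j i (cox i j) ++ v).

Lemma braid_cons i w w' : braid_eq w w' -> braid_eq (i :: w) (i :: w').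
Proof.
elim=> [w1|w1 w2 w3 _ H1 _ H2|u v k l kl]; first exact: braid_refl.
  exact: braid_trans H1 H2.
exact: (@braid_move (i :: u)).
Qed.

(** The element a v can start with i as well as with j. If [a] were shorter than the longest element
    of the dihedral group, (a v)^-1 alpha_j would be nonnegative by the rank two case, and
    nonpositive because a v has a reduced word starting with j; so it would be zero. *)
Lemma reduced_cox_le i j a v l : i != j -> all (pred2 i j) a -> reduced A a ->
    reduced A (i :: v) -> reduced A (j :: v) ->
    (forall k, k \in pred2 i j -> exists2 z, weyl (a ++ v) = weyl (k :: z) & reduced A (k :: z)) ->
  a = alt i j l -> (cox i j <= l)%N.
Proof.
move=> ij aij ra ri rj Hk aE; rewrite leqNgt; apply/negP => lt.
have ji : j != i by rewrite eq_sym.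
have [|x [y [x0 y0 E]]] := rank2_nonneg (k := l) ji; first by rewrite cox_sym.
have [|z Ez rz] := Hk j; first by rewrite inE eqxx orbT.
have N1 : nonneg (weyl (rev (a ++ v)) *m al j).
  rewrite rev_cat weyl_cat -mulmxA aE E mulmxDr -!scalemxAr.
  by apply: nonneg_lin => //; apply: reduced_nonneg.
have N2 := reduced_nonneg rz.
have Ej : weyl (rev (a ++ v)) *m al j = - (weyl (rev z) *m al j).
  rewrite (weyl_rev_eq Ez) rev_cons weyl_rcons -mulmxA srefl_root Aii -[2%:Z]/(1 + 1 : int) scalerDl scale1r.
  by rewrite opprD addrA subrr add0r mulmxN.
have Z : weyl (rev z) *m al j = 0.
  apply/matrixP => k m; rewrite ord1 [RHS]mxE; apply/eqP; rewrite eq_le N2 andbT.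
  by have := N1 k; rewrite Ej; move: (weyl _ *m _) => u; rewrite mxE oppr_ge0.
have : al j = 0 by rewrite -[al j]mul1mx -(weyl_Krev z) -mulmxA Z mulmx0.
by move/matrixP/(_ j ord0); rewrite !mxE !eqxx.
Qed.

(* Matsumoto's theorem: two reduced words i u and j u' of w are both braid    *)
(* equivalent to words starting with the longest element of <s_i, s_j>.       *)
Theorem matsumoto w w' : reduced A w -> reduced A w' -> weyl w = weyl w' -> braid_eq w w'.
Proof.
move: {2}(size w) (leqnn (size w)) => n; elim: n w w' => [|n IH] w w' wn rw rw' E;
  have Sw : size w = size w' by apply/eqP; rewrite eqn_leq rw ?rw'.
  by case: w wn Sw {rw rw' E} => // _; case: w' => // _; apply: braid_refl.
case: w wn Sw rw E => [|i u] wn; case: w' rw' => [|j u'] // rw' Sw rw E; first exact: braid_refl.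
(* Words with the same first letter are settled by induction, after this letter has been
   cancelled. *)
have samehead k z z' : (size z <= n)%N -> reduced A (k :: z) -> reduced A (k :: z') ->
    weyl (k :: z) = weyl (k :: z') -> braid_eq (k :: z) (k :: z').
  move=> zn rz rz' Ez; apply/braid_cons/IH => //; [exact: reduced_tail rz|exact: reduced_tail rz'|].
  by rewrite -[LHS]mul1mx -(srefl_sq k) -mulmxA -weyl_cons Ez weyl_cons mulmxA srefl_sq mul1mx.
case: (eqVneq i j) => [ij|ij]; first by rewrite -ij in rw' E *; apply: samehead.
have [a [v [H1 H2 H3 [Hi Hj] _]]] := reduced_split i j rw.
have rav : reduced A (a ++ v) by apply: reduced_eq rw; rewrite ?size_cat.
have Hk k : k \in pred2 i j -> exists2 z, weyl (a ++ v) = weyl (k :: z) & reduced A (k :: z).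
  by rewrite H2 inE => /orP[]/eqP ->; [exists u|exists u'].
have ra := reduced_catl rav.
(* Once [a] starts with a full alternating word, one braid move exchanges its two orders; each end
   of this move shares its first letter with one of the given words. *)
suff [k [l [v' [kl aE]]]] : exists k l v', ((k == i) && (l == j) || (k == j) && (l == i)) /\
    a ++ v = alt k l (cox k l) ++ v'.
  have nkl : k != l by case/orP: kl => /andP[/eqP-> /eqP->]; rewrite // eq_sym.
  have cE := cox_sym nkl; have c0 := cox_gt0 k l.
  have rz : reduced A (alt l k (cox k l) ++ v').
    apply: reduced_eq rav; first by rewrite aE !weyl_cat weyl_braid.
    by rewrite aE !size_cat !size_alt.
  have Ez : weyl (alt l k (cox k l) ++ v') = weyl (i :: u).
    by rewrite -H2 aE !weyl_cat weyl_braid.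
  have B1 := braid_move [::] v' nkl.
  have B2 : braid_eq (alt l k (cox k l) ++ v') (alt k l (cox k l) ++ v').
    by rewrite cE; apply: (@braid_move [::] v'); rewrite eq_sym.
  have sz x y : size (alt x y (cox k l) ++ v') = size (i :: u).
    by rewrite -H3 -(size_cat a) aE !size_cat !size_alt.
  rewrite aE in rav H2.
  have sa x y z : exists z', alt x y (cox k l) ++ z = x :: z'.
    by case: (cox k l) c0 => //= c _; exists (alt y x c ++ z).
  have [z1 E1] := sa k l v'; have [z2 E2] := sa l k v'.
  rewrite /= E1 E2 in B1 B2 rav rz H2 Ez.
  have s1 : size z1 = size u by have := sz k l; rewrite E1 /= => -[].
  have s2 : size z2 = size u by have := sz l k; rewrite E2 /= => -[].
  case/orP: kl => /andP[/eqP kE /eqP lE]; rewrite kE lE in B1 B2 rav rz H2 Ez.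
    apply: braid_trans (samehead _ _ _ _ rw rav _) _ => //.
    apply: braid_trans B1 (samehead _ _ _ _ rz rw' _); rewrite ?s2 // Ez //.
  apply: braid_trans (samehead _ _ _ _ rw rz _) _ => //.
  apply: braid_trans B2 (samehead _ _ _ _ rav rw' _); rewrite ?s1 // H2 //.
have [aE|aE] := reduced_alt H1 ra.
  have L := reduced_cox_le ij H1 ra Hi Hj Hk aE.
  have [l El] := alt_catr i j (cox i j) (size a - cox i j).
  by exists i, j, (l ++ v); rewrite !eqxx catA -El subnKC -?aE.
have L : (cox j i <= size a)%N.
  apply: (@reduced_cox_le j i a v) => //; first by rewrite eq_sym.
    by apply: sub_all H1 => k; rewrite !inE orbC.
  by move=> k; rewrite inE orbC; apply: Hk.
have [l El] := alt_catr j i (cox j i) (size a - cox j i).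
by exists j, i, (l ++ v); rewrite !eqxx orbT catA -El subnKC -?aE.
Qed.

End WeylWords.

(** * Generic braid relations *)

Section TorusCharacters.
Variables (K : numFieldType) (N : nat).
Implicit Types (t : 'cV[K]_N) (u v : 'cV[int]_N).

Lemma torus_charD u v t : torus K N t -> torus_char (u + v) t = torus_char u t * torus_char v t.
Proof.
move=> Tt; rewrite /torus_char -big_split /=; apply: eq_bigr => j _.
by rewrite mxE expfzDr.
Qed.

Lemma torus_char_sum (I : Type) (r : seq I) (F : I -> 'cV[int]_N) t : torus K N t ->
  torus_char (\sum_(i <- r) F i) t = \prod_(i <- r) torus_char (F i) t.
Proof.
move=> Tt; elim: r => [|i r IH]; last by rewrite !big_cons torus_charD // IH.
by rewrite !big_nil /torus_char big1 // => j _; rewrite mxE.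
Qed.

Lemma torus_charZ c u t : torus_char (c *: u) t = torus_char u t ^ c.
Proof.
rewrite /torus_char (big_morph (fun x => x ^ c) (id1 := 1) (op1 := *%R)).
- by apply: eq_bigr => j _; rewrite mxE mulrC exprz_exp.
- by move=> x y; rewrite expfzMl.
- exact: exp1rz.
Qed.

Lemma torus_char_root i t : torus_char (simple_root i) t = t i ord0.
Proof.
rewrite /torus_char (bigD1 i) //= big1 ?mulr1 /simple_root ?mxE ?eqxx //.
by move=> j ji; rewrite mxE (negbTE ji).
Qed.

(** The action of the Weyl group on the torus, in the coordinates alpha_j (t). *)
Definition tpull (M : 'M[int]_N) t : 'cV[K]_N :=
  \col_j torus_char (M *m simple_root j) t.

Lemma torus_char_pull M u t : torus K N t -> torus_char (M *m u) t = torus_char u (tpull M t).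
Proof.
move=> Tt; have -> : M *m u = \sum_j u j ord0 *: (M *m simple_root j).
  rewrite -[in LHS](mulmx1 M) -mulmxA; apply/matrixP => k l; rewrite ord1 mxE summxE.
  under [RHS]eq_bigr => j _ do rewrite !mxE mulr_sumr.
  rewrite exchange_big; apply: eq_bigr => j _ /=; rewrite mul1mx.
  rewrite (bigD1 j) //= big1 ?addr0 => [|h hj]; rewrite !mxE; last first.
    by rewrite [j == h]eq_sym (negbTE hj) mulr0 mulr0.
  by rewrite !eqxx mulr1 mulrC.
rewrite torus_char_sum //; apply: eq_bigr => j _.
by rewrite torus_charZ !mxE.
Qed.

Lemma torus_char_gt0 u t : postorus t -> 0 < torus_char u t.
Proof. by move=> Pt; apply: prodr_gt0 => j _; rewrite exprz_gt0. Qed.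

Lemma tpull_pos M t : postorus t -> postorus (tpull M t).
Proof. by move=> Pt j; rewrite mxE torus_char_gt0. Qed.

End TorusCharacters.

Section BraidRelations.
Variables (K : numFieldType) (N m : nat) (A : 'M[int]_N) (P : set 'cV[K]_m).
Variable e : 'I_N -> K -> 'cV[K]_m -> 'cV[K]_m.

Record braid_rels : Prop := BraidRels {
  braid2 : forall i j, A i j = 0 -> A j i = 0 -> forall c d x, 0 < c -> 0 < d -> P x ->
    e i c (e j d x) = e j d (e i c x);
  braid3 : forall i j, A i j = -1 -> A j i = -1 -> forall c d x, 0 < c -> 0 < d -> P x ->
    e i c (e j (c * d) (e i d x)) = e j d (e i (c * d) (e j c x));
  braid4 : forall i j, A i j = -2%:Z -> A j i = -1 ->
    forall c d x, 0 < c -> 0 < d -> P x ->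
    e i c (e j (c ^+ 2 * d) (e i (c * d) (e j d x))) =
    e j d (e i (c * d) (e j (c ^+ 2 * d) (e i c x))) }.

Hypothesis rels : braid_rels.
Hypothesis eP : forall i c x, 0 < c -> P x -> P (e i c x).
Hypothesis Aii : forall i, A i i = 2%:Z.
Hypothesis Arank2 : rank2_cartan A.

(** The character attached to a letter depends on the letters to its right. For the left factor
    their effect is to move the torus point by the inverse of the right factor. *)
Lemma e_word_cat w1 w2 t x : postorus t ->
  e_word A e t (w1 ++ w2) x = e_word A e (tpull (weyl A (rev w2)) t) w1 (e_word A e t w2 x).
Proof.
move=> Pt; elim: w1 => //= i w1 ->; congr (e i _ _).
rewrite rev_cat weyl_cat -mulmxA torus_char_pull //; exact: postorus_torus.
Qed.

Lemma e_word_pos w t x : postorus t -> P x -> P (e_word A e t w x).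
Proof. by move=> Pt Px; elim: w => //= i w IH; apply: eP => //; apply: torus_char_gt0. Qed.

Lemma e_word_alt i j t x : i != j -> postorus t -> P x ->
  e_word A e t (alt i j (cox A i j)) x = e_word A e t (alt j i (cox A i j)) x.
Proof.
move=> ij Pt Px; have Tt := postorus_torus Pt.
pose sel (h : bool) := if h then i else j.
(* Words in i and j are coded by booleans, and [act] computes their images of alpha_i and alpha_j as
   pairs of integers. The exponents are then found by evaluation; they are the positive roots of the
   rank two system. *)
pose fix act (a b : int) (w : seq bool) (h : bool) {struct w} : int * int :=
  if w is h' :: w' then
    let cd := act a b w' h in
    if h' then (- cd.1 - a * cd.2, cd.2) else (cd.1, - cd.2 - b * cd.1)
  else if h then (1, 0) else (0, 1).
have Hact w h : weyl A (map sel w) *m simple_root (sel h) =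
    (act (A i j) (A j i) w h).1 *: simple_root i + (act (A i j) (A j i) w h).2 *: simple_root j.
  elim: w => [|h' w IH] /=.
    by rewrite weyl_nil mul1mx; case: h; rewrite scale1r scale0r ?addr0 ?add0r.
  rewrite weyl_cons -mulmxA IH mulmxDr -!scalemxAr.
  case: h'; rewrite !srefl_root Aii /=; move: (act _ _ w h) (simple_root i) (simple_root j) => p f1 f2.
    by apply/matrixP => a b; rewrite !mxE; ring.
  by apply/matrixP => a b; rewrite !mxE; ring.
have ch w h c d : act (A i j) (A j i) w h = (c, d) ->
    torus_char (weyl A (map sel w) *m simple_root (sel h)) t = t i ord0 ^ c * t j ord0 ^ d.
  by move=> E; rewrite Hact E torus_charD // !torus_charZ !torus_char_root.
have ti := Pt i; have tj := Pt j.
have c1 : torus_char (weyl A (rev [::]) *m simple_root i) t = t i ord0.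
  by rewrite (ch [::] true 1 0) // expr1z expr0z mulr1.
have c2 : torus_char (weyl A (rev [::]) *m simple_root j) t = t j ord0.
  by rewrite (ch [::] false 0 1) // expr1z expr0z mul1r.
rewrite /cox; case: (Arank2 ij) => -[E1 E2]; rewrite E1 E2 in ch; rewrite E1 ?E2 /= c1 c2.
- rewrite (ch [:: false] true 1 0) // (ch [:: true] false 0 1) //.
  by rewrite !expr1z !expr0z mulr1 mul1r; apply: (braid2 rels).
- rewrite (ch [:: true] false 1 1) // (ch [:: true; false] true 0 1) //.
  rewrite (ch [:: false] true 1 1) // (ch [:: false; true] false 1 0) //.
  by rewrite !expr1z !expr0z mulr1 mul1r [t i _ * _]mulrC; apply: (braid3 rels).
- rewrite (ch [:: false] true 1 1) // (ch [:: false; true] false 2 1) //.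
  rewrite (ch [:: false; true; false] true 1 0) //.
  rewrite (ch [:: true] false 2 1) // (ch [:: true; false] true 1 1) //.
  rewrite (ch [:: true; false; true] false 0 1) //.
  by rewrite !expr1z !expr0z mulr1 mul1r; apply: (braid4 rels).
- rewrite (ch [:: false] true 1 2) // (ch [:: false; true] false 1 1) //.
  rewrite (ch [:: false; true; false] true 1 0) //.
  rewrite (ch [:: true] false 1 1) // (ch [:: true; false] true 1 2) //.
  rewrite (ch [:: true; false; true] false 0 1) //.
  rewrite !expr1z !expr0z mulr1 mul1r ![t i _ * _]mulrC; symmetry; exact: (braid4 rels).
Qed.

(** Matsumoto's theorem reduces the claim to single braid moves. A move inside a word takes place at
    a torus point moved by the letters to its right, so [t] has to vary in the induction. *)
Lemma e_word_reduced w w' t x : reduced A w -> reduced A w' -> weyl A w = weyl A w' ->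
  postorus t -> P x -> e_word A e t w x = e_word A e t w' x.
Proof.
move=> rw rw' E Pt Px; have := matsumoto Aii Arank2 rw rw' E => {rw rw' E} H.
elim: H t Pt => [//|w1 w2 w3 _ IH1 _ IH2 t Pt|u v i j ij t Pt]; first by rewrite IH1 // IH2.
rewrite !(e_word_cat _ _ _ Pt) !rev_cat !weyl_cat e_word_alt //.
- by rewrite -(weyl_rev_eq Aii (weyl_braid Aii Arank2 ij)).
- exact: tpull_pos.
- exact: e_word_pos.
Qed.

End BraidRelations.

(** * From identities at positive points to a geometric crystal *)

Section GenericCrystal.
Variables (K : numFieldType) (N m : nat) (A : 'M[int]_N) (X : pspace K m).
Local Notation TX := (ptimes (tspace K 1) X).
Implicit Types (e : 'I_N -> K -> 'cV[K]_m -> 'cV[K]_m) (gam eps : 'I_N -> 'cV[K]_m -> K).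

(** The axioms for positive points and positive parameters only: there all maps are honest functions
    that can be composed. *)
Record positive_crystal e gam eps : Prop := PositiveCrystal {
  pc_e : forall i, posmap TX X (uncurry_map (e i));
  pc_gam : forall i, posrat X (gam i);
  pc_eps : forall i, posrat X (eps i);
  pc_e1 : forall i x, pos X x -> e i 1 x = x;
  pc_eM : forall i c d x, 0 < c -> 0 < d -> pos X x -> e i c (e i d x) = e i (c * d) x;
  pc_gam_e : forall i j c x, 0 < c -> pos X x -> gam j (e i c x) = c ^ A i j * gam j x;
  pc_eps_e : forall i c x, 0 < c -> pos X x -> eps i (e i c x) = c^-1 * eps i x;
  pc_braid : braid_rels A (pos X) e }.

Definition pair1 (c : K) (x : 'cV[K]_m) : 'cV[K]_(1 + m) := col_mx (const_mx c) x.

Lemma uncurry_pair1 (f : K -> 'cV[K]_m -> 'cV[K]_m) c x : uncurry_map f (pair1 c x) = f c x.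
Proof. by rewrite /uncurry_map col_mxKu col_mxKd mxE. Qed.

Lemma one_timesE (x : 'cV[K]_m) : one_times x = pair1 1 x.
Proof. by []. Qed.

Lemma pair1_surj (s : 'cV[K]_(1 + m)) : s = pair1 (usubmx s ord0 ord0) (dsubmx s).
Proof.
rewrite -[LHS]vsubmxK; congr col_mx; apply/matrixP => i j.
by rewrite !mxE !ord1.
Qed.

Lemma posmap_pair1 k (Z : pspace K k) (chi : 'cV[K]_k -> K) (f : 'cV[K]_k -> 'cV[K]_m) :
    posrat Z chi -> (forall z, pos Z z -> 0 < chi z) -> posmap Z X f ->
  posmap Z TX (fun z => pair1 (chi z) (f z)).
Proof.
move=> Hc c0 Hf; apply: (posmap_pair (f := fun z => const_mx (chi z))) => //.
apply: posmap_tspace => [i|s Ps i]; last by rewrite mxE c0.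
by apply: rat_on_ext Hc => s _; rewrite mxE.
Qed.

Lemma posmap_e e i k (Z : pspace K k) (chi : 'cV[K]_k -> K) (f : 'cV[K]_k -> 'cV[K]_m) :
    posmap TX X (uncurry_map (e i)) ->
    posrat Z chi -> (forall z, pos Z z -> 0 < chi z) -> posmap Z X f ->
  posmap Z X (fun z => e i (chi z) (f z)).
Proof.
move=> He Hc c0 Hf; apply: posmap_ext (posmap_comp (posmap_pair1 Hc c0 Hf) He) => z _.
by rewrite uncurry_pair1.
Qed.

Section Regular.
Variable f f' : K -> 'cV[K]_m -> 'cV[K]_m.
Hypothesis fmap : posmap TX X (uncurry_map f).
Hypothesis f1 : forall x, pos X x -> f 1 x = x.
Hypothesis ff' : generically (car TX) (fun s => uncurry_map f' s = uncurry_map f s).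

Let one_pos x : pos X x -> pos TX (one_times x).
Proof. by move=> Px; split; rewrite ?col_mxKu ?col_mxKd // => i; rewrite mxE. Qed.

Let one_car x : car X x -> car TX (one_times x).
Proof. by move=> Px; split; rewrite ?col_mxKu ?col_mxKd // => i; rewrite mxE oner_neq0. Qed.

(** At a positive x the identity e^1 x = x reads p (1, x) = x_i q (1, x). As an identity of
    polynomials it extends to all of [X], including the points where q (1, x) = 0. *)
Let value_one i p q : (forall s, pos TX s -> peval q s != 0) ->
    (forall s, car TX s -> peval q s != 0 -> uncurry_map f s i ord0 = peval p s / peval q s) ->
  forall x, car X x -> peval p (one_times x) = x i ord0 * peval q (one_times x).
Proof.
move=> q0 H x Xx; have [a Ha] := peval_col_r p (const_mx 1).
have [b Hb] := peval_col_r q (const_mx 1).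
have := @peval_pos_eq0 _ _ X (a - 'X_i * b) _ _ Xx.
rewrite pevalB pevalM pevalX -Ha -Hb => E; apply/eqP; rewrite -subr_eq0; apply/eqP/E => y Py.
have Py1 := one_pos Py; have := H _ (pos_car Py1) (q0 _ Py1).
rewrite one_timesE uncurry_pair1 f1 // pevalB pevalM pevalX -Ha -Hb => ->.
by rewrite divfK ?subrr // q0.
Qed.

Lemma dom_one : posgen X (fun x => dom (car TX) (car X) (uncurry_map f') (one_times x)).
Proof.
have H i : exists pq : {mpoly K[1 + m]} * {mpoly K[1 + m]},
    (forall s, pos TX s -> peval pq.2 s != 0) /\
    (forall s, car TX s -> peval pq.2 s != 0 ->
      uncurry_map f s i ord0 = peval pq.1 s / peval pq.2 s).
  by have [p [q H]] := posmap_rat fmap i; exists (p, q).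
have [pq {}H] := choice H.
have : posgen X (fun x => forall i, peval (pq i).2 (one_times x) != 0).
  apply: posgen_allord => i; have [b Hb] := peval_col_r (pq i).2 (const_mx 1).
  by exists b; split=> [s Ps|s Xs]; rewrite -Hb // (H i).1 //; apply: one_pos.
apply: posgenS => x Xx n; split; first exact: one_car.
exists x => // i; exists (pq i).1, (pq i).2; split=> //.
  have [q0 Hq] := H i.
  have : posgen TX (fun s => uncurry_map f s i ord0 = peval (pq i).1 s / peval (pq i).2 s).
    by exists (pq i).2.
  move/posgen_generically/(generically_and ff').
  by apply: generically_impl => s _ [-> ->].
by rewrite (value_one (H i).1 (H i).2) // mulfK.
Qed.

(** The fraction p / q may have poles at positive points. Still p qf = pf q holds on the whole
    product; at c = 1 the factor qf is nonzero at positive points and can be cancelled, so p (1, x)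
    = x_i q (1, x) there and then everywhere. *)
Lemma regular_one x u : car X x ->
  regular_value (car TX) (uncurry_map f') (one_times x) u -> u = x.
Proof.
move=> Xx H; apply/matrixP => i j; rewrite ord1.
have [p [q [q0 Hpq ->]]] := H i.
have [pf [qf [qf0 Hf]]] := posmap_rat fmap i.
have Hq : generically (car TX) (fun s => peval q s != 0).
  by exists q; split=> //; exists (one_times x) => //; apply: one_car.
have Hqf : generically (car TX) (fun s => peval qf s != 0).
  by apply: posgen_generically; exists qf.
have [r [[s0 Ts0 r0] Hr]] := generically_and (generically_and ff' Hpq) (generically_and Hq Hqf).
have E s : car TX s -> peval p s * peval qf s = peval pf s * peval q s.
  move=> Ts; have [_ /(_ (p * qf - pf * q) r)] := car_irr TX; case=> [t Tt|H1|H1].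
  - have [->|nr] := eqVneq (peval r t) 0; first by rewrite mulr0.
    have [[E1 E2] [n1 n2]] := Hr _ Tt nr.
    rewrite E1 Hf // in E2; move/eqP: E2; rewrite eqr_div // => /eqP E2.
    by rewrite pevalB !pevalM E2 subrr mul0r.
  - by have := H1 _ Ts; rewrite pevalB !pevalM => /eqP; rewrite subr_eq0 => /eqP.
  - by rewrite H1 ?eqxx in r0.
suff -> : peval p (one_times x) = x i ord0 * peval q (one_times x) by rewrite mulfK.
have [a Ha] := peval_col_r p (const_mx 1); have [b Hb] := peval_col_r q (const_mx 1).
have := @peval_pos_eq0 _ _ X (a - 'X_i * b) _ _ Xx.
rewrite pevalB pevalM pevalX -Ha -Hb => E'; apply/eqP; rewrite -subr_eq0; apply/eqP/E' => y Py.
rewrite pevalB pevalM pevalX -Ha -Hb.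
have nf := qf0 _ (one_pos Py); apply: (mulIf nf); rewrite mul0r mulrBl.
have Xy := pos_car Py; have := E _ (one_car Xy); rewrite one_timesE => ->.
by rewrite -!one_timesE (value_one qf0 Hf) // mulrAC subrr.
Qed.

End Regular.

Variables (e e' : 'I_N -> K -> 'cV[K]_m -> 'cV[K]_m) (gam gam' eps eps' : 'I_N -> 'cV[K]_m -> K).
Hypothesis PC : positive_crystal e gam eps.
Hypothesis Aii : forall i, A i i = 2%:Z.
Hypothesis Arank2 : rank2_cartan A.
Hypothesis ee' : forall i, generically (car TX) (fun s => uncurry_map (e' i) s = uncurry_map (e i) s).
Hypothesis gg' : forall i, generically (car X) (fun x => gam' i x = gam i x).
Hypothesis hh' : forall i, generically (car X) (fun x => eps' i x = eps i x).

Lemma e_pos i c x : 0 < c -> pos X x -> pos X (e i c x).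
Proof.
move=> c0 Px; rewrite -uncurry_pair1; apply: (posmap_pos (pc_e PC i)).
by split; rewrite ?col_mxKu ?col_mxKd // => k; rewrite mxE.
Qed.

(** Surjectivity onto pairs of a positive parameter and a positive point keeps the preimage of the
    exceptional set of [ee'] proper. *)
Lemma generically_e k (Z : pspace K k) (chi : 'cV[K]_k -> K) (f : 'cV[K]_k -> 'cV[K]_m) i :
    posrat Z chi -> (forall z, pos Z z -> 0 < chi z) -> posmap Z X f ->
    (forall c x, 0 < c -> pos X x -> exists2 z, pos Z z & chi z = c /\ f z = x) ->
  generically (car Z) (fun z => e' i (chi z) (f z) = e i (chi z) (f z)).
Proof.
move=> Hc c0 Hf surj.
have := generically_comp (posmap_pair1 Hc c0 Hf) _ (ee' i).
case=> [s [Ts Xs]|q [q0 Hq]].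
  have [z Pz [E1 E2]] := surj _ _ (Ts ord0) Xs.
  by exists z; rewrite // E1 E2 -pair1_surj.
by exists q; split=> // z Zz /(Hq _ Zz); rewrite !uncurry_pair1.
Qed.

Lemma e_inv i c x : 0 < c -> pos X x -> exists2 y, pos X y & e i c y = x.
Proof.
move=> c0 Px; have c0' : 0 < c^-1 by rewrite invr_gt0.
exists (e i c^-1 x); first exact: e_pos.
by rewrite (pc_eM PC) // divff ?gt_eqF // (pc_e1 PC).
Qed.

Local Notation TN k := (ptimes (tspace K k) X).

Let chi_u k (i : 'I_k) : posrat (TN k) (fun s => usubmx s i ord0).
Proof. exact: (posmap_rat (posmap_fst (tspace K k) X)). Qed.

Let torus_char_rat k (b : 'cV[int]_k) : posrat (TN k) (fun s => torus_char b (usubmx s)).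
Proof.
apply: rat_on_prod => j _; apply: rat_onXz; [exact: pos_car| |exact: chi_u].
by move=> s [/(_ j) + _]; move=> /gt_eqF ->.
Qed.

Let torus_char_pos k (b : 'cV[int]_k) s : pos (TN k) s -> 0 < torus_char b (usubmx s).
Proof. by case=> Pt _; apply: torus_char_gt0. Qed.

Let pos_col k (t : 'cV[K]_k) x : postorus t -> pos X x -> pos (TN k) (col_mx t x).
Proof. by move=> Pt Px; split; rewrite ?col_mxKu ?col_mxKd. Qed.

Let posmap_word w : posmap (TN N) X (fun s => e_word A e (usubmx s) w (dsubmx s)).
Proof.
elim: w => [|i w IH] /=; first exact: posmap_snd.
pose b := weyl A (rev w) *m simple_root i.
exact: (posmap_e (pc_e PC i) (torus_char_rat b) (@torus_char_pos _ b) IH).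
Qed.

Let word_inv t w x : postorus t -> pos X x -> exists2 y, pos X y & e_word A e t w y = x.
Proof.
move=> Pt; elim: w x => [|i w IH] x Px; first by exists x.
have [y Py Ey] := @e_inv i _ _ (torus_char_gt0 (weyl A (rev w) *m simple_root i) Pt) Px.
by have [z Pz Ez] := IH _ Py; exists z => //=; rewrite Ez.
Qed.

Let word_char_surj w i (c : K) : 0 < c -> exists2 t : 'cV[K]_N, postorus t &
  torus_char (weyl A (rev w) *m simple_root i) t = c.
Proof.
(* Row i of w defines a cocharacter. Its pairing with w^-1 alpha_i is the diagonal entry i of w
   w^-1, which is 1. *)
move=> c0; exists (\col_j c ^ (weyl A w i j)); first by move=> j; rewrite mxE exprz_gt0.
rewrite /torus_char; have := weyl_Krev Aii w => /matrixP/(_ i i).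
rewrite !mxE eqxx => E; rewrite -[RHS]expr1z -[1%R in RHS]E.
have H (r : seq 'I_N) (F : 'I_N -> int) : c ^ (\sum_(j <- r) F j) = \prod_(j <- r) c ^ F j.
  elim: r => [|j r IH]; first by rewrite !big_nil.
  by rewrite !big_cons expfzDr ?gt_eqF // IH.
rewrite H; apply: eq_bigr => j _; rewrite !mxE exprz_exp; congr (c ^ (_ * _)).
rewrite (bigD1 i) //= big1 ?addr0 => [|k ki]; first by rewrite mxE !eqxx mulr1.
by rewrite mxE (negbTE ki) mulr0.
Qed.

(** The operators are replaced one letter at a time. At each letter the parameter and the point
    together must take all positive values, which is the purpose of [word_char_surj] and
    [word_inv]. *)
Let word_generically w : generically (car (TN N)) (fun s =>
  e_word A e' (usubmx s) w (dsubmx s) = e_word A e (usubmx s) w (dsubmx s)).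
Proof.
elim: w => [|i w IH] /=; first by apply: (@posgen_generically _ _ (TN N)); apply: posgen_true.
pose b := weyl A (rev w) *m simple_root i.
have H := @generically_e _ (TN N) _ _ i (torus_char_rat b) (@torus_char_pos _ b) (posmap_word w).
apply: generically_impl (generically_and IH (H _)) => [s _ [-> ->] //|c x c0 Px].
have [t Pt <-] := word_char_surj w i c0; have [y Py Ey] := word_inv w Pt Px.
by exists (col_mx t y); rewrite ?col_mxKu ?col_mxKd //; apply: pos_col.
Qed.

Theorem generic_crystal : geometric_crystal A (car X) e' gam' eps'.
Proof.
have surj1 c x : 0 < c -> pos X x ->
    exists2 z : 'cV[K]_(1 + m), pos TX z & usubmx z ord0 ord0 = c /\ dsubmx z = x.
  move=> c0 Px; exists (pair1 c x); last by rewrite col_mxKu col_mxKd mxE.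
  by apply: pos_col => // i; rewrite mxE.
have u0 k (i : 'I_k) z : pos (TN k) z -> 0 < usubmx z i ord0 by case=> /(_ i).
have me i := posmap_e (pc_e PC i) (@chi_u 1 ord0) (@u0 1%N ord0) (posmap_snd (tspace K 1) X).
have ge i := @generically_e _ TX _ _ i (@chi_u 1 ord0) (@u0 1%N ord0) (posmap_snd (tspace K 1) X) surj1.
have esurj i x : pos X x -> exists2 z, pos TX z & e i (usubmx z ord0 ord0) (dsubmx z) = x.
  move=> Px; have [z Pz [E1 E2]] := surj1 _ _ ltr01 Px.
  by exists z; rewrite // E1 E2 (pc_e1 PC).
(* The behaviour of gamma_j and of epsilon_i under e_i has the same form, with [g] the factor c^a_ij
   or c^-1. *)
have fam (f f' : 'I_N -> 'cV[K]_m -> K) i : (forall j, posrat X (f j)) ->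
    (forall j, generically (car X) (fun x => f' j x = f j x)) ->
    forall (g : K -> K) j, posrat TX (fun s => g (usubmx s ord0 ord0)) ->
    (forall c x, 0 < c -> pos X x -> f j (e i c x) = g c * f j x) ->
    generically_family (car X) (fun (c : 'cV_1) x =>
      f' j (e' i (c ord0 ord0) x) = g (c ord0 ord0) * f' j x).
  move=> Hf ff' g j Hg H.
  have H1 := generically_comp (me i) (esurj i) (ff' j).
  have H2 : generically (car TX) (fun s => f' j (dsubmx s) = f j (dsubmx s)).
    apply: generically_comp (posmap_snd _ _) _ (ff' j) => x Px.
    by have [z Pz [_ E]] := surj1 _ _ ltr01 Px; exists z.
  have H3 : generically (car TX) (fun s => f j (e i (usubmx s ord0 ord0) (dsubmx s)) =
      g (usubmx s ord0 ord0) * f j (dsubmx s)).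
    apply: (@posgen_generically _ _ TX); apply: posrat_eq.
    - exact: (posrat_comp (me i) (Hf j)).
    - by apply: rat_onM Hg _; apply: (posrat_comp (posmap_snd _ _) (Hf j)).
    - by move=> s [Ps1 Ps2]; apply: H.
  apply: generically_impl (generically_and (generically_and (ge i) H1) (generically_and H2 H3)).
  by move=> s _ [[-> ->] [-> ->]].
split.
- exact: car_irr.
- by move=> i; apply: ratfun_ext (posrat_ratfun (pc_gam PC i)); apply: generically_impl (gg' i).
- by move=> i; apply: ratfun_ext (posrat_ratfun (pc_eps PC i)); apply: generically_impl (hh' i).
- move=> i; split.
  + apply: ratmap_ext (posmap_ratmap (pc_e PC i)).
    by apply: generically_impl (ee' i).
  + by move=> x u; apply: (regular_one (pc_e PC i) (pc_e1 PC i) (ee' i)).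
  + have c1 : posrat (TN (1 + 1)) (fun s => usubmx (usubmx s) ord0 ord0).
      by apply: rat_on_ext (@chi_u (1 + 1) (lshift 1 ord0)) => s _; rewrite !mxE.
    have c2 : posrat (TN (1 + 1)) (fun s => dsubmx (usubmx s) ord0 ord0).
      by apply: rat_on_ext (@chi_u (1 + 1) (rshift 1 ord0)) => s _; rewrite !mxE.
    have p1 s : pos (TN (1 + 1)) s -> 0 < usubmx (usubmx s) ord0 ord0.
      by case=> /(_ (lshift 1 ord0)); rewrite !mxE.
    have p2 s : pos (TN (1 + 1)) s -> 0 < dsubmx (usubmx s) ord0 ord0.
      by case=> /(_ (rshift 1 ord0)); rewrite !mxE.
    have sx := posmap_snd (tspace K (1 + 1)) X.
    have surj c d x : 0 < c -> 0 < d -> pos X x -> exists2 z, pos (TN (1 + 1)) z &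
        [/\ usubmx (usubmx z) ord0 ord0 = c, dsubmx (usubmx z) ord0 ord0 = d & dsubmx z = x].
      move=> c0 d0 Px; exists (col_mx (col_mx (const_mx c) (const_mx d)) x).
        apply: pos_col => // k; case: (splitP k) => l Hl.
          suff -> : k = lshift 1 l by rewrite col_mxEu mxE.
          exact: val_inj.
        suff -> : k = rshift 1 l by rewrite col_mxEd mxE.
        exact: val_inj.
      by rewrite !col_mxKu !col_mxKd !mxE.
    have m2 := posmap_e (pc_e PC i) c2 p2 sx.
    have m1 := posmap_e (pc_e PC i) c1 p1 m2.
    have c12 := rat_onM c1 c2.
    have p12 s : pos (TN (1 + 1)) s ->
        0 < usubmx (usubmx s) ord0 ord0 * dsubmx (usubmx s) ord0 ord0.
      by move=> Ps; rewrite mulr_gt0 ?p1 ?p2.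
    have m12 := posmap_e (pc_e PC i) c12 p12 sx.
    have H1 := @generically_e _ (TN (1 + 1)) _ _ i c2 p2 sx.
    have H2 := @generically_e _ (TN (1 + 1)) _ _ i c1 p1 m2.
    have H3 := @generically_e _ (TN (1 + 1)) _ _ i c12 p12 sx.
    have H4 : posgen (TN (1 + 1)) (fun s =>
      e i (usubmx (usubmx s) ord0 ord0) (e i (dsubmx (usubmx s) ord0 ord0) (dsubmx s)) =
      e i (usubmx (usubmx s) ord0 ord0 * dsubmx (usubmx s) ord0 ord0) (dsubmx s)).
      apply: posrat_eqv (posmap_rat m1) (posmap_rat m12) _ => s Ps.
      by case: (Ps) => _ Ps2; apply: (pc_eM PC); rewrite ?p1 ?p2.
    apply: generically_impl (generically_and (generically_and (H1 _) (H2 _))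
      (generically_and (H3 _) (posgen_generically H4))).
    * by move=> s _ [[-> ->] [-> ->]].
    * move=> c x c0 Px; have [z Pz [_ E1 E2]] := surj 1 c x ltr01 c0 Px; by exists z.
    * move=> c x c0 Px; have [z Pz [E0 E1 E2]] := surj c 1 x c0 ltr01 Px; exists z => //.
      by rewrite E0 E1 E2 (pc_e1 PC).
    * move=> c x c0 Px; have [z Pz [E0 E1 E2]] := surj c 1 x c0 ltr01 Px; exists z => //.
      by rewrite E0 E1 E2 mulr1.
- move=> i; apply: posgen_generically.
  exact: (dom_one (pc_e PC i) (pc_e1 PC i) (ee' i)).
- move=> i j; apply: (fam gam gam' i (pc_gam PC) gg' (fun c => c ^ A i j) j).
    apply: rat_onXz => //; [exact: pos_car| |exact: chi_u].
    by move=> s /(@u0 1%N ord0) /gt_eqF ->.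
  by move=> c x c0 Px; rewrite (pc_gam_e PC).
- move=> w w' rw rw' E; rewrite /generically_family.
  have H : posgen (TN N) (fun s => e_word A e (usubmx s) w (dsubmx s) =
      e_word A e (usubmx s) w' (dsubmx s)).
    apply: posrat_eqv (posmap_rat (posmap_word w)) (posmap_rat (posmap_word w')) _.
    move=> s [Pt Px]; apply: (e_word_reduced (pc_braid PC)) => //; exact: e_pos.
  apply: generically_impl (generically_and (posgen_generically H)
    (generically_and (word_generically w) (word_generically w'))).
  by move=> s _ [E1 [-> ->]].
- move=> i; apply: (fam eps eps' i (pc_eps PC) hh' (fun c => c^-1) i).
    apply: rat_onV; [exact: pos_car| |exact: chi_u].
    by move=> s /(@u0 1%N ord0) /gt_eqF ->.
  by move=> c x c0 Px; rewrite (pc_eps_e PC).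
Qed.

End GenericCrystal.

Lemma exprmxZ (K : comNzRingType) d (c : K) (M : 'M[K]_d) l : (c *: M) ^+ l = c ^+ l *: M ^+ l.
Proof.
elim: l => [|l IH]; first by rewrite !expr0 scale1r.
by rewrite !exprS IH -!mulmxE -scalemxAl -scalemxAr scalerA.
Qed.

(** * The crystal of a lift of sigma-bar *)

Section WordMaps.
Variables (R : realType) (g : affine_type) (n : nat) (w : seq nat) (b : wlabel).
Local Notation C := R[i].
Local Notation k := (size w).
Local Notation T := (tspace C k).

(** The entries of Y_i(c) are Laurent polynomials in c, so there are no poles on the whole torus, as
    [pimage] requires. *)
Lemma vpar_reg a : rat_on (torus C k) (torus C k) (fun x => vpar (R := R) g n b x a ord0).
Proof.
pose mr a b (M : 'cV[C]_k -> 'M[C]_(a, b)) :=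
  forall i j, rat_on (torus C k) (torus C k) (fun x => M x i j).
have mrM a1 a2 a3 (M : _ -> 'M_(a1, a2)) (M' : _ -> 'M_(a2, a3)) : mr _ _ M -> mr _ _ M' ->
    mr _ _ (fun x => M x *m M' x).
  move=> H H' i j; apply: (@rat_on_ext _ _ _ _ (fun x => \sum_l M x i l * M' x l j)).
    by move=> x _; rewrite mxE.
  by apply: rat_on_sum => l _; apply: rat_onM.
have mrc a1 a2 (M : 'M_(a1, a2)) : mr _ _ (fun=> M) by move=> i j; apply: rat_on_cst.
have xn0 (j : 'I_k) (x : 'cV[C]_k) : torus C k x -> x j ord0 != 0 by apply.
have mrV (j : 'I_k) : rat_on (torus C k) (torus C k) (fun x => (x j ord0)^-1).
  by apply: rat_onV (@xn0 j) (rat_on_coord _ _ j).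
have mrY i j : mr _ _ (fun x => Y g n i (x j ord0)).
  apply: mrM; last first.
    move=> p q; have [<-|ne] := eqVneq p q.
      apply: (@rat_on_ext _ _ _ _ (fun x => x j ord0 ^ wt g n (lab p) i)).
        by move=> x _; rewrite !mxE eqxx mulr1n.
      by apply: rat_onXz (@xn0 j) (rat_on_coord _ _ j).
    apply: (@rat_on_ext _ _ _ _ (fun=> 0)); last exact: rat_on_cst.
    by move=> x _; rewrite !mxE (negbTE ne) mulr0n.
  move=> p q; apply: (@rat_on_ext _ _ _ _
    (fun x => \sum_(l < dimW g n) (l`!%:R)^-1 * ((x j ord0)^-1 ^+ l * (f_mx R g n i ^+ l) p q))).
    move=> x _; rewrite /exp_nilp summxE; apply: eq_bigr => l _.
    by rewrite exprmxZ !mxE.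
  apply: rat_on_sum => l _; apply: rat_onM; first exact: rat_on_cst.
  by apply: rat_onM; [exact: rat_onX|exact: rat_on_cst].
have mrP (r : seq 'I_k) : mr _ _ (fun x => \prod_(l <- r) Y g n (nth 0%N w l) (x l ord0)).
  elim: r => [|l r IH] i j.
    by apply: rat_on_ext (mrc _ _ 1 i j) => x _; rewrite big_nil.
  by apply: rat_on_ext (mrM _ _ _ _ _ (mrY (nth 0%N w l) l) IH i j) => x _; rewrite big_cons.
by apply: (mrM _ _ _ _ _ (mrP _)).
Qed.

Lemma Pmon_gt0 i (x : 'cV[C]_k) l : postorus x -> 0 < Pmon g n i x l.
Proof.
move=> Px; rewrite /Pmon invr_gt0 mulr_gt0 ?Px // prodr_gt0 // => j _.
by rewrite exprz_gt0.
Qed.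

Lemma gam_par_rat i : posrat T (gam_par (R := R) g n (w := w) i).
Proof.
apply: rat_on_prod => j _; apply: rat_onXz; [exact: pos_car| |exact: rat_on_coord].
by move=> x /(_ j)/gt_eqF ->.
Qed.

Lemma Pmon_rat i l : posrat T (fun x => Pmon g n i x l).
Proof.
apply: rat_onV; first exact: pos_car.
  by move=> x Px; rewrite -invr_eq0 gt_eqF //; apply: Pmon_gt0.
apply: rat_onM; last exact: rat_on_coord.
apply: rat_on_prod => j _; apply: rat_onXz; [exact: pos_car| |exact: rat_on_coord].
by move=> x /(_ j)/gt_eqF ->.
Qed.

Lemma eps_par_rat i : posrat T (eps_par (R := R) g n (w := w) i).
Proof. by apply: rat_on_sum => l _; apply: Pmon_rat. Qed.

Lemma eps_term_ge0 i (Q : pred 'I_k) (x : 'cV[C]_k) : postorus x ->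
  0 <= \sum_(l < k | (nth 0%N w l == i) && Q l) Pmon g n i x l.
Proof. by move=> Px; apply: sumr_ge0 => l _; apply/ltW/Pmon_gt0. Qed.

Definition e_num (i : nat) (c : C) (x : 'cV[C]_k) (j : 'I_k) : C :=
  c * (\sum_(l < k | (nth 0%N w l == i) && (l <= j)%N) Pmon g n i x l) +
  \sum_(l < k | (nth 0%N w l == i) && (j < l)%N) Pmon g n i x l.
Definition e_den (i : nat) (c : C) (x : 'cV[C]_k) (j : 'I_k) : C :=
  c * (\sum_(l < k | (nth 0%N w l == i) && (l < j)%N) Pmon g n i x l) +
  \sum_(l < k | (nth 0%N w l == i) && (j <= l)%N) Pmon g n i x l.

Lemma e_parE i c x j : e_par g n i c x j ord0 = x j ord0 * (e_num i c x j / e_den i c x j).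
Proof. by rewrite mxE. Qed.

(** All numerators and denominators in the formula for e_i have this form. They are positive because
    the letter i occurs in the word, so that at least one P_m is present. *)
Lemma eps_two_gt0 i (Q Q' : pred 'I_k) c (x : 'cV[C]_k) : i \in w -> 0 < c -> postorus x ->
    (forall l, Q l || Q' l) ->
  0 < c * (\sum_(l < k | (nth 0%N w l == i) && Q l) Pmon g n i x l) +
  \sum_(l < k | (nth 0%N w l == i) && Q' l) Pmon g n i x l.
Proof.
move=> iw c0 Px QQ; have lt : (index i w < k)%N by rewrite index_mem.
have H (F : pred 'I_k) : F (Ordinal lt) ->
    0 < \sum_(l < k | (nth 0%N w l == i) && F l) Pmon g n i x l.
  move=> FQ; rewrite (bigD1 (Ordinal lt)) /=; last by rewrite FQ nth_index ?eqxx.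
  apply: ltr_pwDl; first exact: Pmon_gt0.
  by apply: sumr_ge0 => l _; apply/ltW/Pmon_gt0.
case/orP: (QQ (Ordinal lt)) => [/H H1|/H H1].
  by apply: ltr_pwDl; [rewrite mulr_gt0|exact: eps_term_ge0].
by apply: ltr_wpDl => //; rewrite mulr_ge0 ?eps_term_ge0 // ltW.
Qed.

Variable i : nat.
Hypothesis iw : i \in w.

Lemma e_num_gt0 c x j : 0 < c -> postorus x -> 0 < e_num i c x j.
Proof. by move=> c0 Px; apply: eps_two_gt0 => // l; case: leqP. Qed.

Lemma e_den_gt0 c x j : 0 < c -> postorus x -> 0 < e_den i c x j.
Proof. by move=> c0 Px; apply: eps_two_gt0 => // l; case: ltnP. Qed.

Lemma e_par_pos c (x : 'cV[C]_k) : 0 < c -> postorus x -> postorus (e_par g n i c x).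
Proof.
by move=> c0 Px j; rewrite e_parE mulr_gt0 ?divr_gt0 ?e_num_gt0 ?e_den_gt0.
Qed.

Lemma e_par1 (x : 'cV[C]_k) : postorus x -> e_par g n i 1 x = x.
Proof.
move=> Px; apply/matrixP => j h; rewrite ord1 e_parE.
suff -> : e_num i 1 x j = e_den i 1 x j by rewrite divff ?mulr1 // gt_eqF ?e_den_gt0.
have H (Q : pred 'I_k) : \sum_(l < k | nth 0%N w l == i) Pmon g n i x l =
    \sum_(l < k | (nth 0%N w l == i) && Q l) Pmon g n i x l +
    \sum_(l < k | (nth 0%N w l == i) && ~~ Q l) Pmon g n i x l.
  by rewrite (bigID Q).
rewrite /e_num /e_den !mul1r.
transitivity (\sum_(l < k | nth 0%N w l == i) Pmon g n i x l).
  rewrite (H (fun l => (l <= j)%N)); congr (_ + _).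
  by apply: eq_bigl => l; rewrite ltnNge.
rewrite (H (fun l => (l < j)%N)); congr (_ + _).
by apply: eq_bigl => l; rewrite -leqNgt.
Qed.

Lemma e_par_map : posmap (ptimes (tspace C 1) T) T (uncurry_map (e_par (R := R) g n (w := w) i)).
Proof.
have fst_rat : posrat (ptimes (tspace C 1) T) (fun s => usubmx s ord0 ord0).
  exact: (posmap_rat (posmap_fst _ _)).
have PP l : posrat (ptimes (tspace C 1) T) (fun s => Pmon g n i (dsubmx s) l).
  exact: (posrat_comp (posmap_snd _ _) (Pmon_rat i l)).
apply: posmap_tspace; last first.
  by move=> s [Pc Px] j; apply: e_par_pos.
move=> j; apply: (@rat_on_ext _ _ _ _ (fun s => dsubmx s j ord0 *
  (e_num i (usubmx s ord0 ord0) (dsubmx s) j / e_den i (usubmx s ord0 ord0) (dsubmx s) j))).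
  by move=> s _; rewrite /uncurry_map e_parE.
apply: rat_onM; first exact: (posmap_rat (posmap_snd _ _)).
apply: rat_on_div; first exact: pos_car.
- by move=> s [Pc Px]; rewrite gt_eqF // e_den_gt0.
- by apply: rat_onD; [apply: rat_onM fst_rat _|]; apply: rat_on_sum => l _; exact: PP.
- by apply: rat_onD; [apply: rat_onM fst_rat _|]; apply: rat_on_sum => l _; exact: PP.
Qed.

End WordMaps.

Section CrystalOfLift.
Variables (R : realType) (g : affine_type) (n : nat).
Local Notation C := R[i].
Local Notation w1 := (word1 g n).
Local Notation w2 := (tgt_word g n).
Local Notation b2 := (tgt_base g n).
Local Notation s0 := (sigma_index g n 0).
Local Notation T1 := (tspace C (size w1)).
Local Notation T2 := (tspace C (size w2)).
Local Notation vp1 := (vpar (R := R) g n (w := w1) (V 1)).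
Local Notation vp2 := (vpar (R := R) g n (w := w2) b2).

Definition V1space := pimage (X := T1) (fun a => @vpar_reg R g n w1 (V 1) a).
Definition V2space := pimage (X := T2) (fun a => @vpar_reg R g n w2 b2 a).

Variables (S : 'cV[C]_(size w1) -> 'cV[C]_(size w2)) (S' : 'cV[C]_(size w2) -> 'cV[C]_(size w1)).
Variables (cf1 : 'cV[C]_(dimW g n) -> 'cV[C]_(size w1)) (cf2 : 'cV[C]_(dimW g n) -> 'cV[C]_(size w2)).

Definition ex (i : 'I_n.+1) (c : C) (x : 'cV[C]_(size w1)) : 'cV[C]_(size w1) :=
  if i == ord0 then S' (e_par g n s0 c (S x)) else e_par g n i c x.
Definition gamx (i : 'I_n.+1) (x : 'cV[C]_(size w1)) : C :=
  if i == ord0 then gam_par g n s0 (S x) else gam_par g n i x.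
Definition epsx (i : 'I_n.+1) (x : 'cV[C]_(size w1)) : C :=
  if i == ord0 then eps_par g n s0 (S x) else eps_par g n i x.

(** What a type has to provide: a formula [S] for sigma-bar in torus coordinates with inverse [S'],
    rational inverses [cf1] and [cf2] of the two parametrizations, and the crystal identities on the
    torus. *)
Record lift_data : Prop := LiftData {
  ld_S : posmap T1 T2 S;
  ld_S' : posmap T2 T1 S';
  ld_SK : forall x, postorus x -> S' (S x) = x;
  ld_S'K : forall y, postorus y -> S (S' y) = y;
  ld_lift : is_sigma_lift S;
  ld_uniq : forall y, is_sigma_lift y -> generically (torus C _) (fun x => y x = S x);
  ld_cf1 : forall i, posrat V1space (fun u => cf1 u i ord0);
  ld_cf1K : forall x, torus C _ x -> cf1 (vp1 x) = x;
  ld_cf2 : forall i, posrat V2space (fun u => cf2 u i ord0);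
  ld_cf2K : forall x, torus C _ x -> cf2 (vp2 x) = x;
  ld_s0 : s0 \in w2;
  ld_mem : forall i, (0 < i <= n)%N -> i \in w1;
  ld_Aii : forall i, cartan_mx g n i i = 2%:Z;
  ld_rank2 : rank2_cartan (cartan_mx g n);
  ld_eM : forall i c d x, 0 < c -> 0 < d -> postorus x -> ex i c (ex i d x) = ex i (c * d) x;
  ld_gam_e : forall i j c x, 0 < c -> postorus x ->
    gamx j (ex i c x) = c ^ cartan_mx g n i j * gamx j x;
  ld_eps_e : forall i c x, 0 < c -> postorus x -> epsx i (ex i c x) = c^-1 * epsx i x;
  ld_braid : braid_rels (cartan_mx g n) (@postorus C _) ex }.

Hypothesis LD : lift_data.

Let ex_map i : posmap (ptimes (tspace C 1) T1) T1 (uncurry_map (ex i)).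
Proof.
have [i0|i0] := eqVneq i ord0; last first.
  apply: posmap_ext (e_par_map R g n (i := i) _); last first.
    by apply: (ld_mem LD); rewrite lt0n -ltnS ltn_ord andbT; by apply: contra i0 => /eqP i0; apply/eqP/val_inj.
  by move=> s _; rewrite /uncurry_map /ex (negbTE i0).
apply: (@posmap_ext _ _ _ _ _ (fun s =>
  S' (e_par g n s0 (usubmx s ord0 ord0) (S (dsubmx s))))).
  by move=> s _; rewrite /uncurry_map /ex i0 eqxx.
apply: posmap_comp (ld_S' LD).
apply: (@posmap_ext _ _ _ _ _ (fun s => uncurry_map (e_par g n s0)
   (pair1 (usubmx s ord0 ord0) (S (dsubmx s))))); first by move=> s _; rewrite uncurry_pair1.
apply: posmap_comp (e_par_map R g n (ld_s0 LD)).
apply: posmap_pair1; first exact: (posmap_rat (posmap_fst _ _)).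
  by move=> z [].
exact: posmap_comp (posmap_snd _ _) (ld_S LD).
Qed.

Let v1m : posmap T1 V1space vp1 := posmap_pimage _.
Let v2m : posmap T2 V2space vp2 := posmap_pimage _.

(** [coords] picks some preimage; the explicit [cf1] shows that the torus contains only one. *)
Let coords1K x : torus C _ x -> coords w1 (V 1) (vp1 x) = x.
Proof.
move=> Tx; rewrite /coords; case: xgetP => [y _ [Ty Ey]|/(_ x)[]//].
by rewrite -(ld_cf1K LD Ty) Ey ld_cf1K.
Qed.

Let coords2K x : torus C _ x -> coords w2 b2 (vp2 x) = x.
Proof.
move=> Tx; rewrite /coords; case: xgetP => [y _ [Ty Ey]|/(_ x)[]//].
by rewrite -(ld_cf2K LD Ty) Ey ld_cf2K.
Qed.

Let c1m : posmap V1space T1 (coords w1 (V 1)).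
Proof.
apply: (@posmap_ext _ _ _ _ _ cf1); first by move=> _ [x Tx <-]; rewrite coords1K // ld_cf1K.
split; first exact: (ld_cf1 LD).
  by apply: posgen_true => _ [x Tx <-]; rewrite (ld_cf1K LD).
by move=> _ [x Px <-]; rewrite (ld_cf1K LD) //; apply: postorus_torus.
Qed.

Let c2m : posmap V2space T2 (coords w2 b2).
Proof.
apply: (@posmap_ext _ _ _ _ _ cf2); first by move=> _ [x Tx <-]; rewrite coords2K // ld_cf2K.
split; first exact: (ld_cf2 LD).
  by apply: posgen_true => _ [x Tx <-]; rewrite (ld_cf2K LD).
by move=> _ [x Px <-]; rewrite (ld_cf2K LD) //; apply: postorus_torus.
Qed.

Let Sbar (u : 'cV[C]_(dimW g n)) := vp2 (S (coords w1 (V 1) u)).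
Let rho (t : 'cV[C]_(dimW g n)) := vp1 (S' (coords w2 b2 t)).

Let Sbarm : posmap V1space V2space Sbar := posmap_comp (posmap_comp c1m (ld_S LD)) v2m.
Let rhom : posmap V2space V1space rho := posmap_comp (posmap_comp c2m (ld_S' LD)) v1m.

Let SbarK u : pos V1space u -> rho (Sbar u) = u.
Proof.
case=> x Px <-; rewrite /rho /Sbar coords1K; last exact: postorus_torus.
by rewrite coords2K ?(ld_SK LD) //; apply: postorus_torus; apply: (posmap_pos (ld_S LD)).
Qed.

Let rhoK t : pos V2space t -> Sbar (rho t) = t.
Proof.
case=> x Px <-; rewrite /rho /Sbar coords2K; last exact: postorus_torus.
by rewrite coords1K ?(ld_S'K LD) //; apply: postorus_torus; apply: (posmap_pos (ld_S' LD)).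
Qed.

(** The choice in [sigma_lift] does not fall back on its default because [S] is a lift, and by
    uniqueness it then agrees generically with [S]. The inverse parametrization is onto the positive
    points of the torus, so this can be pulled back to the variety. *)
Let sigma_bar_generically : generically (car V1space) (fun u => sigma_bar R g n u = Sbar u).
Proof.
have L : is_sigma_lift (sigma_lift (R := R) (g := g) (n := n)).
  rewrite /sigma_lift; case: xgetP => [//|H]; by case: (H S); apply: (ld_lift LD).
have surj x : pos T1 x -> exists2 u, pos V1space u & coords w1 (V 1) u = x.
  by move=> Px; exists (vp1 x); [exists x|rewrite coords1K //; apply: postorus_torus].
by apply: generically_impl (generically_comp c1m surj (ld_uniq LD L)) => u _ E; rewrite /sigma_bar E.
Qed.

Let rho_surj u : pos V1space u -> exists2 t, pos V2space t & rho t = u.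
Proof. by move=> Pu; exists (Sbar u); [exact: (posmap_pos Sbarm)|exact: SbarK]. Qed.

Let SbarK_gen : generically (car V1space) (fun u => rho (Sbar u) = u).
Proof.
apply/posgen_generically/posrat_eqv => [i|i|]; last exact: SbarK.
  exact: (posmap_rat (posmap_comp Sbarm rhom)).
exact: rat_on_coord.
Qed.

Let rhoK_gen : generically (car V2space) (fun t => Sbar (rho t) = t).
Proof.
apply/posgen_generically/posrat_eqv => [i|i|]; last exact: rhoK.
  exact: (posmap_rat (posmap_comp rhom Sbarm)).
exact: rat_on_coord.
Qed.

Lemma sigma_bar_rational_inverse :
  rational_inverse (Vg R g n) (Vtgt R g n) (sigma_bar R g n) rho.
Proof.
split.
- apply: (@ratmap_ext _ _ V1space) (posmap_ratmap Sbarm).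
  by apply: generically_impl sigma_bar_generically => u _ ->.
- exact: posmap_ratmap rhom.
- by apply: generically_impl (generically_and sigma_bar_generically SbarK_gen) => u _ [-> ->].
- apply: generically_impl (generically_and (generically_comp rhom rho_surj sigma_bar_generically) rhoK_gen).
  by move=> t _ [-> ->].
Qed.

Section Inverse.
Variable sbi : 'cV[C]_(dimW g n) -> 'cV[C]_(dimW g n).
Hypothesis sbiP : rational_inverse (Vg R g n) (Vtgt R g n) (sigma_bar R g n) sbi.

(** A rational inverse is generically unique: both maps undo [sigma_bar], and [rho] is onto the
    positive points, so the identity for [sbi] may be evaluated at values of [rho]. *)
Let sbi_rho : generically (car V2space) (fun t => sbi t = rho t).
Proof.
case: sbiP => _ _ H _; have [_ _ _ H'] := sigma_bar_rational_inverse.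
have H2 := generically_comp rhom rho_surj H.
by apply: generically_impl (generically_and H2 H') => t _ [E1 E2]; rewrite E2 in E1.
Qed.

Let eu := locked (fun (i : 'I_n.+1) (c : C) (u : 'cV[C]_(dimW g n)) =>
  vp1 (ex i c (coords w1 (V 1) u))).
Let euE i c u : eu i c u = vp1 (ex i c (coords w1 (V 1) u)).
Proof. by rewrite /eu -lock. Qed.
Let gamu (i : 'I_n.+1) (u : 'cV[C]_(dimW g n)) := gamx i (coords w1 (V 1) u).
Let epsu (i : 'I_n.+1) (u : 'cV[C]_(dimW g n)) := epsx i (coords w1 (V 1) u).
Local Notation TV := (ptimes (tspace C 1) V1space).

Let ex_pos i c x : 0 < c -> postorus x -> postorus (ex i c x).
Proof.
move=> c0 Px; rewrite -uncurry_pair1; apply: (posmap_pos (ex_map i)).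
by split; rewrite ?col_mxKu ?col_mxKd // => k; rewrite mxE.
Qed.

Let eu_vp i c x : torus C _ x -> eu i c (vp1 x) = vp1 (ex i c x).
Proof. by move=> Tx; rewrite euE coords1K. Qed.

Let fst_rat : posrat TV (fun s => usubmx s ord0 ord0).
Proof. exact: (posmap_rat (posmap_fst _ _)). Qed.

Let fst_pos s : pos TV s -> 0 < usubmx s ord0 ord0.
Proof. by case. Qed.

Let step i c x u : postorus x -> u = vp1 x -> eu i c u = vp1 (ex i c x).
Proof. by move=> Px ->; apply/eu_vp/postorus_torus. Qed.

Let eu_crystal : positive_crystal (cartan_mx g n) V1space eu gamu epsu.
Proof.
split.
- move=> i.
  apply: (@posmap_ext _ _ _ _ _ (fun s => vp1 (uncurry_map (ex i)
     (pair1 (usubmx s ord0 ord0) (coords w1 (V 1) (dsubmx s)))))).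
    by move=> s _; rewrite uncurry_pair1 /uncurry_map euE.
  apply: posmap_comp v1m; apply: posmap_comp (ex_map i).
  by apply: posmap_pair1; [exact: fst_rat|exact: fst_pos|exact: posmap_comp (posmap_snd _ _) c1m].
- move=> i; apply: (posrat_comp (h := gamx i) c1m); apply: (@rat_on_ext _ _ _ _
    (if i == ord0 then fun x => gam_par g n s0 (S x) else gam_par (w := w1) g n i)).
    by move=> x _; rewrite /gamx; case: ifP.
  case: ifP => _; last exact: (gam_par_rat R g n w1).
  exact: (posrat_comp (ld_S LD) (gam_par_rat R g n w2 s0)).
- move=> i; apply: (posrat_comp (h := epsx i) c1m); apply: (@rat_on_ext _ _ _ _
    (if i == ord0 then fun x => eps_par g n s0 (S x) else eps_par (w := w1) g n i)).
    by move=> x _; rewrite /epsx; case: ifP.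
  case: ifP => _; last exact: (eps_par_rat R g n w1).
  exact: (posrat_comp (ld_S LD) (eps_par_rat R g n w2 s0)).
- move=> i _ [x Px <-]; rewrite eu_vp; last exact: postorus_torus.
  congr vp1; rewrite /ex; case: ifPn => i0.
    rewrite e_par1; [exact: (ld_SK LD)|exact: (ld_s0 LD)|exact: (posmap_pos (ld_S LD))].
  apply: e_par1 Px; apply: (ld_mem LD); rewrite lt0n -ltnS ltn_ord andbT.
  by apply: contra i0 => /eqP i0; apply/eqP/val_inj.
- move=> i c d _ c0 d0 [x Px <-].
  rewrite (step i c (ex_pos i d0 Px) (step i d Px erefl)) (step i (c * d) Px erefl).
  by rewrite (ld_eM LD).
- move=> i j c _ c0 [x Px <-]; have Px' := ex_pos i c0 Px; rewrite (step i c Px erefl).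
  apply: (etrans (congr1 (gamx j) (coords1K (postorus_torus Px')))).
  apply: etrans (ld_gam_e LD i j c0 Px) _.
  exact: (congr1 (fun y => _ * gamx j y) (esym (coords1K (postorus_torus Px)))).
- move=> i c _ c0 [x Px <-]; have Px' := ex_pos i c0 Px; rewrite (step i c Px erefl).
  apply: (etrans (congr1 (epsx i) (coords1K (postorus_torus Px')))).
  apply: etrans (ld_eps_e LD i c0 Px) _.
  exact: (congr1 (fun y => _ * epsx i y) (esym (coords1K (postorus_torus Px)))).
- split=> i j E1 E2 c d _ c0 d0 [x Px <-]; have cd0 := mulr_gt0 c0 d0; have c20 := exprn_gt0 2 c0.
  + have L := step i c (ex_pos j d0 Px) (step j d Px erefl).
    have Rr := step j d (ex_pos i c0 Px) (step i c Px erefl).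
    exact: etrans L (etrans (congr1 _ (braid2 (ld_braid LD) E1 E2 c0 d0 Px)) (esym Rr)).
  + have P1 := ex_pos i d0 Px; have P2 := ex_pos j c0 Px.
    have L := step i c (ex_pos j cd0 P1) (step j _ P1 (step i d Px erefl)).
    have Rr := step j d (ex_pos i cd0 P2) (step i _ P2 (step j c Px erefl)).
    exact: etrans L (etrans (congr1 _ (braid3 (ld_braid LD) E1 E2 c0 d0 Px)) (esym Rr)).
  + have c2d0 := mulr_gt0 c20 d0; have P1 := ex_pos j d0 Px; have P2 := ex_pos i c0 Px.
    have P3 := ex_pos i cd0 P1; have P4 := ex_pos j c2d0 P2.
    have L := step i c (ex_pos j c2d0 P3) (step j _ P3 (step i _ P1 (step j d Px erefl))).
    have Rr := step j d (ex_pos i cd0 P4) (step i _ P4 (step j _ P2 (step i c Px erefl))).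
    exact: etrans L (etrans (congr1 _ (braid4 (ld_braid LD) E1 E2 c0 d0 Px)) (esym Rr)).
Qed.

Let snd_gen (Q : _ -> Prop) : generically (car V1space) Q ->
  generically (car TV) (fun s => Q (dsubmx s)).
Proof.
apply: (generically_comp (posmap_snd (tspace C 1) V1space)) => u Pu.
exists (col_mx (const_mx 1) u); last by rewrite col_mxKd.
by split; rewrite ?col_mxKu ?col_mxKd // => i; rewrite mxE.
Qed.

Let S_torus : generically (car V1space) (fun u => torus C _ (S (coords w1 (V 1) u))).
Proof. exact: posgen_generically (posmap_car (posmap_comp c1m (ld_S LD))). Qed.

Lemma crystal_of_lift : geometric_crystal (cartan_mx g n) (Vg R g n)
  (e_full R g n sbi) (gam_full R g n) (eps_full R g n).
Proof.
apply: (generic_crystal eu_crystal (ld_Aii LD) (ld_rank2 LD)).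
- move=> i; have [i0|i0] := eqVneq i ord0; last first.
    apply: (@posgen_generically _ _ TV); apply: posgen_true => s _.
    by rewrite /uncurry_map /e_full euE /ex (negbTE i0).
  pose h1 (s : 'cV[C]_(1 + dimW g n)) :=
    e_par g n s0 (usubmx s ord0 ord0) (S (coords w1 (V 1) (dsubmx s))).
  have h1m : posmap TV T2 h1.
    apply: (@posmap_ext _ _ _ _ _ (fun s => uncurry_map (e_par g n s0)
       (pair1 (usubmx s ord0 ord0) (S (coords w1 (V 1) (dsubmx s)))))).
      by move=> s _; rewrite uncurry_pair1.
    apply: posmap_comp (e_par_map R g n (ld_s0 LD)).
    apply: posmap_pair1; [exact: fst_rat|exact: fst_pos|].
    exact: posmap_comp (posmap_comp (posmap_snd _ _) c1m) (ld_S LD).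
  have hm : posmap TV V2space (fun s => vp2 (h1 s)) := posmap_comp h1m v2m.
  have hsurj t : pos V2space t -> exists2 s, pos TV s & vp2 (h1 s) = t.
    case=> y Py <-; have Px := posmap_pos (ld_S' LD) Py.
    exists (pair1 1 (vp1 (S' y))).
      by split=> [k|]; rewrite ?col_mxKu ?col_mxKd; [rewrite mxE|exists (S' y)].
    congr vp2; rewrite /h1 col_mxKu col_mxKd mxE coords1K; last exact: postorus_torus.
    by rewrite (ld_S'K LD) // e_par1 // (ld_s0 LD).
  have H1 := generically_comp hm hsurj sbi_rho.
  have H2 := posgen_generically (posmap_car h1m).
  apply: generically_impl (generically_and (generically_and H1 H2)
    (generically_and (snd_gen sigma_bar_generically) (snd_gen S_torus))).
  move=> s _ [[E1 E2] [E3 E4]].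
  have K1 : coords w2 b2 (Sbar (dsubmx s)) = S (coords w1 (V 1) (dsubmx s)) := coords2K E4.
  rewrite /uncurry_map /e_full euE /ex i0 eqxx /eV E3 K1; apply: etrans E1 _.
  exact: (congr1 (fun y => vp1 (S' y)) (coords2K E2)).
- move=> i; have [i0|i0] := eqVneq i ord0; last first.
    apply: (@posgen_generically _ _ V1space); apply: posgen_true => u _.
    by rewrite /gam_full /gamu /gamx (negbTE i0).
  apply: generically_impl (generically_and sigma_bar_generically S_torus) => u _ [E1 E2].
  rewrite /gam_full /gamu /gamx i0 eqxx /gamV E1.
  exact: (congr1 (fun y => gam_par g n s0 y) (coords2K E2)).
- move=> i; have [i0|i0] := eqVneq i ord0; last first.
    apply: (@posgen_generically _ _ V1space); apply: posgen_true => u _.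
    by rewrite /eps_full /epsu /epsx (negbTE i0).
  apply: generically_impl (generically_and sigma_bar_generically S_torus) => u _ [E1 E2].
  rewrite /eps_full /epsu /epsx i0 eqxx /epsV E1.
  exact: (congr1 (fun y => eps_par g n s0 y) (coords2K E2)).
Qed.

End Inverse.

End CrystalOfLift.

(** * States *)

(* The two ends of the Dynkin diagram of a type other than A: 0 and 1 (or     *)
(* n - 1 and n) may be the two branches of a fork, or the end node may have a *)
(* root shorter or longer than its neighbour's.                               *)
Inductive endtype := Fork | Short | Long.
Definition isF (e : endtype) : bool := if e is Fork then true else false.
Definition isS (e : endtype) : bool := if e is Short then true else false.
Definition isL (e : endtype) : bool := if e is Long then true else false.

Ltac pos_tac := repeat first
  [ done | assumption | apply: addr_gt0 | apply: mulr_gt0 | apply: exprn_gt0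
  | rewrite invr_gt0 ].
Ltac neq0_tac := rewrite ?mulf_neq0 ?gt_eqF //; pos_tac.

Ltac case_ifs := repeat match goal with
  |- context [if ?b then _ else _] =>
    lazymatch b with context [if _ then _ else _] => fail | _ => case: (boolP b) => ? end
  end.

Section Ends.
Variables (n : nat) (e0 en : endtype).

Definition rank_ok : bool := (2 + isF e0 + isF en <= n)%N.

(* The position of a node along the chain, both branches of a fork having the *)
(* same one.                                                                  *)
Definition lev (i : nat) : nat :=
  if isF e0 && (i == 0%N) then 1%N else if isF en && (i == n) then n.-1 else i.
(** [kap i] is the exponent of y_i in w_l, while [lam i] enters only into epsilon_i and the Cartan
    matrix. An entry -2 in row i and column j comes either from a short end i or from a long end
    j. *)
Definition kap (i : nat) : nat :=
  if (i == 0%N) && isS e0 || (i == n) && isS en then 2%N else 1%N.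
Definition lam (i : nat) : nat :=
  if (i == 0%N) && isL e0 || (i == n) && isL en then 2%N else 1%N.
Definition adj (i j : nat) : bool := (lev i == (lev j).+1) || (lev j == (lev i).+1).
Definition ecart (i j : nat) : int :=
  if i == j then 2%:Z else if adj i j then - (kap i * lam j)%:Z else 0.
(** p_l and q_l belong to the link between the positions l and l + 1; a fork shortens the chain by
    one position. *)
Definition okp (l : nat) : bool := (isF e0 <= l)%N && (l + isF en < n)%N.

Section States.
Variable K : numFieldType.
Implicit Types (y p : nat -> K) (st : (nat -> K) * (nat -> K)).

Definition wlev y l : K := \prod_(i <- iota 0 n.+1 | lev i == l) y i ^+ kap i.
Definition blev y l : K := wlev y l + wlev y l.+1.
Definition yup i (c : K) y j := if j == i then c * y j else y j.

(* In a state (y, p) put q_l = blev y l / p_l. The crystal operator E i c     *)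
(* multiplies y_i by c and keeps p_l for l <> lev i and q_(lev i).            *)
Definition E i c st : (nat -> K) * (nat -> K) :=
  (yup i c st.1, fun l => if (lev i == l) && okp l
    then st.2 l * (blev (yup i c st.1) l / blev st.1 l) else st.2 l).
Definition qst st l := blev st.1 l / st.2 l.
Definition pst st : Prop := (forall j, 0 < st.1 j) /\ (forall l, 0 < st.2 l).

Lemma wlev_yup i c y l : (i <= n)%N ->
  wlev (yup i c y) l = (if lev i == l then c ^+ kap i else 1) * wlev y l.
Proof.
move=> lein; rewrite /wlev.
have -> : (if lev i == l then c ^+ kap i else 1) =
    \prod_(j <- iota 0 n.+1 | lev j == l) (if j == i then c ^+ kap i else 1).
  rewrite big_mkcond (bigD1_seq i) ?iota_uniq ?mem_iota //= eqxx big1 ?mulr1 // => j ji.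
  by rewrite (negbTE ji) if_same.
rewrite -big_split; apply: eq_bigr => j _ /=; rewrite /yup.
by case: eqP => [->|_]; rewrite ?exprMn ?mul1r.
Qed.

Lemma wlev_gt0 y l : (forall j, 0 < y j) -> 0 < wlev y l.
Proof. by move=> y0; apply: prodr_gt0 => j _; apply: exprn_gt0. Qed.

Lemma blev_gt0 y l : (forall j, 0 < y j) -> 0 < blev y l.
Proof. by move=> y0; rewrite addr_gt0 ?wlev_gt0. Qed.

Lemma yup_gt0 i c y : 0 < c -> (forall j, 0 < y j) -> forall j, 0 < yup i c y j.
Proof. by move=> c0 y0 j; rewrite /yup; case: ifP => _; rewrite ?mulr_gt0. Qed.

Lemma E_pos i c st : 0 < c -> pst st -> pst (E i c st).
Proof.
move=> c0 [y0 p0]; split; first exact: yup_gt0.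
move=> l /=; case: ifP => _ //.
by rewrite mulr_gt0 // divr_gt0 ?blev_gt0 //; exact: yup_gt0.
Qed.

Lemma yup_yup i c d y : yup i c (yup i d y) = yup i (c * d) y.
Proof. by apply: boolp.funext => j; rewrite /yup; case: eqP; rewrite ?mulrA. Qed.

Lemma yupC i j c d y : yup i c (yup j d y) = yup j d (yup i c y).
Proof.
apply: boolp.funext => k; rewrite /yup; do 2!case: eqP => // _.
by rewrite mulrCA.
Qed.

Lemma yup1 i y : yup i 1 y = y.
Proof. by apply: boolp.funext => k; rewrite /yup mul1r if_same. Qed.

Lemma E1 i st : pst st -> E i 1 st = st.
Proof.
case: st => y p [y0 p0]; rewrite /E yup1; congr pair; apply: boolp.funext => l /=.
by rewrite divff ?mulr1 ?if_same // gt_eqF // blev_gt0.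
Qed.

Lemma EM i c d st : 0 < c -> 0 < d -> pst st -> E i c (E i d st) = E i (c * d) st.
Proof.
case: st => y p c0 d0 [y0 p0]; rewrite /E /= yup_yup; congr pair; apply: boolp.funext => l /=.
case: (_ && _) => //; rewrite -mulrA; congr (_ * _).
rewrite mulrC -mulrA mulKf // gt_eqF // blev_gt0 //; exact: yup_gt0.
Qed.

Lemma E_q i c st l : pst st -> 0 < c -> okp l -> lev i = l -> qst (E i c st) l = qst st l.
Proof.
case: st => y p [y0 p0] c0 ok li; rewrite /qst /E /= li eqxx ok /=.
have b0 := blev_gt0 l y0; have b1 := blev_gt0 l (yup_gt0 i c0 y0); have := p0 l => /= p0l.
by field; rewrite !gt_eqF.
Qed.

Definition egam i st : K := \prod_(j <- iota 0 n.+1) st.1 j ^ ecart j i.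
Definition eeps i st : K :=
  ((if (0 < lev i)%N && okp (lev i).-1 then st.2 (lev i).-1 else 1) *
   (if okp (lev i) then qst st (lev i) else 1)) ^+ lam i / st.1 i.

Lemma egam_E i j c st : (i <= n)%N -> 0 < c -> pst st ->
  egam j (E i c st) = c ^ ecart i j * egam j st.
Proof.
case: st => y p lein c0 [y0 p0]; rewrite /egam /=.
have D F : \prod_(k <- iota 0 n.+1) F k = F i * \prod_(k <- iota 0 n.+1 | k != i) F k :> K.
  by rewrite (bigD1_seq i) ?iota_uniq // mem_iota.
rewrite !D /yup eqxx expfzMl -mulrA; congr (_ * (_ * _)).
by apply: eq_bigr => k ki; rewrite (negbTE ki).
Qed.

(** The p and q in epsilon_i are exactly those that e_i keeps: p at the link below the position of i
    and q at the link above. Only the denominator y_i changes. *)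
Lemma eeps_E i c st : 0 < c -> pst st -> eeps i (E i c st) = c^-1 * eeps i st.
Proof.
move=> c0 Pst; rewrite /eeps.
have -> : (if okp (lev i) then qst (E i c st) (lev i) else 1) =
    (if okp (lev i) then qst st (lev i) else 1).
  by case: ifP => // ok; apply: E_q.
have -> : (if (0 < lev i)%N && okp (lev i).-1 then (E i c st).2 (lev i).-1 else 1) =
    (if (0 < lev i)%N && okp (lev i).-1 then st.2 (lev i).-1 else 1).
  case: ifP => // /andP[l0 _] /=; rewrite -[in X in lev i == X](ltn_predK l0).
  by rewrite (_ : (lev i == (lev i).-1) = false) //; apply/eqP; lia.
by rewrite /= /yup eqxx invfM [RHS]mulrCA.
Qed.

(** The nodes have positions at distance at least two, or the same position, as the branches of a
    fork do. In the latter case the factors of p_l telescope to an expression symmetric in the two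
    operators. *)
Lemma E_comm i j c d st : (i <= n)%N -> (j <= n)%N -> ~~ adj i j -> 0 < c -> 0 < d -> pst st ->
  E i c (E j d st) = E j d (E i c st).
Proof.
case: st => y p lein lejn nadj c0 d0 [y0 p0].
rewrite /E /= yupC; congr pair; apply: boolp.funext => l /=.
have [ok|] := boolP (okp l); last by rewrite !andbF.
have ii : lev i = l -> (lev i == l.+1) = false by move=> ->; apply/eqP; lia.
have jj : lev j = l -> (lev j == l.+1) = false by move=> ->; apply/eqP; lia.
have w0 := wlev_gt0 l y0; have w1 := wlev_gt0 l.+1 y0; have p0l := p0 l; rewrite /= in p0l.
rewrite !andbT /blev !wlev_yup //.
case: (eqVneq (lev i) l) => li; case: (eqVneq (lev j) l) => lj //.
- by rewrite ii // jj // !mul1r; field; neq0_tac.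
- have -> : (lev j == l.+1) = false.
    by apply/negbTE; apply: contra nadj; rewrite /adj li => ->; rewrite orbT.
  by rewrite ii // !mul1r.
- have -> : (lev i == l.+1) = false.
    by apply/negbTE; apply: contra nadj; rewrite /adj lj => ->.
  by rewrite jj // !mul1r.
Qed.

Lemma adj_neq i j : adj i j -> (i == j) = false.
Proof. by move=> ij; apply/negbTE; apply: contraL ij => /eqP->; rewrite /adj orbb; apply/eqP; lia. Qed.

Let lev_cases i j l : adj i j ->
  [\/ [/\ lev i == l, (lev i == l.+1) = false, (lev j == l) = false & lev j == l.+1],
      [/\ lev i == l, (lev i == l.+1) = false, (lev j == l) = false & (lev j == l.+1) = false],
      [/\ (lev i == l) = false, lev i == l.+1, lev j == l & (lev j == l.+1) = false] |
      [/\ (lev i == l) = false, (lev i == l.+1) = false, lev j == l & (lev j == l.+1) = false]] \/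
  (lev i == l) = false /\ (lev j == l) = false.
Proof.
rewrite /adj; case: (eqVneq (lev i) l) => [->|li] /=.
  case: (eqVneq (lev j) l) => [->|lj]; first by move=> /orP[]/eqP; lia.
  rewrite (ltn_eqF (ltnSn l)); case: (eqVneq (lev j) l.+1) => lj' H; left; [by constructor 1|by constructor 2].
case: (eqVneq (lev j) l) => [->|lj] H; last by right.
rewrite (ltn_eqF (ltnSn l)); case: (eqVneq (lev i) l.+1) => li'; left; [by constructor 3|by constructor 4].
Qed.

(** The relation is checked link by link: only w_l, w_(l+1) and p_l are involved, and for each way
    in which the two positions can meet the link there remains an identity of rational functions in
    these and the parameters. *)
Lemma E_braid3 i j c d st : (i <= n)%N -> (j <= n)%N -> adj i j -> kap i = 1%N -> kap j = 1%N ->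
  0 < c -> 0 < d -> pst st ->
  E i c (E j (c * d) (E i d st)) = E j d (E i (c * d) (E j c st)).
Proof.
case: st => y p lein lejn ij ki kj c0 d0 [y0 p0]; rewrite /E /=; congr pair.
  apply: boolp.funext => k; rewrite /yup; case: (eqVneq k i) => [->|_].
    by rewrite (adj_neq ij) mulrA.
  by case: eqP => // _; ring.
apply: boolp.funext => l /=; have [ok|] := boolP (okp l); last by rewrite !andbF.
have w0 := wlev_gt0 l y0; have w1 := wlev_gt0 l.+1 y0; have p0l := p0 l; rewrite /= in p0l.
rewrite !andbT /blev !wlev_yup // ki kj !expr1.
move: (wlev y l) (wlev y l.+1) (p l) w0 w1 p0l => w w' q w0 w1 p0l.
case: (lev_cases l ij) => [[[-> -> -> ->]|[-> -> -> ->]|[-> -> -> ->]|[-> -> -> ->]]|[-> ->]] //;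
  rewrite !mul1r; field; neq0_tac.
Qed.

(** With a_ij = -2 and a_ji = -1 the value [kap i] = 2 is that of a short end i. The value 1 occurs
    when j is a long end, since [lam] does not enter into [E]. *)
Lemma E_braid4 i j c d st : (i <= n)%N -> (j <= n)%N -> adj i j ->
  (kap i = 1%N \/ kap i = 2%N) -> kap j = 1%N -> 0 < c -> 0 < d -> pst st ->
  E i c (E j (c ^+ 2 * d) (E i (c * d) (E j d st))) =
  E j d (E i (c * d) (E j (c ^+ 2 * d) (E i c st))).
Proof.
case: st => y p lein lejn ij ki kj c0 d0 [y0 p0]; rewrite /E /=; congr pair.
  apply: boolp.funext => k; rewrite /yup; case: (eqVneq k i) => [->|_].
    by rewrite (adj_neq ij); ring.
  by case: eqP => // _; ring.
apply: boolp.funext => l /=; have [ok|] := boolP (okp l); last by rewrite !andbF.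
have w0 := wlev_gt0 l y0; have w1 := wlev_gt0 l.+1 y0; have p0l := p0 l; rewrite /= in p0l.
rewrite !andbT /blev !wlev_yup // kj.
move: (wlev y l) (wlev y l.+1) (p l) w0 w1 p0l => w w' q w0 w1 p0l.
case: (lev_cases l ij) => [[[-> -> -> ->]|[-> -> -> ->]|[-> -> -> ->]|[-> -> -> ->]]|[-> ->]] //;
  case: ki => ki; rewrite ?ki ?expr1 !mul1r; field; neq0_tac.
Qed.

End States.
End Ends.

(** * Scaling of states *)

Section Scaling.
Variables (n : nat) (e0 en : endtype) (K : numFieldType).
Hypothesis nok : rank_ok n e0 en.
Local Notation lev := (lev n e0 en).
Local Notation kap := (kap n e0 en).
Local Notation lam := (lam n e0 en).
Local Notation okp := (okp n e0 en).
Local Notation wlev := (wlev n e0 en).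
Local Notation E := (E n e0 en).
Implicit Types (y p : nat -> K) (st : (nat -> K) * (nat -> K)).

Definition nodes (l : nat) : seq nat :=
  if isF e0 && (l == 1%N) then [:: 0; 1]%N
  else if isF en && (l == n.-1) then [:: n.-1; n] else [:: l].
Definition oklev (l : nat) : bool := (isF e0 <= l)%N && (l + isF en <= n)%N.

Lemma lev_nodes l : oklev l ->
  perm_eq [seq j <- iota 0 n.+1 | lev j == l] (nodes l).
Proof.
move=> okl; apply: uniq_perm; first by rewrite filter_uniq ?iota_uniq.
  by rewrite /nodes; do 2!case: ifP => //; rewrite /= inE => _ _; rewrite andbT; move: nok;
     rewrite /rank_ok; lia.
move=> j; rewrite mem_filter mem_iota /nodes; move: nok okl; rewrite /rank_ok /oklev /lev.
by case: (e0); case: (en) => /=; rewrite ?inE; do ?case: eqP; rewrite ?inE; lia.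
Qed.

Lemma prod_lev (F : nat -> K) l : oklev l ->
  \prod_(j <- iota 0 n.+1 | lev j == l) F j = \prod_(j <- nodes l) F j.
Proof. by move=> okl; rewrite -big_filter (perm_big _ (lev_nodes okl)). Qed.

Lemma lev_oklev i : (i <= n)%N -> oklev (lev i).
Proof.
move: nok; rewrite /rank_ok /oklev /lev; case: (e0); case: (en) => /=; do ?case: eqP; lia.
Qed.

Lemma okp_oklev l : okp l -> oklev l /\ oklev l.+1.
Proof. by rewrite /okp /oklev => /andP[]; lia. Qed.

(* The null vector of the Cartan matrix. *)
Definition dd (j : nat) : nat :=
  if (n < j)%N then 0%N else if isF e0 && (j <= 1)%N || isF en && (n.-1 <= j)%N ||
    (kap j == 2%N) then 1%N else 2%N.

(** This makes every w_l homogeneous of degree 2, so that p_l q_l = w_l + w_(l+1) is compatible with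
    p and q having degree 1. *)
Lemma dd_kap l : oklev l -> (\sum_(j <- nodes l) dd j * kap j = 2)%N.
Proof.
move: nok; rewrite /rank_ok /oklev /nodes /dd /kap /lev.
case: (e0); case: (en) => /= nk okl; case_ifs; rewrite ?big_cons ?big_nil; case_ifs; lia.
Qed.

Definition sc (s : K) st : (nat -> K) * (nat -> K) :=
  (fun j => s ^+ dd j * st.1 j, fun l => if okp l then s * st.2 l else st.2 l).

Lemma wlev_sc s st l : oklev l -> wlev (sc s st).1 l = s ^+ 2 * wlev st.1 l.
Proof.
move=> okl; rewrite /wlev !prod_lev // -(dd_kap okl) /nodes.
by case: ifP => _; [|case: ifP => _]; rewrite !big_cons !big_nil /= ?exprMn ?exprD ?exprM; ring.
Qed.

Lemma blev_sc s st l : okp l -> blev n e0 en (sc s st).1 l = s ^+ 2 * blev n e0 en st.1 l.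
Proof. by move=> /okp_oklev[o1 o2]; rewrite /blev !wlev_sc // mulrDr. Qed.

Lemma sc_pos s st : 0 < s -> pst st -> pst (sc s st).
Proof.
move=> s0 [y0 p0]; split=> j /=; first by rewrite mulr_gt0 ?exprn_gt0.
by case: ifP; rewrite ?mulr_gt0.
Qed.

Lemma qst_sc s st l : 0 < s -> okp l -> qst n e0 en (sc s st) l = s * qst n e0 en st l.
Proof.
move=> s0 okl; rewrite /qst blev_sc //= okl invfM mulrACA expr2 -[s * s * _]mulrA.
by rewrite divff ?gt_eqF // mulr1.
Qed.

Lemma E_sc s i c st : 0 < s -> (i <= n)%N -> E i c (sc s st) = sc s (E i c st).
Proof.
case: st => y p s0 lein.
have H : yup i c (sc s (y, p)).1 = (sc s (yup i c y, p)).1.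
  by apply: boolp.funext => j; rewrite /yup /=; case: ifP => // _; rewrite mulrCA.
rewrite /E H /=; congr pair; apply: boolp.funext => l /=.
have [okl|] := boolP (okp l); last by rewrite !andbF.
rewrite andbT; case: ifP => // _.
rewrite -[yup i c y]/((yup i c y, p).1) !blev_sc // -mulrA; congr (_ * (_ * _)) => /=.
have -> : (fun j => s ^+ dd j * y j) = (sc s (y, p)).1 by [].
rewrite blev_sc //= invfM mulrACA divff ?mul1r //.
by rewrite expf_neq0 // gt_eqF.
Qed.

(** The exponent of s is the sum of dd_j a_ji over j. The neighbours of i are grouped by position;
    by [dd_kap] each neighbouring position contributes -2 [lam i], and dd_i is [lam i] times the
    number of these positions. *)
Lemma egam_sc s i st : 0 < s -> (i <= n)%N -> egam n e0 en i (sc s st) = egam n e0 en i st.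
Proof.
move=> s0 lein; rewrite /egam.
under eq_bigr => j _ do rewrite /= expfzMl.
rewrite big_split /= [X in X * _](_ : _ = 1) ?mul1r //.
have Hs (r : seq nat) (F : nat -> int) : \prod_(j <- r) s ^ F j = s ^ (\sum_(j <- r) F j).
  elim: r => [|j r IH]; first by rewrite !big_nil.
  by rewrite !big_cons expfzDr ?gt_eqF // IH.
under eq_bigr => j _ do rewrite exprnP exprz_exp.
rewrite Hs (_ : \sum_(j <- _) _ = 0) //.
have D F : \sum_(k <- iota 0 n.+1) F k = F i + \sum_(k <- iota 0 n.+1 | k != i) F k :> int.
  by rewrite (bigD1_seq i) ?iota_uniq // mem_iota.
rewrite D /ecart eqxx => {D}.
have adjl j : adj n e0 en j i = (lev j == (lev i).+1) || (0 < lev i)%N && (lev j == (lev i).-1).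
  by rewrite /adj; case: (lev i) => [|l] //=; rewrite [in RHS]orbC eqSS [l == _]eq_sym orbC.
have Hl l : \sum_(j <- iota 0 n.+1 | lev j == l) (dd j * kap j)%:Z = (2 * oklev l)%:Z.
  have [okl|nl] := boolP (oklev l).
    rewrite -big_filter (perm_big _ (lev_nodes okl)) /= -(dd_kap okl) muln1.
    by rewrite (big_morph _ PoszD (erefl _)).
  rewrite big_seq_cond big1 // => j /andP[]; rewrite mem_iota => jn /eqP E'.
  by move: nl; rewrite -E' lev_oklev.
have -> : \sum_(j <- iota 0 n.+1 | j != i) (dd j)%:Z *
    (if j == i then 2%:Z else if adj n e0 en j i then - (kap j * lam i)%:Z else 0) =
   - (lam i)%:Z * (\sum_(j <- iota 0 n.+1 | lev j == (lev i).+1) (dd j * kap j)%:Z +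
    (if (0 < lev i)%N then \sum_(j <- iota 0 n.+1 | lev j == (lev i).-1) (dd j * kap j)%:Z else 0)).
  have -> : (if (0 < lev i)%N then \sum_(j <- iota 0 n.+1 | lev j == (lev i).-1) (dd j * kap j)%:Z else 0) =
     \sum_(j <- iota 0 n.+1 | (0 < lev i)%N && (lev j == (lev i).-1)) (dd j * kap j)%:Z.
    by case: ifP => // _; rewrite big_pred0.
  rewrite big_mkcond [X in _ * (X + _)]big_mkcond [X in _ * (_ + X)]big_mkcond /=.
  rewrite -big_split mulr_sumr; apply: eq_bigr => j _ /=; rewrite adjl.
  case: (eqVneq j i) => [->|_] /=.
    rewrite ltn_eqF //; case: (posnP (lev i)) => [//|l0] /=; first by rewrite mulr0.
    by rewrite (_ : (lev i == (lev i).-1) = false) ?mulr0 //; apply/eqP; lia.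
  case: (eqVneq (lev j) (lev i).+1) => [->|_] /=.
    rewrite (_ : (_ && _) = false) ?addr0 ?PoszM; last by apply/negbTE/negP => /andP[_ /eqP]; lia.
    by ring.
  by case: (_ && _); rewrite ?PoszM; ring.
rewrite !Hl; move: nok lein; rewrite /rank_ok /oklev /dd /lam /kap /lev.
case: (e0); case: (en) => /= nk lein; case_ifs; lia.
Qed.

(** The number of links at the position of i, times [lam i], is the degree dd_i of y_i. *)
Lemma eeps_sc s i st : 0 < s -> (i <= n)%N -> pst st ->
  eeps n e0 en i (sc s st) = eeps n e0 en i st.
Proof.
move=> s0 lein [y0 p0]; rewrite /eeps.
have -> : (if (0 < lev i)%N && okp (lev i).-1 then (sc s st).2 (lev i).-1 else 1) =
   (if (0 < lev i)%N && okp (lev i).-1 then s else 1) *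
   (if (0 < lev i)%N && okp (lev i).-1 then st.2 (lev i).-1 else 1).
  by case: ifP => [/andP[_ ok]|_] /=; rewrite ?ok ?mul1r.
have -> : (if okp (lev i) then qst n e0 en (sc s st) (lev i) else 1) =
   (if okp (lev i) then s else 1) * (if okp (lev i) then qst n e0 en st (lev i) else 1).
  by case: ifP => ok; rewrite ?qst_sc ?mul1r.
rewrite /= mulrACA exprMn invfM mulrACA [X in X * _](_ : _ = 1) ?mul1r //.
have -> : s ^- dd i = (s ^+ dd i)^-1 by [].
suff -> : ((if (0 < lev i)%N && okp (lev i).-1 then s else 1) *
    (if okp (lev i) then s else 1)) ^+ lam i = s ^+ dd i.
  by rewrite divff // expf_neq0 // gt_eqF.
have -> : (if (0 < lev i)%N && okp (lev i).-1 then s else 1) = s ^+ ((0 < lev i)%N && okp (lev i).-1).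
  by case: (_ && _).
have -> : (if okp (lev i) then s else 1) = s ^+ okp (lev i) by case: (okp _).
rewrite -exprD -exprM; congr (s ^+ _).
move: nok lein; rewrite /rank_ok /okp /dd /lam /kap /lev.
case: (e0); case: (en) => /= nk lein; case_ifs; lia.
Qed.

End Scaling.

(** * Reflection of the diagram *)

Section Flip.
Variables (n : nat) (e0 en : endtype) (K : numFieldType).
Hypothesis nok : rank_ok n e0 en.
Implicit Types (y p : nat -> K) (st : (nat -> K) * (nat -> K)).

(* The values of a state that carry no information are required to be 1, so   *)
(* that equal states are equal as functions on nat.                           *)
Definition canon st : Prop :=
  (forall j, (n < j)%N -> st.1 j = 1) /\ (forall l, ~~ okp n e0 en l -> st.2 l = 1).

Lemma E_canon i c st : (i <= n)%N -> canon st -> canon (E n e0 en i c st).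
Proof.
move=> lein [yc pc]; split=> j /= H; last by rewrite (negbTE H) andbF pc.
by rewrite /yup yc // (_ : (j == i) = false) //; apply/eqP; lia.
Qed.

Lemma sc_canon s st : canon st -> canon (sc n e0 en s st).
Proof.
move=> [yc pc]; split=> j /= H; last by rewrite (negbTE H) pc.
by rewrite /dd H yc // expr0 mulr1.
Qed.

Definition fl st : (nat -> K) * (nat -> K) :=
  (fun j => if (j <= n)%N then st.1 (n - j)%N else 1,
   fun l => if okp n en e0 l then qst n e0 en st (n.-1 - l)%N else 1).

Lemma lev_flip i : (i <= n)%N -> lev n en e0 (n - i)%N = (n - lev n e0 en i)%N.
Proof.
move=> lein; move: nok; rewrite /rank_ok /lev; case: (e0); case: (en) => /= nk; case_ifs; lia.
Qed.

Lemma kap_flip i : (i <= n)%N -> kap n en e0 (n - i)%N = kap n e0 en i.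
Proof.
move=> lein; move: nok; rewrite /rank_ok /kap; case: (e0); case: (en) => /= nk; case_ifs; lia.
Qed.

Lemma lam_flip i : (i <= n)%N -> lam n en e0 (n - i)%N = lam n e0 en i.
Proof.
move=> lein; move: nok; rewrite /rank_ok /lam; case: (e0); case: (en) => /= nk; case_ifs; lia.
Qed.

Lemma lev_le i : (i <= n)%N -> (lev n e0 en i <= n)%N.
Proof.
move=> lein; move: nok; rewrite /rank_ok /lev; case: (e0); case: (en) => /= nk; case_ifs; lia.
Qed.

Lemma ecart_flip i j : (i <= n)%N -> (j <= n)%N -> ecart n en e0 (n - i)%N (n - j)%N = ecart n e0 en i j.
Proof.
move=> ni nj; rewrite /ecart /adj !lev_flip // kap_flip // lam_flip //.
have := lev_le ni; have := lev_le nj; move: (lev n e0 en i) (lev n e0 en j) => a b bn an.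
rewrite (_ : (n - i == n - j)%N = (i == j)); last by lia.
by rewrite (_ : ((n - a == (n - b).+1)%N || (n - b == (n - a).+1)%N)%N = ((a == b.+1) || (b == a.+1)));
  last lia.
Qed.

Lemma okp_flip l : (l < n)%N -> okp n e0 en (n.-1 - l)%N = okp n en e0 l.
Proof. by rewrite /okp; case: (e0); case: (en) => /=; lia. Qed.

Lemma okp_lt l : okp n en e0 l -> (l < n)%N.
Proof. by rewrite /okp => /andP[_]; lia. Qed.

Lemma prod_rev (F : nat -> K) : \prod_(j <- iota 0 n.+1) F (n - j)%N = \prod_(j <- iota 0 n.+1) F j.
Proof.
rewrite -(big_map (fun j => n - j)%N xpredT); apply: perm_big; apply: uniq_perm.
- rewrite map_inj_in_uniq ?iota_uniq // => i j; rewrite !mem_iota; lia.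
- exact: iota_uniq.
- move=> j; rewrite mem_iota; apply/mapP/idP => [[i + ->]|jn]; first by rewrite mem_iota; lia.
  by exists (n - j)%N; rewrite ?mem_iota; lia.
Qed.

Lemma wlev_flip st l : (l <= n)%N -> wlev n en e0 (fl st).1 l = wlev n e0 en st.1 (n - l)%N.
Proof.
move=> ln; rewrite /wlev big_mkcond [RHS]big_mkcond -[RHS]prod_rev big_seq [RHS]big_seq.
apply: eq_bigr => j; rewrite mem_iota leq0n add0n ltnS andTb => jn; rewrite /= jn.
have nj : (n - j <= n)%N by lia.
have -> : lev n en e0 j = (n - lev n e0 en (n - j))%N by rewrite -lev_flip // subKn.
have -> : kap n en e0 j = kap n e0 en (n - j) by rewrite -kap_flip // subKn.
have := lev_le nj; move: (lev _ _ _ _) => a an.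
by rewrite (_ : (n - a == l)%N = (a == n - l)%N) //; lia.
Qed.

Lemma blev_flip st l : (l < n)%N -> blev n en e0 (fl st).1 l = blev n e0 en st.1 (n.-1 - l)%N.
Proof.
move=> ln; rewrite /blev !wlev_flip 1?addrC; try lia.
by congr (wlev _ _ _ _ _ + wlev _ _ _ _ _); lia.
Qed.

Lemma qst_gt0 st l : pst st -> 0 < qst n e0 en st l.
Proof. by move=> [y0 p0]; rewrite divr_gt0 ?blev_gt0. Qed.

Lemma fl_pos st : pst st -> pst (fl st).
Proof.
move=> Pst; split=> j /=; case: ifP => // _; first by case: Pst.
exact: qst_gt0.
Qed.

Lemma qst_flip st l : pst st -> okp n en e0 l -> qst n en e0 (fl st) l = st.2 (n.-1 - l)%N.
Proof.
move=> [y0 p0] okl; rewrite /qst blev_flip /= ?okl; last exact: okp_lt okl.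
rewrite /qst; have b0 := blev_gt0 n e0 en (n.-1 - l)%N y0; have p1 := p0 (n.-1 - l)%N.
by field; rewrite !gt_eqF.
Qed.

(** e_i keeps p at the link below its position, q at the link above, and both p and q at all other
    links. The reflection exchanges p with q and below with above, so it preserves this
    description. *)
Lemma E_flip i c st : (i <= n)%N -> 0 < c -> pst st ->
  E n en e0 (n - i)%N c (fl st) = fl (E n e0 en i c st).
Proof.
move=> ni c0 Pst; rewrite /E.
have H : yup (n - i)%N c (fl st).1 = (fl (E n e0 en i c st)).1.
  apply: boolp.funext => j; rewrite /yup /=; case: (leqP j n) => jn; last first.
    by rewrite (_ : (j == n - i)%N = false) //; apply/eqP; lia.
  by rewrite (_ : (j == n - i)%N = (n - j == i)%N) //; lia.
rewrite H -/(E n e0 en i c st); congr pair; apply: boolp.funext => l.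
have [okl|] := boolP (okp n en e0 l); last by move=> /negbTE nk; rewrite andbF /= nk.
have ln := okp_lt okl; rewrite lev_flip // andbT.
have EP := E_pos n e0 en i c0 Pst.
rewrite (blev_flip (E n e0 en i c st)) // (blev_flip st) //.
have -> : (n - lev n e0 en i == l)%N = (lev n e0 en i == (n.-1 - l).+1)%N.
  by have := lev_le ni; lia.
rewrite /fl /= okl {1}/qst.
have b0 : 0 < blev n e0 en st.1 (n.-1 - l)%N by case: Pst => y0 _; apply: blev_gt0.
have b1 : 0 < blev n e0 en (yup i c st.1) (n.-1 - l)%N by case: EP => y0 _; apply: blev_gt0 y0.
have p1 : 0 < st.2 (n.-1 - l)%N by case: Pst.
case: (eqVneq (lev n e0 en i) (n.-1 - l).+1)%N => li.
  rewrite /qst /= li (_ : ((n.-1 - l)%N.+1 == _)%N = false) /=; last by apply/eqP; lia.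
  by field; rewrite !gt_eqF.
have [li'|li'] := eqVneq (lev n e0 en i) (n.-1 - l)%N.
  by rewrite -/(E n e0 en i c st) (E_q Pst c0) // okp_flip.
rewrite /qst /= (negbTE li') /=; congr (_ / _); rewrite /blev !wlev_yup //.
by rewrite (negbTE li) (negbTE li') !mul1r.
Qed.

Lemma egam_flip i st : (i <= n)%N -> egam n en e0 (n - i)%N (fl st) = egam n e0 en i st.
Proof.
move=> ni; rewrite /egam -[LHS]prod_rev big_seq [RHS]big_seq; apply: eq_bigr => j.
by rewrite mem_iota leq0n add0n ltnS andTb => jn; rewrite /= leq_subr subKn // ecart_flip.
Qed.

Lemma eeps_flip i st : (i <= n)%N -> pst st -> eeps n en e0 (n - i)%N (fl st) = eeps n e0 en i st.
Proof.
move=> ni Pst; rewrite /eeps lam_flip // [_.1 _ in LHS]/= leq_subr subKn //; congr (_ ^+ _ / _).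
rewrite mulrC lev_flip //; have ln := lev_le ni; move: (lev n e0 en i) ln => a an; congr (_ * _).
  have -> : okp n en e0 (n - a)%N = (0 < a)%N && okp n e0 en a.-1.
    by rewrite /okp; lia.
  case: ifP => [/andP[a0 ok]|//]; rewrite qst_flip //; first by congr (st.2 _); lia.
  by move: ok; rewrite /okp; lia.
have -> : ((0 < n - a)%N && okp n en e0 (n - a).-1)%N = okp n e0 en a.
  by rewrite /okp; lia.
case: ifP => // ok; have an' : (a < n)%N by move: ok; rewrite /okp; lia.
rewrite /fl /= (_ : okp n en e0 (n - a).-1); last by move: ok; rewrite /okp; lia.
by rewrite (_ : (n.-1 - (n - a).-1)%N = a) //; lia.
Qed.

End Flip.

Lemma canon_fl n e0 en (K : numFieldType) (st : (nat -> K) * (nat -> K)) :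
  canon n en e0 (fl n e0 en st).
Proof. by split=> j H /=; [rewrite leqNgt H|rewrite (negbTE H)]. Qed.

Lemma rank_ok_sym n e0 en : rank_ok n e0 en -> rank_ok n en e0.
Proof. by rewrite /rank_ok; lia. Qed.

Lemma flK n e0 en (K : numFieldType) (st : (nat -> K) * (nat -> K)) :
  rank_ok n e0 en -> pst st -> canon n e0 en st -> fl n en e0 (fl n e0 en st) = st.
Proof.
move=> nok Pst [yc pc]; rewrite {1}/fl [RHS]surjective_pairing; congr pair; apply: boolp.funext => j.
  by rewrite /=; case: (leqP j n) => jn; rewrite ?leq_subr ?subKn // yc.
have [okj|/pc ->//] := boolP (okp n e0 en j).
have jn : (j < n)%N by move: okj; rewrite /okp; lia.
rewrite qst_flip //; last by move: okj; rewrite /okp; lia.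
by congr (st.2 _); lia.
Qed.

(** * Exchange of the two branches of a fork *)

Section Swap.
Variables (n : nat) (en : endtype) (K : numFieldType).
Hypothesis nok : rank_ok n Fork en.
Implicit Types (y p : nat -> K) (st : (nat -> K) * (nat -> K)).

Definition sw (i : nat) : nat := if i == 0%N then 1%N else if i == 1%N then 0%N else i.
Definition swp st : (nat -> K) * (nat -> K) := (fun j => st.1 (sw j), st.2).

Lemma swK : involutive sw.
Proof. by case=> [|[|]]. Qed.

Lemma sw_le i : (i <= n)%N -> (sw i <= n)%N.
Proof. by move=> ?; move: nok; rewrite /rank_ok /sw => /= nk; case_ifs; lia. Qed.

Lemma lev_sw i : lev n Fork en (sw i) = lev n Fork en i.
Proof.
move: nok; rewrite /rank_ok /lev /sw /=; case: (en) => /= nk;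
  by case: i => [|[|i]] //=; case_ifs; lia.
Qed.

Lemma kap_sw i : kap n Fork en (sw i) = kap n Fork en i.
Proof.
move: nok; rewrite /rank_ok /kap /sw /=; case: (en) => /= nk;
  by case: i => [|[|i]] //=; case_ifs; lia.
Qed.

Lemma lam_sw i : lam n Fork en (sw i) = lam n Fork en i.
Proof.
move: nok; rewrite /rank_ok /lam /sw /=; case: (en) => /= nk;
  by case: i => [|[|i]] //=; case_ifs; lia.
Qed.

Lemma ecart_sw i j : ecart n Fork en (sw i) (sw j) = ecart n Fork en i j.
Proof. by rewrite /ecart /adj !lev_sw kap_sw lam_sw (inj_eq (inv_inj swK)). Qed.

Lemma prod_sw (F : nat -> K) : \prod_(j <- iota 0 n.+1) F (sw j) = \prod_(j <- iota 0 n.+1) F j.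
Proof.
rewrite -(big_map sw xpredT); apply: perm_big; apply: uniq_perm.
- by rewrite map_inj_uniq ?iota_uniq //; apply: inv_inj swK.
- exact: iota_uniq.
- move=> j; rewrite mem_iota add0n; apply/mapP/idP => [[i + ->]|jn].
    by rewrite mem_iota add0n !ltnS => /sw_le.
  by exists (sw j); rewrite ?swK // mem_iota add0n ltnS sw_le.
Qed.

(** Both branches of the fork have the same position and the same exponent, so w does not
    distinguish y_0 from y_1. *)
Lemma wlev_sw y l : wlev n Fork en (fun j => y (sw j)) l = wlev n Fork en y l.
Proof.
rewrite /wlev big_mkcond [RHS]big_mkcond /= -[RHS]prod_sw.
by apply: eq_bigr => j _; rewrite lev_sw kap_sw.
Qed.

Lemma yup_sw i c y : yup (sw i) c (fun j => y (sw j)) = fun j => yup i c y (sw j).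
Proof. by apply: boolp.funext => j; rewrite /yup -(inj_eq (inv_inj swK)) swK. Qed.

Lemma E_swap i c st : E n Fork en (sw i) c (swp st) = swp (E n Fork en i c st).
Proof.
rewrite /E /swp /= yup_sw; congr pair; apply: boolp.funext => l.
by rewrite lev_sw /blev !wlev_sw.
Qed.

Lemma egam_swap i st : egam n Fork en (sw i) (swp st) = egam n Fork en i st.
Proof. by rewrite /egam -[RHS]prod_sw; apply: eq_bigr => j _; rewrite /= -(ecart_sw (sw j)) swK. Qed.

Lemma eeps_swap i st : eeps n Fork en (sw i) (swp st) = eeps n Fork en i st.
Proof. by rewrite /eeps lev_sw lam_sw /qst /= swK /blev !wlev_sw. Qed.

Lemma swp_pos st : pst st -> pst (swp st).
Proof. by move=> [y0 p0]; split=> //= j. Qed.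

Lemma swp_canon st : canon n Fork en st -> canon n Fork en (swp st).
Proof.
move=> [yc pc]; split=> // j jn; rewrite /= yc //; move: nok jn; rewrite /rank_ok /sw => /= nk ?.
by case_ifs; lia.
Qed.

End Swap.

(* Points x and y of the two parametrizing tori are the elements of one and   *)
(* the same space of states modulo scaling, written in two gauges. There all  *)
(* e_i, e_0 included, are explicit.                                           *)
Section Model.
Variables (R : realType) (g : affine_type) (n : nat).
Local Notation C := R[i].
Local Notation w1 := (word1 g n).
Local Notation w2 := (tgt_word g n).
Local Notation s0 := (sigma_index g n 0).
Variables (St : Type) (ok : St -> Prop) (EE : nat -> C -> St -> St) (scl : C -> St -> St).
Variables (gg ep : nat -> St -> C).
Variables (m1 : 'cV[C]_(size w1) -> St) (n1 : St -> 'cV[C]_(size w1)).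
Variables (m2 : 'cV[C]_(size w2) -> St) (n2 : St -> 'cV[C]_(size w2)).

Record state_model : Prop := StateModel {
  sm_m1 : forall x, postorus x -> ok (m1 x);
  sm_m2 : forall x, postorus x -> ok (m2 x);
  sm_n1 : forall st, ok st -> postorus (n1 st);
  sm_n2 : forall st, ok st -> postorus (n2 st);
  sm_n1K : forall x, postorus x -> n1 (m1 x) = x;
  sm_n2K : forall x, postorus x -> n2 (m2 x) = x;
  sm_m1K : forall st, ok st -> exists2 s, 0 < s & m1 (n1 st) = scl s st;
  sm_m2K : forall st, ok st -> exists2 s, 0 < s & m2 (n2 st) = scl s st;
  sm_n1sc : forall s st, 0 < s -> ok st -> n1 (scl s st) = n1 st;
  sm_n2sc : forall s st, 0 < s -> ok st -> n2 (scl s st) = n2 st;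
  sm_scok : forall s st, 0 < s -> ok st -> ok (scl s st);
  sm_Eok : forall i c st, (i <= n)%N -> 0 < c -> ok st -> ok (EE i c st);
  sm_Esc : forall i c s st, (i <= n)%N -> 0 < c -> 0 < s -> ok st ->
    EE i c (scl s st) = scl s (EE i c st);
  sm_e1 : forall i c x, (0 < i <= n)%N -> 0 < c -> postorus x ->
    e_par g n i c x = n1 (EE i c (m1 x));
  sm_e2 : forall c x, 0 < c -> postorus x -> e_par g n s0 c x = n2 (EE 0 c (m2 x));
  sm_gam1 : forall i x, (0 < i <= n)%N -> postorus x -> gam_par g n i x = gg i (m1 x);
  sm_gam2 : forall x, postorus x -> gam_par g n s0 x = gg 0 (m2 x);
  sm_eps1 : forall i x, (0 < i <= n)%N -> postorus x -> eps_par g n i x = ep i (m1 x);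
  sm_eps2 : forall x, postorus x -> eps_par g n s0 x = ep 0 (m2 x);
  sm_ggsc : forall i s st, (i <= n)%N -> 0 < s -> ok st -> gg i (scl s st) = gg i st;
  sm_epsc : forall i s st, (i <= n)%N -> 0 < s -> ok st -> ep i (scl s st) = ep i st;
  sm_EM : forall i c d st, (i <= n)%N -> 0 < c -> 0 < d -> ok st ->
    EE i c (EE i d st) = EE i (c * d) st;
  sm_ggE : forall i j c st, (i <= n)%N -> (j <= n)%N -> 0 < c -> ok st ->
    gg j (EE i c st) = c ^ cartan g n i j * gg j st;
  sm_epE : forall i c st, (i <= n)%N -> 0 < c -> ok st -> ep i (EE i c st) = c^-1 * ep i st;
  sm_br2 : forall i j, (i <= n)%N -> (j <= n)%N -> cartan g n i j = 0 -> cartan g n j i = 0 ->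
    forall c d st, 0 < c -> 0 < d -> ok st -> EE i c (EE j d st) = EE j d (EE i c st);
  sm_br3 : forall i j, (i <= n)%N -> (j <= n)%N -> cartan g n i j = -1 -> cartan g n j i = -1 ->
    forall c d st, 0 < c -> 0 < d -> ok st ->
    EE i c (EE j (c * d) (EE i d st)) = EE j d (EE i (c * d) (EE j c st));
  sm_br4 : forall i j, (i <= n)%N -> (j <= n)%N ->
    cartan g n i j = -2%:Z -> cartan g n j i = -1 ->
    forall c d st, 0 < c -> 0 < d -> ok st ->
    EE i c (EE j (c ^+ 2 * d) (EE i (c * d) (EE j d st))) =
    EE j d (EE i (c * d) (EE j (c ^+ 2 * d) (EE i c st))) }.

Hypothesis SM : state_model.

Definition mS x := n2 (m1 x).
Definition mS' y := n1 (m2 y).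

Lemma mSK x : postorus x -> mS' (mS x) = x.
Proof.
move=> Px; have ok1 := sm_m1 SM Px; rewrite /mS' /mS.
by have [s s0 ->] := sm_m2K SM ok1; rewrite (sm_n1sc SM) // (sm_n1K SM).
Qed.

Lemma mS'K y : postorus y -> mS (mS' y) = y.
Proof.
move=> Py; have ok1 := sm_m2 SM Py; rewrite /mS' /mS.
by have [s s0 ->] := sm_m1K SM ok1; rewrite (sm_n2sc SM) // (sm_n2K SM).
Qed.

Local Notation ex := (ex mS mS').
Local Notation gamx := (gamx mS).
Local Notation epsx := (epsx mS).

Let ord_pos (i : 'I_n.+1) : i != ord0 -> (0 < i <= n)%N.
Proof.
move=> i0; rewrite lt0n -ltnS ltn_ord andbT.
by apply: contra i0 => /eqP i0; apply/eqP/val_inj.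
Qed.

Let ord_le (i : 'I_n.+1) : (i <= n)%N. Proof. by rewrite -ltnS. Qed.

(** For i = 0 the operator is conjugated by the passage to the second gauge. The scalars introduced
    by the changes of gauge commute with the operators and are not seen by [n1]. *)
Lemma exE i c x : 0 < c -> postorus x -> ex i c x = n1 (EE i c (m1 x)).
Proof.
move=> c0 Px; rewrite /ex; case: ifPn => [/eqP ->|/ord_pos i0]; last exact: (sm_e1 SM).
have ok1 := sm_m1 SM Px; have Py := sm_n2 SM ok1.
rewrite (sm_e2 SM c0 Py) /mS'.
have [s sp E2] := sm_m2K SM ok1; have ok2 := sm_scok SM sp ok1.
have ok3 := sm_Eok SM (leq0n n) c0 ok2.
rewrite /mS E2; have [s' sp' ->] := sm_m2K SM ok3; rewrite (sm_n1sc SM) // (sm_Esc SM) //.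
by rewrite (sm_n1sc SM) //; apply: (sm_Eok SM).
Qed.

Lemma gamxE i x : postorus x -> gamx i x = gg i (m1 x).
Proof.
move=> Px; rewrite /gamx; case: ifPn => [/eqP ->|/ord_pos i0]; last exact: (sm_gam1 SM).
have ok1 := sm_m1 SM Px; have Py := sm_n2 SM ok1.
by rewrite (sm_gam2 SM Py) /mS; have [s sp ->] := sm_m2K SM ok1; rewrite (sm_ggsc SM).
Qed.

Lemma epsxE i x : postorus x -> epsx i x = ep i (m1 x).
Proof.
move=> Px; rewrite /epsx; case: ifPn => [/eqP ->|/ord_pos i0]; last exact: (sm_eps1 SM).
have ok1 := sm_m1 SM Px; have Py := sm_n2 SM ok1.
by rewrite (sm_eps2 SM Py) /mS; have [s sp ->] := sm_m2K SM ok1; rewrite (sm_epsc SM).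
Qed.

(** Composites are followed on states. Each state represents its point only up to a scalar, which
    the next step absorbs. *)
Let step (i : 'I_n.+1) c st x : 0 < c -> ok st -> x = n1 st ->
  ex i c x = n1 (EE i c st) /\ ok (EE i c st).
Proof.
move=> c0 okst ->; have Px := sm_n1 SM okst; split; last exact: (sm_Eok SM).
rewrite exE //; have [s sp ->] := sm_m1K SM okst; rewrite (sm_Esc SM) // (sm_n1sc SM) //.
exact: (sm_Eok SM).
Qed.

Lemma model_eM i c d x : 0 < c -> 0 < d -> postorus x -> ex i c (ex i d x) = ex i (c * d) x.
Proof.
move=> c0 d0 Px; have ok1 := sm_m1 SM Px; have E0 := esym (sm_n1K SM Px).
have [E1 ok2] := step i d0 ok1 E0; have [-> _] := step i c0 ok2 E1.
have [-> _] := step i (mulr_gt0 c0 d0) ok1 E0.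
by rewrite (sm_EM SM).
Qed.

Lemma model_gam i j c x : 0 < c -> postorus x ->
  gamx j (ex i c x) = c ^ cartan_mx g n i j * gamx j x.
Proof.
move=> c0 Px; have ok1 := sm_m1 SM Px; have E0 := esym (sm_n1K SM Px).
have [-> ok2] := step i c0 ok1 E0; rewrite !gamxE //; last exact: (sm_n1 SM).
have [s sp ->] := sm_m1K SM ok2.
by rewrite (sm_ggsc SM) // (sm_ggE SM) // mxE.
Qed.

Lemma model_eps i c x : 0 < c -> postorus x -> epsx i (ex i c x) = c^-1 * epsx i x.
Proof.
move=> c0 Px; have ok1 := sm_m1 SM Px; have E0 := esym (sm_n1K SM Px).
have [-> ok2] := step i c0 ok1 E0; rewrite !epsxE //; last exact: (sm_n1 SM).
have [s sp ->] := sm_m1K SM ok2.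
by rewrite (sm_epsc SM) // (sm_epE SM).
Qed.

Lemma model_braid : braid_rels (cartan_mx g n) (@postorus _ _) ex.
Proof.
split=> i j; rewrite !mxE => A1 A2 c d x c0 d0 Px; have ok0 := sm_m1 SM Px;
  have E0 := esym (sm_n1K SM Px); have cd0 := mulr_gt0 c0 d0.
- have [E1 ok1] := step j d0 ok0 E0; have [-> _] := step i c0 ok1 E1.
  have [F1 okf1] := step i c0 ok0 E0; have [-> _] := step j d0 okf1 F1.
  by rewrite (sm_br2 SM _ _ A1 A2).
- have [E1 ok1] := step i d0 ok0 E0; have [E2 ok2] := step j cd0 ok1 E1.
  have [-> _] := step i c0 ok2 E2.
  have [F1 okf1] := step j c0 ok0 E0; have [F2 okf2] := step i cd0 okf1 F1.
  have [-> _] := step j d0 okf2 F2.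
  by rewrite (sm_br3 SM _ _ A1 A2).
- have ccd0 : 0 < c ^+ 2 * d by rewrite mulr_gt0 // exprn_gt0.
  have [E1 ok1] := step j d0 ok0 E0; have [E2 ok2] := step i cd0 ok1 E1.
  have [E3 ok3] := step j ccd0 ok2 E2; have [-> _] := step i c0 ok3 E3.
  have [F1 okf1] := step i c0 ok0 E0; have [F2 okf2] := step j ccd0 okf1 F1.
  have [F3 okf3] := step i cd0 okf2 F2; have [-> _] := step j d0 okf3 F3.
  by rewrite (sm_br4 SM _ _ A1 A2).
Qed.

Lemma model_lift_data (cf1 : 'cV[C]_(dimW g n) -> 'cV[C]_(size w1))
    (cf2 : 'cV[C]_(dimW g n) -> 'cV[C]_(size w2)) :
    (forall i, posrat (tspace C (size w1)) (fun x => mS x i ord0)) ->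
    (forall i, posrat (tspace C (size w2)) (fun y => mS' y i ord0)) ->
    is_sigma_lift mS ->
    (forall y, is_sigma_lift y -> generically (torus C _) (fun x => y x = mS x)) ->
    (forall i, posrat (V1space R g n) (fun u => cf1 u i ord0)) ->
    (forall x, torus C _ x -> cf1 (vpar g n (V 1) x) = x) ->
    (forall i, posrat (V2space R g n) (fun u => cf2 u i ord0)) ->
    (forall x, torus C _ x -> cf2 (vpar g n (tgt_base g n) x) = x) ->
    s0 \in w2 -> (forall i, (0 < i <= n)%N -> i \in w1) ->
    rank2_cartan (cartan_mx g n) ->
  lift_data mS mS' cf1 cf2.
Proof.
move=> H1 H2 H3 H4 H5 H6 H7 H8 H9 H10 H11; split=> //.
- by apply: posmap_tspace => // x Px; apply: (sm_n2 SM); apply: (sm_m1 SM).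
- by apply: posmap_tspace => // x Px; apply: (sm_n1 SM); apply: (sm_m2 SM).
- exact: mSK.
- exact: mS'K.
- by move=> i; rewrite mxE /cartan eqxx.
- exact: model_eM.
- exact: model_gam.
- exact: model_eps.
- exact: model_braid.
Qed.

End Model.

(** * Words and their states *)

Section Words.
Variables (n : nat) (e0 en : endtype) (K : numFieldType).
Hypothesis nok : rank_ok n e0 en.
Local Notation lev := (lev n e0 en).
Local Notation kap := (kap n e0 en).
Local Notation lam := (lam n e0 en).
Local Notation okp := (okp n e0 en).
Local Notation wlev := (wlev n e0 en).
Local Notation blev := (blev n e0 en).
Local Notation ecart := (ecart n e0 en).
Implicit Types (x : nat -> K) (st : (nat -> K) * (nat -> K)).

(* The letters F0, ..., n followed by n - 1 - Fn, ..., 1, where F0 and Fn     *)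
(* tell whether there is a fork at 0, resp. at n.                             *)
Definition wsize : nat := (2 * n - isF e0 - isF en)%N.
Definition idx (j : nat) : nat :=
  if (j + isF e0 <= n)%N then (j + isF e0)%N else (wsize - j)%N.
Definition pos1 (i : nat) : nat := (i - isF e0)%N.
Definition pos2 (i : nat) : nat := (wsize - i)%N.

Definition PM x i l : K := (\prod_(j <- iota 0 l) x j ^ ecart (idx j) i * x l)^-1.
Definition epsN x i : K := \sum_(l <- iota 0 wsize | idx l == i) PM x i l.
Definition gamN x i : K := \prod_(j <- iota 0 wsize) x j ^ ecart (idx j) i.
Definition eN i c x j : K := x j *
  ((c * (\sum_(l <- iota 0 wsize | (idx l == i) && (l <= j)%N) PM x i l)
    + \sum_(l <- iota 0 wsize | (idx l == i) && (j < l)%N) PM x i l) /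
   (c * (\sum_(l <- iota 0 wsize | (idx l == i) && (l < j)%N) PM x i l)
    + \sum_(l <- iota 0 wsize | (idx l == i) && (j <= l)%N) PM x i l)).

(** For a letter occurring twice, p_l is the first occurrence. The exponent [kap] matters at l = 0
    only: p_0 is the coefficient of v_bar1, which Y_0(c) multiplies by c^2 at a short end and by c
    at a long one. *)
Definition mst x : (nat -> K) * (nat -> K) :=
  (fun m => \prod_(j <- iota 0 wsize | idx j == m) x j,
   fun l => if okp l then x (pos1 l) ^+ kap l else 1).
Definition xof st (j : nat) : K :=
  if (j < wsize)%N then
    if (j + isF e0 <= n)%N then
      if (0 < idx j)%N && okp (idx j) then st.2 (idx j) else st.1 (idx j)
    else st.1 (idx j) / st.2 (idx j)
  else 1.

(** A letter occurs twice exactly if it is positive and has a link above its position; the second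
    pass of the word runs down through these letters. *)
Definition occ (i : nat) : seq nat :=
  if (0 < i)%N && okp i then [:: pos1 i; pos2 i] else [:: pos1 i].

Lemma occ_perm i : (isF e0 <= i <= n)%N ->
  perm_eq [seq j <- iota 0 wsize | idx j == i] (occ i).
Proof.
move=> iin; apply: uniq_perm; first by rewrite filter_uniq ?iota_uniq.
  rewrite /occ; case: ifP => //= H; rewrite inE andbT; move: H ; move: nok.
  by rewrite /rank_ok /pos1 /pos2 /okp /wsize; lia.
move=> j; rewrite mem_filter mem_iota /occ; move: nok ; rewrite /rank_ok /idx /wsize /okp.
by case: ifP => H; case: ifP => H'; rewrite !inE /pos1 /pos2 /wsize; lia.
Qed.

Lemma prod_occ (F : nat -> K) i : (isF e0 <= i <= n)%N ->
  \prod_(j <- iota 0 wsize | idx j == i) F j = \prod_(j <- occ i) F j.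
Proof. by move=> ok; rewrite -big_filter (perm_big _ (occ_perm ok)). Qed.

Lemma sum_occ (F : nat -> K) Q i : (isF e0 <= i <= n)%N ->
  \sum_(j <- iota 0 wsize | (idx j == i) && Q j) F j = \sum_(j <- occ i | Q j) F j.
Proof. by move=> ok; rewrite -big_filter_cond (perm_big _ (occ_perm ok)). Qed.

Lemma idx_bounds j : (j < wsize)%N -> (isF e0 <= idx j <= n)%N.
Proof. by move: nok; rewrite /rank_ok /idx /wsize; case: ifP; lia. Qed.

Lemma idx_pos1 l : okp l -> idx (pos1 l) = l /\ (pos1 l < wsize)%N.
Proof. by move: nok; rewrite /rank_ok /okp /idx /pos1 /wsize; case: ifP; lia. Qed.

Lemma okp_lev l i : okp l -> (0 < i <= n)%N -> lev i = l -> i = l.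
Proof.
move: nok; rewrite /rank_ok /okp /lev; case: (e0); case: (en) => /= nk; case_ifs; lia.
Qed.

Lemma lev_okp l : okp l -> (lev l = l)%N.
Proof.
move: nok; rewrite /rank_ok /okp /lev; case: (e0); case: (en) => /= nk; case_ifs; lia.
Qed.

Lemma kap_okp l : okp l -> (0 < l)%N -> kap l = 1%N.
Proof. by rewrite /okp /kap; case_ifs; lia. Qed.

Lemma lam_okp l : okp l -> (0 < l)%N -> lam l = 1%N.
Proof. by rewrite /okp /lam; case_ifs; lia. Qed.

Lemma prod_by_letter (F : nat -> K) (Q : pred nat) :
  \prod_(m <- iota 0 n.+1 | Q m) \prod_(j <- iota 0 wsize | idx j == m) F j =
  \prod_(j <- iota 0 wsize | Q (idx j)) F j.
Proof.
have H m : (if Q m then \prod_(j <- iota 0 wsize | idx j == m) F j else 1) =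
    \prod_(j <- iota 0 wsize) (if Q (idx j) && (idx j == m) then F j else 1).
  rewrite big_mkcond; case Qm: (Q m); last first.
    by rewrite big1 // => j _; case: (eqVneq (idx j) m) => [->|]; rewrite ?Qm ?andbF.
  by apply: eq_bigr => j _; case: (eqVneq (idx j) m) => [->|]; rewrite ?Qm ?andbF.
rewrite big_mkcond (eq_bigr _ (fun m _ => H m)).
rewrite exchange_big [RHS]big_mkcond /= big_seq [RHS]big_seq; apply: eq_bigr => j.
rewrite mem_iota add0n => jk; have /andP[_ jn] := idx_bounds jk.
have jr : idx j \in iota 0 n.+1 by rewrite mem_iota add0n ltnS jn.
rewrite (bigD1_seq (idx j) jr (iota_uniq _ _)).
rewrite /= eqxx andbT big1 ?mulr1 // => m mj.
by rewrite [idx j == m]eq_sym (negbTE mj) andbF.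
Qed.

Lemma gamN_mst x i : gamN x i = egam n e0 en i (mst x).
Proof.
have H m : (mst x).1 m ^ ecart m i = \prod_(j <- iota 0 wsize | idx j == m) x j ^ ecart (idx j) i.
  rewrite (big_morph (fun z : K => z ^ ecart m i) (id1 := 1) (op1 := *%R)).
  - by apply: eq_bigr => j /eqP ->.
  - by move=> a b; rewrite expfzMl.
  - exact: exp1rz.
rewrite /egam (eq_bigr _ (fun m _ => H m)).
by rewrite (prod_by_letter (fun j => x j ^ ecart (idx j) i) predT).
Qed.

Lemma wlev_mst x l : wlev (mst x).1 l =
  \prod_(j <- iota 0 wsize | lev (idx j) == l) x j ^+ kap (idx j).
Proof.
rewrite /wlev -(prod_by_letter (fun j => x j ^+ kap (idx j)) (fun m => lev m == l)) /=.
apply: eq_bigr => m _; rewrite -prodrXl.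
by apply: eq_bigr => j /eqP ->.
Qed.

Lemma prod_supp (F : nat -> K) (r s : seq nat) : uniq r -> uniq s -> {subset s <= r} ->
  (forall j, j \in r -> j \notin s -> F j = 1) -> \prod_(j <- r) F j = \prod_(j <- s) F j.
Proof.
move=> ur us sr H; rewrite (bigID (mem s)) /= [X in _ * X]big_seq_cond [X in _ * X]big1 ?mulr1 => [|j /andP[jr js]].
  rewrite -big_filter; apply: perm_big; apply: uniq_perm; rewrite ?filter_uniq //.
  by move=> j; rewrite mem_filter; apply: andb_idr; apply: sr.
exact: H.
Qed.

(** Before the first i the only adjacent letter is the first occurrence of the node at the position
    below. It enters with exponent -kap lam, and its power kap is p at that position. *)
Lemma PM_first x i : (0 < i <= n)%N ->
  PM x i (pos1 i) =
  (if (0 < lev i)%N && okp (lev i).-1 then (mst x).2 (lev i).-1 else 1) ^+ lam i / x (pos1 i).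
Proof.
move=> iin; rewrite /PM invfM; congr (_ * _).
have idxE j : (j < pos1 i)%N -> idx j = (j + isF e0)%N.
  by rewrite /pos1 /idx => H; case: ifP => //; lia.
case: ifPn => [/andP[l0 okl]|nok'].
  rewrite (@prod_supp _ _ [:: pos1 (lev i).-1]) ?iota_uniq //; last 2 first.
  - move=> j; rewrite inE => /eqP ->; rewrite mem_iota; move: okl iin; move: nok.
    by rewrite /pos1 /okp /rank_ok /lev; case: (e0); case: (en) => /= ?; case_ifs; lia.
  - move=> j; rewrite mem_iota add0n inE => jl nj; rewrite idxE // /ecart /adj.
    rewrite (_ : (_ == i) = false) 1?(_ : (_ || _) = false) //; last first.
      by apply/eqP; move: jl; rewrite /pos1; lia.
    apply/negbTE; move: jl nj okl iin; move: nok; rewrite /rank_ok /pos1 /okp /lev.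
    by case: (e0); case: (en) => /= ?; case_ifs; lia.
  rewrite big_seq1 /= okl; have [-> _] := idx_pos1 okl.
  rewrite /ecart /adj (lev_okp okl) prednK // eqxx orbT.
  rewrite (_ : ((lev i).-1 == i) = false); last first.
    by apply/eqP; move: okl l0 iin; rewrite /okp /lev; case_ifs; lia.
  by rewrite -exprM invr_expz opprK.
rewrite big_seq big1 ?expr1n ?invr1 // => j; rewrite mem_iota add0n => jl; rewrite idxE // /ecart /adj.
rewrite (_ : (_ == i) = false) 1?(_ : (_ || _) = false) //; last first.
  by apply/eqP; move: jl; rewrite /pos1; lia.
apply/negbTE; move: jl nok' iin; move: nok; rewrite /rank_ok /pos1 /okp /lev.
by case: (e0); case: (en) => /= ?; case_ifs; lia.
Qed.

Lemma mst_y2 x i : (0 < i)%N -> okp i -> (mst x).1 i = x (pos1 i) * x (pos2 i).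
Proof.
move=> i0 oki; rewrite /= prod_occ /occ ?i0 ?oki ?big_cons ?big_nil ?mulr1 //.
by move: oki; rewrite /okp; lia.
Qed.

Lemma mst_y1 x i : (isF e0 <= i <= n)%N -> ~~ ((0 < i)%N && okp i) -> (mst x).1 i = x (pos1 i).
Proof. by move=> iin /negbTE ni; rewrite /= prod_occ // /occ ni big_cons big_nil mulr1. Qed.

Lemma wlev_mst_okp x i : (0 < i)%N -> okp i -> wlev (mst x).1 i = x (pos1 i) * x (pos2 i).
Proof.
move=> i0 oki; rewrite -mst_y2 // /wlev prod_lev //; last by case: (okp_oklev nok oki).
rewrite /nodes; move: (oki) nok; rewrite /okp /rank_ok => oki' nk.
case: ifP => [/andP[F0 /eqP i1]|_].
  rewrite i1 in oki *; rewrite !big_cons big_nil mulr1 (kap_okp oki) // expr1.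
  have -> : (mst x).1 0%N = 1.
    rewrite /= big_seq_cond big1 // => j /andP[]; rewrite mem_iota add0n => /idx_bounds.
    by rewrite F0 => /andP[+ _] /eqP ji; rewrite ji.
  by rewrite expr1n mul1r.
case: ifP => [|_]; first by lia.
by rewrite big_cons big_nil mulr1 kap_okp.
Qed.

(** Between the two letters i lie all letters of position i + 1 and no other neighbours of i. They
    contribute w_(i+1), and the two letters i have product w_i. Hence the sum of the two terms is
    the first one times (w_i + w_(i+1)) / w_i, which brings q_i into epsilon_i. *)
Lemma PM_second x i : (forall j, x j != 0) -> (0 < i)%N -> okp i ->
  PM x i (pos2 i) = PM x i (pos1 i) * (wlev (mst x).1 i.+1 / wlev (mst x).1 i).
Proof.
move=> x0 i0 oki; rewrite (wlev_mst_okp _ i0 oki) {1}/PM.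
have H12 : (pos1 i < pos2 i)%N by move: oki nok; rewrite /okp /rank_ok /pos1 /pos2 /wsize; lia.
rewrite -(subnKC H12) addSnnS iotaD big_cat /= add0n big_cons [idx _](proj1 (idx_pos1 oki)).
rewrite [ecart i i](_ : _ = 2%:Z); last by rewrite /ecart eqxx.
have -> : \prod_(j <- iota (pos1 i).+1 (pos2 i - (pos1 i).+1)) x j ^ ecart (idx j) i =
    (wlev (mst x).1 i.+1)^-1.
  rewrite wlev_mst -prodfV [RHS]big_mkcond /=; symmetry; set r := iota (pos1 i).+1 _.
  have ur : uniq r by apply: iota_uniq.
  rewrite (@prod_supp _ _ r) ?iota_uniq //; last 2 first.
  - move=> j; rewrite !mem_iota; move: oki nok; rewrite /okp /rank_ok /pos1 /pos2 /wsize; lia.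
  - move=> j; rewrite !mem_iota => jk nj; case: ifP => // /eqP; move: jk nj oki; move: nok.
    rewrite /rank_ok /okp /pos1 /pos2 /wsize /idx /lev /wsize.
    by case: (e0); case: (en) => /= ?; case_ifs; lia.
  rewrite big_seq [RHS]big_seq; apply: eq_bigr => j; rewrite mem_iota => jk.
  have lidx : (i < idx j <= n)%N.
    by move: jk oki; rewrite /okp /pos1 /pos2 /wsize /idx /wsize; case: ifP; lia.
  rewrite /ecart /adj (lev_okp oki) lam_okp // muln1.
  rewrite (_ : (idx j == i) = false); last by apply/eqP; lia.
  have lge : (i <= lev (idx j))%N.
    by move: oki lidx nok; rewrite /okp /rank_ok /lev; case: (e0); case: (en) => /= ? ? ?; case_ifs; lia.
  rewrite (_ : (i == (lev (idx j)).+1) = false) ?orbF; last by apply/eqP; lia.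
  by case: ifP => // _; rewrite -invr_expz.
rewrite /PM -addSnnS (subnKC H12).
have [a0 b0] := (x0 (pos1 i), x0 (pos2 i)).
move: (\prod_(j <- _) _) (wlev _ _) (x _) (x _) a0 b0 => A w a b a0 b0.
have -> : b ^ 2%:Z = b * b by []. by rewrite !invfM !invrK; ring.
Qed.

Lemma epsN_mst x i : (forall j, x j != 0) -> (0 < i <= n)%N -> epsN x i = eeps n e0 en i (mst x).
Proof.
move=> x0 iin; rewrite /epsN.
have iin' : (isF e0 <= i <= n)%N by lia.
under eq_bigl => l do rewrite -[idx l == i]andbT.
rewrite (sum_occ _ predT) // /eeps.
case: (boolP ((0 < i)%N && okp i)) => [/andP[i0 oki]|ni].
  have Ey := mst_y2 x i0 oki; have Ew := wlev_mst_okp x i0 oki.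
  have Eq : qst n e0 en (mst x) i = blev (mst x).1 i / x (pos1 i).
    by rewrite /qst [(mst x).2 i]/= oki kap_okp // expr1.
  transitivity (PM x i (pos1 i) + PM x i (pos2 i)).
    by rewrite /occ i0 oki !big_cons big_nil addr0.
  rewrite PM_second // PM_first // !(lev_okp oki) oki lam_okp // !expr1 Eq Ey /blev Ew.
  have [a0 b0] := (x0 (pos1 i), x0 (pos2 i)).
  move: (if _ then _ else _) (wlev _ _) (x _) (x _) a0 b0 => A w a b a0 b0; field.
  by rewrite a0 b0.
rewrite /occ (negbTE ni) big_cons big_nil addr0 PM_first // mst_y1 //.
rewrite [okp (lev i)](_ : _ = false) ?mulr1 //; apply/negbTE; move: ni iin nok; rewrite /okp /rank_ok /lev.
by case: (e0); case: (en) => /= ? ? ?; case_ifs; lia.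
Qed.

End Words.

(** * Crystal operators on letters and on states, and the choice of gauge *)

Section WordOperators.
Variables (n : nat) (e0 en : endtype) (K : numFieldType).
Hypothesis nok : rank_ok n e0 en.
Local Notation lev := (lev n e0 en).
Local Notation kap := (kap n e0 en).
Local Notation okp := (okp n e0 en).
Local Notation wlev := (wlev n e0 en).
Local Notation blev := (blev n e0 en).
Local Notation wsize := (wsize n e0 en).
Local Notation idx := (idx n e0 en).
Local Notation pos1 := (pos1 e0).
Local Notation pos2 := (pos2 n e0 en).
Local Notation PM := (PM n e0 en).
Local Notation eN := (eN n e0 en).
Local Notation mst := (mst n e0 en).
Local Notation xof := (xof n e0 en).
Local Notation occ := (occ n e0 en).
Implicit Types (x : nat -> K) (st : (nat -> K) * (nat -> K)).

Lemma PM_gt0 x i l : (forall j, 0 < x j) -> 0 < PM x i l.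
Proof.
by move=> x0; rewrite invr_gt0 mulr_gt0 // prodr_gt0 // => j _; rewrite exprz_gt0.
Qed.

Lemma eN_occ x i c j : (0 < i <= n)%N -> eN i c x j = x j *
  ((c * (\sum_(l <- occ i | (l <= j)%N) PM x i l) + \sum_(l <- occ i | (j < l)%N) PM x i l) /
   (c * (\sum_(l <- occ i | (l < j)%N) PM x i l) + \sum_(l <- occ i | (j <= l)%N) PM x i l)).
Proof. by move=> iin; rewrite /eN !(@sum_occ n e0 en) //; lia. Qed.

Lemma occ_sum_gt0 x i c (Q Q' : pred nat) : (forall j, 0 < x j) -> 0 < c ->
    (forall l, Q l || Q' l) ->
  0 < c * (\sum_(l <- occ i | Q l) PM x i l) + \sum_(l <- occ i | Q' l) PM x i l.
Proof.
move=> x0 c0 QQ; have P0 l := PM_gt0 i l x0.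
have S0 (r : seq nat) (T : pred nat) : 0 <= \sum_(l <- r | T l) PM x i l.
  by apply: sumr_ge0 => l _; apply: ltW.
have [r ->] : exists r, occ i = pos1 i :: r by rewrite /occ; case: ifP => _; eexists.
rewrite !big_cons; case/orP: (QQ (pos1 i)) => ->.
  apply: ltr_pwDl; last by case: ifP => _; rewrite ?addr_ge0 // ltW.
  by rewrite mulr_gt0 // ltr_pwDl.
apply: ltr_wpDl; last by rewrite ltr_pwDl.
by rewrite mulr_ge0 ?(ltW c0) //; case: ifP => _; rewrite ?addr_ge0 // ltW.
Qed.

Lemma eN_other x i c j : (forall j, 0 < x j) -> 0 < c -> (0 < i <= n)%N ->
  (j < wsize)%N -> idx j != i -> eN i c x j = x j.
Proof.
move=> x0 c0 iin jk ji; rewrite eN_occ //.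
have H l : l \in occ i -> l != j.
  move=> lo; apply: contra ji => /eqP lj; rewrite -lj.
  have : l \in [seq j <- iota 0 wsize | idx j == i].
    by rewrite (perm_mem (occ_perm nok _)) //; lia.
  by rewrite mem_filter => /andP[].
have E1 (Q Q' : pred nat) : (forall l, l != j -> Q l = Q' l) ->
    \sum_(l <- occ i | Q l) PM x i l = \sum_(l <- occ i | Q' l) PM x i l.
  move=> QQ; rewrite big_seq_cond [RHS]big_seq_cond; apply: eq_bigl => l.
  by case lo: (l \in occ i) => //=; rewrite QQ // H.
rewrite (E1 (fun l => l <= j)%N (fun l => l < j)%N); last by move=> l; lia.
rewrite (E1 (fun l => j < l)%N (fun l => j <= l)%N); last by move=> l; lia.
rewrite divff ?mulr1 // gt_eqF //.
by apply: occ_sum_gt0 => // l; case: ltnP.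
Qed.

Lemma eN_gt0 x i c j : (forall j, 0 < x j) -> 0 < c -> (0 < i <= n)%N -> 0 < eN i c x j.
Proof.
move=> x0 c0 iin; rewrite eN_occ // mulr_gt0 // divr_gt0 //.
  by apply: occ_sum_gt0 => // l; case: leqP.
by apply: occ_sum_gt0 => // l; case: ltnP.
Qed.

Lemma eN_single x i c : (forall j, 0 < x j) -> 0 < c -> (0 < i <= n)%N ->
  ~~ ((0 < i)%N && okp i) -> eN i c x (pos1 i) = c * x (pos1 i).
Proof.
move=> x0 c0 iin /negbTE ni; rewrite eN_occ // /occ ni !big_cons !big_nil leqnn ltnn.
have := PM_gt0 i (pos1 i) x0; move: (PM _ _ _) (x _) => P z P0.
by rewrite !addr0 mulr0 add0r mulfK ?gt_eqF // mulrC.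
Qed.

Lemma pos12 i : okp i -> (pos1 i < pos2 i)%N.
Proof. by move: nok; rewrite /okp /rank_ok /pos1 /pos2 /wsize; lia. Qed.

(** As the second P is the first one times w_(i+1) / w_i, the factor in the formula for e_i is the
    quotient of the new by the old value of w_i + w_(i+1). *)
Lemma eN_first x i c : (forall j, 0 < x j) -> 0 < c -> (0 < i)%N -> okp i ->
  eN i c x (pos1 i) = x (pos1 i) * ((c * wlev (mst x).1 i + wlev (mst x).1 i.+1) / blev (mst x).1 i).
Proof.
move=> x0 c0 i0 oki; have p12 := pos12 oki.
rewrite eN_occ; last by move: oki; rewrite /okp; lia.
rewrite /occ i0 oki !big_cons !big_nil leqnn ltnn p12 (ltnW p12) leqNgt p12 ltnNge (ltnW p12) /=.
rewrite PM_second //; last by move=> j; rewrite gt_eqF.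
have P0 := PM_gt0 i (pos1 i) x0.
have w0 : 0 < wlev (mst x).1 i by rewrite wlev_mst_okp // mulr_gt0.
have w1 : 0 < wlev (mst x).1 i.+1.
  by rewrite wlev_mst //; apply: prodr_gt0 => j _; rewrite exprn_gt0.
rewrite /blev; move: (PM _ _ _) (wlev _ _) (wlev _ _) (x _) P0 w0 w1 => P w w' z P0 w0 w1.
rewrite !addr0 mulr0 add0r; field.
by rewrite !gt_eqF //; pos_tac.
Qed.

Lemma eN_double x i c : (forall j, 0 < x j) -> 0 < c -> (0 < i)%N -> okp i ->
  eN i c x (pos1 i) * eN i c x (pos2 i) = c * (x (pos1 i) * x (pos2 i)).
Proof.
move=> x0 c0 i0 oki; have p12 := pos12 oki.
rewrite !eN_occ; try by move: oki; rewrite /okp; lia.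
rewrite /occ i0 oki !big_cons !big_nil !leqnn !ltnn p12 (ltnW p12).
rewrite [(pos2 i <= pos1 i)%N]leqNgt p12 [(pos2 i < pos1 i)%N]ltnNge (ltnW p12) /=.
have P0 := PM_gt0 i (pos1 i) x0; have P1 := PM_gt0 i (pos2 i) x0.
move: (PM _ _ _) (PM _ _ _) (x _) (x _) P0 P1 => P P' z z' P0 P1.
rewrite !addr0 !mulr0 !add0r; field.
by rewrite !gt_eqF //; pos_tac.
Qed.

Lemma mst_pos x : (forall j, 0 < x j) -> pst (mst x).
Proof.
move=> x0; split=> j /=; first by apply: prodr_gt0.
by case: ifP => // _; rewrite exprn_gt0.
Qed.

(** For a double letter i, p_i is its first occurrence and y_i the product of both: the former
    changes by the factor in [eN_first], and the latter is multiplied by c. *)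
Lemma mst_E i c x : (forall j, 0 < x j) -> 0 < c -> (0 < i <= n)%N ->
  mst (eN i c x) = E n e0 en i c (mst x).
Proof.
move=> x0 c0 iin; rewrite {1}/mst /E; congr pair; apply: boolp.funext => l.
  rewrite /yup; case: (eqVneq l i) => [->|li]; last first.
    rewrite big_seq_cond [RHS]big_seq_cond; apply: eq_bigr => j /andP[].
    by rewrite mem_iota add0n => jk /eqP jl; rewrite eN_other // jl.
  have iin' : (isF e0 <= i <= n)%N by lia.
  rewrite (prod_occ nok) //; case: (boolP ((0 < i)%N && okp i)) => [/andP[i0 oki]|ni].
    by rewrite mst_y2 // /occ i0 oki !big_cons big_nil mulr1 eN_double.
  by rewrite mst_y1 // /occ (negbTE ni) big_cons big_nil mulr1 eN_single.
have [okl|] := boolP (okp l); last by rewrite andbF /= => /negbTE ->.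
rewrite andbT; have [idl pk] := idx_pos1 nok okl.
case: (eqVneq (lev i) l) => li; last first.
  rewrite eN_other // ?idl /= ?okl //.
  by apply: contraNneq li => <-; rewrite (lev_okp nok okl).
have il : i = l := okp_lev nok okl iin li; have i0 : (0 < i)%N by case/andP: iin.
rewrite -il in okl *; rewrite eN_first // [(mst x).2 i]/= okl (kap_okp nok okl i0) !expr1.
rewrite [in RHS]/blev !wlev_yup; try by case/andP: iin.
rewrite (lev_okp nok okl) eqxx (kap_okp nok okl i0) expr1.
by rewrite (ltn_eqF (ltnSn i)) mul1r.
Qed.

Lemma xof_mst x j : (forall j, x j != 0) -> (j < wsize)%N -> xof (mst x) j = x j.
Proof.
move=> x0 jk; rewrite /xof jk; have jb := idx_bounds nok jk.
case: ifP => jn.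
  have p1 : pos1 (idx j) = j by rewrite /pos1 /idx jn addnK.
  case: ifPn => [/andP[i0 oki]|ni]; last by rewrite mst_y1 // p1.
  by rewrite /= oki (kap_okp nok oki i0) expr1 p1.
have [i0 oki] : (0 < idx j)%N /\ okp (idx j).
  by move: jn jk; rewrite /idx /okp => jn; rewrite jn /wsize; lia.
have p2 : pos2 (idx j) = j by rewrite /pos2 /idx jn subKn // ltnW.
by rewrite mst_y2 // p2 [X in _ / X]/= oki (kap_okp nok oki i0) expr1 mulrC mulKf.
Qed.

(* The states of the form mst x: in the fork case y_0, and otherwise p_0, is  *)
(* fixed by scaling.                                                          *)
Definition gauge st : Prop :=
  if isF e0 then st.1 0%N = 1 else st.2 0%N = st.1 0%N ^+ kap 0.
(** The solution s of the gauge condition for [sc s st]: scaling multiplies y_0^(kap 0) by s^2 and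
    p_0 by s, and in the fork case y_0 by s. *)
Definition sg st : K := if isF e0 then (st.1 0%N)^-1 else st.2 0%N / st.1 0%N ^+ kap 0.

Lemma mst_canon x : canon n e0 en (mst x).
Proof.
split=> [m mn|l /negbTE nl] /=; last by rewrite nl.
rewrite big_seq_cond big1 // => j /andP[]; rewrite mem_iota add0n => /(idx_bounds nok).
by move=> /andP[_ +] /eqP jm; rewrite jm leqNgt mn.
Qed.

Lemma ok0 : ~~ isF e0 -> okp 0.
Proof. by move: nok; rewrite /rank_ok /okp; lia. Qed.

Lemma mst_gauge x : gauge (mst x).
Proof.
rewrite /gauge; case: ifPn => F0.
  rewrite /= big_seq_cond big1 // => j /andP[]; rewrite mem_iota add0n => /(idx_bounds nok).
  by rewrite F0 => /andP[+ _] /eqP ji; rewrite ji.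
by rewrite mst_y1 //= ?ok0 // (negbTE F0).
Qed.

(** States have one coordinate more than the torus, and the gauge condition supplies the one that is
    not a function of the letters: y_0 for a fork, p_0 otherwise. *)
Lemma mst_xof st : (forall l, st.2 l != 0) -> canon n e0 en st -> gauge st -> mst (xof st) = st.
Proof.
move=> p0 [yc pc] gst; rewrite {1}/mst [RHS]surjective_pairing.
have X1 i : (isF e0 <= i <= n)%N -> xof st (pos1 i) = if (0 < i)%N && okp i then st.2 i else st.1 i.
  move=> iin; have pk : (pos1 i < wsize)%N by move: iin nok; rewrite /pos1 /wsize /rank_ok; lia.
  have pn : (pos1 i + isF e0 <= n)%N by move: iin; rewrite /pos1; lia.
  have ii : idx (pos1 i) = i by rewrite /idx pn /pos1; lia.
  by rewrite /xof pk pn ii.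
congr pair; apply: boolp.funext => l.
  case: (leqP l n) => ln; last first.
    rewrite yc // big_seq_cond big1 // => j /andP[]; rewrite mem_iota add0n => /(idx_bounds nok).
    by move=> /andP[_ +] /eqP jm; rewrite jm leqNgt ln.
  case: (boolP (isF e0 <= l)%N) => Fl; last first.
    have [F0 l0] : isF e0 /\ l = 0%N by case: (isF e0) Fl; case: (l).
    move: gst; rewrite /gauge F0 l0 => ->.
    rewrite big_seq_cond big1 // => j /andP[]; rewrite mem_iota add0n => /(idx_bounds nok).
    by rewrite F0 => /andP[+ _] /eqP ji; rewrite ji.
  have lin : (isF e0 <= l <= n)%N by rewrite Fl.
  rewrite (prod_occ nok) // /occ; case: ifPn => [/andP[l0 okl]|nl]; last first.
    by rewrite big_cons big_nil mulr1 X1 // (negbTE nl).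
  rewrite !big_cons big_nil mulr1 X1 // l0 okl /=.
  have pk : (pos2 l < wsize)%N by move: okl nok; rewrite /okp /pos2 /wsize /rank_ok; lia.
  have pn : (pos2 l + isF e0 <= n)%N = false.
    by move: okl; rewrite /okp /pos2 /wsize; lia.
  have ii : idx (pos2 l) = l by rewrite /idx pn /pos2 subKn //; move: okl; rewrite /okp /wsize; lia.
  by rewrite /xof pk pn ii mulrC divfK.
case: ifPn => [okl|/pc -> //].
have lin : (isF e0 <= l <= n)%N by move: okl; rewrite /okp; lia.
rewrite X1 // okl andbT; case: ifPn => l0; first by rewrite (kap_okp nok okl l0) expr1.
have {l0} l0 : l = 0%N by move: l0; case: (l).
move: gst; rewrite /gauge l0; case: ifP => // F0.
by move: lin; rewrite F0 l0.
Qed.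

Lemma xof_gt0 st : pst st -> forall j, 0 < xof st j.
Proof.
move=> [y0 p0] j; rewrite /xof; case: ifP => // _; case: ifP => _; last by rewrite divr_gt0.
by case: ifP.
Qed.

Lemma dd_kap0 : (dd n e0 en 0 * kap 0 = if isF e0 then 1 else 2)%N.
Proof.
move: nok; rewrite /rank_ok /dd /kap; case: (e0); case: (en) => /= nk; case_ifs; lia.
Qed.

Lemma kap0F : isF e0 -> kap 0 = 1%N.
Proof.
move: nok; rewrite /rank_ok /kap; case: (e0); case: (en) => //= nk; case_ifs; lia.
Qed.

Lemma sg_gt0 st : pst st -> 0 < sg st.
Proof.
by move=> [y0 p0]; rewrite /sg; case: ifP => _; rewrite ?invr_gt0 // divr_gt0 // exprn_gt0.
Qed.

Lemma gauge_sc st : pst st -> gauge (sc n e0 en (sg st) st).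
Proof.
move=> [y0 p0]; rewrite /gauge /sg /=; have := dd_kap0.
case: ifPn => F0 dk.
  by rewrite kap0F // muln1 in dk; rewrite dk expr1 mulVf // gt_eqF.
rewrite ok0 // exprMn -exprM dk; have := y0 0%N; have := p0 0%N; have := exprn_gt0 (kap 0) (y0 0%N).
move: (_ ^+ kap 0) => w w0 p1 _; field.
by rewrite gt_eqF.
Qed.

Lemma gauge_sg st : pst st -> gauge st -> sg st = 1.
Proof.
move=> [y0 p0]; rewrite /gauge /sg; case: ifP => _ ->; first by rewrite invr1.
by rewrite divff // gt_eqF // exprn_gt0.
Qed.

Lemma sc1 st : sc n e0 en 1 st = st.
Proof.
case: st => y p; rewrite /sc; congr pair; apply: boolp.funext => l /=; first by rewrite expr1n mul1r.
by rewrite mul1r if_same.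
Qed.

Lemma sc_sc a b st : sc n e0 en a (sc n e0 en b st) = sc n e0 en (a * b) st.
Proof.
case: st => y p; rewrite /sc; congr pair; apply: boolp.funext => l /=; first by rewrite exprMn mulrA.
by case: (okp l); rewrite ?mulrA.
Qed.

Lemma sg_sc s st : 0 < s -> pst st -> sg (sc n e0 en s st) = sg st / s.
Proof.
move=> s0 [y0 p0]; rewrite /sg /=; have := dd_kap0; case: ifPn => F0 dk.
  by rewrite kap0F // muln1 in dk; rewrite dk expr1 invfM mulrC.
rewrite ok0 // exprMn -exprM dk; have := exprn_gt0 (kap 0) (y0 0%N).
by move: (_ ^+ kap 0) => w w0; field; rewrite !gt_eqF.
Qed.

Definition norm st : nat -> K := xof (sc n e0 en (sg st) st).

Lemma norm_sc s st : 0 < s -> pst st -> norm (sc n e0 en s st) = norm st.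
Proof. by move=> s0 Pst; rewrite /norm sc_sc sg_sc // divfK // gt_eqF. Qed.

Lemma norm_gt0 st : pst st -> forall j, 0 < norm st j.
Proof. by move=> Pst; apply/xof_gt0/sc_pos => //; apply: sg_gt0. Qed.

Lemma norm_gauge st : pst st -> gauge st -> norm st = xof st.
Proof. by move=> Pst gst; rewrite /norm gauge_sg // sc1. Qed.

Lemma mst_norm st : pst st -> canon n e0 en st -> mst (norm st) = sc n e0 en (sg st) st.
Proof.
move=> Pst cst; have [y0 p0] := sc_pos n e0 en (sg_gt0 Pst) Pst; apply: mst_xof.
- by move=> l; rewrite gt_eqF.
- exact: sc_canon.
- exact: gauge_sc.
Qed.

Lemma norm_mst x j : (forall j, 0 < x j) -> (j < wsize)%N -> norm (mst x) j = x j.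
Proof.
move=> x0 jk; rewrite norm_gauge ?xof_mst //; [|exact: mst_pos|exact: mst_gauge].
by move=> l; rewrite gt_eqF.
Qed.

Lemma eN_norm i c x j : (forall j, 0 < x j) -> 0 < c -> (0 < i <= n)%N -> (j < wsize)%N ->
  eN i c x j = norm (E n e0 en i c (mst x)) j.
Proof.
move=> x0 c0 iin jk; rewrite -mst_E // norm_mst // => l; exact: eN_gt0.
Qed.

End WordOperators.

(** * Cartan matrices *)

Section CartanEnds.
Variables (g : affine_type) (n : nat).
Hypothesis hn : (min_rank g <= n)%N.

Definition left_end : endtype :=
  match g with tyB1 | tyD1 | tyAodd2 => Fork | tyD2 => Short | _ => Long end.
Definition right_end : endtype :=
  match g with tyD1 => Fork | tyB1 | tyD2 | tyAeven2d => Short | _ => Long end.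

Lemma mem_chain (a m i j : nat) :
  ((i, j) \in [seq (k, k.+1) | k <- iota a m]) = (a <= i < a + m)%N && (j == i.+1).
Proof.
apply/mapP/andP => [[k + [-> ->]]|[ai /eqP ->]]; first by rewrite mem_iota eqxx.
by exists i; rewrite ?mem_iota.
Qed.

Lemma rank_ok_ends : g <> tyA1 -> rank_ok n left_end right_end.
Proof. by move: hn; rewrite /rank_ok /left_end /right_end; case: (g). Qed.

Lemma cartan_ends i j : g <> tyA1 -> (i <= n)%N -> (j <= n)%N ->
  cartan g n i j = ecart n left_end right_end i j.
Proof.
move=> gA lein lejn; rewrite /cartan /ecart; case: eqVneq => // ij.
have H (b1 b2 d : bool) k : b1 = b2 -> (b2 -> k = if d then 2%N else 1%N) ->
    (if b1 then if d then - 2%:Z else - 1%:Z else 0) = if b2 then - k%:Z else 0.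
  by move=> -> E; case: b2 E => // ->//; case: d.
apply: H; move: hn gA ij.
  rewrite /edges /adj /left_end /right_end /lev.
  by case: (g) => //= hn' _ ij; rewrite ?inE ?mem_chain ?xpair_eqE; case_ifs; lia.
rewrite /adj /double_entries /left_end /right_end /lev /kap /lam.
by case: (g) => //= hn' _ ij; rewrite ?inE ?xpair_eqE; case_ifs; lia.
Qed.

Lemma cartan_A i j : g = tyA1 -> (i <= n)%N -> (j <= n)%N -> cartan g n i j =
  if i == j then 2%:Z else if (j == i.+1) || (i == j.+1) ||
    (i == 0%N) && (j == n) || (i == n) && (j == 0%N) then -1 else 0.
Proof.
move=> gA lein lejn; rewrite /cartan gA /edges /double_entries !inE !mem_chain !xpair_eqE.
case: eqVneq => // ij; congr (if _ then _ else _); lia.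
Qed.

Lemma cartan_rank2 : rank2_cartan (cartan_mx g n).
Proof.
move=> i j ij; rewrite !mxE; have leni := ltn_ord i; have lenj := ltn_ord j.
have {}ij : (i != j :> nat) by [].
have ji : (j != i :> nat) by rewrite eq_sym.
case: (boolP (if g is tyA1 then true else false)) => gA.
  have {}gA : g = tyA1 by case: (g) gA.
  rewrite !cartan_A // (negbTE ij) (negbTE ji).
  by case: ifP => A; case: ifP => B; [constructor 2|exfalso; lia|exfalso; lia|constructor 1].
have {}gA : g <> tyA1 by move=> E; rewrite E in gA.
rewrite !cartan_ends // /ecart (negbTE ij) (negbTE ji) /adj orbC.
case: ifP => [aij|]; last by constructor 1.
have nok := rank_ok_ends gA.
have : [\/ kap n left_end right_end i * lam n left_end right_end j = 1 /\
           kap n left_end right_end j * lam n left_end right_end i = 1,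
           kap n left_end right_end i * lam n left_end right_end j = 2 /\
           kap n left_end right_end j * lam n left_end right_end i = 1 |
           kap n left_end right_end i * lam n left_end right_end j = 1 /\
           kap n left_end right_end j * lam n left_end right_end i = 2]%N.
  move: aij nok ij leni lenj; rewrite /rank_ok /lev /kap /lam.
  move: (nat_of_ord i) (nat_of_ord j) => a b.
  case: left_end; case: right_end => /=; case_ifs => *;
    first [by constructor 1; lia|by constructor 2; lia|by constructor 3; lia|exfalso; lia].
by case=> -[-> ->]; [constructor 2|constructor 3|constructor 4].
Qed.

Lemma ecart_br i j : g <> tyA1 -> (i <= n)%N -> (j <= n)%N ->
  (cartan g n i j = 0 -> ~~ adj n left_end right_end i j) /\
  (cartan g n i j < 0 -> adj n left_end right_end i j) /\
  (cartan g n i j = -1 -> cartan g n j i = -1 ->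
     kap n left_end right_end i = 1%N /\ kap n left_end right_end j = 1%N) /\
  (cartan g n i j = -2%:Z -> cartan g n j i = -1 ->
     (kap n left_end right_end i = 1%N \/ kap n left_end right_end i = 2%N) /\
     kap n left_end right_end j = 1%N).
Proof.
move=> gA lein lejn; rewrite !cartan_ends // /ecart [j == i]eq_sym.
have -> : adj n left_end right_end j i = adj n left_end right_end i j by rewrite /adj orbC.
case: (eqVneq i j) => [_|ij] //.
case: ifP => aij; last by split=> //; split=> //; split.
have k12 k : kap n left_end right_end k = 1%N \/ kap n left_end right_end k = 2%N.
  by rewrite /kap; case: ifP; [right|left].
have l12 k : lam n left_end right_end k = 1%N \/ lam n left_end right_end k = 2%N.
  by rewrite /lam; case: ifP; [right|left].
by case: (k12 i) (k12 j) (l12 i) (l12 j) => -> [] -> [] -> [] ->; split=> //; split=> //; split=> // _ _;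
  split => //; [left|right].
Qed.

End CartanEnds.

(** * Words read through a relabelling of the nodes *)

Section WordBridge.
Variables (R : realType) (g : affine_type) (n : nat) (e0 en : endtype) (w : seq nat) (t : nat -> nat).
Local Notation C := R[i].
Hypothesis nok : rank_ok n e0 en.
Hypothesis sw : size w = wsize n e0 en.
Hypothesis nw : forall j, (j < size w)%N -> nth 0%N w j = t (idx n e0 en j).
Hypothesis cw : forall a b, (a <= n)%N -> (b <= n)%N -> cartan g n (t a) (t b) = ecart n e0 en a b.
Hypothesis tw : forall a b, (a <= n)%N -> (b <= n)%N -> (t a == t b) = (a == b).
Implicit Types x : 'cV[C]_(size w).

(** The value 1 outside the range keeps the sequence nonzero, or positive, at every index, as the
    lemmas on letters require. *)
Definition fnat m (x : 'cV[C]_m) (j : nat) : C := if insub j is Some o then x o ord0 else 1.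

Lemma fnatE m (x : 'cV[C]_m) (j : 'I_m) : fnat x j = x j ord0.
Proof. by rewrite /fnat valK. Qed.

Lemma fnat_gt0 m (x : 'cV[C]_m) : postorus x -> forall j, 0 < fnat x j.
Proof. by move=> Px j; rewrite /fnat; case: insubP => [o _ _|_]. Qed.

Lemma fnat_neq0 m (x : 'cV[C]_m) : torus C m x -> forall j, fnat x j != 0.
Proof. by move=> Px j; rewrite /fnat; case: insubP => [o _ _|_]; rewrite ?oner_neq0. Qed.

Lemma big_ord_iota (T : Type) (z : T) (op : T -> T -> T) k (P : pred nat) (F : nat -> T) :
  \big[op/z]_(j < k | P j) F j = \big[op/z]_(j <- iota 0 k | P j) F j.
Proof. by rewrite -(big_mkord P F) /index_iota subn0. Qed.

Let idx_le j : (j < size w)%N -> (idx n e0 en j <= n)%N.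
Proof. by rewrite sw => /(idx_bounds nok)/andP[]. Qed.

Lemma Pmon_PM i x (l : 'I_(size w)) : (i <= n)%N ->
  Pmon g n (t i) x l = PM n e0 en (fnat x) i l.
Proof.
move=> lein; rewrite /Pmon /PM fnatE; congr (_ * _)^-1.
rewrite -(big_ord_iota _ _ _ predT (fun j => fnat x j ^ ecart n e0 en (idx n e0 en j) i)).
rewrite (big_ord_widen_cond _ predT (fun j => fnat x j ^ ecart n e0 en (idx n e0 en j) i) (ltnW (ltn_ord l))).
by apply: eq_bigr => j _; rewrite fnatE nw // cw // idx_le.
Qed.

Let sum_word i x (P : pred nat) : (i <= n)%N ->
  \sum_(l < size w | (nth 0%N w l == t i) && P l) Pmon g n (t i) x l =
  \sum_(l <- iota 0 (wsize n e0 en) | (idx n e0 en l == i) && P l) PM n e0 en (fnat x) i l.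
Proof.
move=> lein; rewrite -sw -(big_ord_iota _ _ _ (fun l => (idx n e0 en l == i) && P l)).
apply: eq_big => l; first by rewrite nw // tw // idx_le.
by move=> _; apply: Pmon_PM.
Qed.

Lemma eps_parN i x : (i <= n)%N -> eps_par g n (t i) x = epsN n e0 en (fnat x) i.
Proof.
move=> lein; rewrite /eps_par /epsN.
under eq_bigl => l do rewrite -[nth 0%N w l == t i]andbT.
by rewrite (sum_word x predT) //; apply: eq_bigl => l; rewrite andbT.
Qed.

Lemma e_parN i c x j : (i <= n)%N -> e_par g n (t i) c x j ord0 = eN n e0 en i c (fnat x) j.
Proof.
move=> lein; rewrite mxE /eN fnatE; congr (_ * ((_ * _ + _) / (_ * _ + _))).
- exact: (sum_word x (fun l => l <= j)%N).
- exact: (sum_word x (fun l => j < l)%N).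
- exact: (sum_word x (fun l => l < j)%N).
- exact: (sum_word x (fun l => j <= l)%N).
Qed.

Lemma gam_parN i x : (i <= n)%N -> gam_par g n (t i) x = gamN n e0 en (fnat x) i.
Proof.
move=> lein; rewrite /gam_par /gamN -sw.
rewrite -(big_ord_iota _ _ _ predT (fun j => fnat x j ^ ecart n e0 en (idx n e0 en j) i)).
by apply: eq_bigr => j _; rewrite fnatE nw // cw // idx_le.
Qed.

End WordBridge.

Ltac case_ifs_lia := repeat match goal with
  |- context [if ?b then _ else _] =>
    lazymatch b with context [if _ then _ else _] => fail
    | _ => case: (boolP b) => ?; try (exfalso; lia) end
  end.
Ltac subst_eqs := repeat match goal with
  H : is_true (@eq_op _ _ _) |- _ => move/eqP: H => H; try subst
  end.

(** * The vectors v(x) *)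

Section Run.
Variables (n : nat) (e0 en : endtype) (K : numFieldType).
Hypothesis nok : rank_ok n e0 en.
Local Notation okp := (okp n e0 en).
Local Notation wlev := (wlev n e0 en).
Local Notation wsize := (wsize n e0 en).
Local Notation idx := (idx n e0 en).
Local Notation pos1 := (pos1 e0).
Local Notation pos2 := (pos2 n e0 en).
Local Notation mst := (mst n e0 en).
Implicit Types (x : nat -> K) (st : (nat -> K) * (nat -> K)) (G : wlabel -> K).

Definition oklabel (b : wlabel) : bool :=
  match b with V j | Vbar j => (0 < j <= n)%N | V0 => isS en | Phi => isS e0 end.

(* The vector of a state. In a fork, the missing p_0, q_0 (or p_(n-1),        *)
(* q_(n-1)) are the two y's of the fork.                                      *)
Definition vst st (b : wlabel) : K :=
  match b with
  | V j => if okp j.-1 then qst n e0 en st j.-1 else if j == 1%N then st.1 1%N else st.1 n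
  | Vbar j => if okp j.-1 then st.2 j.-1 else if j == 1%N then st.1 0%N else st.1 n.-1
  | V0 => st.1 n
  | Phi => st.1 0%N
  end.

Definition mid i c G (b : wlabel) : K :=
  match b with
  | V j => if j == i then c * G (V i)
           else if j == i.+1 then c^-1 * G (V i.+1) + G (V i) else G b
  | Vbar j => if j == i.+1 then c * G (Vbar i.+1)
              else if j == i then c^-1 * G (Vbar i) + G (Vbar i.+1) else G b
  | _ => G b
  end.

(** In the short case v_0 lies between v_n and v_bar n. The factor 2 / c comes from f_n v_0 = 2
    v_bar n; the coefficient of v_n reaches v_bar n with factor 1, namely c^2 from the torus times
    c^-2 times 2 / 2! from the square of f_n. *)
Definition end_n c G (b : wlabel) : K :=
  match en, b with
  | Short, V j => if j == n then c ^+ 2 * G b else G b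
  | Short, V0 => G V0 + c * G (V n)
  | Short, Vbar j => if j == n then c ^- 2 * G b + 2 * c^-1 * G V0 + G (V n) else G b
  | Long, V j => if j == n then c * G b else G b
  | Long, Vbar j => if j == n then c^-1 * G b + G (V n) else G b
  | Fork, V j => if (j == n) || (j == n.-1) then c * G b else G b
  | Fork, Vbar j => if j == n then c^-1 * G b + G (V n.-1)
                    else if j == n.-1 then c^-1 * G b + G (V n) else G b
  | _, _ => G b
  end.

Definition end_0 c G (b : wlabel) : K :=
  match e0, b with
  | Short, Vbar j => if j == 1%N then c ^+ 2 * G b else G b
  | Short, Phi => G Phi + c * G (Vbar 1)
  | Short, V j => if j == 1%N then c ^- 2 * G b + 2 * c^-1 * G Phi + G (Vbar 1) else G b
  | Long, Vbar j => if j == 1%N then c * G b else G b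
  | Long, V j => if j == 1%N then c^-1 * G b + G (Vbar 1) else G b
  | _, _ => G b
  end.

Variables (d : nat) (lb : 'I_d -> wlabel) (Ymx : nat -> K -> 'M[K]_d).
Definition vcol G : 'cV[K]_d := \col_a G (lb a).
Hypothesis lb_ok : forall a, oklabel (lb a).
Hypothesis Ymid : forall i c G, (0 < i < n)%N -> c != 0 -> Ymx i c *m vcol G = vcol (mid i c G).
Hypothesis Yn : forall c G, c != 0 -> Ymx n c *m vcol G = vcol (end_n c G).
Hypothesis Y0 : forall c G, c != 0 -> ~~ isF e0 -> Ymx 0 c *m vcol G = vcol (end_0 c G).

Lemma eq_vcol G G' : (forall b, oklabel b -> G b = G' b) -> vcol G = vcol G'.
Proof. by move=> H; apply/matrixP => a j; rewrite !mxE H. Qed.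

Variable x : nat -> K.
Hypothesis x0 : forall j, x j != 0.
Local Notation st := (mst x).

Definition run (t : nat) : 'cV[K]_d :=
  foldr (fun j v => Ymx (idx j) (x j) *m v) (vcol (fun b => (b == V 1)%:R)) (iota t (wsize - t)).

Lemma run_step t : (t < wsize)%N -> run t = Ymx (idx t) (x t) *m run t.+1.
Proof. by move=> tk; rewrite /run -(subnSK tk). Qed.

(** The vector after the final letters i, ..., 1 of the second pass. *)
Let Hrun i b : K :=
  if b is V j then
    if (0 < j <= i)%N then x (pos2 j) else if j == i.+1 then 1 else 0
  else 0.

(** The vector when all letters from the first i onwards have been applied: coefficients with index
    above i are final, and those with index below i are still those of the second pass. *)
Let Jrun i b : K :=
  match b with
  | V j => if (j < i)%N then x (pos2 j) else if j == i then wlev st.1 i else vst st b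
  | Vbar j => if (j < i)%N then 0 else if j == i then 1 else vst st b
  | V0 => st.1 n
  | Phi => 0
  end.

Lemma run_tail i : (i + isF en < n)%N -> run (wsize - i) = vcol (Hrun i).
Proof.
elim: i => [|i IH] lin.
  rewrite /run subn0 subnn; apply: eq_vcol => -[j|j||] //= _.
  rewrite (_ : (V j == V 1) = (j == 1%N)) // (_ : (0 < j <= 0)%N = false); last by lia.
  by case: eqP.
have k1 : (i.+1 <= wsize)%N by move: nok lin; rewrite /rank_ok /wsize; lia.
have k0 : (wsize - i.+1 < wsize)%N by lia.
rewrite run_step // (_ : (wsize - i.+1).+1 = (wsize - i)%N); last by lia.
rewrite IH; last by lia.
have ii : idx (wsize - i.+1) = i.+1.
  by move: nok lin; rewrite /rank_ok /idx /wsize; case: ifP; lia.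
rewrite ii Ymid //; last by lia.
apply: eq_vcol => -[j|j||] //= jn; last by case_ifs; rewrite ?mulr0 ?addr0.
case_ifs_lia; subst_eqs; rewrite ?(mulr0, add0r, mulr1) //; exfalso; lia.
Qed.

Let y1 l : (isF e0 <= l <= n)%N -> ~~ ((0 < l)%N && okp l) -> st.1 l = x (pos1 l).
Proof. exact: mst_y1. Qed.

Let wn : ~~ isF en -> wlev st.1 n = st.1 n ^+ kap n e0 en n.
Proof.
move=> nF; rewrite /wlev prod_lev //; last by move: nok; rewrite /rank_ok /oklev; lia.
rewrite /nodes; case: ifP => [/andP[F0 /eqP n1]|_]; first by move: nok; rewrite /rank_ok; lia.
by rewrite (negbTE nF) /= big_cons big_nil mulr1.
Qed.

(** The turning point of the word, where the shape of the end n matters: the letter n, and for a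
    fork also n - 1, is applied to the vector of the second pass. *)
Lemma run_middle : run (pos1 (n - isF en)) = vcol (Jrun (n - isF en)).
Proof.
have nk := nok; rewrite /rank_ok in nk.
have T := run_tail (i := n.-1 - isF en); have {}T := T _.
have wk : (wsize - (n.-1 - isF en) = (pos1 n).+1)%N by rewrite /wsize /pos1; lia.
rewrite wk in T.
have pk : (pos1 n < wsize)%N by rewrite /pos1 /wsize; lia.
have ip : idx (pos1 n) = n by rewrite /idx /pos1; case: ifP; lia.
have yn : st.1 n = x (pos1 n) by apply: y1; [lia|rewrite /okp; lia].
have R1 : run (pos1 n) = vcol (end_n (x (pos1 n)) (Hrun (n.-1 - isF en))).
  by rewrite run_step // ip T ?Yn //; lia.
have wn' := wn.
have [E|[E|E]] : en = Fork \/ en = Short \/ en = Long by case: (en); auto.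
- have iF : isF en = true by rewrite E.
  have iS : isS en = false by rewrite E.
  rewrite iF !subn1 in T R1 *.
  have pp : (pos1 n.-1).+1 = pos1 n by rewrite /pos1; lia.
  have pk' : (pos1 n.-1 < wsize)%N by rewrite /pos1 /wsize; lia.
  have ip' : idx (pos1 n.-1) = n.-1 by rewrite /idx /pos1; case: ifP; lia.
  rewrite run_step // ip' pp R1 Ymid //; last by lia.
  have yn1 : st.1 n.-1 = x (pos1 n.-1) by apply: y1; [lia|rewrite /okp iF; lia].
  have wn1 : wlev st.1 n.-1 = x (pos1 n.-1) * x (pos1 n).
    rewrite /wlev prod_lev //; last by rewrite /oklev iF; lia.
    rewrite /nodes iF eqxx andTb; case: ifP => [/andP[F0 /eqP n1]|_]; first by lia.
    rewrite !big_cons big_nil mulr1 yn1 yn /kap iS; case_ifs_lia.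
    by rewrite !expr1.
  have ENV c G j : end_n c G (V j) = if (j == n) || (j == n.-1) then c * G (V j) else G (V j).
    by rewrite /end_n E.
  have ENB c G j : end_n c G (Vbar j) = if j == n then c^-1 * G (Vbar j) + G (V n.-1)
      else if j == n.-1 then c^-1 * G (Vbar j) + G (V n) else G (Vbar j).
    by rewrite /end_n E.
  apply: eq_vcol => -[j|j||]; rewrite /oklabel ?iS //; last first.
  + by rewrite /mid /end_n E.
  + move=> jn; rewrite /mid !ENB /Hrun /Jrun /vst /okp iF yn1;
    case_ifs_lia; subst_eqs;
    by rewrite ?(mulr0, add0r, mulr1).
  + move=> jn; rewrite /mid !ENV /Hrun /Jrun /vst /okp iF;
    case_ifs_lia; subst_eqs;
    by rewrite ?(mulr0, add0r, mulr1) ?wn1 ?yn.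
- have iF : isF en = false by rewrite E.
  have iS : isS en = true by rewrite E.
  rewrite iF !subn0 in T R1 wn' *; rewrite R1.
  have kn : kap n e0 en n = 2%N by rewrite /kap iS eqxx orbT.
  rewrite kn yn in wn'; have {}wn' := wn' isT.
  have EN c G b : end_n c G b = match b with
      | V j => if j == n then c ^+ 2 * G b else G b
      | V0 => G V0 + c * G (V n)
      | Vbar j => if j == n then c ^- 2 * G b + 2 * c^-1 * G V0 + G (V n) else G b
      | _ => G b end by rewrite /end_n E.
  apply: eq_vcol => -[j|j||]; rewrite /oklabel ?iS => jn; rewrite EN /Hrun /Jrun /vst /okp ?iF //;
    case_ifs_lia; subst_eqs;
    by rewrite ?(mulr0, add0r, mulr1) ?wn' ?yn.
- have iF : isF en = false by rewrite E.
  have iS : isS en = false by rewrite E.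
  rewrite iF !subn0 in T R1 wn' *; rewrite R1.
  have kn : kap n e0 en n = 1%N by rewrite /kap iS andbF orbF; case: ifP => //; lia.
  rewrite kn yn expr1 in wn'; have {}wn' := wn' isT.
  have EN c G b : end_n c G b = match b with
      | V j => if j == n then c * G b else G b
      | Vbar j => if j == n then c^-1 * G b + G (V n) else G b
      | _ => G b end by rewrite /end_n E.
  apply: eq_vcol => -[j|j||]; rewrite /oklabel ?iS // => jn; rewrite EN /Hrun /Jrun /vst /okp ?iF //;
    case_ifs_lia; subst_eqs;
    by rewrite ?(mulr0, add0r, mulr1) ?wn' ?yn.
Qed.

(** Let x be the first letter i. It adds w_(i+1) / x to the second letter i, and w_i is the product
    of both letters, so the coefficient of v_(i+1) becomes (w_i + w_(i+1)) / x. As x = p_i, this is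
    q_i. *)
Lemma run_head i : (0 < i)%N -> (i + isF en <= n)%N -> run (pos1 i) = vcol (Jrun i).
Proof.
move=> i0 lin; have [m Em] : exists m, (n - isF en - i)%N = m by eexists.
elim: m i i0 lin Em => [|m IH] i i0 lin Em.
  have -> : i = (n - isF en)%N by lia.
  exact: run_middle.
have oki : okp i by rewrite /okp; lia.
have [ii pk] := idx_pos1 nok oki.
have p1 : (pos1 i).+1 = pos1 i.+1 by move: oki; rewrite /okp /pos1; lia.
rewrite run_step // ii p1 IH; [|lia|lia|lia]; rewrite Ymid //; last by lia.
have a0 := x0 (pos1 i).
have Ew := wlev_mst_okp nok x i0 oki.
have Ep : st.2 i = x (pos1 i) by rewrite /= oki kap_okp // expr1.
apply: eq_vcol => -[j|j||] // jn; rewrite /mid /Jrun.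
- case: (eqVneq j i) => [->|ji]; first by case_ifs_lia; rewrite Ew.
  case: (eqVneq j i.+1) => [->|ji1]; last by case_ifs_lia.
  by rewrite /vst [i.+1.-1]/= oki /qst Ep /blev Ew; case_ifs_lia; field.
- case: (eqVneq j i.+1) => [->|ji1].
    by rewrite /vst [i.+1.-1]/= oki Ep; case_ifs_lia; rewrite mulr1.
  case: (eqVneq j i) => [->|ji]; last by case_ifs_lia.
  by case_ifs_lia; rewrite mulr0 add0r.
Qed.

Theorem run_vst : run 0 = vcol (vst st).
Proof.
have nk := nok; rewrite /rank_ok in nk.
have H1 : run (pos1 1) = vcol (Jrun 1) by apply: run_head => //; lia.
have w1 : (1 + isF en < n)%N by lia.
(* With a fork at 0 the word starts with the letter 1 and the vector is complete: the coefficients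
   of v_1 and v_bar1 are y_1 and 1 = y_0. Otherwise Y_0 is still to be applied. *)
case: (boolP (isF e0)) => F0.
  rewrite (_ : pos1 1 = 0%N) in H1; last by rewrite /pos1 F0.
  rewrite H1; apply: eq_vcol => -[j|j||] //; rewrite /oklabel => jn; rewrite /Jrun.
  - rewrite (_ : (j < 1)%N = false); last by lia.
    have ok1 : okp 1 by rewrite /okp; lia.
    case: (eqVneq j 1%N) => [->|//]; rewrite /vst (_ : okp 1.-1 = false) ?eqxx; last by rewrite /okp F0.
    by rewrite wlev_mst_okp // mst_y2.
  - rewrite (_ : (j < 1)%N = false); last by lia.
    case: (eqVneq j 1%N) => [->|//]; rewrite /vst (_ : okp 1.-1 = false) ?eqxx; last by rewrite /okp F0.
    by have := mst_gauge nok x; rewrite /gauge F0 => ->.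
  - by move: F0 jn; case: (e0).
have ok0 := ok0 nok F0.
have [i0 pk] := idx_pos1 nok ok0.
have p0 : pos1 0 = 0%N by [].
have p1 : pos1 1 = 1%N by rewrite /pos1 (negbTE F0).
have y0 : st.1 0%N = x 0%N by rewrite y1 // (negbTE F0).
rewrite p0 in i0 pk; rewrite p1 in H1.
rewrite run_step // i0 H1 Y0 //.
have Ep : st.2 0%N = x 0%N ^+ kap n e0 en 0 by rewrite /= ok0.
have Ew : wlev st.1 0 = x 0%N ^+ kap n e0 en 0.
  rewrite /wlev prod_lev //; last by rewrite /oklev; lia.
  by rewrite /nodes (negbTE F0) andFb (_ : (0%N == n.-1) = false) ?andbF ?big_cons ?big_nil ?y0 ?mulr1 //; lia.
have a0 := x0 0%N.
have kE : kap n e0 en 0 = if isS e0 then 2%N else 1%N.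
  by rewrite /kap /=; case: (isS e0) => //=; rewrite (_ : (0%N == n) = false) //; lia.
have vV : vst st (V 1) = (wlev st.1 0 + wlev st.1 1) / st.2 0%N by rewrite /vst [1.-1]/= ok0.
have vB : vst st (Vbar 1) = st.2 0%N by rewrite /vst [1.-1]/= ok0.
move: kE; have [E|E] : e0 = Short \/ e0 = Long by move: F0; case: (e0); auto.
- have iS : isS e0 = true by rewrite E.
  rewrite iS => kE; rewrite kE in Ep Ew.
  have EN c G b : end_0 c G b = match b with
      | Vbar j => if j == 1%N then c ^+ 2 * G b else G b
      | Phi => G Phi + c * G (Vbar 1)
      | V j => if j == 1%N then c ^- 2 * G b + 2 * c^-1 * G Phi + G (Vbar 1) else G b
      | _ => G b end by rewrite /end_0 E.
  apply: eq_vcol => -[j|j||]; rewrite /oklabel ?iS => jn; rewrite EN /Jrun ?ltnn ?eqxx //.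
  + case: (eqVneq j 1%N) => [->|j1]; last by case_ifs_lia.
    by rewrite ltnn vV Ep Ew; field.
  + case: (eqVneq j 1%N) => [->|j1]; last by case_ifs_lia.
    by rewrite ltnn vB Ep mulr1.
  + by rewrite add0r mulr1 /vst y0.
- have iS : isS e0 = false by rewrite E.
  rewrite iS => kE; rewrite kE expr1 in Ep Ew.
  have EN c G b : end_0 c G b = match b with
      | Vbar j => if j == 1%N then c * G b else G b
      | V j => if j == 1%N then c^-1 * G b + G (Vbar 1) else G b
      | _ => G b end by rewrite /end_0 E.
  apply: eq_vcol => -[j|j||]; rewrite /oklabel ?iS // => jn; rewrite EN /Jrun ?ltnn ?eqxx //.
  + case: (eqVneq j 1%N) => [->|j1]; last by case_ifs_lia.
    by rewrite ltnn vV Ep Ew; field.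
  + case: (eqVneq j 1%N) => [->|j1]; last by case_ifs_lia.
    by rewrite ltnn vB Ep mulr1.
Qed.

End Run.

(** [exp_nilp] sums as many terms as the size of the matrix, so [2 < d] is what puts the square
    among them. *)
Lemma exp_nilp3 (R : realType) d (M : 'M[R[i]]_d) (v : 'cV[R[i]]_d) : (2 < d)%N ->
  M *m (M *m (M *m v)) = 0 ->
  exp_nilp M *m v = v + M *m v + 2^-1 *: (M *m (M *m v)).
Proof.
move=> d2 M3.
have M3k k : (2 < k)%N -> M ^+ k *m v = 0.
  by move=> k2; rewrite -(subnK k2) exprD 2!exprSr expr1 -!mulmxE -!mulmxA M3 mulmx0.
have -> : exp_nilp M = \sum_(0 <= k < d) (k`!%:R)^-1 *: M ^+ k by rewrite big_mkord.
have d1 : (1 < d)%N by lia.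
have d0 : (0 < d)%N by lia.
have tail : \sum_(3 <= k < d) (k`!%:R)^-1 *: M ^+ k *m v = 0.
  by rewrite big_nat big1 // => k /andP[k2 _]; rewrite -scalemxAl M3k // scaler0.
have t0 : (0`!%:R)^-1 *: M ^+ 0 *m v = v.
  by rewrite expr0 fact0 invr1 scale1r; exact: mul1mx.
have t1 : (1`!%:R)^-1 *: M ^+ 1 *m v = M *m v.
  by rewrite expr1 factS fact0 muln1 invr1 scale1r.
have t2 : (2`!%:R)^-1 *: M ^+ 2 *m v = 2^-1 *: (M *m (M *m v)).
  have -> : 2`! = 2%N by [].
  apply: etrans (esym (scalemxAl _ _ _)) _; congr (_ *: _).
  exact: (esym (mulmxA M M v)).
rewrite mulmx_suml.
rewrite (big_ltn d0).
rewrite (big_ltn d1).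
rewrite (big_ltn d2).
rewrite addrA.
apply: (congr2 +%R (congr2 +%R t0 t1)).
apply: etrans (congr2 +%R t2 tail) _.
by rewrite addr0.
Qed.

(** * The action of f_i and Y_i on coefficients *)

Section ModuleTables.
Variables (R : realType) (g : affine_type) (n : nat).
Hypothesis hn : (min_rank g <= n)%N.
Local Notation C := R[i].
Local Notation e0 := (left_end g).
Local Notation en := (right_end g).
Implicit Types (G : wlabel -> C).

Lemma wlabel_eqE :
  ((forall i j, (V i == V j) = (i == j)) *
   (forall i j, (V i == Vbar j) = false) *
   (forall i, (V i == V0) = false) *
   (forall i, (V i == Phi) = false) *
   (forall i j, (Vbar i == V j) = false) *
   (forall i j, (Vbar i == Vbar j) = (i == j)) *
   (forall i, (Vbar i == V0) = false) *
   (forall i, (Vbar i == Phi) = false) *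
   (forall j, (V0 == V j) = false) *
   (forall j, (V0 == Vbar j) = false) *
   ((V0 == V0) = true) *
   ((V0 == Phi) = false) *
   (forall j, (Phi == V j) = false) *
   (forall j, (Phi == Vbar j) = false) *
   ((Phi == V0) = false) *
   ((Phi == Phi) = true))%type.
Proof. by []. Qed.
Lemma mem_V j s : (V j \in [seq V k | k <- s]) = (j \in s).
Proof. by rewrite mem_map // => a b []. Qed.
Lemma mem_Vbar j s : (Vbar j \in [seq Vbar k | k <- s]) = (j \in s).
Proof. by rewrite mem_map // => a b []. Qed.
Lemma notin_V b s : (if b is V _ then false else true) -> (b \in [seq V k | k <- s]) = false.
Proof. by move=> nb; apply/mapP => -[k _ E]; rewrite E in nb. Qed.
Lemma notin_Vbar b s : (if b is Vbar _ then false else true) ->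
  (b \in [seq Vbar k | k <- s]) = false.
Proof. by move=> nb; apply/mapP => -[k _ E]; rewrite E in nb. Qed.

Lemma mem_basis b : g <> tyA1 -> (b \in Defs.basis g n) = oklabel n e0 en b.
Proof.
move=> gA; rewrite /Defs.basis /oklabel /left_end /right_end.
case: (g) gA => // _; case: b => [j|j||]; rewrite ?mem_cat ?mem_V ?mem_Vbar ?notin_V ?notin_Vbar //;
  rewrite ?inE ?in_nil ?wlabel_eqE ?mem_rev ?mem_iota; lia.
Qed.

Lemma mem_basisA b : g = tyA1 -> (b \in Defs.basis g n) = if b is V j then (0 < j <= n.+1)%N else false.
Proof.
by move=> ->; rewrite /Defs.basis; case: b => [j|j||]; rewrite ?mem_V ?notin_V // mem_iota; lia.
Qed.

Lemma uniq_basis : uniq (Defs.basis g n).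
Proof.
have uV s : uniq s -> uniq [seq V k | k <- s] by move=> us; rewrite map_inj_uniq // => a b [].
have uB s : uniq s -> uniq [seq Vbar k | k <- s] by move=> us; rewrite map_inj_uniq // => a b [].
have dis s s' : has (mem [seq V k | k <- s]) [seq Vbar k | k <- s'] = false.
  by apply/hasP => -[_ /mapP[k _ ->]] /=; rewrite notin_V.
have dis' s s' : all (fun b => if b is Vbar _ then false else true) s ->
    has (mem s) [seq Vbar k | k <- s'] = false.
  by move=> /allP al; apply/hasP => -[_ /mapP[k _ ->]] /= /al.
rewrite /Defs.basis; case: (g); rewrite ?cat_uniq ?has_cat ?uV ?uB ?rev_uniq ?iota_uniq //=;
  by rewrite ?dis ?dis' ?notin_V ?notin_Vbar ?inE.
Qed.

Lemma dimW_gt2 : (2 < dimW g n)%N.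
Proof.
move: hn; rewrite /dimW /Defs.basis; case: (g) => /= H;
  rewrite ?size_cat ?size_map ?size_rev ?size_iota //=; lia.
Qed.

Lemma lab_mem (a : 'I_(dimW g n)) : lab a \in Defs.basis g n.
Proof. by rewrite mem_nth. Qed.

Definition gcol G : 'cV[C]_(dimW g n) := vcol (lab (n := n)) G.

Lemma eq_gcol G G' : (forall b, b \in Defs.basis g n -> G b = G' b) -> gcol G = gcol G'.
Proof. by move=> H; apply/matrixP => a j; rewrite !mxE H // lab_mem. Qed.

Definition fop i G b : C :=
  \sum_(t <- arrows g n | (t.1.1.1 == i) && (t.2 == b)) t.1.2%:R * G t.1.1.2.

(** An arrow starting outside the basis would count in [fop] but not in the matrix product; there is
    none. *)
Lemma arrows_src t : t \in arrows g n -> t.1.1.2 \in Defs.basis g n.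
Proof.
have sm (P : pred wlabel) (s1 : seq nat) (f : nat -> nat * wlabel * nat * wlabel) :
  (forall k, k \in s1 -> P (f k).1.1.2) -> forall t, t \in map f s1 -> P t.1.1.2.
  by move=> H _ /mapP[k ks ->]; apply: H.
have com (P : pred wlabel) : (forall k, (0 < k < n)%N -> P (V k) /\ P (Vbar k.+1)) ->
   forall t, t \in [seq (i, V i, 1%N, V i.+1) | i <- iota 1 n.-1] ++
    [seq (i, Vbar i.+1, 1%N, Vbar i) | i <- iota 1 n.-1] -> P t.1.1.2.
  move=> H t0; rewrite mem_cat => /orP[]; apply: sm => k; rewrite mem_iota => kn;
    by have [h1 h2] : P (V k) /\ P (Vbar k.+1) by apply: H; lia.
have [gA|gA] : g = tyA1 \/ g <> tyA1 by case: (g); auto; right.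
  rewrite mem_basisA // gA /arrows mem_cat => /orP[|]; last by rewrite inE => /eqP -> /=.
  apply: (sm (fun b => if b is V j then (0 < j <= n.+1)%N else false)) => k /=.
  rewrite mem_iota; lia.
rewrite mem_basis //; have n2 : (2 <= n)%N by move: hn gA; case: (g) => //=; lia.
have comok : forall t, t \in [seq (i, V i, 1%N, V i.+1) | i <- iota 1 n.-1] ++
    [seq (i, Vbar i.+1, 1%N, Vbar i) | i <- iota 1 n.-1] -> oklabel n e0 en t.1.1.2.
  by apply: com => k kn /=; lia.
move: comok gA; rewrite /arrows /left_end /right_end.
by case: (g) => // comok _; rewrite mem_cat => /orP[/comok //|]; rewrite ?mem_cat !inE => Ht;
  do ?[case/orP: Ht => Ht]; move/eqP: Ht => -> //=; lia.
Qed.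

Lemma f_gcol i G : f_mx R g n i *m gcol G = gcol (fop i G).
Proof.
apply/matrixP => a j; rewrite !mxE.
under eq_bigr => b _ do rewrite !mxE mulr_suml.
have sw (F : 'I_(dimW g n) -> nat * wlabel * nat * wlabel -> C) :
    \sum_(b < dimW g n) \sum_(t <- arrows g n | (t.1.1.1 == i) && (t.1.1.2 == lab b) && (t.2 == lab a)) F b t =
    \sum_(t <- arrows g n | (t.1.1.1 == i) && (t.2 == lab a)) \sum_(b < dimW g n | t.1.1.2 == lab b) F b t.
  rewrite (exchange_big_dep (fun t => (t.1.1.1 == i) && (t.2 == lab a))) /=; last first.
    by move=> b t _ /andP[/andP[-> _] ->].
  by apply: eq_bigr => t /andP[-> ->]; apply: eq_bigl => b; rewrite andbT.
rewrite sw big_seq_cond [RHS]big_seq_cond; apply: eq_bigr => t /andP[tin _].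
have /(nthP V0)[k kn Ek] := arrows_src tin.
rewrite (bigD1 (Ordinal kn)) /=; last by rewrite /lab /= Ek.
rewrite {1}/lab /= Ek big1 ?addr0 // => b /andP[/eqP Eb nb].
case/negP: nb; apply/eqP/val_inj => /=; apply/eqP.
by rewrite -(nth_uniq V0 _ kn uniq_basis) ?Ek ?Eb.
Qed.

Definition wop i c G b : C := c ^ wt g n b i * G b.

Lemma coroot_gcol i c G : coroot_mx g n i c *m gcol G = gcol (wop i c G).
Proof. by apply/matrixP => a j; rewrite mul_diag_mx !mxE. Qed.

(** The hypothesis is that f_i^3 vanishes on the vector, which is the case in every type, so the
    exponential stops at the square. *)
Lemma Y_gcol i c G :
    (forall b, b \in Defs.basis g n -> fop i (fop i (fop i (wop i c G))) b = 0) ->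
  Y g n i c *m gcol G = gcol (fun b => wop i c G b + c^-1 * fop i (wop i c G) b +
     2^-1 * (c^-1 * (c^-1 * fop i (fop i (wop i c G)) b))).
Proof.
move=> H3; rewrite /Y -mulmxA coroot_gcol; set H := wop i c G in H3 *.
have ZG k G' : (k *: f_mx R g n i) *m gcol G' = k *: gcol (fop i G').
  by rewrite -scalemxAl f_gcol.
have GZ k G' : k *: gcol G' = gcol (fun b => k * G' b).
  by apply/matrixP => a j; rewrite !mxE.
have fZ k G' b : fop i (fun b => k * G' b) b = k * fop i G' b.
  by rewrite /fop mulr_sumr; apply: eq_bigr => t _; rewrite mulrCA.
have fZ' k G' : fop i (fun b => k * G' b) = fun b => k * fop i G' b.
  by apply: boolp.funext => b; apply: fZ.
rewrite exp_nilp3 ?dimW_gt2 //; last first.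
  rewrite !(ZG, GZ, fZ'); apply/matrixP => a j; rewrite !mxE H3 ?lab_mem //.
  by rewrite !mulr0.
rewrite !(ZG, GZ, fZ'); apply/matrixP => a j; rewrite !mxE; ring.
Qed.

Lemma sum_iota1 (F : nat -> C) (P : pred nat) a m i :
  \sum_(k <- iota a m | (k == i) && P k) F k = if (a <= i < a + m)%N && P i then F i else 0.
Proof.
rewrite big_mkcondr /=; have [im|im] := boolP (a <= i < a + m)%N.
  by rewrite -big_filter filter_pred1_uniq ?iota_uniq ?mem_iota // big_seq1.
by rewrite big_seq_cond big1 // => k /andP[]; rewrite mem_iota => + /eqP ki; rewrite ki (negbTE im).
Qed.

Hypothesis gA : g <> tyA1.

Lemma fop_mid i G b : (0 < i < n)%N -> fop i G b =
  match b with V j => if j == i.+1 then G (V i) else 0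
             | Vbar j => if j == i then G (Vbar i.+1) else 0 | _ => 0 end.
Proof.
move=> iin; have i0 : (0 == i)%N = false by lia. have ni : (n == i) = false by lia.
have ii : (1 <= i < 1 + n.-1)%N by lia.
have com : \sum_(t <- [seq (i, V i, 1%N, V i.+1) | i <- iota 1 n.-1] ++
    [seq (i, Vbar i.+1, 1%N, Vbar i) | i <- iota 1 n.-1] | (t.1.1.1 == i) && (t.2 == b))
    t.1.2%:R * G t.1.1.2 =
  match b with V j => if j == i.+1 then G (V i) else 0
             | Vbar j => if j == i then G (Vbar i.+1) else 0 | _ => 0 end.
  rewrite big_cat !big_map /= (sum_iota1 (fun k => 1 * G (V k)) (fun k => V k.+1 == b)).
  rewrite (sum_iota1 (fun k => 1 * G (Vbar k.+1)) (fun k => Vbar k == b)) ii !andTb !mul1r.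
  by case: b => [j|j||]; rewrite ?wlabel_eqE ?addr0 ?add0r ?[_ == j]eq_sym.
rewrite /fop /arrows; case: (g) gA => // _; rewrite -?catA ?big_cat /= ?big_cons ?big_nil /= ?i0 ?ni /=;
  by rewrite -?com ?big_cat ?addr0.
Qed.

Lemma fop_n G b : fop n G b =
  match en, b with
  | Short, V0 => G (V n)
  | Short, Vbar j => if j == n then 2 * G V0 else 0
  | Long, Vbar j => if j == n then G (V n) else 0
  | Fork, Vbar j => if j == n then G (V n.-1) else if j == n.-1 then G (V n) else 0
  | _, _ => 0
  end.
Proof.
have n2 : (2 <= n)%N by move: hn gA; case: (g) => //=; lia.
have i0 : (0 == n)%N = false by lia.
have ii : (1 <= n < 1 + n.-1)%N = false by lia.
have com : \sum_(t <- [seq (i, V i, 1%N, V i.+1) | i <- iota 1 n.-1] ++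
    [seq (i, Vbar i.+1, 1%N, Vbar i) | i <- iota 1 n.-1] | (t.1.1.1 == n) && (t.2 == b))
    t.1.2%:R * G t.1.1.2 = 0.
  rewrite big_cat !big_map /= (sum_iota1 (fun k => 1 * G (V k)) (fun k => V k.+1 == b)).
  by rewrite (sum_iota1 (fun k => 1 * G (Vbar k.+1)) (fun k => Vbar k == b)) ii addr0.
move: com; rewrite big_cat /= => com.
rewrite /fop /arrows /right_end; case: (g) gA => // _;
  rewrite -?catA ?big_cat /= ?big_cons ?big_nil /= addrA com ?i0 ?eqxx /=.
all: case: b {com} => [j|j||]; rewrite ?wlabel_eqE ?[_ == j]eq_sym.
all: rewrite ?addr0 ?add0r ?mul1r //; case_ifs; subst_eqs; rewrite ?addr0 ?add0r ?mul1r //; exfalso; lia.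
Qed.

Lemma fop_0 G b : ~~ isF e0 -> fop 0 G b =
  match e0, b with
  | Short, Phi => G (Vbar 1)
  | Short, V j => if j == 1%N then 2 * G Phi else 0
  | Long, V j => if j == 1%N then G (Vbar 1) else 0
  | _, _ => 0
  end.
Proof.
have n2 : (2 <= n)%N by move: hn gA; case: (g) => //=; lia.
have i0 : (n == 0)%N = false by lia.
have com : \sum_(t <- [seq (i, V i, 1%N, V i.+1) | i <- iota 1 n.-1] ++
    [seq (i, Vbar i.+1, 1%N, Vbar i) | i <- iota 1 n.-1] | (t.1.1.1 == 0) && (t.2 == b))
    t.1.2%:R * G t.1.1.2 = 0.
  rewrite big_cat !big_map /= (sum_iota1 (fun k => 1 * G (V k)) (fun k => V k.+1 == b)).
  by rewrite (sum_iota1 (fun k => 1 * G (Vbar k.+1)) (fun k => Vbar k == b)) addr0.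
move: com; rewrite big_cat /= => com.
rewrite /fop /arrows /left_end; case: (g) gA => // _ nF;
  rewrite -?catA ?big_cat /= ?big_cons ?big_nil /= addrA com ?i0 ?eqxx /=.
all: case: b {com} => [j|j||]; rewrite ?wlabel_eqE ?[_ == j]eq_sym.
all: rewrite ?addr0 ?add0r ?mul1r //; case_ifs; subst_eqs; rewrite ?addr0 ?add0r ?mul1r //; exfalso; lia.
Qed.

End ModuleTables.

Section ModuleSteps.
Variables (R : realType) (g : affine_type) (n : nat).
Hypothesis hn : (min_rank g <= n)%N.
Hypothesis gA : g <> tyA1.
Local Notation C := R[i].
Local Notation e0 := (left_end g).
Local Notation en := (right_end g).
Implicit Types (G : wlabel -> C) (c : C).

Lemma n_ge2 : (2 <= n)%N.
Proof. by move: hn gA; case: (g) => //=; lia. Qed.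

Lemma wt_mid i j : (0 < i < n)%N -> (0 < j <= n)%N ->
  wt g n (V j) i = if j == i then 1 else if j == i.+1 then -1 else 0.
Proof.
move=> iin jn; rewrite /= /wtV /Lam; move: hn gA.
case: (g) => //= hn' _; case_ifs; lia.
Qed.

Lemma wt_n j : (0 < j <= n)%N -> wt g n (V j) n =
  match en with Short => if j == n then 2 else 0 | Long => if j == n then 1 else 0
              | Fork => if (j == n) || (j == n.-1) then 1 else 0 end.
Proof.
move=> jn; rewrite /= /wtV /Lam /right_end; move: hn gA.
case: (g) => //= hn' _; case_ifs; lia.
Qed.

Lemma wt_0 j : (0 < j <= n)%N -> ~~ isF e0 -> wt g n (V j) 0 =
  match e0 with Short => if j == 1%N then -2%:Z else 0 | _ => if j == 1%N then -1 else 0 end.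
Proof.
move=> jn; rewrite /= /wtV /Lam /left_end; move: hn gA.
case: (g) => //= hn' _ _; case_ifs; lia.
Qed.

Let expN1 c : c ^ (-1) = c^-1. Proof. exact: exprN1. Qed.
Let expN2 c : c ^ (- 2%:Z) = c ^- 2. Proof. by []. Qed.
Let exp2 c : c ^ 2 = c ^+ 2. Proof. by []. Qed.

Lemma Y_mid i c G : (0 < i < n)%N -> c != 0 ->
  Y g n i c *m gcol g n G = gcol g n (mid i c G).
Proof.
move=> iin c0; have F H b := fop_mid hn gA H b iin.
have F2 H b : fop g n i (fop g n i H) b = 0.
  by rewrite F; case: b => [j|j||] //; case: ifP => // _; rewrite F ?(ltn_eqF (ltnSn i)) ?(gtn_eqF (ltnSn i)).
rewrite Y_gcol //.
apply: eq_gcol => b; rewrite mem_basis // => bok; rewrite F2 !mulr0 addr0 F /wop /mid.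
have Wi : wt g n (V i) i = 1 by rewrite wt_mid ?eqxx //; lia.
have Wi1 : wt g n (V i.+1) i = -1 by rewrite wt_mid ?(gtn_eqF (ltnSn i)) ?eqxx //; lia.
have WB k : wt g n (Vbar k) i = - wt g n (V k) i by [].
case: b bok => [j|j||] jn; last 2 first.
- by rewrite mulr0 addr0 /= expr0z mul1r.
- by rewrite mulr0 addr0 /= expr0z mul1r.
- case: (eqVneq j i) => [->|ji].
    by rewrite (ltn_eqF (ltnSn i)) mulr0 addr0 Wi expr1z.
  case: (eqVneq j i.+1) => [->|ji1]; first by rewrite Wi1 Wi expr1z expN1 mulKf.
  by rewrite mulr0 addr0 wt_mid // (negbTE ji) (negbTE ji1) expr0z mul1r.
- rewrite !WB; case: (eqVneq j i.+1) => [->|ji1].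
    by rewrite (gtn_eqF (ltnSn i)) mulr0 addr0 Wi1 opprK expr1z.
  case: (eqVneq j i) => [->|ji]; first by rewrite Wi Wi1 opprK expr1z expN1 mulKf.
  by rewrite mulr0 addr0 wt_mid // (negbTE ji) (negbTE ji1) oppr0 expr0z mul1r.
Qed.

Lemma Y_n c G : c != 0 -> Y g n n c *m gcol g n G = gcol g n (end_n n en c G).
Proof.
move=> c0; have n2 := n_ge2; have F H b := fop_n hn gA H b.
have W k := wt_n (j := k).
have WB k : wt g n (Vbar k) n = - wt g n (V k) n by [].
have F3 H b : fop g n n (fop g n n (fop g n n H)) b = 0.
  rewrite F; case: (en) (F) => F'; case: b => [j|j||] //; rewrite ?F' ?mulr0 ?if_same //.
rewrite Y_gcol //; apply: eq_gcol => b; rewrite mem_basis // => bok.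
have nn1 : (n == n.-1) = false by lia.
have [E|[E|E]] : en = Fork \/ en = Short \/ en = Long by case: (en); auto.
- have {}F H b' : fop g n n H b' = if b' is Vbar j then if j == n then H (V n.-1) else
      if j == n.-1 then H (V n) else 0 else 0 by rewrite F E.
  have EN b' : end_n n en c G b' = match b' with
      | V j => if (j == n) || (j == n.-1) then c * G b' else G b'
      | Vbar j => if j == n then c^-1 * G b' + G (V n.-1)
                  else if j == n.-1 then c^-1 * G b' + G (V n) else G b'
      | _ => G b' end by rewrite /end_n E; case: b'.
  have W' k : (0 < k <= n)%N -> wt g n (V k) n = if (k == n) || (k == n.-1) then 1 else 0.
    by move=> kn; rewrite W // E.
  have Wn : wt g n (V n) n = 1 by rewrite W' ?eqxx //; lia.
  have Wn1 : wt g n (V n.-1) n = 1 by rewrite W' ?eqxx ?orbT //; lia.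
  rewrite EN !F; case: b bok => [j|j||] jn; rewrite ?mulr0 ?addr0 /wop.
  + by rewrite W' //; case: ifP => _; rewrite ?expr1z ?expr0z ?mul1r.
  + rewrite ?F ?if_same ?mulr0 ?addr0 WB W' // Wn Wn1 expr1z; case: (eqVneq j n) => [_|_] /=.
      by rewrite expN1 mulKf.
    by case: ifP => _; rewrite ?expN1 ?mulKf // oppr0 expr0z mul1r mulr0 addr0.
  + by rewrite /= expr0z mul1r.
  + by rewrite /= expr0z mul1r.
- have {}F H b' : fop g n n H b' = match b' with V0 => H (V n)
      | Vbar j => if j == n then 2 * H V0 else 0 | _ => 0 end by rewrite F E.
  have EN b' : end_n n en c G b' = match b' with
      | V j => if j == n then c ^+ 2 * G b' else G b'
      | V0 => G V0 + c * G (V n)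
      | Vbar j => if j == n then c ^- 2 * G b' + 2 * c^-1 * G V0 + G (V n) else G b'
      | _ => G b' end by rewrite /end_n E; case: b'.
  have W' k : (0 < k <= n)%N -> wt g n (V k) n = if k == n then 2 else 0.
    by move=> kn; rewrite W // E.
  have Wn : wt g n (V n) n = 2 by rewrite W' ?eqxx //; lia.
  rewrite EN !F; case: b bok => [j|j||] jn; rewrite ?mulr0 ?addr0 /wop.
  + by rewrite W' //; case: ifP => _; rewrite ?expr0z ?mul1r.
  + rewrite ?F WB W' // Wn; case: (eqVneq j n) => [_|_] /=.
      rewrite expN2 expr0z mul1r exp2; have : (2 : C) != 0 by rewrite pnatr_eq0.
      by move=> two; field; rewrite c0.
    by rewrite !mulr0 oppr0 expr0z mul1r !addr0.
  + by rewrite ?F ?mulr0 ?addr0 Wn /= expr0z mul1r exp2 expr2 !mulrA mulVf // mul1r.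
  + by rewrite /= expr0z mul1r.
- have {}F H b' : fop g n n H b' = if b' is Vbar j then if j == n then H (V n) else 0 else 0.
    by rewrite F E.
  have EN b' : end_n n en c G b' = match b' with
      | V j => if j == n then c * G b' else G b'
      | Vbar j => if j == n then c^-1 * G b' + G (V n) else G b'
      | _ => G b' end by rewrite /end_n E; case: b'.
  have W' k : (0 < k <= n)%N -> wt g n (V k) n = if k == n then 1 else 0.
    by move=> kn; rewrite W // E.
  have Wn : wt g n (V n) n = 1 by rewrite W' ?eqxx //; lia.
  rewrite EN !F; case: b bok => [j|j||] jn; rewrite ?mulr0 ?addr0 /wop.
  + by rewrite W' //; case: ifP => _; rewrite ?expr1z ?expr0z ?mul1r.
  + rewrite ?F ?if_same ?mulr0 ?addr0 WB W' // Wn expr1z; case: (eqVneq j n) => [_|_] /=.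
      by rewrite expN1 mulKf.
    by rewrite oppr0 expr0z mul1r mulr0 addr0.
  + by rewrite /= expr0z mul1r.
  + by rewrite /= expr0z mul1r.
Qed.

Lemma Y_0 c G : c != 0 -> ~~ isF e0 -> Y g n 0 c *m gcol g n G = gcol g n (end_0 e0 c G).
Proof.
move=> c0 F0; have n2 := n_ge2; have F H b := fop_0 hn gA H b F0.
have W k (kn : (0 < k <= n)%N) := wt_0 kn F0.
have WB k : wt g n (Vbar k) 0 = - wt g n (V k) 0 by [].
have F3 H b : fop g n 0 (fop g n 0 (fop g n 0 H)) b = 0.
  by rewrite F; move: (F); case: (e0) => F'; case: b => [j|j||] //; rewrite ?F' ?mulr0 ?if_same.
rewrite Y_gcol //; apply: eq_gcol => b; rewrite mem_basis // => bok.
have [E|E] : e0 = Short \/ e0 = Long by move: F0; case: (e0); auto.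
- have {}F H b' : fop g n 0 H b' = match b' with Phi => H (Vbar 1)
      | V j => if j == 1%N then 2 * H Phi else 0 | _ => 0 end by rewrite F E.
  have EN b' : end_0 e0 c G b' = match b' with
      | Vbar j => if j == 1%N then c ^+ 2 * G b' else G b'
      | Phi => G Phi + c * G (Vbar 1)
      | V j => if j == 1%N then c ^- 2 * G b' + 2 * c^-1 * G Phi + G (Vbar 1) else G b'
      | _ => G b' end by rewrite /end_0 E; case: b'.
  have W' k : (0 < k <= n)%N -> wt g n (V k) 0 = if k == 1%N then -2%:Z else 0.
    by move=> kn; rewrite W // E.
  have Wn : wt g n (V 1) 0 = -2%:Z by rewrite W' ?eqxx //; lia.
  rewrite EN !F; case: b bok => [j|j||] jn; rewrite ?mulr0 ?addr0 /wop.
  + rewrite ?F WB W' // Wn opprK; case: (eqVneq j 1%N) => [_|_] /=.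
      rewrite expN2 expr0z mul1r exp2; have : (2 : C) != 0 by rewrite pnatr_eq0.
      by move=> two; field; rewrite c0.
    by rewrite !mulr0 expr0z mul1r !addr0.
  + by rewrite WB W' //; case: ifP => _; rewrite ?opprK ?oppr0 ?expr0z ?mul1r.
  + by rewrite /= expr0z mul1r.
  + by rewrite ?F ?mulr0 ?addr0 WB Wn opprK /= expr0z mul1r exp2 expr2 !mulrA mulVf // mul1r.
- have {}F H b' : fop g n 0 H b' = if b' is V j then if j == 1%N then H (Vbar 1) else 0 else 0.
    by rewrite F E.
  have EN b' : end_0 e0 c G b' = match b' with
      | Vbar j => if j == 1%N then c * G b' else G b'
      | V j => if j == 1%N then c^-1 * G b' + G (Vbar 1) else G b'
      | _ => G b' end by rewrite /end_0 E; case: b'.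
  have W' k : (0 < k <= n)%N -> wt g n (V k) 0 = if k == 1%N then -1 else 0.
    by move=> kn; rewrite W // E.
  have Wn : wt g n (V 1) 0 = -1 by rewrite W' ?eqxx //; lia.
  rewrite EN !F; case: b bok => [j|j||] jn; rewrite ?mulr0 ?addr0 /wop.
  + rewrite ?F ?if_same ?mulr0 ?addr0 WB W' // Wn opprK expr1z; case: (eqVneq j 1%N) => [_|_] /=.
      by rewrite expN1 mulKf.
    by rewrite expr0z mul1r mulr0 addr0.
  + by rewrite WB W' //; case: ifP => _; rewrite ?opprK ?oppr0 ?expr1z ?expr0z ?mul1r.
  + by rewrite /= expr0z mul1r.
  + by rewrite /= expr0z mul1r.
Qed.

End ModuleSteps.

(** * The vectors v(x) for both words *)

Section VparRun.
Variables (R : realType) (g : affine_type) (n : nat) (e0 en : endtype).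
Variables (w : seq nat) (t : nat -> nat) (b0 : wlabel) (lb : 'I_(dimW g n) -> wlabel).
Local Notation C := R[i].
Hypothesis sw : size w = wsize n e0 en.
Hypothesis nw : forall j, (j < size w)%N -> nth 0%N w j = t (idx n e0 en j).
Hypothesis lb0 : forall a, (lab a == b0) = (lb a == V 1).

Lemma vpar_run (x : 'cV[C]_(size w)) :
  vpar g n b0 x = run n e0 en lb (fun i c => Y g n (t i) c) (fnat x) 0.
Proof.
rewrite /vpar /run subn0 -sw.
have -> : \prod_(j < size w) Y g n (nth 0%N w j) (x j ord0) =
    \prod_(j <- iota 0 (size w)) Y g n (nth 0%N w j) (fnat x j).
  rewrite -(big_ord_iota _ _ _ predT (fun j => Y g n (nth 0%N w j) (fnat x j))).
  by apply: eq_bigr => j _; rewrite fnatE.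
have : forall j, j \in iota 0 (size w) -> (j < size w)%N by move=> j; rewrite mem_iota.
elim: (iota _ _) => [|j r IH] H /=.
  rewrite big_nil; apply: etrans (mul1mx _) _.
  by apply/matrixP => a k; rewrite !mxE lb0.
rewrite big_cons -mulmxE -mulmxA IH; first by rewrite nw // H ?mem_head.
by move=> k kr; apply: H; rewrite inE kr orbT.
Qed.

End VparRun.

Section VparOne.
Variables (R : realType) (g : affine_type) (n : nat).
Hypothesis hn : (min_rank g <= n)%N.
Hypothesis gA : g <> tyA1.
Local Notation C := R[i].
Local Notation e0 := (left_end g).
Local Notation en := (right_end g).

Lemma word1_ends : word1 g n = iota (isF e0) (n.+1 - isF e0) ++ rev (iota 1 (n.-1 - isF en)).
Proof. by rewrite /left_end /right_end; case: (g) gA => // _ /=; rewrite ?subn1 ?subn0. Qed.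

Lemma size_word1 : size (word1 g n) = wsize n e0 en.
Proof.
have := rank_ok_ends hn gA; rewrite word1_ends size_cat size_rev !size_iota /wsize /rank_ok; lia.
Qed.

Lemma nth_word1 j : (j < size (word1 g n))%N -> nth 0%N (word1 g n) j = idx n e0 en j.
Proof.
have := rank_ok_ends hn gA; rewrite size_word1 word1_ends nth_cat size_iota /idx /wsize /rank_ok => nk jk.
case: ifP => jn; first by rewrite nth_iota //; case: ifP; lia.
by rewrite nth_rev ?size_iota; [rewrite nth_iota; [case: ifP; lia|lia]|lia].
Qed.

Lemma vpar_word1 (x : 'cV[C]_(size (word1 g n))) : torus C _ x ->
  vpar g n (V 1) x = gcol g n (vst n e0 en (mst n e0 en (fnat x))).
Proof.
move=> Tx; rewrite (vpar_run (t := id) (b0 := V 1) (lb := @lab g n) size_word1 nth_word1) //.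
apply: run_vst.
- exact: rank_ok_ends.
- by move=> a; rewrite -mem_basis // lab_mem.
- by move=> i c G iin c0; apply: Y_mid.
- by move=> c G c0; apply: Y_n.
- by move=> c G c0 F0; apply: Y_0.
- exact: fnat_neq0.
Qed.

Lemma mem_word1 i : (0 < i <= n)%N -> i \in word1 g n.
Proof. by move=> iin; rewrite word1_ends mem_cat mem_iota; case: (isF e0); lia. Qed.

End VparOne.

Section VparTwo.
Variables (R : realType) (n : nat).
Hypothesis hn : (2 <= n)%N.
Local Notation C := R[i].
Local Notation g := tyAeven2d.
Local Notation rho := (sigma_label tyC1 n).

Lemma size_word2 : size (word2 n) = wsize n Short Long.
Proof. by rewrite /word2 size_cat size_rev !size_iota /wsize /=; lia. Qed.

Lemma nth_word2 j : (j < size (word2 n))%N -> nth 0%N (word2 n) j = (n - idx n Short Long j)%N.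
Proof.
rewrite size_word2 /word2 nth_cat size_rev size_iota /idx /wsize.
rewrite (_ : isF Short = false) // (_ : isF Long = false) // addn0 !subn0 => jk.
case: ltnP => jn; first by rewrite nth_rev ?size_iota // (nth_iota _ 0); case_ifs; lia.
by rewrite nth_iota; case_ifs; lia.
Qed.

Lemma mem_word2 : 0%N \in word2 n.
Proof. by rewrite mem_cat mem_rev mem_iota. Qed.

Lemma oklabel_rho b : oklabel n Long Short b -> oklabel n Short Long (rho b).
Proof. by case: b => [j|j||] //=; lia. Qed.

(** Read from the other end, [word2] is the word of the reversed diagram, with a short end at 0 and
    a long one at n. The nodes i and n - i and the vectors v_j and v_bar(n+1-j) change places, and
    v_0 takes the part of phi. The label map of type C is this exchange, so [run_vst] applies. *)
Lemma vpar_word2 (x : 'cV[C]_(size (word2 n))) : torus C _ x ->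
  vpar g n (Vbar n) x =
  gcol g n (fun b => vst n Short Long (mst n Short Long (fnat x)) (rho b)).
Proof.
move=> Tx; have nok : rank_ok n Short Long by rewrite /rank_ok /=; lia.
pose lb (a : 'I_(dimW g n)) := rho (lab a).
have labok (a : 'I_(dimW g n)) : oklabel n Long Short (lab a).
  by rewrite -(mem_basis (g := g)) ?lab_mem.
have lb0 a : (lab a == Vbar n) = (lb a == V 1).
  by have := labok a; rewrite /lb; case: (lab a) => [j|j||] //= jn; rewrite !wlabel_eqE; lia.
have vg G : vcol lb G = gcol g n (fun b => G (rho b)) by apply/matrixP => a k; rewrite !mxE.
have eqg G G' : (forall b, oklabel n Long Short b -> G b = G' b) -> gcol g n G = gcol g n G' :> 'cV[C]_(dimW g n).
  by move=> H; apply: eq_gcol => // b; rewrite mem_basis //; apply: H.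
rewrite (vpar_run (t := fun j => (n - j)%N) size_word2 nth_word2 lb0) -vg; apply: run_vst => //.
- by move=> a; apply: oklabel_rho.
- move=> i c G iin c0; rewrite !vg Y_mid //; last by lia.
  apply: eqg => -[j|j||] // jn; rewrite /mid /=.
  + rewrite (_ : (n.+1 - j == i.+1)%N = (j == n - i)%N); last by move: jn => /=; lia.
    rewrite (_ : (n.+1 - j == i)%N = (j == (n - i).+1)%N); last by move: jn => /=; lia.
    rewrite (_ : n.+1 - (n - i).+1 = i)%N; last by lia.
    by rewrite (_ : n.+1 - (n - i) = i.+1)%N //; lia.
  + rewrite (_ : (n.+1 - j == i.+1)%N = (j == n - i)%N); last by move: jn => /=; lia.
    rewrite (_ : (n.+1 - j == i)%N = (j == (n - i).+1)%N); last by move: jn => /=; lia.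
    rewrite (_ : n.+1 - (n - i).+1 = i)%N; last by lia.
    by rewrite (_ : n.+1 - (n - i) = i.+1)%N //; lia.
- move=> c G c0; rewrite !vg subnn Y_0 //; apply: eqg => -[j|j||] // jn; rewrite /end_n /end_0 /=.
  + rewrite (_ : (n.+1 - j == n)%N = (j == 1%N)); last by move: jn => /=; lia.
    by rewrite subSS subn0.
  + rewrite (_ : (n.+1 - j == n)%N = (j == 1%N)); last by move: jn => /=; lia.
    by [].
- move=> c G c0 _; rewrite !vg subn0 Y_n //; apply: eqg => -[j|j||] // jn; rewrite /end_n /end_0 /=.
  + by rewrite (_ : (n.+1 - j == 1)%N = (j == n)); last by move: jn => /=; lia.
  + rewrite (_ : (n.+1 - j == 1)%N = (j == n)); last by move: jn => /=; lia.
    by rewrite (_ : n.+1 - n = 1)%N //; lia.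
  + by rewrite (_ : n.+1 - n = 1)%N //; lia.
- exact: fnat_neq0.
Qed.

End VparTwo.

(** * Coordinates on the varieties *)

Section Reconstruct.
Variables (n : nat) (e0 en : endtype) (K : numFieldType).
Hypothesis nok : rank_ok n e0 en.
Local Notation kap := (kap n e0 en).
Local Notation okp := (okp n e0 en).
Local Notation wlev := (wlev n e0 en).
Local Notation vst := (vst n e0 en).
Local Notation oklabel := (oklabel n e0 en).
Local Notation gauge := (gauge n e0 en).
Implicit Types (x : nat -> K) (st : (nat -> K) * (nat -> K)) (G : wlabel -> K).

(* The products p_l q_l = w_l + w_(l+1) are coordinates of the vector, and    *)
(* the first w_l is one as well by the choice of the gauge.                   *)
Fixpoint wrec G (l : nat) : K :=
  match l with
  | 0 => G (Vbar 1)
  | l'.+1 => if isF e0 && (l' == 0%N) then G (V 1) else G (V l) * G (Vbar l) - wrec G l'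
  end.

Definition yrec G (j : nat) : K :=
  if (n < j)%N then 1
  else if j == 0%N then if isF e0 then 1 else if isS e0 then G Phi else wrec G 0
  else if j == n then if isF en then G (V n) else if isS en then G V0 else wrec G n
  else if isF e0 && (j == 1%N) then G (V 1)
  else if isF en && (j == n.-1) then G (Vbar n)
  else wrec G j.

Definition rst G : (nat -> K) * (nat -> K) :=
  (yrec G, fun l => if okp l then G (Vbar l.+1) else 1).

Section Correct.
Variables (G : wlabel -> K) (st : (nat -> K) * (nat -> K)).
Hypothesis Gst : forall b, oklabel b -> G b = vst st b.
Hypothesis p0 : forall l, st.2 l != 0.
Hypothesis gst : gauge st.

(** The recursion starts correctly because of the gauge: without a fork the coefficient p_0 of
    v_bar1 equals w_0, and with a fork w_1 = y_0 y_1 is the coefficient y_1 of v_1. *)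
Lemma wrecE l : oklev n e0 en l -> (isF e0 <= l)%N -> wrec G l = wlev st.1 l.
Proof.
elim: l => [|l IH] okl Fl.
  have F0 : isF e0 = false by case: (isF e0) Fl.
  have ok00 : okp 0 by apply: ok0; rewrite ?F0.
  rewrite /= Gst /=; last by move: nok; rewrite /rank_ok; lia.
  move: gst; rewrite /gauge F0 ok00 => ->; rewrite /wlev (prod_lev nok) // /nodes F0 /=.
  rewrite (_ : isF en && _ = false); first by rewrite big_cons big_nil mulr1.
  by apply/negbTE/negP => /andP[_ /eqP]; move: nok; rewrite /rank_ok; lia.
rewrite [LHS]/=; case: ifPn => [/andP[F0 /eqP l0]|H].
  rewrite l0 in okl *; rewrite Gst /=; last by move: nok; rewrite /rank_ok; lia.
  rewrite /wlev (prod_lev nok) // /nodes F0 /= !big_cons big_nil mulr1.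
  move: gst; rewrite /gauge F0 => ->; rewrite expr1n mul1r /okp F0 /=.
  rewrite (_ : kap 1 = 1%N) ?expr1 //.
  by move: nok; rewrite /rank_ok /kap F0; case: (e0) F0 => // _; case_ifs; lia.
have ol : okp l by move: H okl Fl; rewrite /okp /oklev; case: (isF e0) => /=; lia.
have ol' : oklev n e0 en l by case: (okp_oklev nok ol).
rewrite IH ?Gst //=; try by move: okl; rewrite /oklev; lia.
  rewrite ol /qst divfK ?p0 // /blev addrAC subrr add0r //.
Qed.

Lemma wlev1 (y : nat -> K) l : oklev n e0 en l -> ~~ (isF e0 && (l == 1%N)) -> ~~ (isF en && (l == n.-1)) ->
  wlev y l = y l ^+ kap l.
Proof.
by move=> okl /negbTE H1 /negbTE H2; rewrite /wlev (prod_lev nok) // /nodes H1 H2 big_cons big_nil mulr1.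
Qed.

Lemma rstE : canon n e0 en st -> rst G = st.
Proof.
move=> [yc pc]; rewrite [RHS]surjective_pairing /rst; congr pair; apply: boolp.funext => j; last first.
  case: ifPn => [ok|/pc ->//]; rewrite Gst /= ?ok //.
  by move: ok; rewrite /okp; lia.
rewrite /yrec; case: ltnP => jn; first by rewrite yc.
have w1 : oklev n e0 en j -> ~~ (isF e0 && (j <= 1)%N) -> ~~ (isF en && (n.-1 <= j)%N) ->
    kap j = 1%N -> wrec G j = st.1 j.
  move=> okj H1 H2 kj; rewrite wrecE // ?wlev1 // ?kj ?expr1 //.
  - by apply: contra H1 => /andP[-> /eqP ->].
  - by apply: contra H2 => /andP[-> /eqP ->] /=.
  - by move: okj; rewrite /oklev => /andP[].
move: nok; rewrite /rank_ok => nk; move: gst; rewrite /gauge.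
case: eqP => [j0|j0].
  case: ifPn => [F0 <-|F0 _]; first by rewrite j0.
  case: ifPn => S0; first by rewrite Gst //= j0.
  rewrite -{1}j0; apply: w1; rewrite ?(negbTE F0) //.
  - by rewrite /oklev j0; lia.
  - by rewrite j0; lia.
  - by rewrite /kap (negbTE S0) j0; case: ifP; lia.
move=> _; case: eqP => [jn'|jn'].
  case: ifPn => [Fn|Fn].
    rewrite Gst /=; last by lia.
    by rewrite /okp Fn (_ : _ && _ = false) ?jn' //; [case: ifP => //; lia|lia].
  case: ifPn => Sn; first by rewrite Gst //= jn'.
  rewrite -jn'; apply: w1; rewrite ?(negbTE Fn) //.
  - by rewrite /oklev; lia.
  - by lia.
  - by rewrite /kap (negbTE Sn) andbF orbF; case: ifP; lia.
case: ifPn => [/andP[F0 /eqP j1]|H1].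
  rewrite Gst /=; last by lia.
  by rewrite /okp F0 j1.
case: ifPn => [/andP[Fn /eqP j1]|H2].
  rewrite Gst /=; last by lia.
  by rewrite /okp Fn (_ : _ && _ = false) ?j1 //; [case: ifP => //; lia|lia].
apply: w1.
- by rewrite /oklev; lia.
- by lia.
- by lia.
- by rewrite /kap; case: ifP; lia.
Qed.

End Correct.

Lemma mst_p_neq0 x l : (forall j, x j != 0) -> (mst n e0 en x).2 l != 0.
Proof. by move=> x0 /=; case: ifP => _; rewrite ?expf_neq0 ?oner_neq0. Qed.

Lemma xof_rst G x j : (forall j, x j != 0) -> (forall b, oklabel b -> G b = vst (mst n e0 en x) b) ->
  (j < wsize n e0 en)%N -> xof n e0 en (rst G) j = x j.
Proof.
move=> x0 H jk; rewrite (rstE H); first exact: xof_mst.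
- by move=> l; apply: mst_p_neq0.
- exact: mst_gauge.
- exact: mst_canon.
Qed.

Lemma mst_y_neq0 x j : (forall j, x j != 0) -> (mst n e0 en x).1 j != 0.
Proof. by move=> x0; rewrite /mst /= prodf_seq_neq0; apply/allP => i _; apply/implyP. Qed.

Lemma long_left : isL e0 -> [/\ kap 0 = 1%N, kap 1 = 1%N, lev n e0 en 1 = 1%N, lam n e0 en 1 = 1%N & okp 1].
Proof.
move=> L0; have [F0 S0] : isF e0 = false /\ isS e0 = false by case: (e0) L0.
move: nok; rewrite /rank_ok /kap /lev /lam /okp F0 S0 /= => nk.
by split; case_ifs; lia.
Qed.

Lemma blev0_long (y : nat -> K) : isL e0 -> blev n e0 en y 0 = y 0%N + y 1%N.
Proof.
move=> L0; have [k0 k1 _ _ _] := long_left L0; have F0 : isF e0 = false by case: (e0) L0.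
move: nok; rewrite /rank_ok /blev => nk.
rewrite !wlev1 ?k0 ?k1 ?expr1 // ?F0 //; try by rewrite /oklev F0; lia.
  by apply/negP => /andP[Fn]; rewrite Fn in nk; lia.
by apply/negP => /andP[Fn]; rewrite Fn in nk; lia.
Qed.

(* A multiple of a vector of the variety lies in the variety again when e_0   *)
(* is long, and it is eps_1 that determines the factor.                       *)
Lemma vst_scale x z s : (forall j, x j != 0) -> (forall j, z j != 0) ->
    (forall b, oklabel b -> vst (mst n e0 en x) b = s * vst (mst n e0 en z) b) ->
    (isL e0 -> eeps n e0 en 1 (mst n e0 en x) = eeps n e0 en 1 (mst n e0 en z) /\
      eeps n e0 en 1 (mst n e0 en z) != 0) ->
  forall j, (j < wsize n e0 en)%N -> x j = z j.
Proof.
move=> x0 z0 H HL; suff s1 : s = 1.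
  move=> j jk; rewrite -(xof_rst (G := vst (mst n e0 en x)) x0) //.
  by apply: xof_rst => // b /H ->; rewrite s1 mul1r.
have gx := mst_gauge nok x; have gz := mst_gauge nok z.
have y0 := mst_y_neq0 0 z0.
have px l := mst_p_neq0 l x0; have pz l := mst_p_neq0 l z0.
have nk := nok; rewrite /rank_ok in nk.
have L1 : oklabel (V 1) by rewrite /=; lia.
have L2 : oklabel (V 2) by rewrite /=; lia.
have L1' : oklabel (Vbar 1) by rewrite /=; lia.
have yx1 := mst_y_neq0 1 x0; have yz1 := mst_y_neq0 1 z0.
move: (mst n e0 en x) (mst n e0 en z) H HL gx gz y0 px pz yx1 yz1 => sx sz H HL gx gz y0 px pz yx1 yz1.
have := H _ L1'; rewrite /=; have [F0|F0] := boolP (isF e0).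
  (* For a fork the coefficient of v_bar1 is y_0 = 1 in both vectors. *)
  move: gx gz; rewrite /gauge /okp F0 /= => -> ->; by rewrite mulr1.
move: gx gz; rewrite /gauge (negbTE F0) (ok0 nok F0) => gx gz.
rewrite gx gz; have [S0|S0] := boolP (isS e0).
  (* For a short end the coefficients of v_bar1 and phi are y_0^2 and y_0, which gives s = s^2. *)
  have /= Ep := H Phi S0; rewrite Ep; have -> : kap 0 = 2%N by rewrite /kap S0.
  move=> /eqP; rewrite exprMn -subr_eq0 -mulrBl mulf_eq0 expf_eq0 (negbTE y0) andbF orbF.
  rewrite expr2 -{3}[s]mulr1 -mulrBr mulf_eq0 => /orP[/eqP s0|]; last by rewrite subr_eq0 => /eqP.
  by have := px 0%N; rewrite gx Ep s0 mul0r /kap S0 expr0n eqxx.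
(* For a long end, epsilon_1 = p_0 q_1 / y_1 forces y_1 to be multiplied by s^2, whereas p_0 = y_0
   is multiplied by s. Then p_0 q_0 = y_0 + y_1, whose left side is multiplied by s^2, leaves only s
   = 1. *)
have L0 : isL e0 by move: F0 S0; case: (e0).
have [k0 k1 lev1 lam1 ok1] := long_left L0.
rewrite k0 !expr1 in gx gz * => E0.
have [E1 n1] := HL L0.
move: E1 n1; rewrite /eeps lev1 lam1 ok1 (ok0 nok F0) /= !expr1.
have := H _ L2; rewrite /= ok1 => ->; rewrite gx gz E0 => E1 n1.
have q1 : qst n e0 en sz 1 != 0 by apply: contraNneq n1 => ->; rewrite mulr0 mul0r.
have s0 : s != 0 by have := px 0%N; rewrite gx E0 mulf_eq0 negb_or => /andP[].
have Ey : sx.1 1%N = s ^+ 2 * sz.1 1%N.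
  move: E1 => /eqP; rewrite eqr_div // => /eqP E1.
  have : (sz.1 0%N * qst n e0 en sz 1) * (s ^+ 2 * sz.1 1%N) =
         (sz.1 0%N * qst n e0 en sz 1) * sx.1 1%N by rewrite -E1; ring.
  by move/(mulfI (mulf_neq0 y0 q1)).
have bl (t : (nat -> K) * (nat -> K)) : t.2 0%N = t.1 0%N -> t.2 0%N != 0 ->
    qst n e0 en t 0 * t.1 0%N = t.1 0%N + t.1 1%N.
  by move=> E t0; rewrite -E /qst divfK // blev0_long // E.
have := H _ L1; rewrite /= (ok0 nok F0) => Eq.
have B1 := bl _ gx (px 0%N); have B2 := bl _ gz (pz 0%N).
rewrite Eq Ey E0 in B1.
have : s * sz.1 0%N * (s - 1) = 0.
  have -> : s * sz.1 0%N * (s - 1) =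
     s * s * (sz.1 0%N + sz.1 1%N) - (s * sz.1 0%N + s ^+ 2 * sz.1 1%N) by ring.
  by rewrite -B1 -B2; ring.
move/eqP; rewrite mulf_eq0 mulf_eq0 (negbTE s0) (negbTE y0) /= subr_eq0 => /eqP.
by [].
Qed.

End Reconstruct.

(** * Rational families of states *)

Section RationalStates.
Variables (R : realType) (n : nat) (e0 en : endtype) (m : nat) (X : pspace R[i] m).
Hypothesis nok : rank_ok n e0 en.
Local Notation C := R[i].
Local Notation state := ((nat -> C) * (nat -> C))%type.
Implicit Types f : 'cV[C]_m -> state.

Definition ratst f : Prop :=
  [/\ forall j, posrat X (fun s => (f s).1 j), forall l, posrat X (fun s => (f s).2 l) &
      forall s, pos X s -> pst (f s)].

Lemma posrat_if (b : bool) (u v : 'cV[C]_m -> C) : (b -> posrat X u) -> (~~ b -> posrat X v) ->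
  posrat X (fun s => if b then u s else v s).
Proof. by case: b => Hu Hv; [apply: Hu|apply: Hv]. Qed.

Lemma posrat_wlev f l : ratst f -> posrat X (fun s => wlev n e0 en (f s).1 l).
Proof. by move=> [Hy _ _]; apply: rat_on_prod => j _; apply/rat_onX/Hy. Qed.

Lemma posrat_blev f l : ratst f -> posrat X (fun s => blev n e0 en (f s).1 l).
Proof. by move=> Hf; apply: rat_onD; apply: posrat_wlev. Qed.

Lemma posrat_div (u v : 'cV[C]_m -> C) : (forall s, pos X s -> 0 < v s) ->
  posrat X u -> posrat X v -> posrat X (fun s => u s / v s).
Proof.
by move=> v0; apply: rat_on_div; [exact: pos_car|move=> s Ps; rewrite gt_eqF // v0].
Qed.

Lemma posrat_qst f l : ratst f -> posrat X (fun s => qst n e0 en (f s) l).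
Proof.
move=> Hf; case: (Hf) => _ Hp Hpos; apply: posrat_div => //; last exact: posrat_blev.
by move=> s /Hpos [].
Qed.

Lemma ratst_fl f : ratst f -> ratst (fun s => fl n e0 en (f s)).
Proof.
move=> Hf; case: (Hf) => Hy Hp Hpos; split=> [j|l|s Ps] /=.
- by apply: posrat_if => _; [apply: Hy|apply: rat_on_cst].
- by apply: posrat_if => _; [apply: posrat_qst|apply: rat_on_cst].
- by apply: fl_pos; apply: Hpos.
Qed.

Lemma ratst_swp f : ratst f -> ratst (fun s => swp (f s)).
Proof.
by move=> [Hy Hp Hpos]; split=> [j|l|s Ps] /=; [apply: Hy|apply: Hp|apply/swp_pos/Hpos].
Qed.

Lemma posrat_sg f : ratst f -> posrat X (fun s => sg n e0 en (f s)).
Proof.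
move=> [Hy Hp Hpos]; rewrite /sg; case: (isF e0).
  by apply: rat_onV; [exact: pos_car|move=> s /Hpos[y0 _]; rewrite gt_eqF|exact: Hy].
apply: posrat_div; first by move=> s /Hpos[y0 _]; rewrite exprn_gt0.
  exact: Hp.
by apply: rat_onX; exact: Hy.
Qed.

Lemma ratst_sc f (h : 'cV[C]_m -> C) : posrat X h -> (forall s, pos X s -> 0 < h s) -> ratst f ->
  ratst (fun s => sc n e0 en (h s) (f s)).
Proof.
move=> Hh h0 [Hy Hp Hpos]; split=> [j|l|s Ps] /=.
- by apply: rat_onM; [apply: rat_onX|apply: Hy].
- by apply: posrat_if => _; [apply: rat_onM => //; apply: Hp|apply: Hp].
- by apply: sc_pos; [apply: h0|apply: Hpos].
Qed.

Lemma posrat_xof f j : ratst f -> posrat X (fun s => xof n e0 en (f s) j).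
Proof.
move=> [Hy Hp Hpos]; rewrite /xof; do ?(apply: posrat_if => _; try exact: rat_on_cst) => //.
by apply: posrat_div => // s /Hpos[].
Qed.

Lemma posrat_norm f j : ratst f -> posrat X (fun s => norm n e0 en (f s) j).
Proof.
move=> Hf; apply: posrat_xof; apply: ratst_sc => //; first exact: posrat_sg.
by case: Hf => _ _ Hpos s /Hpos; apply: sg_gt0.
Qed.

End RationalStates.

Lemma ratst_mst (R : realType) n e0 en k :
  ratst (tspace R[i] k) (fun x => mst n e0 en (fnat x)).
Proof.
have H j : posrat (tspace R[i] k) (fun x => fnat x j).
  by rewrite /fnat; case: insub => [o|]; [apply: rat_on_coord|apply: rat_on_cst].
split=> [j|l|x Px] /=; first by apply: rat_on_prod => i _; exact: H.
- by apply: posrat_if => _; [apply/rat_onX; exact: H|apply: rat_on_cst].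
- by apply: mst_pos => j; apply: fnat_gt0.
Qed.

Section VarietyCoordinates.
Variables (R : realType) (g : affine_type) (n : nat) (e0 en : endtype).
Variables (w : seq nat) (b0 : wlabel) (lbl : wlabel -> wlabel).
Local Notation C := R[i].
Hypothesis nok : rank_ok n e0 en.
Hypothesis sw : size w = wsize n e0 en.
Hypothesis lblP : forall b, oklabel n e0 en b -> lbl b \in Defs.basis g n /\ lbl (lbl b) = b.
Hypothesis vE : forall x : 'cV[C]_(size w), torus C _ x ->
  vpar g n b0 x = gcol g n (fun b => vst n e0 en (mst n e0 en (fnat x)) (lbl b)).
Local Notation VS := (pimage (X := tspace C (size w)) (fun a => @vpar_reg R g n w b0 a)).

Definition vcoef (u : 'cV[C]_(dimW g n)) (b : wlabel) : C :=
  \sum_a (lab a == b)%:R * u a ord0.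
(** The rational inverse of the parametrization, through the state recovered from the coefficients;
    [lbl] accounts for the renaming of labels that goes with the second word. *)
Definition cfv (u : 'cV[C]_(dimW g n)) : 'cV[C]_(size w) :=
  \col_j xof n e0 en (rst n e0 en (fun b => vcoef u (lbl b))) j.

Lemma vcoef_gcol G b : b \in Defs.basis g n -> vcoef (gcol g n G) b = G b.
Proof.
move=> bb; have bs : (index b (Defs.basis g n) < dimW g n)%N by rewrite index_mem.
have Eb : lab (Ordinal bs) = b by rewrite /lab nth_index.
rewrite /vcoef (bigD1 (Ordinal bs)) //= Eb eqxx mul1r !mxE Eb big1 ?addr0 // => a na.
case: eqP => [E|]; last by rewrite mul0r.
case/eqP: na; apply: val_inj => /=; apply/eqP.
by rewrite -(nth_uniq V0 _ _ (uniq_basis g n)) ?index_mem ?nth_index //; apply/eqP.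
Qed.

Lemma cfv_state (x : 'cV[C]_(size w)) : torus C _ x -> forall b, oklabel n e0 en b ->
  vcoef (vpar g n b0 x) (lbl b) = vst n e0 en (mst n e0 en (fnat x)) b.
Proof.
move=> Tx b okb; have [lb ll] := lblP okb.
have -> : vcoef (vpar g n b0 x) (lbl b) = vcoef (gcol g n (fun b => vst n e0 en (mst n e0 en (fnat x)) (lbl b))) (lbl b).
  by congr (vcoef _ _); exact: vE.
by rewrite vcoef_gcol // ll.
Qed.

Lemma cfvK (x : 'cV[C]_(size w)) : torus C _ x -> cfv (vpar g n b0 x) = x.
Proof.
move=> Tx; apply/colP => j; rewrite mxE (@xof_rst n e0 en C nok _ (fnat x)) //.
- by rewrite fnatE.
- exact: fnat_neq0.
- exact: cfv_state.
- by rewrite -sw.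
Qed.

Lemma rst_vpar (x : 'cV[C]_(size w)) : torus C _ x ->
  rst n e0 en (fun b => vcoef (vpar g n b0 x) (lbl b)) = mst n e0 en (fnat x).
Proof.
move=> Tx; apply: rstE (cfv_state Tx) _ _ _ => //; last 2 first.
- exact: mst_gauge.
- exact: mst_canon.
by move=> l; apply: mst_p_neq0; apply: fnat_neq0.
Qed.

Lemma ratst_rst : ratst VS (fun u => rst n e0 en (fun b => vcoef u (lbl b))).
Proof.
have H b : posrat VS (fun u => vcoef u b).
  by apply: rat_on_sum => a _; apply: rat_onM; [apply: rat_on_cst|apply: rat_on_coord].
have Hw l : posrat VS (fun u => wrec e0 (fun b => vcoef u (lbl b)) l).
  elim: l => [|l IH] /=; first exact: H.
  apply: posrat_if => _; first exact: H.
  by apply: rat_onB; [apply: rat_onM; exact: H|exact: IH].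
split=> [j|l|_ [x Px <-]].
- by rewrite /= /yrec; do !(apply: posrat_if => _; try exact: rat_on_cst); first [exact: H|exact: Hw].
- by apply: posrat_if => _; [apply: H|apply: rat_on_cst].
- rewrite (rst_vpar (postorus_torus Px)); apply: mst_pos => j; exact: fnat_gt0.
Qed.

Lemma cfv_rat i : posrat VS (fun u => cfv u i ord0).
Proof.
apply: (@rat_on_ext _ _ _ _ (fun u => xof n e0 en (rst n e0 en (fun b => vcoef u (lbl b))) i)).
  by move=> u _; rewrite mxE.
exact: posrat_xof ratst_rst.
Qed.

End VarietyCoordinates.

(** * Lifts of sigma-bar *)

(* A symmetry of the space of states that exchanges the node 0 with a node of *)
(* the word which parametrizes the target.                                    *)
Record twist (K : numFieldType) n e0 en e0' en' (tau : nat -> nat)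
    (th th' : (nat -> K) * (nat -> K) -> (nat -> K) * (nat -> K))
    (lbl : wlabel -> wlabel) : Prop := Twist {
  tw_ok : rank_ok n e0' en';
  tw_tau : forall i, (i <= n)%N -> (tau i <= n)%N;
  tw_tau0 : (0 < tau 0)%N;
  tw_pos : forall st, pst st -> pst (th st);
  tw_pos' : forall st, pst st -> pst (th' st);
  tw_canon : forall st, canon n e0 en st -> canon n e0' en' (th st);
  tw_canon' : forall st, canon n e0' en' st -> canon n e0 en (th' st);
  tw_K : forall st, pst st -> canon n e0 en st -> th' (th st) = st;
  tw_K' : forall st, pst st -> canon n e0' en' st -> th (th' st) = st;
  tw_E : forall i c st, (i <= n)%N -> 0 < c -> pst st ->
    E n e0' en' (tau i) c (th st) = th (E n e0 en i c st);
  tw_gam : forall i st, (i <= n)%N -> egam n e0' en' (tau i) (th st) = egam n e0 en i st;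
  tw_eps : forall i st, (i <= n)%N -> pst st ->
    eeps n e0' en' (tau i) (th st) = eeps n e0 en i st;
  tw_sc : forall s st, 0 < s -> th (sc n e0 en s st) = sc n e0' en' s (th st);
  tw_sc' : forall s st, 0 < s -> th' (sc n e0' en' s st) = sc n e0 en s (th' st);
  tw_lbl : forall b, oklabel n e0 en b -> oklabel n e0' en' (lbl b);
  tw_lbl' : forall b, oklabel n e0' en' b -> oklabel n e0 en (lbl b);
  tw_lblK : forall b, oklabel n e0 en b -> lbl (lbl b) = b;
  tw_lblK' : forall b, oklabel n e0' en' b -> lbl (lbl b) = b;
  tw_vst : forall st b, pst st -> oklabel n e0 en b ->
    vst n e0' en' (th st) (lbl b) = vst n e0 en st b }.

Section TwistInstances.
Variables (K : numFieldType) (n : nat) (e0 en : endtype).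
Hypothesis nok : rank_ok n e0 en.
Implicit Types st : (nat -> K) * (nat -> K).

Lemma dd_flip j : (j <= n)%N -> dd n en e0 j = dd n e0 en (n - j)%N.
Proof.
by move: nok; rewrite /rank_ok /dd /kap; case: (e0); case: (en) => /= nk jn; case_ifs; lia.
Qed.

Lemma fl_sc s st : 0 < s -> fl n e0 en (sc n e0 en s st) = sc n en e0 s (fl n e0 en st).
Proof.
move=> s0; rewrite /fl /sc; congr pair; apply: boolp.funext => j /=.
  case: leqP => jn; first by rewrite dd_flip.
  by rewrite /dd jn expr0 mulr1.
case: ifPn => // ok; rewrite -/(sc n e0 en s st) qst_sc // okp_flip //.
exact: okp_lt ok.
Qed.

(** All coefficients have degree 1: besides p and q the vector contains only those y_j that belong
    to a fork or a short end, and these have dd_j = 1. *)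
Lemma vst_sc s st b : 0 < s -> oklabel n e0 en b -> vst n e0 en (sc n e0 en s st) b = s * vst n e0 en st b.
Proof.
move=> s0; have k0 : isS e0 -> dd n e0 en 0 = 1%N.
  by move: nok; rewrite /rank_ok /dd /kap; case: (e0) => //= nk; case_ifs; lia.
have kn : isS en -> dd n e0 en n = 1%N.
  by move: nok; rewrite /rank_ok /dd /kap; case: (en) => //= nk; case_ifs; lia.
have nok0 j : (0 < j <= n)%N -> ~~ okp n e0 en j.-1 ->
    (j == 1%N) && isF e0 || (j == n) && isF en && (j != 1%N).
  by move: nok; rewrite /rank_ok /okp; case: (isF e0); case: (isF en) => /=; lia.
have f0 : isF e0 -> dd n e0 en 0 = 1%N /\ dd n e0 en 1 = 1%N.
  by move: nok; rewrite /rank_ok /dd => nk F0; rewrite F0 /=; split; case_ifs; lia.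
have fn : isF en -> dd n e0 en n = 1%N /\ dd n e0 en n.-1 = 1%N.
  by move: nok; rewrite /rank_ok /dd => nk Fn; rewrite Fn /=; split; case_ifs; lia.
case: b => [j|j||] /= jn.
- case: ifPn => [ok|/(nok0 _ jn)/orP[/andP[/eqP -> F]|/andP[/andP[/eqP jE F] j1]]].
  + by rewrite -/(sc n e0 en s st) qst_sc.
  + by have [_ ->] := f0 F.
  + by rewrite (negbTE j1); have [-> _] := fn F.
- case: ifPn => [ok|/(nok0 _ jn)/orP[/andP[/eqP -> F]|/andP[/andP[/eqP jE F] j1]]].
  + by rewrite ?ok.
  + by have [-> _] := f0 F.
  + by rewrite (negbTE j1); have [_ ->] := fn F.
- by rewrite kn.
- by rewrite k0.
Qed.

(** For the types without forks. The reflection turns p_l into q_(n-1-l), so the coefficient of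
    v_bar j becomes that of v_(n+1-j), which is the effect of sigma on W. *)
Lemma twist_fl : ~~ isF e0 -> ~~ isF en ->
  twist n e0 en en e0 (fun i => n - i)%N (@fl n e0 en K) (@fl n en e0 K) (sigma_label tyC1 n).
Proof.
move=> F0 Fn; have nok' := rank_ok_sym nok.
have okl l : okp n e0 en l = (l < n)%N by rewrite /okp (negbTE F0) (negbTE Fn) addn0.
have okl' l : okp n en e0 l = (l < n)%N by rewrite /okp (negbTE F0) (negbTE Fn) addn0.
split.
- exact: nok'.
- by move=> i _; apply: leq_subr.
- by move: nok; rewrite /rank_ok; lia.
- by move=> st; apply: fl_pos.
- by move=> st; apply: fl_pos.
- by move=> st _; apply: canon_fl.
- by move=> st _; apply: canon_fl.
- by move=> st; apply: flK.
- by move=> st; apply: flK.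
- by move=> i c st; apply: E_flip.
- by move=> i st; apply: egam_flip.
- by move=> i st; apply: eeps_flip.
- by move=> s st; apply: fl_sc.
- move=> s st s0; rewrite /fl /sc; congr pair; apply: boolp.funext => j /=.
    case: leqP => jn; first by rewrite dd_flip ?leq_subr // subKn.
    by rewrite /dd jn expr0 mulr1.
  case: ifPn => // ok; rewrite -/(sc n en e0 s st); apply: qst_sc => //.
  by move: ok; rewrite okl okl'; lia.
- by case=> [j|j||] //=; lia.
- by case=> [j|j||] //=; lia.
- by case=> [j|j||] //= jn; congr (_ _); lia.
- by case=> [j|j||] //= jn; congr (_ _); lia.
- move=> st [j|j||] Pst //= jn; rewrite ?leqnn ?subnn ?subn0 // ?okl ?okl'.
  + rewrite (_ : (n.+1 - j).-1 < n)%N; last by lia.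
    rewrite (_ : j.-1 < n)%N; last by lia.
    by congr (qst _ _ _ _ _); lia.
  + rewrite (_ : (n.+1 - j).-1 < n)%N; last by lia.
    rewrite (_ : j.-1 < n)%N; last by lia.
    rewrite -/(fl n e0 en st) qst_flip //; last by rewrite okl'; lia.
    by congr (st.2 _); lia.
Qed.

End TwistInstances.

(** At a fork the coefficients of v_1 and v_bar1 are y_1 and y_0, so exchanging the branches
    exchanges just these two coefficients. The three types with a fork at 0 have the same label
    map. *)
Lemma twist_swp (K : numFieldType) n en : rank_ok n Fork en ->
  twist n Fork en Fork en sw (@swp K) (@swp K) (sigma_label tyB1 n).
Proof.
move=> nok; have nk : (3 + isF en <= n)%N by move: nok; rewrite /rank_ok /=; lia.
have swpK' st : swp (swp st) = st :> (nat -> K) * (nat -> K).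
  rewrite /swp [RHS]surjective_pairing; congr pair; apply: boolp.funext => j /=.
  by rewrite swK.
have swsc s st : 0 < s -> swp (sc n Fork en s st) = sc n Fork en s (swp st) :> (nat -> K) * (nat -> K).
  move=> _; rewrite /swp /sc; congr pair; apply: boolp.funext => j /=.
  congr (_ ^+ _ * _); rewrite /dd /kap /sw [isF Fork]/=.
  have : isF en && isS en = false by case: (en).
  move: nk; clear -j; case_ifs; lia.
have swl : ((forall j, sigma_label tyB1 n (V j) = if j == 1%N then Vbar 1 else V j) *
    (forall j, sigma_label tyB1 n (Vbar j) = if j == 1%N then V 1 else Vbar j))%type by [].
split; try by [].
- by move=> i; exact: (sw_le nok).
- by move=> st; apply: swp_pos.
- by move=> st; apply: swp_pos.
- by move=> st; apply: swp_canon.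
- by move=> st; apply: swp_canon.
- by move=> i c st _ _ _; apply: E_swap.
- by move=> i st _; exact: (egam_swap nok).
- by move=> i st _ _; apply: eeps_swap.
- by move=> [j|j||] jn; rewrite ?swl //; case: ifP => _ //=; lia.
- by move=> [j|j||] jn; rewrite ?swl //; case: ifP => _ //=; lia.
- by move=> [j|j||] _ //; rewrite swl; case: (j =P 1%N) => [->|/eqP/negbTE j1]; rewrite swl ?eqxx ?j1.
- by move=> [j|j||] _ //; rewrite swl; case: (j =P 1%N) => [->|/eqP/negbTE j1]; rewrite swl ?eqxx ?j1.
- have qs st l : qst n Fork en (swp st) l = qst n Fork en st l by rewrite /qst /blev !wlev_sw.
  move=> st [j|j||] Pst jn; rewrite ?swl /=; rewrite /= in jn.
  + case: (j =P 1%N) => [->|j1] /=; first by rewrite /okp.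
    rewrite qs; case: ifP => // _; case: eqP => // _.
    by rewrite /sw; case: eqP => [|_]; [lia|case: eqP => //; lia].
  + case: (j =P 1%N) => [->|j1] /=; first by rewrite /okp.
    case: ifP => // _; case: eqP => // _.
    by rewrite /sw; case: eqP => [|_]; [lia|case: eqP => //; lia].
  + by rewrite /sw; case: eqP => [|_]; [lia|case: eqP => //; lia].
  + by [].
Qed.

Lemma eeps_gt0 n e0 en (K : numFieldType) i (st : (nat -> K) * (nat -> K)) :
  pst st -> 0 < eeps n e0 en i st.
Proof.
move=> Pst; case: (Pst) => y0 p0; rewrite divr_gt0 // exprn_gt0 // mulr_gt0 //; case: ifP => // _.
exact: qst_gt0.
Qed.

Lemma fnat_col (R : realType) m (F : nat -> R[i]) : (forall j, (m <= j)%N -> F j = 1) ->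
  fnat (\col_(j < m) F j) = F.
Proof.
move=> H; apply: boolp.funext => j; rewrite /fnat; case: insubP => [o _ <-|]; first by rewrite mxE.
by rewrite -leqNgt => /H ->.
Qed.

Lemma norm_out n e0 en (K : numFieldType) (st : (nat -> K) * (nat -> K)) j :
  (wsize n e0 en <= j)%N -> norm n e0 en st j = 1.
Proof. by move=> jk; rewrite /norm /xof ltnNge jk. Qed.

(** * The two gauges given by a twist *)

Section TwistModel.
Variables (R : realType) (g : affine_type) (n : nat).
Local Notation C := R[i].
Local Notation w1 := (word1 g n).
Local Notation w2 := (tgt_word g n).
Local Notation b2 := (tgt_base g n).
Local Notation e0 := (left_end g).
Local Notation en := (right_end g).
Local Notation state := ((nat -> C) * (nat -> C))%type.
Variables (e0' en' : endtype) (tau t2 : nat -> nat) (th th' : state -> state).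
Variables (lbl lbl2 : wlabel -> wlabel).
Hypothesis hn : (min_rank g <= n)%N.
Hypothesis gA : g <> tyA1.
Hypothesis TW : twist n e0 en e0' en' tau th th' lbl.
Hypothesis sw2 : size w2 = wsize n e0' en'.
Hypothesis nw2 : forall j, (j < size w2)%N -> nth 0%N w2 j = t2 (idx n e0' en' j).
Hypothesis cw2 : forall a b, (a <= n)%N -> (b <= n)%N -> cartan g n (t2 a) (t2 b) = ecart n e0' en' a b.
Hypothesis tw2 : forall a b, (a <= n)%N -> (b <= n)%N -> (t2 a == t2 b) = (a == b).
Hypothesis s0E : sigma_index g n 0 = t2 (tau 0).

Let nok : rank_ok n e0 en. Proof. exact: rank_ok_ends. Qed.
Let nok' : rank_ok n e0' en'. Proof. exact: tw_ok TW. Qed.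
Let sw1 : size w1 = wsize n e0 en. Proof. exact: size_word1. Qed.
Let nw1 : forall j, (j < size w1)%N -> nth 0%N w1 j = id (idx n e0 en j).
Proof. by move=> j; apply: nth_word1. Qed.
Let cw1 a b : (a <= n)%N -> (b <= n)%N -> cartan g n (id a) (id b) = ecart n e0 en a b.
Proof. exact: cartan_ends. Qed.
Let tw1 a b : (a <= n)%N -> (b <= n)%N -> (id a == id b :> nat) = (a == b). Proof. by []. Qed.

Definition tst1 (x : 'cV[C]_(size w1)) : state := mst n e0 en (fnat x).
Definition tst2 (y : 'cV[C]_(size w2)) : state := th' (mst n e0' en' (fnat y)).
Definition tnorm1 (st : state) : 'cV[C]_(size w1) := \col_j norm n e0 en st j.
Definition tnorm2 (st : state) : 'cV[C]_(size w2) := \col_j norm n e0' en' (th st) j.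

Let mstP (x : 'cV[C]_(size w1)) : postorus x -> pst (tst1 x).
Proof. by move=> Px; apply: mst_pos => j; apply: fnat_gt0. Qed.
Let mstP' (y : 'cV[C]_(size w2)) : postorus y -> pst (mst n e0' en' (fnat y)).
Proof. by move=> Px; apply: mst_pos => j; apply: fnat_gt0. Qed.

Lemma fnorm1 st : fnat (tnorm1 st) = norm n e0 en st.
Proof. by apply: fnat_col => j; rewrite sw1; apply: norm_out. Qed.
Lemma fnorm2 st : fnat (tnorm2 st) = norm n e0' en' (th st).
Proof. by apply: fnat_col => j; rewrite sw2; apply: norm_out. Qed.

(** The symmetry carries node 0 to the positive node [tau 0], where the formula on letters of the
    target word applies; transported back to the common states it becomes [E] at 0. *)
Lemma twist_state_model :
  state_model (fun st => pst st /\ canon n e0 en st) (E n e0 en (K := C)) (sc n e0 en (K := C))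
    (egam n e0 en (K := C)) (eeps n e0 en (K := C)) tst1 tnorm1 tst2 tnorm2.
Proof.
have c1 x : canon n e0 en (tst1 x) by exact: mst_canon.
have c2 y : canon n e0' en' (mst n e0' en' (fnat (m := size w2) y)) by exact: mst_canon.
have t0n : (0 < tau 0 <= n)%N by rewrite (tw_tau0 TW) (tw_tau TW).
have x0 (x : 'cV[C]_(size w1)) : postorus x -> forall j, fnat x j != 0.
  by move=> Px j; rewrite gt_eqF // fnat_gt0.
have y0 (x : 'cV[C]_(size w2)) : postorus x -> forall j, fnat x j != 0.
  by move=> Px j; rewrite gt_eqF // fnat_gt0.
split.
- by move=> x Px; split; [apply: mstP|].
- by move=> y Py; split; [apply: (tw_pos' TW); apply: mstP'|apply: (tw_canon' TW)].
- by move=> st [Pst _] j; rewrite mxE; apply: norm_gt0.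
- by move=> st [Pst _] j; rewrite mxE; apply: norm_gt0 => //; apply: (tw_pos TW).
- move=> x Px; apply/colP => j; rewrite mxE norm_mst ?fnatE // -?sw1 //.
  by move=> k; apply: fnat_gt0.
- move=> y Py; apply/colP => j; rewrite mxE (tw_K' TW) //; last exact: mstP'.
  by rewrite norm_mst ?fnatE // -?sw2 // => k; apply: fnat_gt0.
- move=> st [Pst cst]; exists (sg n e0 en st); first exact: sg_gt0.
  by rewrite /tst1 fnorm1 mst_norm.
- move=> st [Pst cst]; have Pt := tw_pos TW Pst; exists (sg n e0' en' (th st)); first exact: sg_gt0.
  rewrite /tst2 fnorm2 mst_norm //; last exact: (tw_canon TW).
  by rewrite (tw_sc' TW) ?sg_gt0 // (tw_K TW).
- by move=> s st s0 [Pst cst]; apply/colP => j; rewrite !mxE norm_sc.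
- move=> s st s0 [Pst cst]; apply/colP => j; rewrite !mxE (tw_sc TW) // norm_sc //.
  exact: (tw_pos TW).
- by move=> s st s0 [Pst cst]; split; [apply: sc_pos|apply: sc_canon].
- by move=> i c st lein c0 [Pst cst]; split; [apply: E_pos|apply: E_canon].
- by move=> i c s st lein c0 s0 [Pst cst]; apply: E_sc.
- move=> i c x iin c0 Px; apply/colP => j.
  rewrite (e_parN nok sw1 nw1 cw1 tw1) ?mxE; last by lia.
  by rewrite eN_norm -?sw1 // => k; apply: fnat_gt0.
- move=> c y c0 Py; apply/colP => j; rewrite s0E (e_parN nok' sw2 nw2 cw2 tw2) ?(tw_tau TW) // mxE.
  rewrite eN_norm -?sw2 //; last by move=> k; apply: fnat_gt0.
  rewrite -(tw_E TW) //; last by apply: (tw_pos' TW); apply: mstP'.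
  by rewrite (tw_K' TW) //; apply: mstP'.
- move=> i x iin Px; rewrite (gam_parN nok sw1 nw1 cw1) ?gamN_mst //; lia.
- move=> y Py; rewrite s0E (gam_parN nok' sw2 nw2 cw2) ?(tw_tau TW) // gamN_mst //.
  by rewrite -(tw_gam TW) // (tw_K' TW) //; apply: mstP'.
- move=> i x iin Px; rewrite (eps_parN nok sw1 nw1 cw1 tw1) ?epsN_mst //; [exact: x0|lia].
- move=> y Py; rewrite s0E (eps_parN nok' sw2 nw2 cw2 tw2) ?(tw_tau TW) // epsN_mst //; last exact: y0.
  rewrite -(tw_eps TW) //; last by apply: (tw_pos' TW); apply: mstP'.
  by rewrite (tw_K' TW) //; apply: mstP'.
- by move=> i s st lein s0 [Pst cst]; apply: egam_sc.
- by move=> i s st lein s0 [Pst cst]; apply: eeps_sc.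
- by move=> i c d st lein c0 d0 [Pst cst]; apply: EM.
- by move=> i j c st lein lejn c0 [Pst cst]; rewrite egam_E // -cartan_ends.
- by move=> i c st lein c0 [Pst cst]; apply: eeps_E.
- move=> i j lein lejn A1 A2 c d st c0 d0 [Pst _]; apply: E_comm => //.
  by have [H _] := ecart_br hn gA lein lejn; apply: H.
- move=> i j lein lejn A1 A2 c d st c0 d0 [Pst _].
  have [_ [H1 [H2 _]]] := ecart_br hn gA lein lejn; have [k1 k2] := H2 A1 A2.
  by apply: E_braid3 => //; apply: H1; rewrite A1.
- move=> i j lein lejn A1 A2 c d st c0 d0 [Pst _].
  have [_ [H1 [_ H2]]] := ecart_br hn gA lein lejn; have [k1 k2] := H2 A1 A2.
  by apply: E_braid4 => //; apply: H1; rewrite A1.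
Qed.

End TwistModel.

Lemma vpar_posrat (R : realType) g n (w : seq nat) b i :
  posrat (tspace R[i] (size w)) (fun x => vpar g n b x i ord0).
Proof.
have [p [q [q0 H]]] := @vpar_reg R g n w b i; exists p, q; split=> // s Ps.
by apply: q0; apply: postorus_torus.
Qed.

(** * Existence and uniqueness of the lift of a twist *)

Section TwistLift.
Variables (R : realType) (g : affine_type) (n : nat).
Local Notation C := R[i].
Local Notation w1 := (word1 g n).
Local Notation w2 := (tgt_word g n).
Local Notation b2 := (tgt_base g n).
Local Notation e0 := (left_end g).
Local Notation en := (right_end g).
Local Notation state := ((nat -> C) * (nat -> C))%type.
Variables (e0' en' : endtype) (tau t2 : nat -> nat) (th th' : state -> state).
Variables (lbl lbl2 : wlabel -> wlabel) (M : 'M[C]_(dimW g n)).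
Hypothesis hn : (min_rank g <= n)%N.
Hypothesis gA : g <> tyA1.
Hypothesis TW : twist n e0 en e0' en' tau th th' lbl.
Hypothesis TR : forall m (X : pspace C m) f, ratst X f -> ratst X (fun s => th (f s)).
Hypothesis TR' : forall m (X : pspace C m) f, ratst X f -> ratst X (fun s => th' (f s)).
Hypothesis sw2 : size w2 = wsize n e0' en'.
Hypothesis nw2 : forall j, (j < size w2)%N -> nth 0%N w2 j = t2 (idx n e0' en' j).
Hypothesis cw2 : forall a b, (a <= n)%N -> (b <= n)%N -> cartan g n (t2 a) (t2 b) = ecart n e0' en' a b.
Hypothesis tw2 : forall a b, (a <= n)%N -> (b <= n)%N -> (t2 a == t2 b) = (a == b).
Hypothesis vE2 : forall y : 'cV[C]_(size w2), torus C _ y ->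
  vpar g n b2 y = gcol g n (fun b => vst n e0' en' (mst n e0' en' (fnat y)) (lbl2 b)).
Hypothesis lbl2P : forall b, oklabel n e0' en' b -> lbl2 b \in Defs.basis g n /\ lbl2 (lbl2 b) = b.
Hypothesis lbl2P' : forall b, oklabel n e0 en b -> oklabel n e0' en' (lbl2 b).
Hypothesis ME : forall x : 'cV[C]_(size w1), torus C _ x -> M *m vpar g n (V 1) x =
  gcol g n (fun b => vst n e0 en (mst n e0 en (fnat x)) (lbl (lbl2 b))).

Let nok : rank_ok n e0 en. Proof. exact: rank_ok_ends. Qed.
Let nok' : rank_ok n e0' en'. Proof. exact: tw_ok TW. Qed.
Let sw1 : size w1 = wsize n e0 en. Proof. exact: size_word1. Qed.

Local Notation st1 := (@tst1 R g n).
Local Notation nm2 := (tnorm2 g n e0' en' th).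
Local Notation MS := (mS st1 nm2).
Local Notation T1 := (tspace C (size w1)).
Local Notation T2 := (tspace C (size w2)).

(** The function a in the definition of sigma-bar: the factor that brings the twisted state into the
    gauge of the target. *)
Definition lift_scale (x : 'cV[C]_(size w1)) : C := sg n e0' en' (th (st1 x)).

Lemma mS_rat i : posrat T1 (fun x => MS x i ord0).
Proof.
apply: (@rat_on_ext _ _ _ _ (fun x => norm n e0' en' (th (st1 x)) i)).
  by move=> x _; rewrite [RHS]mxE.
by apply: posrat_norm; apply: TR; apply: ratst_mst.
Qed.

Lemma mS'_rat i : posrat T2 (fun y => mS' (@tnorm1 R g n) (tst2 e0' en' th') y i ord0).
Proof.
apply: (@rat_on_ext _ _ _ _ (fun y => norm n e0 en (th' (mst n e0' en' (fnat y))) i)).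
  by move=> x _; rewrite [RHS]mxE.
by apply: posrat_norm; apply: TR'; apply: ratst_mst.
Qed.

Let stP x : postorus x -> pst (st1 x) /\ canon n e0 en (st1 x).
Proof. by move=> Px; split; [apply: mst_pos => j; apply: fnat_gt0|apply: mst_canon]. Qed.

Lemma mS_map : posmap T1 T2 MS.
Proof.
apply: posmap_tspace mS_rat _ => x Px i; rewrite [X in 0 < X]mxE; apply: norm_gt0 => //.
by apply: (tw_pos TW); case: (stP Px).
Qed.

Lemma lift_scale_rat : posrat T1 lift_scale.
Proof. by apply: posrat_sg; apply: TR; apply: ratst_mst. Qed.

Lemma lift_scale_gt0 x : postorus x -> 0 < lift_scale x.
Proof. by move=> Px; apply: sg_gt0; apply: (tw_pos TW); case: (stP Px). Qed.

Let mst_mS x : postorus x ->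
  mst n e0' en' (fnat (MS x)) = sc n e0' en' (lift_scale x) (th (st1 x)).
Proof.
move=> Px; have [Pst cst] := stP Px.
rewrite /mS (fnorm2 _ sw2) mst_norm //; first exact: (tw_pos TW).
exact: (tw_canon TW).
Qed.

Lemma lift_at x : postorus x -> vpar g n b2 (MS x) = lift_scale x *: (M *m vpar g n (V 1) x).
Proof.
move=> Px; have [Pst cst] := stP Px; have l0 := lift_scale_gt0 Px.
have PS : postorus (MS x) by apply: (posmap_pos mS_map).
apply: etrans (vE2 (postorus_torus PS)) _.
apply: etrans (congr1 (fun u => lift_scale x *: u) (esym (ME (postorus_torus Px)))).
rewrite mst_mS //; apply/matrixP => a k; rewrite !mxE.
have okb : oklabel n e0 en (lab a) by rewrite -mem_basis // lab_mem.
have okb2 := lbl2P' okb; rewrite vst_sc //; congr (_ * _).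
by rewrite -{1}(tw_lblK' TW okb2) (tw_vst TW) //; apply: (tw_lbl' TW).
Qed.

Lemma lift_generic : generically (torus C _) (fun x =>
  vpar g n b2 (MS x) = lift_scale x *: (M *m vpar g n (V 1) x)).
Proof.
apply: (@posgen_generically _ _ T1); apply: posrat_eqv; last exact: lift_at.
  move=> i; exact: (posrat_comp mS_map (@vpar_posrat R g n w2 b2 i)).
move=> i; apply: (@rat_on_ext _ _ _ _ (fun x => lift_scale x * \sum_k M i k * vpar g n (V 1) x k ord0)).
  by move=> x _; rewrite !mxE.
apply: rat_onM; first exact: lift_scale_rat.
by apply: rat_on_sum => k _; apply: rat_onM; [apply: rat_on_cst|exact: (@vpar_posrat R g n w1 (V 1) k)].
Qed.

Lemma eps_at i x : (0 < i <= n)%N -> (0 < tau i)%N -> postorus x ->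
  eps_par g n (t2 (tau i)) (MS x) = eps_par g n i x /\ eps_par g n i x != 0.
Proof.
move=> iin ti Px; have [Pst cst] := stP Px; have l0 := lift_scale_gt0 Px.
have PS : postorus (MS x) by apply: (posmap_pos mS_map).
have lein : (i <= n)%N by lia.
have tn := tw_tau TW lein.
rewrite (eps_parN nok' sw2 nw2 cw2 tw2) // epsN_mst ?ti //; last first.
  by move=> j; rewrite gt_eqF // fnat_gt0.
rewrite mst_mS // eeps_sc //; last exact: (tw_pos TW).
rewrite (tw_eps TW) //.
rewrite (eps_parN (t := id) nok sw1 (@nth_word1 g n hn gA) (fun a b => @cartan_ends g n hn a b gA) (fun a b _ _ => erefl)) //.
rewrite epsN_mst //; last by move=> j; rewrite gt_eqF // fnat_gt0.
by split=> //; rewrite gt_eqF // eeps_gt0.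
Qed.

(** That epsilon_i does not vanish is recorded along with the equality, because [vst_scale] asks for
    it at a long end. *)
Lemma eps_generic : generically (torus C _) (fun x => forall i : 'I_n.+1, (0 < i)%N -> (0 < tau i)%N ->
  eps_par g n (t2 (tau i)) (MS x) = eps_par g n i x /\ eps_par g n i x != 0).
Proof.
apply: (@posgen_generically _ _ T1); apply: posgen_allord => i.
have [i0|i0] := boolP ((0 < i)%N && (0 < tau i)%N); last first.
  by apply: posgen_true => x _ i1 i2; rewrite i1 i2 in i0.
have {i0}[i1 i2] := andP i0; have iin : (0 < i <= n)%N by rewrite i1 -ltnS ltn_ord.
have H1 : posgen T1 (fun x => eps_par g n (t2 (tau i)) (MS x) = eps_par g n i x).
  apply: posrat_eq; last by move=> x Px; case: (eps_at iin i2 Px).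
    exact: (posrat_comp mS_map (eps_par_rat _ _ _ _ _)).
  exact: eps_par_rat.
have H2 : posgen T1 (fun x => eps_par g n i x != 0).
  by apply: posrat_neq0; [exact: eps_par_rat|move=> x Px; case: (eps_at iin i2 Px)].
by apply: posgenS (posgenI H1 H2) => x _ H _ _.
Qed.

(** Two lifts have proportional vectors, and [vst_scale] shows that the factor is 1. At a long end
    of the target this takes a comparison of epsilon_1, so the node 1 must be the image of some i >
    0, whose epsilon is prescribed. *)
Lemma lift_unique (y : 'cV[C]_(size w1) -> 'cV[C]_(size w2)) (a : 'cV[C]_(size w1) -> C) :
    (isL e0' -> exists2 i, (0 < i <= n)%N & tau i = 1%N) ->
    generically (torus C _) (fun x => torus C _ (y x)) ->
    generically (torus C _) (fun x => vpar g n b2 (y x) = a x *: (M *m vpar g n (V 1) x) /\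
      (isL e0' -> forall i, (0 < i <= n)%N -> (0 < tau i)%N ->
         eps_par g n (t2 (tau i)) (y x) = eps_par g n i x)) ->
  generically (torus C _) (fun x => y x = MS x).
Proof.
move=> HL G1 G2.
have G3 := posgen_generically (posmap_car mS_map).
have G4 : generically (torus C (size w1)) (fun x => lift_scale x != 0).
  apply: (@posgen_generically _ _ T1); apply: posrat_neq0; first exact: lift_scale_rat.
  by move=> x Px; rewrite gt_eqF // lift_scale_gt0.
have G := generically_and (X := T1) (generically_and (X := T1) (generically_and (X := T1) G1 G2) (generically_and (X := T1) G3 G4))
  (generically_and (X := T1) lift_generic eps_generic).
apply: (generically_impl (X := T1)) G => x Tx [[[Ty [Ey HE]] [TS a0]] [ES HES]].
have k0 : vpar g n b2 (y x) = (a x / lift_scale x) *: vpar g n b2 (MS x).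
  apply: etrans Ey _; apply: esym; apply: etrans (congr1 (fun u => (a x / lift_scale x) *: u) ES) _.
  by rewrite scalerA divfK.
have vs u s b : vcoef (g := g) (n := n) (s *: u) b = s * vcoef u b :> C.
  by rewrite /vcoef mulr_sumr; apply: eq_bigr => i _; rewrite mxE mulrCA.
apply/colP => j; rewrite -!fnatE.
apply: (@vst_scale n e0' en' C nok' _ _ (a x / lift_scale x)).
- exact: fnat_neq0.
- exact: fnat_neq0.
- move=> b okb; rewrite -(cfv_state lbl2P vE2 Ty) // -(cfv_state lbl2P vE2 TS) //.
  apply: etrans (congr1 (fun u => vcoef u (lbl2 b)) k0) _; exact: vs.
- move=> L0; have [i iin ti] := HL L0; have n1 : (1 <= n)%N by lia.
  have lein : (i < n.+1)%N by lia.
  have i0 : (0 < i)%N by lia.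
  have ti0 : (0 < tau i)%N by rewrite ti.
  have [E1 n0] := HES (Ordinal lein) i0 ti0.
  have E2 := HE L0 i iin ti0.
  rewrite /= ti in E1 E2.
  have EE (z : 'cV[C]_(size w2)) : torus C _ z -> eps_par g n (t2 1) z = eeps n e0' en' 1 (mst n e0' en' (fnat z)).
    move=> Tz; rewrite (eps_parN nok' sw2 nw2 cw2 tw2) ?epsN_mst ?n1 //; exact: fnat_neq0.
  rewrite -!EE // E1 E2; by split.
- by rewrite -sw2.
Qed.

End TwistLift.

(** * Positivity of the scale factor *)

Section PosLaurent.
Variables (R : realType) (r : nat).
Local Notation C := R[i].
Implicit Types f h : 'cV[C]_r -> C.

Lemma pos_laurent1 : pos_laurent (fun _ : 'cV[C]_r => 1).
Proof.
exists [:: (1, 0)]; split=> //=; first by rewrite ltr01.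
by move=> x _; rewrite big_seq1 mul1r /torus_char big1 // => j _; rewrite mxE.
Qed.

Lemma pos_laurent_coord i : pos_laurent (fun x : 'cV[C]_r => x i ord0).
Proof.
exists [:: (1, delta_mx i ord0)]; split=> //=; first by rewrite ltr01.
move=> x _; rewrite big_seq1 mul1r /torus_char (bigD1 i) //= mxE !eqxx expr1z big1 ?mulr1 // => j ji.
by rewrite mxE (negbTE ji).
Qed.

Lemma pos_laurentD f h : pos_laurent f -> pos_laurent h -> pos_laurent (fun x => f x + h x).
Proof.
move=> [s [s0 sp sE]] [t [t0 tp tE]]; exists (s ++ t); split.
- by case: (s) s0.
- by rewrite all_cat sp.
- by move=> x Tx; rewrite big_cat /= sE // tE.
Qed.

Lemma pos_laurentM f h : pos_laurent f -> pos_laurent h -> pos_laurent (fun x => f x * h x).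
Proof.
move=> [s [s0 sp sE]] [t [t0 tp tE]]; exists [seq (a.1 * b.1, a.2 + b.2) | a <- s, b <- t]; split.
- by rewrite -size_eq0 size_allpairs muln_eq0 !size_eq0 negb_or s0.
- apply/allP => _ /allpairsP[[a b] /= [sa tb ->]] /=.
  by rewrite mulr_gt0 //; [apply: (allP sp)|apply: (allP tp)].
- move=> x Tx; rewrite big_allpairs_dep sE // tE // mulr_suml; apply: eq_bigr => a _.
  by rewrite mulr_sumr; apply: eq_bigr => b _ /=; rewrite torus_charD // mulrACA.
Qed.

Lemma pos_laurentX f k : pos_laurent f -> pos_laurent (fun x => f x ^+ k).
Proof.
move=> Hf; elim: k => [|k IH]; first by under eq_fun => x do rewrite expr0; exact: pos_laurent1.
by under eq_fun => x do rewrite exprS; exact: pos_laurentM.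
Qed.

Lemma pos_laurent_prod (s : seq nat) (P : pred nat) (F : nat -> 'cV[C]_r -> C) :
  (forall j, pos_laurent (F j)) -> pos_laurent (fun x => \prod_(j <- s | P j) F j x).
Proof.
move=> H; elim: s => [|j s IH]; first by under eq_fun => x do rewrite big_nil; exact: pos_laurent1.
under eq_fun => x do rewrite big_cons.
by case: (P j) => //; apply: pos_laurentM.
Qed.

Lemma pos_laurent_y n e0 en j : pos_laurent (fun x : 'cV[C]_r => (mst n e0 en (fnat x)).1 j).
Proof.
apply: pos_laurent_prod => k; rewrite /fnat; case: insub => [o|]; last exact: pos_laurent1.
exact: pos_laurent_coord.
Qed.

Lemma pos_laurent_p n e0 en l : pos_laurent (fun x : 'cV[C]_r => (mst n e0 en (fnat x)).2 l).
Proof.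
rewrite /=; case: (okp n e0 en l); last exact: pos_laurent1.
apply: pos_laurentX; rewrite /fnat; case: insub => [o|]; last exact: pos_laurent1.
exact: pos_laurent_coord.
Qed.

Lemma pos_laurent_blev n e0 en l :
  pos_laurent (fun x : 'cV[C]_r => blev n e0 en (mst n e0 en (fnat x)).1 l).
Proof.
by apply: pos_laurentD; apply: pos_laurent_prod => j; apply: pos_laurentX; exact: pos_laurent_y.
Qed.

Lemma pos_ratfun_swp n en :
  pos_ratfun (fun x : 'cV[C]_r => sg n Fork en (swp (mst n Fork en (fnat x)))).
Proof.
exists (fun=> 1), (fun x => (mst n Fork en (fnat x)).1 1%N); split.
- exact: pos_laurent1.
- exact: pos_laurent_y.
- by move=> x _; rewrite /sg [isF _]/= mul1r.
Qed.

(** For the reflected state p_0 / y_0^kap reads q_(n-1) / y_n^kap, and q_(n-1) is (w_(n-1) + w_n) /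
    p_(n-1). *)
Lemma pos_ratfun_fl n e0 en : rank_ok n e0 en -> ~~ isF e0 -> ~~ isF en ->
  pos_ratfun (fun x : 'cV[C]_r => sg n en e0 (fl n e0 en (mst n e0 en (fnat x)))).
Proof.
move=> nok F0 Fn; exists (fun x => blev n e0 en (mst n e0 en (fnat x)).1 n.-1),
  (fun x => (mst n e0 en (fnat x)).2 n.-1 * (mst n e0 en (fnat x)).1 n ^+ kap n en e0 0); split.
- exact: pos_laurent_blev.
- by apply: pos_laurentM; [exact: pos_laurent_p|apply: pos_laurentX; exact: pos_laurent_y].
- move=> x _; rewrite /sg (negbTE Fn); move: (mst _ _ _ _) => st.
  have -> : (fl n e0 en st).2 0%N = qst n e0 en st n.-1.
    by rewrite /= (ok0 (rank_ok_sym nok) Fn) subn0.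
  have -> : (fl n e0 en st).1 0%N = st.1 n by rewrite /= subn0.
  by rewrite /qst invfM mulrA.
Qed.

End PosLaurent.

Section TwistLiftData.
Variables (R : realType) (g : affine_type) (n : nat).
Local Notation C := R[i].
Local Notation w1 := (word1 g n).
Local Notation w2 := (tgt_word g n).
Local Notation b2 := (tgt_base g n).
Local Notation e0 := (left_end g).
Local Notation en := (right_end g).
Local Notation state := ((nat -> C) * (nat -> C))%type.
Variables (e0' en' : endtype) (tau t2 : nat -> nat) (th th' : state -> state).
Variables (lbl lbl2 : wlabel -> wlabel) (M : 'M[C]_(dimW g n)).
Hypothesis hn : (min_rank g <= n)%N.
Hypothesis gA : g <> tyA1.
Hypothesis TW : twist n e0 en e0' en' tau th th' lbl.
Hypothesis TR : forall m (X : pspace C m) f, ratst X f -> ratst X (fun s => th (f s)).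
Hypothesis TR' : forall m (X : pspace C m) f, ratst X f -> ratst X (fun s => th' (f s)).
Hypothesis sw2 : size w2 = wsize n e0' en'.
Hypothesis nw2 : forall j, (j < size w2)%N -> nth 0%N w2 j = t2 (idx n e0' en' j).
Hypothesis cw2 : forall a b, (a <= n)%N -> (b <= n)%N -> cartan g n (t2 a) (t2 b) = ecart n e0' en' a b.
Hypothesis tw2 : forall a b, (a <= n)%N -> (b <= n)%N -> (t2 a == t2 b) = (a == b).
Hypothesis s0E : sigma_index g n 0 = t2 (tau 0).
Hypothesis s0w : sigma_index g n 0 \in w2.
Hypothesis vE2 : forall y : 'cV[C]_(size w2), torus C _ y ->
  vpar g n b2 y = gcol g n (fun b => vst n e0' en' (mst n e0' en' (fnat y)) (lbl2 b)).
Hypothesis lbl2P : forall b, oklabel n e0' en' b -> lbl2 b \in Defs.basis g n /\ lbl2 (lbl2 b) = b.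

Local Notation MS := (mS (@tst1 R g n) (tnorm2 g n e0' en' th)).

Lemma twist_lift_data : is_sigma_lift MS ->
    (forall y, is_sigma_lift y -> generically (torus C _) (fun x => y x = MS x)) ->
  exists S S' cf1 cf2, @lift_data R g n S S' cf1 cf2.
Proof.
move=> HL HU; have nok := rank_ok_ends hn gA; have nok' := tw_ok TW.
have id_ok b : oklabel n e0 en b -> id b \in Defs.basis g n /\ id (id b) = b.
  by rewrite -mem_basis.
have vE1 (x : 'cV[C]_(size w1)) : torus C _ x ->
    vpar g n (V 1) x = gcol g n (fun b => vst n e0 en (mst n e0 en (fnat x)) (id b)).
  exact: (@vpar_word1 R g n hn gA x).
have SM := twist_state_model hn gA TW sw2 nw2 cw2 tw2 s0E.
exists MS, (mS' (@tnorm1 R g n) (tst2 e0' en' th')),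
  (@cfv R g n e0 en w1 id), (@cfv R g n e0' en' w2 lbl2).
apply: (model_lift_data SM) => //.
- exact: (mS_rat e0' en' TR).
- exact: (mS'_rat e0' en' TR').
- exact: (cfv_rat nok id_ok vE1).
- exact: (cfvK nok (size_word1 hn gA) id_ok vE1).
- exact: (cfv_rat nok' lbl2P vE2).
- exact: (cfvK nok' sw2 lbl2P vE2).
- by move=> i iin; apply: mem_word1.
- exact: cartan_rank2.
Qed.

End TwistLiftData.

(** * Types whose target variety is the source *)

Section SelfTarget.
Variables (R : realType) (g : affine_type) (n : nat).
Local Notation C := R[i].
Hypothesis gd : g <> tyAeven2d.

(** The word and base vector of the target agree with those of the source only after a case
    distinction on [g], and the types of the vectors depend on them; so statements are transported
    as predicates in both. *)
Lemma tgt_self (P : seq nat -> wlabel -> Prop) : P (word1 g n) (V 1) -> P (tgt_word g n) (tgt_base g n).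
Proof. by case: (g) gd. Qed.

Lemma is_sigma_liftE (y : 'cV[C]_(size (word1 g n)) -> 'cV[C]_(size (tgt_word g n))) :
  is_sigma_lift y <->
  ratmap (torus C _) (torus C _) y /\ exists a, pos_ratfun a /\
  generically (torus C _) (fun x =>
    vpar g n (tgt_base g n) (y x) = a x *: sigma_W (vpar g n (V 1) x) /\
    forall i, (0 < i <= n)%N -> sigma_index g n i != 0%N ->
      eps_par g n (sigma_index g n i) (y x) = eps_par g n i x).
Proof. by rewrite /is_sigma_lift; move: y; case: (g) gd. Qed.

End SelfTarget.

(** [sl] is the inverse of the permutation of labels, which in type A is not an involution: the
    coefficient of sigma(u) at b is that of u at the preimage of b. *)
Lemma sigma_gcol (R : realType) g n sl G :
    (forall b, b \in Defs.basis g n -> [/\ sl b \in Defs.basis g n,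
      sigma_label g n (sl b) = b & sl (sigma_label g n b) = b]) ->
  sigma_W (gcol g n G) = gcol g n (fun b => G (sl b)) :> 'cV[R[i]]_(dimW g n).
Proof.
move=> H; apply/matrixP => a k; rewrite ord1 /sigma_W mxE [RHS]mxE.
have [la ll _] := H _ (lab_mem a).
rewrite -(vcoef_gcol G la) /vcoef; apply: eq_bigr => j _; rewrite mxE; congr ((nat_of_bool _)%:R * _).
have [_ _ llj] := H _ (lab_mem j).
by apply/eqP/eqP => E; [rewrite E llj|rewrite E ll].
Qed.

Section SelfTwist.
Variables (R : realType) (g : affine_type) (n : nat).
Local Notation C := R[i].
Local Notation w1 := (word1 g n).
Local Notation w2 := (tgt_word g n).
Local Notation e0 := (left_end g).
Local Notation en := (right_end g).
Local Notation state := ((nat -> C) * (nat -> C))%type.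
Variables (tau : nat -> nat) (th th' : state -> state).
Hypothesis hn : (min_rank g <= n)%N.
Hypothesis gA : g <> tyA1.
Hypothesis gd : g <> tyAeven2d.
Hypothesis TW : twist n e0 en e0 en tau th th' (sigma_label g n).
Hypothesis TR : forall m (X : pspace C m) f, ratst X f -> ratst X (fun s => th (f s)).
Hypothesis TR' : forall m (X : pspace C m) f, ratst X f -> ratst X (fun s => th' (f s)).
Hypothesis tauE : forall i, (i <= n)%N -> sigma_index g n i = tau i.
Hypothesis PR : pos_ratfun (lift_scale e0 en th (R := R) (g := g) (n := n)).
Hypothesis HL : isL e0 -> exists2 i, (0 < i <= n)%N & tau i = 1%N.

Lemma self_lift_data : exists S S' cf1 cf2, @lift_data R g n S S' cf1 cf2.
Proof.
have nok := rank_ok_ends hn gA.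
have sw2 : size w2 = wsize n e0 en.
  exact: (tgt_self gd (P := fun w _ => size w = wsize n e0 en) (size_word1 hn gA)).
have nw2 : forall j, (j < size w2)%N -> nth 0%N w2 j = id (idx n e0 en j).
  exact: (tgt_self gd (P := fun w _ => forall j, (j < size w)%N -> nth 0%N w j = id (idx n e0 en j))
    (nth_word1 hn gA)).
have cw2 a b : (a <= n)%N -> (b <= n)%N -> cartan g n (id a) (id b) = ecart n e0 en a b.
  exact: cartan_ends.
have tw2 a b : (a <= n)%N -> (b <= n)%N -> (id a == id b :> nat) = (a == b) by [].
have vE2 : forall y : 'cV[C]_(size w2), torus C _ y -> vpar g n (tgt_base g n) y =
    gcol g n (fun b => vst n e0 en (mst n e0 en (fnat y)) (id b)).
  exact: (tgt_self gd (P := fun w b0 => forall y : 'cV[C]_(size w), torus C _ y ->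
    vpar g n b0 y = gcol g n (fun b => vst n e0 en (mst n e0 en (fnat y)) (id b)))
    (@vpar_word1 R g n hn gA)).
have id_ok b : oklabel n e0 en b -> id b \in Defs.basis g n /\ id (id b) = b by rewrite -mem_basis.
have lblB b : b \in Defs.basis g n -> [/\ sigma_label g n b \in Defs.basis g n,
    sigma_label g n (sigma_label g n b) = b & sigma_label g n (sigma_label g n b) = b].
  by rewrite !mem_basis // => okb; split; [apply: (tw_lbl TW)|apply: (tw_lblK TW)|apply: (tw_lblK TW)].
have id_ok' b : oklabel n e0 en b -> oklabel n e0 en (id b) by [].
pose M : 'M[C]_(dimW g n) := \matrix_(a, b) (lab a == sigma_label g n (lab b))%:R.
have ME : forall x : 'cV[C]_(size w1), torus C _ x -> M *m vpar g n (V 1) x =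
    gcol g n (fun b => vst n e0 en (mst n e0 en (fnat x)) (sigma_label g n (id b))).
  move=> x Tx; apply: etrans (congr1 (fun u => M *m u) (vpar_word1 hn gA Tx)) _.
  exact: (sigma_gcol _ lblB).
have s0w : sigma_index g n 0 \in w2.
  apply: (tgt_self gd (P := fun w _ => sigma_index g n 0 \in w)).
  by rewrite tauE // mem_word1 // (tw_tau0 TW) (tw_tau TW).
apply: (twist_lift_data hn gA TW TR TR' sw2 nw2 cw2 tw2 (tauE (leq0n n)) s0w vE2 id_ok).
  apply/(is_sigma_liftE gd); split; first exact: (posmap_ratmap (mS_map hn gA TW TR)).
  exists (lift_scale e0 en th (R := R) (g := g) (n := n)); split=> //.
  have G := generically_and (X := tspace C _) (lift_generic hn gA TW TR sw2 vE2 id_ok' ME)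
    (eps_generic hn gA TW TR sw2 nw2 cw2 tw2).
  apply: (generically_impl (X := tspace C _)) G => x _ [E1 E2]; split=> // i /andP[i0 lein].
  rewrite tauE // -lt0n => ti; have lein' : (i < n.+1)%N by [].
  by have [] := E2 (Ordinal lein') i0 ti.
move=> y /(is_sigma_liftE gd)[[_ Ty] [a [_ Ha]]].
apply: (lift_unique hn gA TW TR sw2 nw2 cw2 tw2 vE2 id_ok id_ok' ME (a := a)) => //.
apply: (generically_impl (X := tspace C _)) Ha => x _ [E1 E2]; split=> // _ i iin ti.
have lein : (i <= n)%N by case/andP: iin.
by rewrite -(tauE lein) E2 // tauE // -lt0n.
Qed.

End SelfTwist.

Lemma lift_data_swp (R : realType) g n : (min_rank g <= n)%N -> left_end g = Fork ->
  exists S S' cf1 cf2, @lift_data R g n S S' cf1 cf2.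
Proof.
move=> hn F0; have gA : g <> tyA1 by move=> E; rewrite E in F0.
have gd : g <> tyAeven2d by move=> E; rewrite E in F0.
have nok := rank_ok_ends hn gA; rewrite F0 in nok.
have TW := twist_swp (R[i]) nok.
have lE : sigma_label tyB1 n = sigma_label g n by case: (g) F0.
rewrite lE -F0 in TW; apply: (self_lift_data hn gA gd TW).
- by move=> m X f; apply: ratst_swp.
- by move=> m X f; apply: ratst_swp.
- by move=> i _; case: (g) F0.
- rewrite /lift_scale /tst1 F0; exact: pos_ratfun_swp.
- by rewrite F0.
Qed.

Lemma lift_data_flC (R : realType) n : (2 <= n)%N ->
  exists S S' cf1 cf2, @lift_data R tyC1 n S S' cf1 cf2.
Proof.
move=> hn; have nok : rank_ok n Long Long by rewrite /rank_ok /= !addn0.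
apply: (self_lift_data (g := tyC1) (hn : (min_rank tyC1 <= n)%N) _ _
  (twist_fl (R[i]) nok isT isT : twist n (left_end tyC1) (right_end tyC1) (left_end tyC1) (right_end tyC1) _ _ _ (sigma_label tyC1 n))) => //.
- by move=> m X f; apply: ratst_fl.
- by move=> m X f; apply: ratst_fl.
- exact: pos_ratfun_fl.
(* The reflection takes n - 1 to the node 1, whose epsilon fixes the factor at the long end. *)
- by move=> _; exists n.-1; lia.
Qed.

Lemma lift_data_flD (R : realType) n : (2 <= n)%N ->
  exists S S' cf1 cf2, @lift_data R tyD2 n S S' cf1 cf2.
Proof.
move=> hn; have nok : rank_ok n Short Short by rewrite /rank_ok /= !addn0.
apply: (self_lift_data (g := tyD2) (hn : (min_rank tyD2 <= n)%N) _ _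
  (twist_fl (R[i]) nok isT isT : twist n (left_end tyD2) (right_end tyD2) (left_end tyD2) (right_end tyD2) _ _ _ (sigma_label tyD2 n))) => //.
- by move=> m X f; apply: ratst_fl.
- by move=> m X f; apply: ratst_fl.
- exact: pos_ratfun_fl.
Qed.

(** The reflection and the relabelling [t2] of the second word cancel, so node 0 stays 0. No sigma
    acts on W here and the matrix is the identity. The reversed diagram has a short end at 0, so the
    vector alone determines the lift, in accordance with the definition of sigma-bar for this
    type. *)
Lemma lift_data_flA (R : realType) n : (2 <= n)%N ->
  exists S S' cf1 cf2, @lift_data R tyAeven2d n S S' cf1 cf2.
Proof.
move=> hn; have nok : rank_ok n Long Short by rewrite /rank_ok /= !addn0.
have hn' : (min_rank tyAeven2d <= n)%N by [].
have gA : tyAeven2d <> tyA1 by [].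
have TW := twist_fl (R[i]) nok isT isT.
have TR m (X : pspace R[i] m) f : ratst X f -> ratst X (fun s => fl n Long Short (f s)) by apply: ratst_fl.
have TR' m (X : pspace R[i] m) f : ratst X f -> ratst X (fun s => fl n Short Long (f s)) by apply: ratst_fl.
pose t2 i := (n - i)%N.
have cw2 a b : (a <= n)%N -> (b <= n)%N -> cartan tyAeven2d n (t2 a) (t2 b) = ecart n Short Long a b.
  by move=> an bn; rewrite cartan_ends ?leq_subr // (ecart_flip (rank_ok_sym nok)).
have tw2 a b : (a <= n)%N -> (b <= n)%N -> (t2 a == t2 b) = (a == b) by rewrite /t2; lia.
have s0E : sigma_index tyAeven2d n 0 = t2 (n - 0)%N by rewrite /t2 subKn.
have lblP b : oklabel n Short Long b -> sigma_label tyC1 n b \in Defs.basis tyAeven2d n /\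
    sigma_label tyC1 n (sigma_label tyC1 n b) = b.
  move=> okb; rewrite mem_basis //; split; first exact: (tw_lbl' TW).
  exact: (tw_lblK' TW).
have lblP' b : oklabel n Long Short b -> oklabel n Short Long (sigma_label tyC1 n b) by exact: (tw_lbl TW).
have ME : forall x : 'cV[R[i]]_(size (word1 tyAeven2d n)), torus R[i] _ x ->
    1%:M *m vpar tyAeven2d n (V 1) x = gcol tyAeven2d n
      (fun b => vst n Long Short (mst n Long Short (fnat x)) (sigma_label tyC1 n (sigma_label tyC1 n b))).
  move=> x Tx; apply: etrans (mul1mx _) _; apply: etrans (vpar_word1 hn' gA Tx) _.
  by apply: eq_gcol => b; rewrite mem_basis // => okb; rewrite (tw_lblK TW).
have sw2 := size_word2 hn; have nw2 := @nth_word2 n hn.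
have vE2 := @vpar_word2 R n hn.
apply: (twist_lift_data (g := tyAeven2d) hn' gA TW TR TR' sw2 nw2 cw2 tw2 s0E (mem_word2 n) vE2 lblP).
  split; first exact: (posmap_ratmap (mS_map hn' gA TW TR)).
  exists (lift_scale (g := tyAeven2d) Short Long (@fl n Long Short R[i])); split.
    by apply: (@posrat_ratfun _ _ (tspace _ _)); apply: lift_scale_rat.
  have G := lift_generic hn' gA TW TR sw2 vE2 lblP' ME.
  apply: (generically_impl (X := tspace _ _)) G => x _ E1; apply: etrans E1 _.
  by congr (_ *: _); apply: mul1mx.
move=> y [[_ Ty] [a [_ Ha]]].
apply: (lift_unique hn' gA TW TR sw2 nw2 cw2 tw2 vE2 lblP lblP' ME (a := a)) => //.
apply: (generically_impl (X := tspace _ _)) Ha => x _ E1; split=> //; apply: etrans E1 _.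
by congr (_ *: _); apply: esym; apply: mul1mx.
Qed.

(** * Type A *)

Section TypeAVector.
Variables (R : realType) (n : nat).
Hypothesis hn : (2 <= n)%N.
Local Notation C := R[i].
Local Notation g := tyA1.
Implicit Types (x z : nat -> C) (G : wlabel -> C).

Lemma fop_A i G b : (0 < i <= n)%N -> fop g n i G b =
  if b is V j then if j == i.+1 then G (V i) else 0 else 0.
Proof.
move=> iin; rewrite /fop /arrows big_cat big_map /= (sum_iota1 (fun k => 1 * G (V k)) (fun k => V k.+1 == b)).
rewrite big_cons big_nil /= (_ : (0 == i)%N = false); last by lia.
rewrite (_ : (1 <= i < 1 + n)%N); last by lia.
by case: b => [j|j||]; rewrite ?wlabel_eqE ?mul1r ?addr0 // [j == _]eq_sym.
Qed.

Lemma wt_A i j : (0 < i <= n)%N -> (0 < j <= n.+1)%N ->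
  wt g n (V j) i = if j == i then 1 else if j == i.+1 then -1 else 0.
Proof. by move=> iin jn; rewrite /= /wtV /Lam; case_ifs; lia. Qed.

Lemma Y_A i c G : (0 < i <= n)%N -> c != 0 -> Y g n i c *m gcol g n G = gcol g n (mid i c G).
Proof.
move=> iin c0; have F H b := fop_A H b iin.
have F2 (H : wlabel -> C) b : fop g n i (fop g n i H) b = 0.
  by rewrite !F; case: b => [j|j||] //; rewrite (ltn_eqF (ltnSn i)) if_same.
rewrite Y_gcol; [|exact: hn|by move=> b _; rewrite F2].
apply: eq_gcol => b; rewrite mem_basisA // => bok; rewrite F2 !mulr0 addr0 F /wop /mid.
case: b bok => [j|//|//|//] jn; rewrite wt_A //.
case: (eqVneq j i) => [->|ji]; first by rewrite (ltn_eqF (ltnSn i)) mulr0 addr0 expr1z.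
case: (eqVneq j i.+1) => [->|ji1]; last by rewrite mulr0 addr0 expr0z mul1r.
rewrite wt_A ?eqxx; [|by lia|by lia].
by rewrite expr1z mulKf // exprN1.
Qed.

(* The coefficient of v_i for 0 < i <= n, and that of v_(n+1) for i = 0.       *)
Definition zst x (i : nat) : C := if (0 < i <= n)%N then x (n - i)%N else 1.
Definition zvec z (b : wlabel) : C := if b is V j then z (if j == n.+1 then 0%N else j) else 0.
Definition zpart x k (b : wlabel) : C :=
  if b is V j then if (j <= k)%N then x (n - j)%N else if j == k.+1 then 1 else 0 else 0.

(** Before the letter i is applied the coefficient of v_i is 1 and that of v_(i+1) is 0; the former
    becomes the letter, and v_(i+1) receives the new 1. *)
Lemma run_A x k : (forall j, x j != 0) -> (k <= n)%N ->
  (\prod_(j <- iota (n - k) k) Y g n (n - j) (x j)) *m gcol g n (zpart x 0) = gcol g n (zpart x k).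
Proof.
move=> x0; elim: k => [|k IH] kn; first by rewrite big_nil; exact: mul1mx.
rewrite [iota _ _]/= big_cons -mulmxE -mulmxA (_ : (n - k.+1).+1 = n - k)%N; last by lia.
apply: etrans (congr1 (fun u => _ *m u) (IH (ltnW kn))) _.
rewrite (_ : (n - (n - k.+1)) = k.+1)%N; last by lia.
rewrite Y_A //; apply: eq_gcol => b; rewrite mem_basisA //; case: b => [j|//|//|//] jn.
rewrite /mid /zpart ltnn eqxx (_ : (k.+2 <= k)%N = false); last by lia.
rewrite (_ : (k.+2 == k.+1) = false) ?mulr0 ?add0r; last by lia.
by case_ifs; subst_eqs; rewrite ?mulr1 //; exfalso; lia.
Qed.

Lemma size_wordA : size (word1 g n) = n. Proof. by rewrite size_rev size_iota. Qed.

Lemma nth_wordA j : (j < n)%N -> nth 0%N (word1 g n) j = (n - j)%N.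
Proof. by move=> jn; rewrite nth_rev ?size_iota // nth_iota; lia. Qed.

Lemma vpar_A (x : 'cV[C]_(size (word1 g n))) : torus C _ x ->
  vpar g n (V 1) x = gcol g n (zvec (zst (fnat x))).
Proof.
move=> Tx; rewrite /vpar.
have -> : \prod_(j < size (word1 g n)) Y g n (nth 0%N (word1 g n) j) (x j ord0) =
    \prod_(j <- iota 0 (size (word1 g n))) Y g n (n - j) (fnat x j).
  rewrite -(big_ord_iota _ _ _ predT (fun j => Y g n (n - j) (fnat x j))).
  by apply: eq_bigr => j _; rewrite fnatE nth_wordA // -[X in (_ < X)%N]size_wordA.
rewrite [X in iota 0 X]size_wordA.
have -> : @bvec R g n (V 1) = gcol g n (zpart (fnat x) 0).
  apply/matrixP => a k; rewrite !mxE; have := lab_mem a; rewrite mem_basisA //.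
  case: (lab a) => [j|//|//|//] jn; rewrite /zpart wlabel_eqE.
  by rewrite (_ : (j <= 0)%N = false); [case: eqP|lia].
have := run_A (fnat_neq0 Tx) (leqnn n); rewrite subnn => H; apply: etrans H _.
apply: eq_gcol => b; rewrite mem_basisA //; case: b => [j|//|//|//] jn.
by rewrite /zpart /zvec /zst; case_ifs; rewrite ?subnn //; exfalso; lia.
Qed.

End TypeAVector.

(** * Homogeneous coordinates and their cyclic rotation *)

Section TypeAModel.
Variables (R : realType) (n : nat).
Hypothesis hn : (2 <= n)%N.
Local Notation C := R[i].
Local Notation g := tyA1.
Local Notation w := (word1 tyA1 n).
Local Notation cart := (cartan tyA1 n).
Implicit Types (z : nat -> C) (x : 'cV[C]_(size w)).

Definition nx (i : nat) : nat := if i == n then 0%N else i.+1.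
Definition pv (i : nat) : nat := if i == 0%N then n else i.-1.

Lemma cart_cyclic k i : (k <= n)%N -> (i <= n)%N ->
  cart k i = (2 * (k == i))%:Z - (k == nx i)%:Z - (k == pv i)%:Z.
Proof. by move=> kn ni; rewrite cartan_A // /nx /pv; case_ifs; lia. Qed.

(** (1, ..., 1) is the null vector of the cyclic Cartan matrix, so gamma_i does not change when all
    homogeneous coordinates are scaled. *)
Lemma sum_cart i : (i <= n)%N -> \sum_(k < n.+1) cart k i = 0.
Proof.
move=> ni; have S a : (a <= n)%N -> \sum_(k < n.+1) (k == a :> nat)%:Z = 1 :> int.
  move=> an; have an' : (a < n.+1)%N by [].
  rewrite (bigD1 (Ordinal an')) //= eqxx big1 ?addr0 // => k ka.
  by rewrite (_ : (k == a :> nat) = false) //; apply: negbTE; apply: contra ka => /eqP ka; apply/eqP/val_inj.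
rewrite (eq_bigr (fun k : 'I_n.+1 => 2%:Z * (k == i :> nat)%:Z - (k == nx i :> nat)%:Z - (k == pv i :> nat)%:Z)).
  rewrite !sumrB -mulr_sumr !S //; rewrite /nx /pv; case_ifs; lia.
by move=> k _; rewrite cart_cyclic ?PoszM // -ltnS.
Qed.

Definition okA z : Prop := (forall j, 0 < z j) /\ (forall j, (n < j)%N -> z j = 1).
Definition sclA (s : C) z (j : nat) : C := if (j <= n)%N then s * z j else z j.
Definition ggA i z : C := \prod_(k < n.+1) z k ^ cart k i.
Definition epA i z : C := z (nx i) / z i.
Definition rotl z (j : nat) : C := if (j <= n)%N then z (nx j) else 1.
Definition rotr z (j : nat) : C := if (j <= n)%N then z (pv j) else 1.
Definition nA z : 'cV[C]_(size w) := \col_j (z (n - j)%N / z 0%N).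
Definition mA x : nat -> C := zst n (fnat x).

Lemma nx_le i : (i <= n)%N -> (nx i <= n)%N. Proof. by rewrite /nx; case_ifs; lia. Qed.
Lemma pv_le i : (i <= n)%N -> (pv i <= n)%N. Proof. by rewrite /pv; case_ifs; lia. Qed.
Lemma nxK i : (i <= n)%N -> pv (nx i) = i. Proof. by move=> ni; rewrite /nx /pv; case_ifs; lia. Qed.
Lemma pvK i : (i <= n)%N -> nx (pv i) = i. Proof. by move=> ni; rewrite /nx /pv; case_ifs; lia. Qed.

Lemma rotlK z : okA z -> rotr (rotl z) = z.
Proof.
move=> [_ zc]; apply: boolp.funext => j; rewrite /rotr; case: leqP => jn; last by rewrite zc.
by rewrite /rotl pv_le // pvK.
Qed.

Lemma rotrK z : okA z -> rotl (rotr z) = z.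
Proof.
move=> [_ zc]; apply: boolp.funext => j; rewrite /rotl; case: leqP => jn; last by rewrite zc.
by rewrite /rotr nx_le // nxK.
Qed.

Lemma rotl_ok z : okA z -> okA (rotl z).
Proof. by move=> [z0 zc]; split=> j; rewrite /rotl; [case: ifP|move=> jn; rewrite leqNgt jn]. Qed.

Lemma rotr_ok z : okA z -> okA (rotr z).
Proof. by move=> [z0 zc]; split=> j; rewrite /rotr; [case: ifP|move=> jn; rewrite leqNgt jn]. Qed.

Lemma rotl_scl s z : rotl (sclA s z) = sclA s (rotl z).
Proof. by apply: boolp.funext => j; rewrite /rotl /sclA; case: leqP => // jn; rewrite nx_le. Qed.

Lemma rotr_scl s z : rotr (sclA s z) = sclA s (rotr z).
Proof. by apply: boolp.funext => j; rewrite /rotr /sclA; case: leqP => // jn; rewrite pv_le. Qed.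

Lemma mA_ok x : postorus x -> okA (mA x).
Proof.
move=> Px; split=> j; rewrite /mA /zst; first by case: ifP => // _; apply: fnat_gt0.
by move=> jn; rewrite (leqNgt j) jn andbF.
Qed.

Lemma nAK x : nA (mA x) = x.
Proof.
apply/colP => j; rewrite mxE /mA /zst /= divr1; have jn : (j < n)%N.
  by rewrite -[X in (_ < X)%N](size_wordA n).
rewrite (_ : 0 < n - j <= n)%N; last by lia.
by rewrite (_ : n - (n - j) = j)%N ?fnatE //; lia.
Qed.

Lemma mAK z : z 0%N != 0 -> (forall j, (n < j)%N -> z j = 1) -> mA (nA z) = sclA (z 0%N)^-1 z.
Proof.
move=> z0 zc; apply: boolp.funext => k; rewrite /mA /zst /sclA.
case: (posnP k) => [->|k0] /=; first by rewrite mulVf.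
case: (leqP k n) => kn; last by rewrite zc.
have jn : (n - k < size w)%N by rewrite size_wordA; lia.
rewrite (_ : (n - k)%N = Ordinal jn) // fnatE mxE /= mulrC.
by rewrite (_ : n - (n - k) = k)%N //; lia.
Qed.

Lemma nA_scl s z : s != 0 -> nA (sclA s z) = nA z.
Proof.
by move=> s0; apply/colP => j; rewrite !mxE /sclA leq_subr /= invfM mulrACA divff // mul1r.
Qed.

Lemma nA_pos z : okA z -> postorus (nA z).
Proof. by move=> [z0 _] j; rewrite mxE divr_gt0. Qed.

Section Letter.
Variables (i : nat).
Hypothesis iin : (0 < i <= n)%N.

Let lt0 : (n - i < size w)%N. Proof. by rewrite size_wordA; lia. Qed.
Let l0 := Ordinal lt0.

Let letterE (l : 'I_(size w)) : (nth 0%N w l == i) = (l == l0).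
Proof.
have ln : (l < n)%N by rewrite -[X in (_ < X)%N](size_wordA n).
by rewrite (nth_wordA hn) // -val_eqE /=; lia.
Qed.

Let sum_letter (Q : pred 'I_(size w)) (P : 'I_(size w) -> C) :
  \sum_(l < size w | (nth 0%N w l == i) && Q l) P l = if Q l0 then P l0 else 0.
Proof.
rewrite (eq_bigl (fun l => (l == l0) && Q l)) => [|l]; last by rewrite letterE.
by rewrite big_mkcondr big_pred1_eq.
Qed.

(** Each letter occurs once, so the sum of the P has a single term, and the quotient in the formula
    for e_i is c at that letter and 1 at all others. *)
Lemma e_parA c x j : 0 < c -> postorus x ->
  e_par g n i c x j ord0 = if (n - j == i)%N then c * x j ord0 else x j ord0.
Proof.
move=> c0 Px; rewrite mxE !sum_letter; have := Pmon_gt0 g n i l0 Px; move: (Pmon _ _ _ _ _) => P P0.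
have jn : (j < n)%N by rewrite -[X in (_ < X)%N](size_wordA n).
rewrite /=; case: (ltngtP (n - i) j)%N => ij.
- rewrite (_ : (n - j == i)%N = false); last by lia.
  by rewrite !addr0 divff ?mulr1 // mulf_neq0 // gt_eqF.
- rewrite (_ : (n - j == i)%N = false); last by lia.
  by rewrite mulr0 !add0r divff ?mulr1 // gt_eqF.
- rewrite (_ : (n - j == i)%N = true); last by lia.
  by rewrite addr0 mulr0 add0r mulfK ?gt_eqF // mulrC.
Qed.

(** The letter i + 1 stands just before i and is the only neighbour of i to its left. For i = n
    there is none, and z_0 = 1 takes its place. *)
Lemma eps_parA x : torus C _ x -> eps_par g n i x = epA i (mA x).
Proof.
move=> Tx; rewrite /eps_par.
under eq_bigl => l do rewrite -[nth 0%N w l == i]andbT.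
rewrite (sum_letter predT) /= /Pmon /epA /mA /zst iin -(fnatE x l0) /= invfM; congr (_ / _).
rewrite /nx; case: (eqVneq i n) => [E|ni] /=.
  by rewrite big1 ?invr1 // => j; rewrite E subnn.
have lt1 : ((n - i).-1 < size w)%N by rewrite size_wordA; lia.
rewrite (_ : (i < n)%N); last by lia.
rewrite (bigD1 (Ordinal lt1)) /=; last by lia.
rewrite big1 ?mulr1 => [|j /andP[ji jl]].
  rewrite -fnatE /= (nth_wordA hn); last by lia.
  rewrite cart_cyclic; [|by lia|by lia].
  rewrite (_ : (n - (n - i).-1 = i.+1)%N); last by lia.
  rewrite /nx (negbTE ni) eqxx (_ : (i.+1 == i) = false); last by lia.
  rewrite (_ : (i.+1 == pv i) = false); last by rewrite /pv; case_ifs; lia.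
  by rewrite sub0r subr0 exprN1 invrK (_ : (n - i).-1 = (n - i.+1)%N) //; lia.
have jl' : (j != (n - i).-1 :> nat) by rewrite -val_eqE in jl.
rewrite (nth_wordA hn); last by lia.
rewrite cart_cyclic; [|by lia|by lia].
rewrite (_ : (n - j == i)%N = false); last by lia.
rewrite (_ : (n - j == nx i)%N = false); last by rewrite /nx; case_ifs; lia.
by rewrite (_ : (n - j == pv i)%N = false) ?expr0z //; rewrite /pv; case_ifs; lia.
Qed.

End Letter.

Lemma gam_parA i x : gam_par g n i x = ggA i (mA x).
Proof.
rewrite /gam_par /ggA big_ord_recl /= [mA x 0%N]/= exp1rz mul1r.
rewrite (eq_bigr (fun j : 'I_(size w) => fnat x j ^ cart (n - j) i)); last first.
  by move=> j _; rewrite fnatE (nth_wordA hn) // -[X in (_ < X)%N](size_wordA n).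
rewrite /mA; move: (fnat x) => X.
rewrite (big_ord_iota _ _ _ predT (fun j => X j ^ cart (n - j) i)) size_wordA.
rewrite -(big_ord_iota _ _ _ predT (fun j => X j ^ cart (n - j) i)).
rewrite (reindex_inj rev_ord_inj); apply: eq_bigr => j _ /=.
rewrite /zst /bump /= add1n ltn_ord (_ : n - (n - j.+1) = j.+1)%N //.
by have := ltn_ord j; lia.
Qed.

Lemma ggA_E i j c z : (i <= n)%N -> (j <= n)%N -> 0 < c -> okA z ->
  ggA j (yup i c z) = c ^ cart i j * ggA j z.
Proof.
move=> ni nj c0 [z0 _]; have ni' : (i < n.+1)%N by [].
rewrite /ggA (bigD1 (Ordinal ni') isT) [in RHS](bigD1 (Ordinal ni') isT) /= /yup eqxx expfzMl mulrA.
congr (_ * _).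
apply: eq_bigr => k ki; rewrite (_ : (k == i :> nat) = false) //.
by apply/negbTE; apply: contra ki => /eqP ki; apply/eqP/val_inj.
Qed.

Lemma ggA_scl i s z : (i <= n)%N -> 0 < s -> ggA i (sclA s z) = ggA i z.
Proof.
move=> ni s0; have sz (F : 'I_n.+1 -> int) : \prod_k s ^ F k = s ^ (\sum_k F k).
  apply: esym; apply: (big_morph (fun a => s ^ a)) => [a b|]; last by rewrite expr0z.
  by rewrite expfzDr // gt_eqF.
rewrite /ggA (eq_bigr (fun k : 'I_n.+1 => s ^ cart k i * z k ^ cart k i)).
  have s1 : \prod_(k < n.+1) s ^ cart k i = 1 by rewrite (sz (fun k => cart k i)) (sum_cart ni).
  apply: etrans (big_split _ _ _ _ _) _.
  apply: etrans (congr1 ( *%R^~ _) s1) _.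
  exact: mul1r.
by move=> k _; rewrite /sclA -ltnS ltn_ord expfzMl.
Qed.

End TypeAModel.

Section TypeALift.
Variables (R : realType) (n : nat).
Hypothesis hn : (2 <= n)%N.
Local Notation C := R[i].
Local Notation g := tyA1.
Local Notation w := (word1 tyA1 n).
Local Notation T := (tspace C (size w)).
Implicit Types (z : nat -> C) (x : 'cV[C]_(size w)).

Definition mA2 (y : 'cV[C]_(size w)) : nat -> C := rotl n (mA y).
Definition nA2 z : 'cV[C]_(size w) := nA n (rotr n z).

(** On homogeneous coordinates e_i multiplies z_i by c and does nothing else, so the braid relations
    just compare the total factor of each coordinate. *)
Lemma state_model_A :
  state_model (g := g) (okA n) (fun i c z => yup i c z) (@sclA R n) (@ggA R n) (@epA R n)
    (@mA R n) (@nA R n) mA2 nA2.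
Proof.
have s01 : sigma_index g n 0 = 1%N by rewrite /= modn_small //; lia.
have i1 : (0 < 1 <= n)%N by lia.
have z0 z : okA n z -> z 0%N != 0 by move=> [z0 _]; rewrite gt_eqF.
have scok s z : 0 < s -> okA n z -> okA n (sclA n s z).
  move=> s0 [zp zc]; split=> j; rewrite /sclA; first by case: ifP => _ //; rewrite mulr_gt0.
  by move=> jn; rewrite leqNgt jn zc.
have iv z : okA n z -> 0 < (z 0%N)^-1 by move=> [zp _]; rewrite invr_gt0.
have tor x : postorus x -> torus C _ x by apply: postorus_torus.
have nA_yup i c x : (0 < i <= n)%N -> 0 < c -> postorus x -> e_par g n i c x = nA n (yup i c (mA x)).
  move=> iin c0 Px; apply/colP => j; rewrite e_parA // mxE /yup.
  have jn : (j < n)%N by rewrite -[X in (_ < X)%N](size_wordA n).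
  rewrite [in X in _ / X](_ : (0 == i)%N = false); last by lia.
  rewrite [mA x 0%N]/= divr1 /mA /zst (_ : 0 < n - j <= n)%N; last by lia.
  rewrite (_ : n - (n - j) = j)%N; last by lia.
  by rewrite fnatE.
split.
- by move=> x; apply: mA_ok.
- by move=> x Px; apply/rotl_ok/mA_ok.
- by move=> z; apply: nA_pos.
- by move=> z oz; apply/nA_pos/rotr_ok.
- by move=> x _; apply: nAK.
- by move=> y Py; rewrite /nA2 rotlK ?nAK //; apply: mA_ok.
- by move=> z oz; exists (z 0%N)^-1; [apply: iv|apply: mAK => //; [exact: z0|by case: oz]].
- move=> z oz; have or := rotr_ok oz; exists (rotr n z 0%N)^-1; first exact: iv.
  by rewrite /mA2 /nA2 mAK ?rotl_scl ?rotrK //; [exact: z0|case: or].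
- by move=> s z s0 oz; apply: nA_scl; rewrite gt_eqF.
- by move=> s z s0 oz; rewrite /nA2 rotr_scl // nA_scl // gt_eqF.
- exact: scok.
- move=> i c z ni c0 [zp zc]; split; first exact: yup_gt0.
  by move=> j jn; rewrite /yup zc // (_ : (j == i) = false) //; lia.
- move=> i c s z ni c0 s0 oz; apply: boolp.funext => j; rewrite /yup /sclA.
  by case: (j == i); case: (j <= n)%N => //; rewrite mulrCA.
- exact: nA_yup.
(* Because of [rotl], the coordinate z_0 of the common state is the coordinate 1 of the target,
   where e_1 acts. *)
- move=> c y c0 Py; rewrite s01 nA_yup //; congr (nA n _); apply: boolp.funext => j.
  have oy := mA_ok Py; rewrite -{1}(rotlK hn oy) /mA2 /rotr /yup.
  case: (leqP j n) => jn; last by rewrite (_ : (j == 1%N) = false) //; lia.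
  by rewrite (_ : (pv n j == 0%N) = (j == 1%N)) // /pv; case_ifs; lia.
- by move=> i x iin Px; apply: gam_parA.
- move=> y Py; have oy := mA_ok Py; rewrite s01 gam_parA // -{1}(rotlK hn oy) -/(mA2 y).
  have c1 k : (k <= n)%N -> cartan g n (nx n k) 1 = cartan g n k 0.
    by move=> kn; rewrite !cart_cyclic // ?nx_le // /nx /pv; case_ifs; lia.
  rewrite /ggA; move: (mA2 y) => z.
  have kle (k : 'I_n.+1) : (k <= n)%N by rewrite -ltnS.
  have vn (k : 'I_n.+1) : (inord (nx n k) : 'I_n.+1) = nx n k :> nat.
    by rewrite inordK // ltnS nx_le.
  have inj_nx : injective (fun k : 'I_n.+1 => inord (nx n k) : 'I_n.+1).
    move=> a b /(congr1 val) ab; apply: val_inj => /=.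
    by rewrite -(nxK hn (kle a)) -(nxK hn (kle b)); congr (pv n _); rewrite -(vn a) -(vn b).
  rewrite (reindex_inj inj_nx); apply: eq_bigr => k _ /=.
  have kn := kle k; rewrite vn (c1 k kn) /rotr (nx_le hn kn) (nxK hn kn); by [].
- by move=> i x iin Px; apply: eps_parA => //; apply: tor.
- move=> y Py; have oy := mA_ok Py; rewrite s01 eps_parA //; last exact: tor.
  rewrite -{1}(rotlK hn oy) -/(mA2 y) /epA /rotr /nx /pv.
  by case_ifs => //; exfalso; lia.
- by move=> i s z ni s0 oz; apply: ggA_scl.
- move=> i s z ni s0 oz; rewrite /epA /sclA nx_le // ni invfM mulrACA divff ?mul1r //.
  by rewrite gt_eqF.
- by move=> i c d z *; apply: yup_yup.
- by move=> i j c z; apply: ggA_E.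
- move=> i c z ni c0 oz; rewrite /epA /yup eqxx (_ : (nx n i == i) = false).
    by rewrite invfM mulrCA.
  by rewrite /nx; case_ifs; lia.
- by move=> i j _ _ _ _ c d z *; apply: yupC.
- move=> i j ni nj A1 A2 c d z c0 d0 oz.
  apply: boolp.funext => k; rewrite /yup; case: (k == i); case: (k == j) => //; ring.
- move=> i j ni nj A1 A2 c d z c0 d0 oz.
  apply: boolp.funext => k; rewrite /yup; case: (k == i); case: (k == j) => //; ring.
Qed.

End TypeALift.

Section TypeALiftData.
Variables (R : realType) (n : nat).
Hypothesis hn : (2 <= n)%N.
Local Notation C := R[i].
Local Notation g := tyA1.
Local Notation w := (word1 tyA1 n).
Local Notation T := (tspace C (size w)).
Implicit Types (z : nat -> C) (x : 'cV[C]_(size w)).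
Local Notation MS := (mS (@mA R n) (@nA2 R n)).

Let mA_rat k : posrat T (fun x => mA x k).
Proof.
rewrite /mA /zst; case: (0 < k <= n)%N; last exact: rat_on_cst.
by rewrite /fnat; case: insub => [o|]; [apply: rat_on_coord|apply: rat_on_cst].
Qed.

Lemma mS_rat_A i : posrat T (fun x => MS x i ord0).
Proof.
apply: (@rat_on_ext _ _ _ _ (fun x => rotr n (mA x) (n - i) / rotr n (mA x) 0)).
  by move=> x _; rewrite [RHS]mxE.
have H k : posrat T (fun x => rotr n (mA x) k).
  by rewrite /rotr; case: (k <= n)%N; [apply: mA_rat|apply: rat_on_cst].
by apply: posrat_div => // x Px; have [] := rotr_ok (mA_ok Px).
Qed.

Lemma mS'_rat_A i : posrat T (fun x => mS' (@nA R n) (@mA2 R n) x i ord0).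
Proof.
apply: (@rat_on_ext _ _ _ _ (fun x => rotl n (mA x) (n - i) / rotl n (mA x) 0)).
  by move=> x _; rewrite [RHS]mxE.
have H k : posrat T (fun x => rotl n (mA x) k).
  by rewrite /rotl; case: (k <= n)%N; [apply: mA_rat|apply: rat_on_cst].
by apply: posrat_div => // x Px; have [] := rotl_ok (mA_ok Px).
Qed.

Lemma mA_neq0 x k : torus C _ x -> mA x k != 0.
Proof. by move=> Tx; rewrite /mA /zst; case: ifP => _; rewrite ?oner_neq0 ?fnat_neq0. Qed.

(** In type A the lift is a monomial map, so it is defined, and has its properties, on the whole
    torus and not only at positive points. *)
Lemma mS_torus_A x : torus C _ x -> torus C _ (MS x).
Proof.
move=> Tx i; have H k : rotr n (mA x) k != 0.
  by rewrite /rotr; case: (k <= n)%N; rewrite ?mA_neq0 ?oner_neq0.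
by rewrite mxE mulf_neq0 // invr_eq0.
Qed.

Let mA_MS x : torus C _ x -> mA (MS x) = sclA n (mA x n)^-1 (rotr n (mA x)).
Proof.
move=> Tx; rewrite /mS /nA2 mAK //; first exact: mA_neq0.
by move=> j jn; rewrite /rotr leqNgt jn.
Qed.

Lemma lift_A x : torus C _ x ->
  vpar g n (V 1) (MS x) = (mA x n)^-1 *: sigma_W (vpar g n (V 1) x).
Proof.
move=> Tx; apply: etrans (vpar_A hn (mS_torus_A Tx)) _; rewrite -/(mA (MS x)) mA_MS //.
pose sl b := if b is V j then (if j == 1%N then V n.+1 else V j.-1) else b.
have slP b : b \in Defs.basis g n -> [/\ sl b \in Defs.basis g n,
      sigma_label g n (sl b) = b & sl (sigma_label g n b) = b].
  rewrite !mem_basisA //; case: b => [j|//|//|//] jn; rewrite /sl /=.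
  have [->|j1] := eqVneq j 1%N.
    split; first by lia.
      by rewrite /= modnn.
    by rewrite modn_small; [|lia].
  split; first by lia.
    by rewrite /= modn_small ?prednK //; lia.
  have [->|jn1] := eqVneq j n.+1; first by rewrite modnn.
  by rewrite modn_small ?eqSS ?(negbTE _); [case: eqP => // ?; lia|lia].
have E : sigma_W (vpar g n (V 1) x) = gcol g n (fun b => zvec n (mA x) (sl b)).
  by apply: etrans (congr1 (@sigma_W R g n) (vpar_A hn Tx)) _; exact: sigma_gcol.
apply: etrans _ (congr1 (fun u => (mA x n)^-1 *: u) (esym E)).
apply/matrixP => a k; rewrite !mxE; have := lab_mem a; rewrite mem_basisA //.
case: (lab a) => [j|//|//|//] jn; rewrite /zvec /sl /sclA /rotr /pv.
by case_ifs; subst_eqs => //; try (exfalso; lia); congr (_ * mA x _); lia.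
Qed.

Lemma eps_lift_A i x : (0 < i <= n)%N -> sigma_index g n i != 0%N -> torus C _ x ->
  eps_par g n (sigma_index g n i) (MS x) = eps_par g n i x.
Proof.
move=> iin; have [->|ni] := eqVneq i n; first by rewrite /= modnn.
have si : sigma_index g n i = i.+1 by rewrite /= modn_small //; lia.
move=> _ Tx; have i1 : (0 < i.+1 <= n)%N by lia.
rewrite si (eps_parA hn i1 (mS_torus_A Tx)) (eps_parA hn iin Tx).
rewrite mA_MS // /epA /sclA /rotr /nx /pv.
have z0 := mA_neq0 n Tx.
rewrite (_ : ((if i.+1 == n then 0 else i.+2) <= n)%N); last by case_ifs; lia.
rewrite (_ : (i < n)%N); last by lia.
rewrite (negbTE ni) /= invfM invrK mulrACA mulVf // mul1r.
by congr (mA x _ / _); case_ifs; lia.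
Qed.

Definition cfA (u : 'cV[C]_(dimW g n)) : 'cV[C]_(size w) := \col_j vcoef u (V (n - j)).

Lemma cfAK x : torus C _ x -> cfA (vpar g n (V 1) x) = x.
Proof.
move=> Tx; apply/colP => j; rewrite mxE.
have jn : (j < n)%N by rewrite -[X in (_ < X)%N](size_wordA n).
apply: etrans (congr1 (fun u => vcoef u _) (vpar_A hn Tx)) _.
rewrite vcoef_gcol; last by rewrite mem_basisA //; lia.
rewrite /zvec /zst (_ : (n - j == n.+1)%N = false); last by lia.
rewrite (_ : (0 < n - j <= n)%N); last by lia.
by rewrite (_ : n - (n - j) = j)%N ?fnatE //; lia.
Qed.

Lemma cfA_rat i : posrat (V1space R g n) (fun u => cfA u i ord0).
Proof.
apply: (@rat_on_ext _ _ _ _ (fun u => vcoef u (V (n - i)))); first by move=> u _; rewrite mxE.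
by apply: rat_on_sum => a _; apply: rat_onM; [apply: rat_on_cst|apply: rat_on_coord].
Qed.

Lemma lift_data_A : exists S S' cf1 cf2, @lift_data R g n S S' cf1 cf2.
Proof.
exists MS, (mS' (@nA R n) (@mA2 R n)), cfA, cfA.
have genT (Q : 'cV[C]_(size w) -> Prop) : (forall x, torus C _ x -> Q x) -> generically (torus C _) Q.
  by move=> H; apply: (@posgen_generically _ _ T); apply: posgen_true.
apply: (model_lift_data (state_model_A R hn)).
- exact: mS_rat_A.
- exact: mS'_rat_A.
- split.
    split; first by move=> i; apply: (@posrat_ratfun _ _ T); apply: mS_rat_A.
    by apply: genT => x; apply: mS_torus_A.
  exists (fun x => (mA x n)^-1); split.
    exists (fun=> 1), (fun x => fnat x 0%N); split.
    + exact: pos_laurent1.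
    + by rewrite /fnat; case: insub => [o|]; [apply: pos_laurent_coord|apply: pos_laurent1].
    + by move=> x _; rewrite /mA /zst leqnn andbT (_ : (0 < n)%N) ?subnn ?mul1r //; lia.
  by apply: genT => x Tx; split; [apply: lift_A|move=> i iin si; apply: eps_lift_A].
- move=> y [[_ Ty] [a [_ Ha]]].
  have G := generically_and (X := T) Ty Ha.
  apply: (generically_impl (X := T)) G => x Tx [Tyx [Ey _]].
  have z0 := mA_neq0 n Tx; have TS := mS_torus_A Tx.
  have k0 : vpar g n (V 1) (y x) = (a x * mA x n) *: vpar g n (V 1) (MS x).
    apply: etrans Ey _; apply: esym.
    apply: etrans (congr1 (fun u => (a x * mA x n) *: u) (lift_A Tx)) _.
    by rewrite scalerA mulfK.
  have last_coef (t : 'cV[C]_(size w)) : torus C _ t -> vcoef (vpar g n (V 1) t) (V n.+1) = 1.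
    move=> Tt; apply: etrans (congr1 (fun u => vcoef u _) (vpar_A hn Tt)) _.
    by rewrite vcoef_gcol /zvec ?eqxx // mem_basisA //=; lia.
  have vs u s b : vcoef (g := g) (n := n) (s *: u) b = s * vcoef u b :> C.
    by rewrite /vcoef mulr_sumr; apply: eq_bigr => i _; rewrite mxE mulrCA.
  (* The coefficient of v_(n+1) is 1 for every point of the variety, and this fixes the factor. *)
  have k1 : a x * mA x n = 1.
    have E := etrans (congr1 (fun u => vcoef u (V n.+1)) k0) (vs _ _ _).
    apply: etrans (esym (mulr1 _)) _; apply: etrans (congr1 ( *%R _) (esym (last_coef _ TS))) _.
    exact: etrans (esym E) (last_coef _ Tyx).
  apply: etrans (esym (cfAK Tyx)) _; apply: etrans _ (cfAK TS).
  apply: (congr1 cfA); apply: etrans k0 _; rewrite k1; exact: scale1r.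
- exact: cfA_rat.
- exact: cfAK.
- exact: cfA_rat.
- exact: cfAK.
- by rewrite /= modn_small ?mem_rev ?mem_iota //; lia.
- by move=> i iin; rewrite mem_rev mem_iota; lia.
- exact: cartan_rank2.
Qed.

End TypeALiftData.

Theorem theorem5p2 (R : realType) (g : affine_type) (n : nat)
    (hn : (min_rank g <= n)%N) :
  birational (Vg R g n) (Vtgt R g n) (sigma_bar R g n) /\
  forall sbi, rational_inverse (Vg R g n) (Vtgt R g n) (sigma_bar R g n) sbi ->
    geometric_crystal (cartan_mx g n) (Vg R g n)
      (e_full R g n sbi) (gam_full R g n) (eps_full R g n).
Proof.
have [S [S' [cf1 [cf2 LD]]]] : exists S S' cf1 cf2, @lift_data R g n S S' cf1 cf2.
  case: g hn => hn.
  - exact: lift_data_A.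
  - exact: lift_data_swp.
  - exact: lift_data_flC.
  - exact: lift_data_swp.
  - exact: lift_data_swp.
  - exact: lift_data_flD.
  - exact: lift_data_flA.
split; first by eexists; exact: (sigma_bar_rational_inverse LD).
by move=> sbi sbiP; apply: (crystal_of_lift LD).
Qed.
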